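(* For $2\le n\le g+1$, $$a^{(g)}_n=(-1)^{n-1}\binom{g}{n-2}+\sum_{i=2}^{n}(-1)^{n-i}\binom{g+1}{n-i}\,i^g+\sum_{i=0}^{n-3}(-1)^i\left(\binom{g}{n-1}\binom{g}{n-2-i}-\binom{g}{n}\binom{g}{n-3-i}\right).$$
   Context: Let $g\ge 2$ and let $(J,\Theta)$ be a $g$-dimensional principally polarized abelian variety over $\mathbb{C}$, $J=\mathbb{C}^g/(\mathbb{Z}^g+\tau\mathbb{Z}^g)$ with $\tau$ symmetric of positive definite imaginary part, $\Theta$ the zero divisor of Riemann's theta function $\theta(z)$ associated with $\tau$, $z=(z_1,\dots,z_g)$. Assume $\Theta$ is non-singular. For $n\ge0$, $A_n$ is the space of meromorphic functions on $J$ with poles only on $\Theta$, of order at most $n$; $A_n=0$ for $n<0$; $\operatorname{gr}_nA=A_n/A_{n-1}$, $\operatorname{gr}A=\bigoplus_{n\ge0}\operatorname{gr}_nA$. The operators $\partial_i=\partial/\partial z_i$ map $A_n$ into $A_{n+1}$ and hence $\operatorname{gr}_nA$ into $\operatorname{gr}_{n+1}A$. Let $T^*=\bigoplus_{i=1}^g\mathbb{C}\,dz_i$, with $\wedge^pT^*$ placed in degree $-p$. $H^k=\bigoplus_nH^k_n$ is the $k$-th (graded) cohomology of the complex $(\operatorname{gr}A\otimes\wedge^\bullet T^*,d)$, $d=\sum_{i=1}^g\partial_i\otimes dz_i$; in particular $H^g_{n-g}=(\operatorname{gr}_nA\otimes\wedge^gT^* )/d(\operatorname{gr}_{n-1}A\otimes\wedge^{g-1}T^*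 )$. Put $a^{(g)}_n=\dim H^g_{n-g}$. Empty sums are $0$ and $\binom{g}{m}=0$ for $m>g$. *)

(* Defs.v *)
From mathcomp Require Import all_boot all_order all_algebra.
From mathcomp Require Import all_classical all_reals all_analysis.
From mathcomp Require Import complex.

Set Implicit Arguments.
Unset Strict Implicit.
Unset Printing Implicit Defensive.

Import Order.TTheory GRing.Theory Num.Theory.
Import numFieldNormedType.Exports.

Local Open Scope classical_set_scope.
Local Open Scope ring_scope.

(* The complex numbers.  The packed type is used (rather than R[i] itself) so
   that the topology and normed-module instances of MathComp-Analysis apply;
   differentiability and directional derivatives of functions
   'rV[CC R]_g -> CC R are thus complex ones. *)
Definition CC (R : realType) : numClosedFieldType := R[i].

Section Theta.
Variables (R : realType) (g : nat).
Local Notation C := (CC R).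
Implicit Types (tau : 'M[C]_g) (z : 'rV[C]_g).

Definition cexp (z : C) : C :=
  (expR (complex.Re z))%:C%C * (cos (complex.Im z) +i* sin (complex.Im z))%C.

Definition period_matrix tau : Prop :=
  tau^T = tau /\
  forall x : 'rV[R]_g, x != 0 ->
    0 < (x *m map_mx (fun c : C => complex.Im c) tau *m x^T) 0 0.

Definition zvec (m : 'rV[int]_g) : 'rV[C]_g := map_mx intr m.

Definition theta_term tau z (m : 'rV[int]_g) : C :=
  cexp ('i%C * (pi : R)%:C%C *
    ((zvec m *m tau *m (zvec m)^T) 0 0 + 2 * (zvec m *m z^T) 0 0)).

(* The series over Z^g converges absolutely, so it may be summed as the limit
   of its sums over the boxes {-N, ..., N}^g. *)
Definition theta tau z : C :=
  limn (fun N : nat => \sum_(k : {ffun 'I_g -> 'I_(N.*2.+1)})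
    theta_term tau z (\row_j ((k j)%:Z - N%:Z))).

Definition holomorphic_on (U : set 'rV[C]_g) (f : 'rV[C]_g -> C) : Prop :=
  forall z, U z -> differentiable f z.

(* The divisor of zeros of theta is non-singular (in particular reduced). *)
Definition nonsingular_theta_divisor tau : Prop :=
  forall z, theta tau z = 0 ->
    exists i : 'I_g, 'D_(delta_mx 0 i) (theta tau) z != 0.

Definition lattice_periodic tau (f : 'rV[C]_g -> C) : Prop :=
  forall (p q : 'rV[int]_g) z, f (z + zvec p + zvec q *m tau) = f z.

(* A meromorphic function on J with poles only on Theta is encoded by its
   lift to C^g, holomorphic outside theta = 0; as it is determined by its
   values there, we make the encoding unique by giving it the value 0 wherever
   theta vanishes.  Pole order at most n means that theta^n f extends to a
   holomorphic function. *)
Definition A tau (n : int) : set ('rV[C]_g -> C) :=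
  match n with
  | Posz m => [set f |
      [/\ lattice_periodic tau f,
          forall z, theta tau z = 0 -> f z = 0,
          holomorphic_on [set z | theta tau z != 0] f
        & exists2 h : 'rV[C]_g -> C, holomorphic_on setT h &
            forall z, theta tau z != 0 -> theta tau z ^+ m * f z = h z]]
  | Negz _ => [set 0]
  end.

Definition partial tau (i : 'I_g) (f : 'rV[C]_g -> C) : 'rV[C]_g -> C :=
  fun z => if theta tau z == 0 then 0 else 'D_(delta_mx 0 i) f z.

(* A family (w_S) indexed by sets S = {s_1 < ... < s_k} stands for the form
   \sum_S w_S dz_(s_1) /\ ... /\ dz_(s_k). *)
Definition dz_form := {set 'I_g} -> ('rV[C]_g -> C).

(* A_n (x) wedge^k T^*; it represents gr_n A (x) wedge^k T^* modulo
   A_(n-1) (x) wedge^k T^*. *)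
Definition kform tau (n : int) (k : nat) : set dz_form :=
  [set w | forall S : {set 'I_g},
     if #|S| == k then A tau n (w S) else w S = 0].

(* d = \sum_i partial_i (x) dz_i; the sign is that of
   dz_i /\ dz_(S \ i) = +/- dz_S. *)
Definition dform tau (w : dz_form) : dz_form :=
  fun S z => \sum_(i in S)
    (-1) ^+ #|[set j in S | (j < i)%N]| * partial tau i (w (S :\ i)) z.

(* H^k_m, the cohomology at gr_(m+k) A (x) wedge^k T^*, is presented as the
   quotient cocycle k m / coboundary k m of spaces of representatives in
   A_(m+k) (x) wedge^k T^*: a representative w is a cocycle when d w vanishes
   in gr_(m+k+1) A (x) wedge^(k+1) T^*, and a coboundary when its class in
   gr_(m+k) A (x) wedge^k T^* is the class of some d e. *)
Definition cocycle tau (k : nat) (m : int) : set dz_form :=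
  [set w | kform tau (m + k%:Z) k w /\
           kform tau (m + k%:Z) k.+1 (dform tau w)].

Definition coboundary tau (k : nat) (m : int) : set dz_form :=
  [set w | exists e r : dz_form,
     [/\ match k with
         | 0 => e = 0
         | k'.+1 => kform tau (m + k'%:Z) k' e
         end,
         kform tau (m + k%:Z - 1) k r
       & w = dform tau e + r]].

End Theta.

(* The quotient of the subspace V by the subspace W has a basis of d
   elements. *)
Definition dim_quotient (K : fieldType) (E : lmodType K) (V W : set E)
    (d : nat) : Prop :=
  exists v : 'I_d -> E,
    [/\ forall i, V (v i),
        forall c : 'I_d -> K, W (\sum_i c i *: v i) -> forall i, c i = 0
      & forall x, V x -> exists c : 'I_d -> K, W (x - \sum_i c i *: v i)].

Definition dim_H (R : realType) (g : nat) (tau : 'M[CC R]_g) (k : nat)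
    (m : int) (d : nat) : Prop :=
  @dim_quotient (CC R) ({set 'I_g} -> ('rV[CC R]_g -> CC R))
    (cocycle tau k m) (coboundary tau k m) d.

(* Main.v *)
(* Let O be the ring of Z^g-periodic entire functions.  A function in A_n is
   h / theta^n, where h in O is invariant under the operators T_l of weight n
   that fix theta when n = 1; call V_n the space of these h.  In top degree the
   cohomology is V_n modulo the span of theta V_(n-1) and of the numerators
   theta d_i h - (n-1) h d_i theta of the d_i (h / theta^(n-1)).

   Consider the Koszul complex of theta, d_1 theta, ..., d_g theta over O; its
   j-th term, j <= g+1, is given weight n-j, and the lattice acts on it by T_l
   twisted by the affine action on (theta, d_i theta).  As Theta is
   non-singular these g+1 functions have no common zero, hence generate the
   unit ideal of O (Gelfand-Mazur gives approximate Bezout identities on every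
   strip |Im z| <= r, and an infinite product glues them), so that the columns
   are exact.  Along the rows we take the Koszul complex of the commuting
   operators T_l - 1, a model for group cohomology.  On Fourier coefficients
   normalised by a Gaussian, T_l of weight m <> 0 is a shift by m, so the rows
   with j < n are exact except in degree 0, where the dimension is
   C(g+1,j) (n-j)^g, and the rows with j > n are exact in degrees < g.  In the
   row j = n only constants matter, and there the differential is a Lefschetz
   operator, injective below the middle degree by the sl_2 commutation relation;
   this gives dimension C(g,q) C(g,n-1) - C(g,q-1) C(g,n) in degree q < n.
   Chasing from the row n down to degree 0, the homology at j >= 1 of the
   degree 0 invariants of the rows is the cohomology of the row n in degree
   n-1-j.  The dimension sought is the homology at j = 0, which the alternating
   sum of these dimensions determines. *)

(* The twist of the action is what brings the derivations in. Since T_l d_i theta = d_i theta - 2 pi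
   i l_i theta, an invariant of the row j = 1 is a tuple (v_0, v_1, ..., v_g) with v_i in V_(n-1)
   for i >= 1 and T_l v_0 = v_0 + 2 pi i sum_i l_i v_i for the generators l. All of these have the
   form v_i = - (n-1) h_i, v_0 = u + sum_i d_i h_i with u and h_i in V_(n-1), and the Koszul
   differential sends them to theta u plus the numerators of the d_i (h_i / theta^(n-1)). The
   division by n - 1 is one place where n >= 2 matters. The bound n <= g + 1 comes from the rows j >
   n, exact only in degrees < g: the chase at j >= 1 reaches degree n - 1 - j, which must stay below
   g. No sheaf and no integral occurs. Goursat's theorem for Riemann sums and averages over dyadic
   grids yield Fourier coefficients; periodic entire functions then become the sequences that decay
   faster than every exponential, and statements about the rows become difference equations on
   Z^g. *)
Require Import Defs.
From HB Require Import structures.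
From mathcomp Require Import all_boot all_order all_algebra.
From mathcomp Require Import all_classical all_reals all_analysis.
From mathcomp Require Import complex ring lra zify.
Set Implicit Arguments.
Unset Strict Implicit.
Unset Printing Implicit Defensive.
Import Order.TTheory GRing.Theory Num.Theory.
Import numFieldNormedType.Exports.
Local Open Scope classical_set_scope.
Local Open Scope ring_scope.

(** * Complex modulus and convergence of sequences *)

Section Modulus.
Variable R : realType.
Local Notation C := (CC R).
Implicit Types (z w : C) (x y : R).

(** The norm of [C] takes its values in [C] itself; a real-valued modulus lets [lra] and [nra] deal
    with the estimates. *)
Definition nm z : R := Normc.normc (z : R[i]).
Definition rc x : C := (x%:C)%C.

Lemma nmE z : `|z| = rc (nm z).
Proof. by []. Qed.

Lemma nm_ge0 z : 0 <= nm z.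
Proof. by case: z => a b; apply: sqrtr_ge0. Qed.

Lemma nm0 : nm 0 = 0. Proof. exact: Normc.normc0. Qed.
Lemma nm1 : nm 1 = 1. Proof. exact: Normc.normc1. Qed.
Lemma nm_eq0 z : nm z = 0 -> z = 0. Proof. exact: Normc.eq0_normc. Qed.
Lemma nmM z w : nm (z * w) = nm z * nm w. Proof. exact: Normc.normcM. Qed.
Lemma nmV z : nm z^-1 = (nm z)^-1. Proof. exact: Normc.normcV. Qed.
Lemma nmN z : nm (- z) = nm z. Proof. exact: normcN. Qed.
Lemma nmD z w : nm (z + w) <= nm z + nm w. Proof. exact: le_normcD. Qed.
Lemma nmB z w : nm (z - w) <= nm z + nm w.
Proof. by rewrite -(nmN w); exact: nmD. Qed.
Lemma nmC z w : nm (z - w) = nm (w - z).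
Proof. by rewrite -nmN opprB. Qed.
Lemma nmX z n : nm (z ^+ n) = nm z ^+ n.
Proof. by elim: n => [|n IH]; rewrite ?expr0 ?nm1// !exprS nmM IH. Qed.
Lemma nm_gt0 z : z != 0 -> 0 < nm z.
Proof.
move=> z0; rewrite lt_neqAle nm_ge0 andbT eq_sym.
by apply: contraNneq z0 => /nm_eq0 ->.
Qed.

Lemma nm_sum (I : Type) (r : seq I) (P : pred I) (F : I -> C) :
  nm (\sum_(i <- r | P i) F i) <= \sum_(i <- r | P i) nm (F i).
Proof.
elim/big_rec2: _ => [|i a b _ H]; first by rewrite nm0.
by apply: le_trans (nmD _ _) _; rewrite lerD2l.
Qed.

Lemma rcM x y : rc (x * y) = rc x * rc y. Proof. exact: rmorphM. Qed.
Lemma rcD x y : rc (x + y) = rc x + rc y. Proof. exact: rmorphD. Qed.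
Lemma rcN x : rc (- x) = - rc x. Proof. exact: rmorphN. Qed.
Lemma rcB x y : rc (x - y) = rc x - rc y. Proof. exact: rmorphB. Qed.
Lemma rcV x : rc x^-1 = (rc x)^-1. Proof. exact: (@fmorphV R C (real_complex R)). Qed.
Lemma rc0 : rc 0 = 0. Proof. by []. Qed.
Lemma rc1 : rc 1 = 1. Proof. by []. Qed.
Lemma rc_nat n : rc n%:R = n%:R. Proof. exact: rmorph_nat. Qed.
Lemma rc_int (k : int) : rc k%:~R = k%:~R. Proof. exact: rmorph_int. Qed.
Lemma rcX x n : rc (x ^+ n) = rc x ^+ n. Proof. exact: rmorphXn. Qed.
Lemma rc_inj : injective rc. Proof. exact: complexI. Qed.

Lemma nm_rc x : nm (rc x) = `|x|.
Proof. by rewrite /nm /rc /= expr0n addr0 sqrtr_sqr. Qed.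
Lemma nm_nat n : nm n%:R = n%:R.
Proof. by rewrite -rc_nat nm_rc normr_nat. Qed.
Lemma nm_int (k : int) : nm k%:~R = `|k%:~R|.
Proof. by rewrite -rc_int nm_rc. Qed.

Definition re z : R := complex.Re z.
Definition im z : R := complex.Im z.
Definition iC : C := ('i)%C.

Lemma reD z w : re (z + w) = re z + re w. Proof. by case: z w => [a b] [c d]. Qed.
Lemma imD z w : im (z + w) = im z + im w. Proof. by case: z w => [a b] [c d]. Qed.
Lemma reN z : re (- z) = - re z. Proof. by case: z. Qed.
Lemma imN z : im (- z) = - im z. Proof. by case: z. Qed.
Lemma reB z w : re (z - w) = re z - re w. Proof. by rewrite reD reN. Qed.
Lemma imB z w : im (z - w) = im z - im w. Proof. by rewrite imD imN. Qed.
Lemma re_rc x : re (rc x) = x. Proof. by []. Qed.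
Lemma im_rc x : im (rc x) = 0. Proof. by []. Qed.
Lemma reM z w : re (z * w) = re z * re w - im z * im w.
Proof. by case: z w => [a b] [c d]. Qed.
Lemma imM z w : im (z * w) = re z * im w + im z * re w.
Proof. by case: z w => [a b] [c d]. Qed.
Lemma re_iC : re iC = 0. Proof. by []. Qed.
Lemma im_iC : im iC = 1. Proof. by []. Qed.
Lemma Ceq z w : re z = re w -> im z = im w -> z = w.
Proof. by case: z w => [a b] [c d] /= -> ->. Qed.
Lemma reimE z : z = rc (re z) + iC * rc (im z).
Proof. by apply: Ceq; rewrite ?reD ?imD ?reM ?imM ?re_rc ?im_rc ?re_iC ?im_iC; ring. Qed.
Lemma re_sum (I : Type) (r : seq I) (P : pred I) (F : I -> C) :
  re (\sum_(i <- r | P i) F i) = \sum_(i <- r | P i) re (F i).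
Proof. by elim/big_rec2: _ => [//|i a b _ <-]; rewrite reD. Qed.
Lemma im_sum (I : Type) (r : seq I) (P : pred I) (F : I -> C) :
  im (\sum_(i <- r | P i) F i) = \sum_(i <- r | P i) im (F i).
Proof. by elim/big_rec2: _ => [//|i a b _ <-]; rewrite imD. Qed.

Lemma nm_iC : nm iC = 1.
Proof. by rewrite /nm /= expr0n expr1n add0r sqrtr1. Qed.

Lemma re_nm z : `|re z| <= nm z.
Proof.
by case: z => a b; rewrite /nm /re /= -sqrtr_sqr ler_wsqrtr// lerDl sqr_ge0.
Qed.
Lemma im_nm z : `|im z| <= nm z.
Proof.
by case: z => a b; rewrite /nm /im /= -sqrtr_sqr ler_wsqrtr// lerDr sqr_ge0.
Qed.
Lemma nm_reim z : nm z <= `|re z| + `|im z|.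
Proof.
rewrite [X in nm X](reimE z); apply: le_trans (nmD _ _) _.
by rewrite nmM nm_iC mul1r !nm_rc.
Qed.

Lemma ler_nmB z w : `|nm z - nm w| <= nm (z - w).
Proof.
have := nmD (z - w) w; have := nmD (w - z) z; rewrite !subrK (nmC w z) => H K.
by rewrite ler_norml; apply/andP; split; lra.
Qed.

Lemma nm_small z : (forall e : R, 0 < e -> nm z <= e) -> z = 0.
Proof.
move=> H; apply: nm_eq0; apply/eqP; rewrite eq_le nm_ge0 andbT.
by apply/ler_addgt0Pr => e e0; rewrite add0r; apply: H.
Qed.

(** Convergence by explicit real epsilons; [tends_lim] connects it with the [limn] that defines
    theta. *)
Definition tends (u : nat -> C) (l : C) :=
  forall e : R, 0 < e -> exists N, forall n, (N <= n)%N -> nm (u n - l) < e.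

Lemma tends_ext u v l : (forall n, u n = v n) -> tends u l -> tends v l.
Proof. by move=> /funext ->. Qed.

Lemma tends_near N0 u v l : (forall n, (N0 <= n)%N -> u n = v n) ->
  tends u l -> tends v l.
Proof.
move=> E H e /H[N HN]; exists (maxn N N0) => n; rewrite geq_max => /andP[a b].
by rewrite -E//; apply: HN.
Qed.

Lemma tends_cst l : tends (fun=> l) l.
Proof. by move=> e e0; exists 0%N => n _; rewrite subrr nm0. Qed.

Lemma tendsD u v l m : tends u l -> tends v m -> tends (fun n => u n + v n) (l + m).
Proof.
move=> H K e e0; have e2 : 0 < e / 2 by rewrite divr_gt0.
have [N HN] := H _ e2; have [N' HN'] := K _ e2; exists (maxn N N') => n.
rewrite geq_max => /andP[/HN a /HN' b].
rewrite (_ : _ - _ = (u n - l) + (v n - m)); last by ring.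
by apply: le_lt_trans (nmD _ _) _; lra.
Qed.

Lemma tendsZ a u l : tends u l -> tends (fun n => a * u n) (a * l).
Proof.
move=> H e e0; have h : 0 < nm a + 1 by have := nm_ge0 a; lra.
have [N HN] := H (e / (nm a + 1)) (divr_gt0 e0 h); exists N => n /HN.
rewrite ltr_pdivlMr// => K; rewrite -mulrBr nmM.
have := nm_ge0 (u n - l); have := nm_ge0 a; nra.
Qed.

Lemma tendsN u l : tends u l -> tends (fun n => - u n) (- l).
Proof.
move=> /(tendsZ (-1)); rewrite mulN1r; apply: tends_ext => n.
by rewrite mulN1r.
Qed.

Lemma tendsB u v l m : tends u l -> tends v m -> tends (fun n => u n - v n) (l - m).
Proof. by move=> H /tendsN; apply: tendsD. Qed.

Lemma tends_le u l (b : R) N : tends u l ->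
  (forall n, (N <= n)%N -> nm (u n) <= b) -> nm l <= b.
Proof.
move=> H K; apply/ler_addgt0Pr => e /H[N' HN'].
have := HN' _ (leq_maxr N N'); have := K _ (leq_maxl N N').
set n := maxn _ _; have := nmD (u n) (l - u n).
rewrite (nmC l); rewrite (_ : u n + (l - u n) = l); last by ring.
lra.
Qed.

Lemma tends_uniq u l l' : tends u l -> tends u l' -> l = l'.
Proof.
move=> H K; apply/subr0_eq/nm_small => e e0.
by apply: (@tends_le (fun=> 0) _ _ 0%N); [have := tendsB H K; apply: tends_ext => n; rewrite subrr|rewrite nm0 ltW].
Qed.

Lemma tends_sum (I : finType) (u : I -> nat -> C) (l : I -> C) :
  (forall i, tends (u i) (l i)) -> tends (fun n => \sum_i u i n) (\sum_i l i).
Proof.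
move=> H; elim: (index_enum I) => [|i r IH].
  by rewrite big_nil; apply: tends_ext (tends_cst 0) => n; rewrite big_nil.
rewrite big_cons; apply: tends_ext (tendsD (H i) IH) => n.
by rewrite big_cons.
Qed.

(** Radii of balls are elements of [C]; a positive one is real, so its real part can serve as
    radius. *)
Lemma nbhs_nm (z : C) (A : set C) : nbhs z A ->
  exists2 d : R, 0 < d & forall w, nm (w - z) < d -> A w.
Proof.
move=> /nbhs_ballP[e /= e0 H]; exists (re e).
  by move: e0; rewrite ltcE /= => /andP[].
move=> w Hw; apply: H; rewrite /ball /= distrC nmE /rc.
move: e0; rewrite !ltcE /= => /andP[/eqP <- _]; rewrite eqxx /=.
exact: Hw.
Qed.

Lemma nbhs_nmE (z : C) (A : set C) (d : R) : 0 < d ->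
  (forall w, nm (w - z) < d -> A w) -> nbhs z A.
Proof.
move=> d0 H; apply/nbhs_ballP; exists (rc d) => /=.
  by rewrite /rc ltcR.
move=> w; rewrite /ball /= nmE /rc ltcR nmC; exact: H.
Qed.

Lemma tends_cvg u l : tends u l -> u @ \oo --> l.
Proof.
move=> H A /nbhs_nm[d d0 HA]; have [N HN] := H _ d0.
by exists N => // n /= Hn; apply/HA/HN.
Qed.

Lemma tends_lim u l : tends u l -> limn u = l.
Proof. by move=> /tends_cvg; apply: cvg_lim; apply: norm_hausdorff. Qed.

Lemma real_cauchy (u : nat -> R) :
  (forall e : R, 0 < e -> exists N, forall n m, (N <= n)%N -> (N <= m)%N -> `|u n - u m| < e) ->
  exists l, forall e : R, 0 < e -> exists N, forall n, (N <= n)%N -> `|u n - l| < e.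
Proof.
move=> H.
have /cvg_ex[l Hl] : cvgn u.
  apply/cauchy_cvgP/cauchy_ballP => e e0; have [N HN] := H _ e0.
  exists (u @` [set n | (N <= n)%N], u @` [set n | (N <= n)%N]) => /=.
    by split; exists N => // n /= hn; exists n.
  by case=> a b [/= [n hn <-] [m hm <-]]; rewrite /ball /=; apply: HN.
exists l => e e0; have /cvgrPdist_lt/(_ _ e0)[N _ HN] := Hl.
by exists N => n Hn; rewrite distrC; apply: HN.
Qed.

Lemma tends_cauchy u :
  (forall e : R, 0 < e -> exists N, forall n m, (N <= n)%N -> (N <= m)%N -> nm (u n - u m) < e) ->
  exists l, tends u l.
Proof.
move=> H.
have [a Ha] : exists l, forall e : R, 0 < e -> exists N, forall n, (N <= n)%N -> `|re (u n) - l| < e.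
  apply: real_cauchy => e /H[N HN]; exists N => n m hn hm.
  by rewrite -reB; apply: le_lt_trans (re_nm _) (HN _ _ hn hm).
have [b Hb] : exists l, forall e : R, 0 < e -> exists N, forall n, (N <= n)%N -> `|im (u n) - l| < e.
  apply: real_cauchy => e /H[N HN]; exists N => n m hn hm.
  by rewrite -imB; apply: le_lt_trans (im_nm _) (HN _ _ hn hm).
exists (rc a + iC * rc b) => e e0; have e2 : 0 < e / 2 by rewrite divr_gt0.
have [N HN] := Ha _ e2; have [N' HN'] := Hb _ e2; exists (maxn N N') => n.
rewrite geq_max => /andP[/HN h /HN' k]; apply: le_lt_trans (nm_reim _) _.
rewrite reB imB !reD !imD !reM !imM !re_rc !im_rc re_iC im_iC.
rewrite (_ : a + _ = a); last by ring.
rewrite (_ : 0 + _ = b); last by ring.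
lra.
Qed.

End Modulus.
Arguments iC {R}.

(** * The exponential *)

Section Exponential.
Variable R : realType.
Local Notation C := (CC R).
Implicit Types (z w : C) (x y a b : R).

Lemma sin_odd_abs x : `|sin x| <= `|x|.
Proof.
have H y : 0 <= y -> `|sin y| <= `|y|.
  move=> y0.
  have [c _] := @MVT_segment R sin cos 0 y y0 (fun t _ => is_derive_sin t)
    (continuous_subspaceT (@continuous_sin R)).
  rewrite sin0 !subr0 => ->; rewrite normrM ler_piMl//.
  by rewrite ler_norml cos_geN1 cos_le1.
have [/H//|/ltW x0] := leP 0 x.
by have := H (- x); rewrite oppr_ge0 sinN !normrN; apply.
Qed.

Lemma one_sub_cos x : 1 - cos x = 2 * sin (x / 2) ^+ 2.
Proof.
have := cos2Dsin2 (x / 2); have -> : cos x = cos (x / 2 + x / 2) by congr cos; field.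
by rewrite cosD => H; nra.
Qed.

Lemma cos_abs x : `|cos x - 1| <= x ^+ 2 / 2 /\ `|cos x - 1| <= `|x|.
Proof.
have h := sin_odd_abs (x / 2); have k : `|sin (x / 2)| <= 1.
  by rewrite ler_norml sin_geN1 sin_le1.
have e := one_sub_cos x; rewrite distrC e.
rewrite ger0_norm; last by rewrite mulr_ge0// sqr_ge0.
rewrite -real_normK ?num_real// -[x ^+ 2]real_normK ?num_real//.
move: h k; rewrite normrM (@ger0_norm _ 2^-1) ?invr_ge0//.
have := normr_ge0 (sin (x / 2)); have := normr_ge0 x.
set u := `|sin _|; set v := `|x| => *; split; nra.
Qed.

Lemma sin_sub_abs x : `|sin x - x| <= x ^+ 2.
Proof.
wlog x0 : x / 0 <= x => [H|].
  have [/H//|/ltW x0] := leP 0 x.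
  have := H (- x); rewrite oppr_ge0 => /(_ x0); rewrite sinN sqrrN.
  by rewrite -opprD normrN.
have D t : is_derive t (1 : R) (fun u : R => sin u - u) (cos t - 1) by apply: is_deriveB.
have [|c] := @MVT_segment R (fun u => sin u - u) (fun t => cos t - 1) 0 x x0 (fun t _ => D t).
  apply: continuous_subspaceT => t; apply: cvgB; [exact: continuous_sin|exact: cvg_id].
rewrite in_itv/= => /andP[c0 cx]; rewrite sin0 !subr0 => ->.
rewrite normrM (ger0_norm x0); have [_] := cos_abs c.
rewrite (ger0_norm c0); have := normr_ge0 (cos c - 1); nra.
Qed.

Lemma expR_bounds a : `|expR a - 1| <= `|a| * expR `|a| /\
  `|expR a - 1 - a| <= a ^+ 2 * expR `|a|.
Proof.
have h1 := expR_ge1Dx a; have h2 := expR_ge1Dx (- a).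
have p := expR_gt0 a; have q := expR_gt0 (- a).
have pq : expR a * expR (- a) = 1 by rewrite -expRD subrr expR0.
have h3 : expR a - 1 <= a * expR a by nra.
have [a0|/ltW a0] := leP 0 a.
  by rewrite (ger0_norm a0) !ger0_norm; [split; nra|lra|lra].
have l1 : expR a <= 1 by rewrite -[leRHS]expR0 ler_expR.
have l2 : 1 <= expR (- a) by rewrite -[leLHS]expR0 ler_expR oppr_ge0.
rewrite (ler0_norm a0) ler0_norm ?ger0_norm; [split; nra|lra|lra].
Qed.

Lemma re_cexp z : re (cexp z) = expR (re z) * cos (im z).
Proof. by case: z => a b; rewrite /cexp /re /=; ring. Qed.
Lemma im_cexp z : im (cexp z) = expR (re z) * sin (im z).
Proof. by case: z => a b; rewrite /cexp /im /=; ring. Qed.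

Lemma cexpD z w : cexp (z + w) = cexp z * cexp w.
Proof.
apply: Ceq.
  by rewrite reM !re_cexp !im_cexp reD imD expRD cosD; ring.
by rewrite imM !re_cexp !im_cexp reD imD expRD sinD; ring.
Qed.

Lemma nm_cexp z : nm (cexp z) = expR (re z).
Proof.
rewrite /nm /Normc.normc; case E: (cexp z) => [a b].
have -> : a = re (cexp z) by rewrite E.
have -> : b = im (cexp z) by rewrite E.
by rewrite re_cexp im_cexp !exprMn -mulrDr cos2Dsin2 mulr1 sqrtr_sqr ger0_norm// expR_ge0.
Qed.

Lemma cexp0 : cexp (0 : C) = 1.
Proof.
by apply: Ceq; rewrite ?re_cexp ?im_cexp -?rc0 ?re_rc ?im_rc expR0 ?cos0 ?sin0 ?mulr1 ?mulr0.
Qed.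

(** Obtained from real bounds on [expR], [cos] and [sin], part by part. The constant is crude; only
    the second order in z and the exponential growth count later. *)
Lemma cexp_taylor z : nm (cexp z - 1 - z) <= 4 * nm z ^+ 2 * expR (nm z).
Proof.
apply: le_trans (nm_reim _) _; rewrite !reB !imB re_cexp im_cexp -[in re 1]rc1 -[in im 1]rc1 re_rc im_rc.
have ha := re_nm z; have hb := im_nm z.
set a := re z in ha *; set b := im z in hb *; set r := nm z in ha hb *.
have [e1 e2] := expR_bounds a; have [c1 _] := cos_abs b; have s1 := sin_odd_abs b.
have s2 := sin_sub_abs b.
have er : expR `|a| <= expR r by rewrite ler_expR.
have er' : expR a <= expR r by rewrite ler_expR (le_trans (ler_norm _)).
have e0 := expR_gt0 `|a|; have e0' := expR_gt0 a.
have r0 : 0 <= r := nm_ge0 z.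
have r1 : 1 <= expR r by rewrite -[leLHS]expR0 ler_expR.
have A : `|expR a * cos b - 1 - a| <= `|expR a - 1 - a| + expR a * `|cos b - 1|.
  have -> : expR a * `|cos b - 1| = `|expR a * (cos b - 1)| by rewrite normrM (gtr0_norm e0').
  by apply: le_trans _ (ler_normD _ _); rewrite le_eqVlt; apply/orP; left; apply/eqP; congr (`|_|); ring.
have B : `|expR a * sin b - 0 - b| <= `|expR a - 1| * `|sin b| + `|sin b - b|.
  rewrite -normrM; apply: le_trans _ (ler_normD _ _).
  by rewrite le_eqVlt; apply/orP; left; apply/eqP; congr (`|_|); ring.
apply: le_trans (lerD A B) _.
have a2 : a ^+ 2 <= r ^+ 2 by rewrite -[a ^+ 2]real_normK ?num_real// ler_sqr ?nnegrE.
have b2 : b ^+ 2 <= r ^+ 2 by rewrite -[b ^+ 2]real_normK ?num_real// ler_sqr ?nnegrE.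
have r2 : 0 <= r ^+ 2 by rewrite sqr_ge0.
have t1 : `|expR a - 1 - a| <= r ^+ 2 * expR r.
  by apply: le_trans e2 _; apply: ler_pM => //; exact: sqr_ge0.
have t2 : expR a * `|cos b - 1| <= expR r * r ^+ 2.
  apply: ler_pM => //; lra.
have t3 : `|expR a - 1| * `|sin b| <= (r * expR r) * r.
  apply: ler_pM => //; last lra.
  by apply: le_trans e1 _; apply: ler_pM => //; exact: ltW.
have t4 : `|sin b - b| <= r ^+ 2 * expR r by nra.
rewrite expr2 in t1 t2 t4 *; nra.
Qed.

Definition ex z : C := cexp (2 * iC * rc pi * z).

Lemma exD z w : ex (z + w) = ex z * ex w.
Proof. by rewrite /ex mulrDr cexpD. Qed.
Lemma ex0 : ex 0 = 1. Proof. by rewrite /ex mulr0 cexp0. Qed.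
Lemma exN z : ex (- z) = (ex z)^-1.
Proof.
have e : ex z * ex (- z) = 1 by rewrite -exD subrr ex0.
have n0 : ex z != 0 by apply: contra_eq_neq e => ->; rewrite mul0r eq_sym oner_neq0.
by apply: (mulfI n0); rewrite e divff.
Qed.
Lemma ex_neq0 z : ex z != 0.
Proof.
apply/eqP => e; have : ex z * ex (- z) = 1 by rewrite -exD subrr ex0.
by rewrite e mul0r => /eqP; rewrite eq_sym oner_eq0.
Qed.
Lemma exX z n : ex (n%:R * z) = ex z ^+ n.
Proof.
elim: n => [|n IH]; first by rewrite mul0r ex0.
by rewrite -natr1 mulrDl mul1r exD IH exprSr.
Qed.

Lemma ex_arg z : (2 * iC * rc pi * z) = rc (- (2 * pi * im z)) + iC * rc (2 * pi * re z).
Proof.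
have -> : (2 : C) = rc 2 by rewrite rc_nat.
by apply: Ceq; rewrite ?reD ?imD ?reM ?imM ?reM ?imM ?re_rc ?im_rc ?re_iC ?im_iC ?re_rc ?im_rc; ring.
Qed.

Lemma nm_ex z : nm (ex z) = expR (- (2 * pi * im z)).
Proof.
by rewrite /ex nm_cexp ex_arg reD reM !re_rc im_rc re_iC im_iC; congr expR; ring.
Qed.

Lemma ex1 : ex 1 = 1.
Proof.
rewrite /ex ex_arg -rc1 im_rc re_rc !mulr0 oppr0 rc0 add0r.
have e : 2 * pi = pi *+ 2 :> R by rewrite mulr2n; ring.
apply: Ceq; rewrite ?re_cexp ?im_cexp reM imM re_iC im_iC re_rc im_rc
  !mulr0 !mul0r mulr1 mul1r subr0 add0r expR0 mul1r e.
  by rewrite cos2pi.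
by rewrite sin2pi.
Qed.

Lemma ex_nat (n : nat) : ex n%:R = 1.
Proof. by rewrite -[n%:R]mulr1 exX ex1 expr1n. Qed.

Lemma ex_int (k : int) : ex k%:~R = 1.
Proof.
case: (intP k) => [|n|n]; rewrite ?ex0//.
  by rewrite -pmulrn ex_nat.
by rewrite mulrNz exN -pmulrn ex_nat invr1.
Qed.

Lemma ex_taylor : exists2 K : R, 0 <= K & forall z,
  nm (ex z - 1 - 2 * iC * rc pi * z) <= K * nm z ^+ 2 * expR (8 * nm z).
Proof.
(* [2 * pi] is bounded by 8, whose square is 64; the same 8 appears in the exponent. *)
exists (4 * 64) => [|z]; first lra.
apply: le_trans (cexp_taylor _) _; rewrite !nmM nm_iC nm_rc.
rewrite (_ : nm 2 = 2) ?nm_nat//.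
have p0 := @pi_gt0 R; have p4 : pi <= 4 :> R by have := @pihalf_lt2 R; lra.
rewrite mulr1 (gtr0_norm p0); have := nm_ge0 z; set r := nm z => r0.
have h : 2 * pi * r <= 8 * r by nra.
have h0 : 0 <= 2 * pi * r by nra.
apply: ler_pM; rewrite ?ler_expR ?expR_ge0//; first by rewrite mulr_ge0// sqr_ge0.
rewrite !expr2; nra.
Qed.

End Exponential.

(** * Differentiability of functions of several complex variables *)

Section Diff.
Variables (R : realType) (g : nat).
Local Notation C := (CC R).
Implicit Types (f : 'rV[C]_g -> C) (z w : 'rV[C]_g).

Lemma nbhs_rV z (A : set 'rV[C]_g) : nbhs z A ->
  exists2 d : R, 0 < d & forall w, (forall j, nm (w 0 j - z 0 j) < d) -> A w.
Proof.
move=> /nbhs_ballP[e /= e0 H]; exists (re e).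
  by move: e0; rewrite ltcE /= => /andP[].
move=> w Hw; apply: H; split=> // i j; rewrite ord1 /ball /= distrC nmE /rc.
move: e0; rewrite !ltcE /= => /andP[/eqP <- _]; rewrite eqxx /=.
exact: Hw.
Qed.

Lemma nbhs_rVE z (A : set 'rV[C]_g) (d : R) : 0 < d ->
  (forall w, (forall j, nm (w 0 j - z 0 j) < d) -> A w) -> nbhs z A.
Proof.
move=> d0 H; apply/nbhs_ballP; exists (rc d) => /=.
  by rewrite /rc ltcR.
move=> w [_ Hw]; apply: H => j; have := Hw 0 j.
by rewrite /ball /= nmE /rc ltcR nmC.
Qed.

Definition cont f := forall z (e : R), 0 < e -> exists2 d : R, 0 < d &
  forall w, (forall j, nm (w 0 j - z 0 j) < d) -> nm (f w - f z) < e.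

Lemma differentiable_cont f : (forall z, differentiable f z) -> cont f.
Proof.
move=> H z e e0; have /differentiable_continuous /(_ [set y | nm (y - f z) < e]) := H z.
case/(_ _)/Wrap => [|/nbhs_rV//].
exact: (@nbhs_nmE _ _ _ e).
Qed.

Lemma derive_pt f z v : differentiable f z -> forall e : R, 0 < e ->
  exists2 d : R, 0 < d & forall t : C, nm t < d ->
   nm (f (z + t *: v) - f z - t * 'D_v f z) <= e * nm t.
Proof.
move=> /(diff_derivable (v := v)) /derivableP[D E] e e0.
have /(_ [set y | nm (y - 'D_v f z) < e]) := D.
case/(_ _)/Wrap => [|]; first exact: (@nbhs_nmE _ _ _ e).
rewrite /= /dnbhs /within /= => /nbhs_nm[d d0 Hd]; exists d => // t td.
have [->|t0] := eqVneq t 0.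
  by rewrite scale0r addr0 mul0r subrr subr0 nm0 mulr0.
have h : nm ((f (z + t *: v) - f z) / t - 'D_v f z) <= e.
  have := Hd t; rewrite subr0 => /(_ td t0) /= /ltW.
  by rewrite [_^-1 *: _]mulrC [t *: v + z]addrC.
have -> : f (z + t *: v) - f z - t * 'D_v f z = ((f (z + t *: v) - f z) / t - 'D_v f z) * t.
  by rewrite mulrBl divfK// [t * _]mulrC.
by rewrite nmM; apply: ler_wpM2r => //; apply: nm_ge0.
Qed.

Definition lform (a : 'I_g -> C) (w : 'rV[C]_g) : C := \sum_j w 0 j * a j.

Lemma lform_is_linear a : linear (lform a : 'rV[C]_g -> C).
Proof.
move=> k u v; rewrite /lform scaler_sumr -big_split /=; apply: eq_bigr => j _.
by rewrite !mxE mulrDl [_ *: _]mulrA.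
Qed.
HB.instance Definition _ a := GRing.isLinear.Build C 'rV[C]_g C _ (lform a) (lform_is_linear a).

Lemma rV_norm_ge w j : nm (w 0 j) <= re `|w|.
Proof.
have : `|w 0 j| <= `|w|.
  by rewrite [leRHS]mx_normE -[leLHS]nngE num_le; exact: (le_bigmax _ _ (0, j)).
by rewrite nmE /rc lecE => /andP[].
Qed.

Lemma rV_norm_rc w : `|w| = rc (re `|w|).
Proof. by rewrite [rc _]RRe_real// normr_real. Qed.

Lemma rV_norm_le w (b : R) : 0 <= b -> (forall j, nm (w 0 j) <= b) -> `|w| <= rc b.
Proof.
move=> b0 H; have rb0 : 0 <= rc b by rewrite /rc lecR.
rewrite [leLHS]mx_normE -[leRHS]/((NngNum rb0)%:num) num_le; apply/bigmax_leP; split => //.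
by case=> i j _; rewrite -num_le /= ord1 nmE /rc lecR.
Qed.

(** The way a series is proved differentiable: a quadratic remainder makes the linear form [a]
    satisfy the characterisation of the differential, which is unique, and the partial derivatives
    are read off from it. *)
Lemma diff_from_bound f z (a : 'I_g -> C) (K : R) :
  (forall w (r : R), 0 <= r <= 1 -> (forall j, nm (w 0 j) <= r) ->
    nm (f (z + w) - f z - \sum_j w 0 j * a j) <= K * r ^+ 2) ->
  differentiable f z /\ forall j, 'D_(delta_mx 0 j) f z = a j.
Proof.
move=> H.
have Lc : continuous (lform a).
  move=> u A /nbhs_nm[d d0 HA]; set s := 1 + \sum_j nm (a j).
  have s0 : 0 < s by rewrite ltr_pwDl// sumr_ge0// => j _; exact: nm_ge0.
  apply: (@nbhs_rVE _ _ (d / s)); first exact: divr_gt0.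
  move=> w Hw; apply: HA; rewrite /lform -sumrB.
  apply: le_lt_trans (nm_sum _ _ _) _.
  apply: (@le_lt_trans _ _ (d / s * \sum_j nm (a j))).
    rewrite mulr_sumr; apply: ler_sum => j _; rewrite -mulrBl nmM ler_wpM2r ?nm_ge0//.
    exact/ltW/Hw.
  rewrite mulrAC ltr_pdivrMr// ltr_pM2l// /s; lra.
have O : forall e : C, 0 < e -> \forall w \near (0 : 'rV[C]_g),
    `|(f \o shift z - (cst (f z) + lform a)) w| <= e * `|w|.
  move=> e e0; have e0' : 0 < re e by move: e0; rewrite ltcE /= => /andP[].
  have ee : e = rc (re e) by rewrite [rc _]RRe_real// gtr0_real.
  set K' := 1 + `|K|; have K'0 : 0 < K' by rewrite ltr_pwDl.
  apply: (@nbhs_rVE _ _ (Num.min 1 (re e / K'))).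
    by rewrite lt_min ltr01 divr_gt0.
  move=> w Hw; set r := re `|w|.
  have r0 : 0 <= r by move: (normr_ge0 w); rewrite lecE => /andP[].
  have rm : r <= Num.min 1 (re e / K').
    have : `|w| <= rc (Num.min 1 (re e / K')).
      apply: rV_norm_le => [|j]; first by rewrite le_min ler01 divr_ge0// ltW.
      by have := Hw j; rewrite mxE subr0 => /ltW.
    by rewrite lecE => /andP[].
  rewrite rV_norm_rc -/r ee -rcM nmE /rc lecR.
  rewrite (_ : (f \o shift z - (cst (f z) + lform a)) w = f (z + w) - f z - \sum_j w 0 j * a j); last first.
    by rewrite (addrC z w) -addrA -opprD.
  move: rm; rewrite le_min => /andP[r1 rK].
  have := H w r; rewrite r0 r1 => /(_ isT (fun j => rV_norm_ge w j)).
  move=> h; apply: le_trans h _.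
  rewrite ler_pdivlMr// in rK.
  have : K <= K' by rewrite /K'; have := ler_norm K; lra.
  move: rK; rewrite expr2; nra.
have E : 'd f z = lform a :> ('rV[C]_g -> C).
  by apply: diff_unique => //; apply/eqaddoP.
have D : differentiable f z.
  by apply/diff_locallyP; rewrite E; split => //; apply/eqaddoP.
split=> // j; rewrite deriveE// E /= /lform (bigD1 j)//= big1.
  by rewrite mxE !eqxx mul1r addr0.
by move=> i ij; rewrite mxE eqxx /= (negPf ij) mul0r.
Qed.

End Diff.

(** * Absolutely convergent Fourier series *)

Section LatticeSums.
Variables (R : realType) (g : nat).
Local Notation C := (CC R).
Implicit Types (k l : 'rV[int]_g) (z w : 'rV[C]_g) (F : 'rV[int]_g -> C).

Definition l1 k : R := \sum_j `|(k 0 j)%:~R|.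
Definition dot k z : C := \sum_j (k 0 j)%:~R * z 0 j.
Definition chi k z : C := ex (dot k z).

Lemma l1_ge0 k : 0 <= l1 k. Proof. by apply: sumr_ge0. Qed.
Lemma l1_coord k j : `|(k 0 j)%:~R| <= l1 k.
Proof. by rewrite /l1 (bigD1 j)//= lerDl sumr_ge0. Qed.

Lemma dotDl k l z : dot (k + l) z = dot k z + dot l z.
Proof. by rewrite /dot -big_split; apply: eq_bigr => j _; rewrite mxE rmorphD mulrDl. Qed.
Lemma dotNl k z : dot (- k) z = - dot k z.
Proof. by rewrite /dot -sumrN; apply: eq_bigr => j _; rewrite mxE rmorphN mulNr. Qed.
Lemma dotBl k l z : dot (k - l) z = dot k z - dot l z.
Proof. by rewrite dotDl dotNl. Qed.
Lemma dotDr k z w : dot k (z + w) = dot k z + dot k w.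
Proof. by rewrite /dot -big_split; apply: eq_bigr => j _; rewrite mxE mulrDr. Qed.
Lemma dot0l z : dot 0 z = 0.
Proof. by rewrite /dot big1// => j _; rewrite mxE mul0r. Qed.
Lemma dot_zvec k l : exists n : int, dot k (zvec R l) = n%:~R.
Proof.
exists (\sum_j k 0 j * l 0 j); rewrite rmorph_sum; apply: eq_bigr => j _.
by rewrite mxE rmorphM.
Qed.

Lemma chiDl k l z : chi (k + l) z = chi k z * chi l z.
Proof. by rewrite /chi dotDl exD. Qed.
Lemma chiDr k z w : chi k (z + w) = chi k z * chi k w.
Proof. by rewrite /chi dotDr exD. Qed.
Lemma chiN k z : chi (- k) z = (chi k z)^-1.
Proof. by rewrite /chi dotNl exN. Qed.
Lemma chi0 z : chi 0 z = 1. Proof. by rewrite /chi dot0l ex0. Qed.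
Lemma chi_zvec k l : chi k (zvec R l) = 1.
Proof. by have [n e] := dot_zvec k l; rewrite /chi e ex_int. Qed.

Lemma im_dot k z : im (dot k z) = \sum_j (k 0 j)%:~R * im (z 0 j).
Proof.
rewrite im_sum; apply: eq_bigr => j _.
by rewrite imM -rc_int re_rc im_rc mul0r addr0.
Qed.

Lemma nm_chi_le k z (b : R) : (forall j, `|im (z 0 j)| <= b) ->
  nm (chi k z) <= expR (2 * pi * b * l1 k).
Proof.
move=> H; rewrite nm_ex ler_expR im_dot -mulrN -mulrA ler_pM2l; last first.
  by rewrite mulr_gt0// pi_gt0.
rewrite -sumrN mulr_sumr; apply: ler_sum => j _.
rewrite -mulNr; apply: le_trans (ler_norm _) _; rewrite normrM normrN mulrC.
by apply: ler_wpM2r.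
Qed.

Lemma nm_dot_le k z (r : R) : (forall j, nm (z 0 j) <= r) -> nm (dot k z) <= r * l1 k.
Proof.
move=> H; apply: le_trans (nm_sum _ _ _) _; rewrite mulr_sumr; apply: ler_sum => j _.
by rewrite nmM nm_int mulrC ler_wpM2r.
Qed.

(** The boxes are indexed as in the definition of [theta], so that the two series later agree term
    by term. *)
Definition boxpt N (a : {ffun 'I_g -> 'I_(N.*2.+1)}) : 'rV[int]_g :=
  \row_j ((a j)%:Z - N%:Z).
Definition boxsum N F : C := \sum_(a : {ffun 'I_g -> 'I_(N.*2.+1)}) F (boxpt a).
Definition rboxsum N (F : 'rV[int]_g -> R) : R :=
  \sum_(a : {ffun 'I_g -> 'I_(N.*2.+1)}) F (boxpt a).
Definition inbox N k := [forall j, (absz (k ord0 j) <= N)%N].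

(** The index sets of two boxes have different types; translating indices by [N' - N] embeds one in
    the other, and partial sums become comparable term by term. *)
Lemma boxsum_widen N N' F : (N <= N')%N ->
  boxsum N F = boxsum N' (fun k => if inbox N k then F k else 0).
Proof.
move=> NN'; rewrite [in RHS]/boxsum -big_mkcond.
pose h (a : {ffun 'I_g -> 'I_(N.*2.+1)}) : {ffun 'I_g -> 'I_(N'.*2.+1)} :=
  [ffun j => inord (a j + (N' - N))%N].
pose h' (a : {ffun 'I_g -> 'I_(N'.*2.+1)}) : {ffun 'I_g -> 'I_(N.*2.+1)} :=
  [ffun j => inord (a j - (N' - N))%N].
have hE a : boxpt (h a) = boxpt a.
  apply/rowP => j; rewrite !mxE ffunE inordK; last by have := ltn_ord (a j); lia.
  by lia.
rewrite (reindex_onto h h'); last first.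
  move=> a /forallP H; apply/ffunP => j; rewrite !ffunE; apply: val_inj.
  have := H j; have := ltn_ord (a j); rewrite mxE => h1 h2.
  by rewrite /= inordK inordK; lia.
apply: eq_big => [a|a _]; last by rewrite hE.
symmetry; apply/andP; split.
  rewrite /inbox hE; apply/forallP => j; rewrite mxE; case: (a j) => m hm /=; lia.
apply/eqP/ffunP => j; rewrite !ffunE; apply: val_inj.
by case: (a j) => m hm /=; rewrite inordK inordK; lia.
Qed.

(** Induction on N: the two new end terms are at most [2^-1 ^+ N.+1] each, because
    [expR (-1) <= 1 / 2]. *)
Lemma sum_half_bound N :
  \sum_(i < N.*2.+1) expR (- `|(i%:Z - N%:Z)%:~R|) <= 3 - 2 * 2^-1 ^+ N :> R.
Proof.
have e1 : expR (-1) <= 2^-1 :> R.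
  rewrite expRN lef_pV2 ?posrE ?expR_gt0//; have := expR_ge1Dx (1 : R); lra.
have eN n : expR (- n%:R) <= 2^-1 ^+ n :> R.
  rewrite (_ : - n%:R = n%:R * -1 :> R); last by rewrite mulrN1.
  by rewrite expRM_natl; apply: lerXn2r; rewrite ?nnegrE ?expR_ge0 ?invr_ge0.
elim: N => [|N IH].
  by rewrite big_ord1 /= subrr normr0 oppr0 expR0 expr0; lra.
rewrite doubleS big_ord_recl big_ord_recr /=.
have -> : \sum_(i < (N.*2).+1) expR (- `|((bump 0 i)%:Z - N.+1%:Z)%:~R|) =
  \sum_(i < (N.*2).+1) expR (- `|(i%:Z - N%:Z)%:~R|) :> R.
  by apply: eq_bigr => i _; congr (expR (- `|_%:~R|)); rewrite /bump /=; lia.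
have -> : 0%:Z - N.+1%:Z = - N.+1%:Z by lia.
have -> : (bump 0 (N.*2).+1)%:Z - N.+1%:Z = N.+1%:Z by rewrite /bump /=; lia.
have -> : `|(- N.+1%:Z)%:~R| = N.+1%:R :> R by rewrite rmorphN normrN ger0_norm ?ler0z.
have -> : `|(N.+1%:Z)%:~R| = N.+1%:R :> R by rewrite ger0_norm ?ler0z.
have := eN N.+1.
rewrite exprS; lra.
Qed.

Lemma rboxsum_bound N : rboxsum N (fun k => expR (- l1 k)) <= 3 ^+ g.
Proof.
rewrite /rboxsum (eq_bigr (fun a : {ffun 'I_g -> 'I_(N.*2.+1)} =>
    \prod_j expR (- `|((a j)%:Z - N%:Z)%:~R|))); last first.
  move=> a _; rewrite /l1 -sumrN expR_sum; apply: eq_bigr => j _.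
  by rewrite mxE.
rewrite -(bigA_distr_bigA (fun (j : 'I_g) (i : 'I_(N.*2.+1)) => expR (- `|(i%:Z - N%:Z)%:~R|))).
rewrite prodr_const card_ord; apply: lerXn2r; rewrite ?nnegrE//.
  by apply: sumr_ge0 => i _; exact: expR_ge0.
apply: le_trans (sum_half_bound N) _.
have : 0 <= 2^-1 ^+ N :> R by rewrite exprn_ge0// invr_ge0.
lra.
Qed.

(** Of the two factors [expR (- l1 k)], one is summed over the lattice ([rboxsum_bound]) and the
    other makes the tail outside a box small. *)
Definition domin (M : R) F := forall k, nm (F k) <= M * expR (- (2 * l1 k)).

Lemma boxsum_dist M F N N' : domin M F -> (N <= N')%N ->
  nm (boxsum N' F - boxsum N F) <= M * expR (- N%:R) * 3 ^+ g.
Proof.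
move=> H NN'; rewrite (boxsum_widen _ NN') /boxsum -sumrB.
apply: le_trans (nm_sum _ _ _) _.
have M0 : 0 <= M.
  by rewrite -(pmulr_lge0 _ (expR_gt0 (- (2 * l1 0)))); exact: le_trans (nm_ge0 _) (H 0).
apply: (@le_trans _ _ (M * expR (- N%:R) * rboxsum N' (fun k => expR (- l1 k)))); last first.
  by apply: ler_wpM2l (rboxsum_bound _); rewrite mulr_ge0 ?expR_ge0.
rewrite /rboxsum mulr_sumr; apply: ler_sum => a _.
case: ifPn => [_|/forallPn[j]].
  by rewrite subrr nm0 !mulr_ge0 ?expR_ge0.
rewrite -ltnNge subr0 => hj; apply: le_trans (H _) _.
rewrite -mulrA ler_wpM2l// -expRD ler_expR.
have : N%:R <= l1 (boxpt a).
  apply: le_trans _ (l1_coord _ j); rewrite -[N%:R]/(N%:Z%:~R) -intr_norm ler_int.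
  by have := hj; rewrite -ltz_nat abszE => /ltW.
lra.
Qed.

Lemma boxsum_bound M F N : domin M F -> nm (boxsum N F) <= M * 3 ^+ g.
Proof.
move=> H; apply: le_trans (nm_sum _ _ _) _.
have M0 : 0 <= M.
  by rewrite -(pmulr_lge0 _ (expR_gt0 (- (2 * l1 0)))); exact: le_trans (nm_ge0 _) (H 0).
apply: le_trans _ (ler_wpM2l M0 (rboxsum_bound N)).
rewrite /rboxsum mulr_sumr; apply: ler_sum => a _; apply: le_trans (H _) _.
rewrite ler_wpM2l// ler_expR; have := l1_ge0 (boxpt a); lra.
Qed.

Lemma expRN_small (M e : R) : 0 < e -> exists N, forall n, (N <= n)%N -> M * expR (- n%:R) < e.
Proof.
move=> e0; exists (Num.trunc (`|M| / e)).+1 => n Hn.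
have h : `|M| / e < n%:R.
  apply: lt_le_trans (truncnS_gt _) _; first by rewrite ler_nat.
rewrite expRN ltr_pdivrMr ?expR_gt0//.
have := expR_ge1Dx (n%:R : R); move: h; rewrite ltr_pdivrMr// => h1 h2.
have := ler_norm M; nra.
Qed.

Definition summ F := exists M, domin M F.
Definition zsum F : C := limn (fun N => boxsum N F).

Lemma zsumP F : summ F -> tends (fun N => boxsum N F) (zsum F).
Proof.
move=> [M H]; have [|l Hl] := @tends_cauchy R (fun N => boxsum N F).
  move=> e e0; have [N HN] := expRN_small (M * 3 ^+ g) e0.
  exists N => n m hn hm.
  wlog nm' : n m hn hm / (n <= m)%N => [W|].
    have /orP[h|h] := leq_total n m; first exact: W.
    by rewrite nmC; apply: W.
  rewrite nmC; apply: le_lt_trans (boxsum_dist H nm') _.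
  by rewrite mulrAC; apply: HN.
by rewrite /zsum (tends_lim Hl).
Qed.

Lemma zsum_bound M F : domin M F -> nm (zsum F) <= M * 3 ^+ g.
Proof.
move=> H; apply: (tends_le (N := 0) (zsumP (ex_intro _ M H))) => n _.
exact: boxsum_bound.
Qed.

Lemma zsum_dist M F N : domin M F -> nm (zsum F - boxsum N F) <= M * expR (- N%:R) * 3 ^+ g.
Proof.
move=> H; have := tendsB (zsumP (ex_intro _ M H)) (tends_cst (boxsum N F)).
move=> /(tends_le (N := N)); apply => n hn.
exact: boxsum_dist.
Qed.

Lemma summD F G : summ F -> summ G -> summ (fun k => F k + G k).
Proof.
move=> [M H] [M' H']; exists (M + M') => k; rewrite mulrDl.
exact: le_trans (nmD _ _) (lerD (H k) (H' k)).
Qed.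
Lemma summZ a F : summ F -> summ (fun k => a * F k).
Proof.
move=> [M H]; exists (nm a * M) => k; rewrite nmM -mulrA.
by rewrite ler_wpM2l ?nm_ge0.
Qed.

Lemma zsumD F G : summ F -> summ G -> zsum (fun k => F k + G k) = zsum F + zsum G.
Proof.
move=> HF HG; apply: tends_uniq (zsumP (summD HF HG)) _.
apply: tends_ext (tendsD (zsumP HF) (zsumP HG)) => n.
by rewrite /boxsum big_split.
Qed.
Lemma zsumZ a F : summ F -> zsum (fun k => a * F k) = a * zsum F.
Proof.
move=> HF; apply: tends_uniq (zsumP (summZ a HF)) _.
apply: tends_ext (tendsZ a (zsumP HF)) => n.
by rewrite /boxsum mulr_sumr.
Qed.
Lemma zsumB F G : summ F -> summ G -> zsum (fun k => F k - G k) = zsum F - zsum G.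
Proof.
move=> HF HG; rewrite -[zsum G]mul1r -mulNr -zsumZ// -zsumD//; last exact: summZ.
by congr zsum; apply/funext => k; rewrite mulN1r.
Qed.
Lemma summB F G : summ F -> summ G -> summ (fun k => F k - G k).
Proof.
move=> HF /(summZ (-1)) HG; have := summD HF HG; congr summ.
by apply/funext => k; rewrite mulN1r.
Qed.
Lemma summ_sum (I : finType) (F : I -> 'rV[int]_g -> C) : (forall i, summ (F i)) ->
  summ (fun k => \sum_i F i k) /\ zsum (fun k => \sum_i F i k) = \sum_i zsum (F i).
Proof.
move=> H; elim: (index_enum I) => [|i r [IH1 IH2]].
  rewrite big_nil; have S0 : summ (fun=> 0).
    by exists 0 => k; rewrite mul0r nm0.
  have e : (fun k => \sum_(i <- [::]) F i k) = (fun=> 0) by apply/funext => k; rewrite big_nil.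
  rewrite e; split=> //.
  transitivity (zsum (fun k : 'rV[int]_g => 0 * (0 : C))); last by rewrite (zsumZ 0 S0) mul0r.
  by congr zsum; apply/funext => k; rewrite mulr0.
have e : (fun k => \sum_(i <- i :: r) F i k) = (fun k => F i k + \sum_(i <- r) F i k).
  by apply/funext => k; rewrite big_cons.
rewrite e big_cons -IH2; split; [exact: summD|exact: zsumD].
Qed.

(** Decay faster than every exponential characterises the Fourier coefficients of periodic entire
    functions ([OP_ev], [coef_decay], [ev_coef]). *)
Definition decay F := forall A : R, exists M, forall k, nm (F k) <= M * expR (- (A * l1 k)).

Lemma decay_mul F (G : 'rV[int]_g -> C) (B D : R) : decay F ->
  (forall k, nm (G k) <= B * expR (D * l1 k)) -> decay (fun k => G k * F k).
Proof.
move=> H h A; have [M hM] := H (A + D); exists (B * M) => k.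
rewrite nmM (_ : _ * _ * _ = (B * expR (D * l1 k)) * (M * expR (- ((A + D) * l1 k)))).
  by apply: ler_pM => //; exact: nm_ge0.
by rewrite mulrACA -expRD; congr (_ * expR _); ring.
Qed.

Lemma decayZ a F : decay F -> decay (fun k => a * F k).
Proof.
move=> H; apply: (@decay_mul F (fun=> a) (nm a) 0) => // k.
by rewrite mul0r expR0 mulr1.
Qed.

Lemma l1_sq_exp k : l1 k ^+ 2 <= 4 * expR (l1 k).
Proof.
have h := l1_ge0 k; have := expR_ge1Dx (l1 k / 2).
have -> : expR (l1 k) = expR (l1 k / 2) * expR (l1 k / 2) by rewrite -expRD; congr expR; field.
by set e := expR _ => h1; nra.
Qed.

Lemma decay_coord F j : decay F -> decay (fun k => (k 0 j)%:~R * F k).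
Proof.
move=> H; apply: (@decay_mul F (fun k => (k 0 j)%:~R) 1 1) => // k.
rewrite nm_int mul1r mul1r; apply: le_trans (l1_coord _ _) _.
have := expR_ge1Dx (l1 k); lra.
Qed.

Definition ev (c : 'rV[int]_g -> C) z : C := zsum (fun k => c k * chi k z).

Lemma summ_ev_bound (c : 'rV[int]_g -> C) (b : R) : decay c ->
  exists M, forall z, (forall j, `|im (z 0 j)| <= b) -> domin M (fun k => c k * chi k z).
Proof.
move=> H; have [M h] := H (2 + 2 * pi * b); exists M => z zb k.
rewrite nmM (_ : _ * expR _ = (M * expR (- ((2 + 2 * pi * b) * l1 k))) * expR (2 * pi * b * l1 k)).
  by apply: ler_pM; rewrite ?nm_ge0//; exact: nm_chi_le.
by rewrite -mulrA -expRD; congr (_ * expR _); ring.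
Qed.

Lemma im_bounded z : exists b : R, 0 <= b /\ forall j, `|im (z 0 j)| <= b.
Proof.
exists (\sum_j `|im (z 0 j)|); split; first exact: sumr_ge0.
by move=> j; rewrite (bigD1 j)//= lerDl sumr_ge0.
Qed.

Lemma summ_ev c z : decay c -> summ (fun k => c k * chi k z).
Proof.
move=> /[dup] H; have [b [_ hb]] := im_bounded z => /(summ_ev_bound b)[M HM].
by exists M; apply: HM.
Qed.

Lemma ev_diff (c : 'rV[int]_g -> C) z : decay c ->
  differentiable (ev c) z /\
  forall j, 'D_(delta_mx 0 j) (ev c) z = ev (fun k => 2 * iC * rc pi * ((k 0 j)%:~R * c k)) z.
Proof.
move=> H; have [b [b0 hb]] := im_bounded z.
(* The exponent pays for the size of [chi k z] on the strip ([2 * pi * b]), for the exponential in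
   [ex_taylor] (8), for [l1 k ^+ 2] (1) and for [domin] (2). *)
have [M hM] := H (2 * pi * b + 11).
have M0 : 0 <= M.
  by rewrite -(pmulr_lge0 _ (expR_gt0 (- ((2 * pi * b + 11) * l1 0)))); exact: le_trans (nm_ge0 _) (hM 0).
have [K K0 hK] := ex_taylor R.
apply: (@diff_from_bound _ _ _ _ _ (4 * K * M * 3 ^+ g)) => w r /andP[r0 r1] hw.
have S1 w' : summ (fun k => c k * chi k (z + w')) by exact: summ_ev.
have S2 := summ_ev z H.
have S3 j : summ (fun k => w 0 j * (2 * iC * rc pi * ((k 0 j)%:~R * c k) * chi k z)).
  by apply/summZ/summ_ev/decayZ/decay_coord.
have [S4 E4] := summ_sum S3.
have -> : \sum_j w 0 j * ev (fun k => 2 * iC * rc pi * ((k 0 j)%:~R * c k)) z =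
  zsum (fun k => \sum_j w 0 j * (2 * iC * rc pi * ((k 0 j)%:~R * c k) * chi k z)).
  rewrite E4; apply: eq_bigr => j _; rewrite zsumZ//.
  by apply/summ_ev/decayZ/decay_coord.
rewrite /ev -zsumB// -zsumB//; last exact: summB.
have -> : 4 * K * M * 3 ^+ g * r ^+ 2 = (4 * K * M * r ^+ 2) * 3 ^+ g by ring.
apply: zsum_bound => k.
have -> : c k * chi k (z + w) - c k * chi k z - \sum_j w 0 j * (2 * iC * rc pi * ((k 0 j)%:~R * c k) * chi k z)
  = c k * chi k z * (ex (dot k w) - 1 - 2 * iC * rc pi * dot k w).
  rewrite chiDr /dot [2 * iC * rc pi * \sum__ _]mulr_sumr mulrBr [c k * chi k z * \sum__ _]mulr_sumr.
  congr (_ - _); first by rewrite /chi; ring.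
  by apply: eq_bigr => j _; ring.
rewrite 2!nmM.
have t1 := hM k; have t2 := nm_chi_le k hb; have t3 := hK (dot k w).
have t4 := nm_dot_le k hw; have t5 := l1_sq_exp k; have L0 := l1_ge0 k.
have t6 : nm (dot k w) ^+ 2 <= r ^+ 2 * (4 * expR (l1 k)).
  apply: (@le_trans _ _ ((r * l1 k) ^+ 2)).
    by apply: lerXn2r; rewrite ?nnegrE ?nm_ge0// mulr_ge0.
  by rewrite exprMn ler_wpM2l// sqr_ge0.
have t7 : expR (8 * nm (dot k w)) <= expR (8 * l1 k) by rewrite ler_expR; nra.
have t8 : nm (ex (dot k w) - 1 - 2 * iC * rc pi * dot k w) <= 4 * K * r ^+ 2 * expR (9 * l1 k).
  apply: le_trans t3 _.
  rewrite (_ : 4 * K * r ^+ 2 * _ = K * (r ^+ 2 * (4 * expR (l1 k))) * expR (8 * l1 k)); last first.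
    by rewrite (_ : 9 * l1 k = l1 k + 8 * l1 k) ?expRD; ring.
  apply: ler_pM => //; last by apply: ler_wpM2l.
  by apply: mulr_ge0 => //; exact: sqr_ge0.
rewrite (_ : _ * expR _ = (M * expR (- ((2 * pi * b + 11) * l1 k))) * expR (2 * pi * b * l1 k) * (4 * K * r ^+ 2 * expR (9 * l1 k))).
  apply: ler_pM => //; [by apply: mulr_ge0; exact: nm_ge0|exact: nm_ge0|].
  by apply: ler_pM => //; exact: nm_ge0.
rewrite (_ : - (2 * l1 k) = - ((2 * pi * b + 11) * l1 k) + 2 * pi * b * l1 k + 9 * l1 k) ?expRD; ring.
Qed.

Lemma ev_periodic (c : 'rV[int]_g -> C) z p : ev c (z + zvec R p) = ev c z.
Proof. by rewrite /ev; congr zsum; apply/funext => k; rewrite chiDr chi_zvec mulr1. Qed.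

End LatticeSums.

(** * Goursat's theorem on rectangles *)

Section Goursat.
Variable R : realType.
Local Notation C := (CC R).
Variable f : C -> C.
Implicit Types (p q z : C) (a b : R) (s : nat).

Definition hsum s q a : C := rc (a / 2 ^+ s) * \sum_(i < (2 ^ s)%N) f (q + rc (i%:R * (a / 2 ^+ s))).
Definition vsum s q b : C := rc (b / 2 ^+ s) * \sum_(i < (2 ^ s)%N) f (q + iC * rc (i%:R * (b / 2 ^+ s))).
(** The Riemann sum, with [2 ^ s] steps on each side, of the contour integral of f around the
    rectangle with corner p and sides a and b. *)
Definition csum s p a b : C :=
  hsum s p a - hsum s (p + iC * rc b) a + iC * (vsum s (p + rc a) b - vsum s p b).

Lemma half_sum s (F : nat -> C) :
  \sum_(i < (2 ^ s.+1)%N) F i = \sum_(i < (2 ^ s)%N) F i + \sum_(i < (2 ^ s)%N) F (2 ^ s + i)%N.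
Proof. by rewrite expnS mul2n -addnn big_split_ord. Qed.

Lemma two_pow s : (2 ^ s)%:R = 2 ^+ s :> R. Proof. by rewrite natrX. Qed.

Lemma hsumS s q a : hsum s.+1 q a = hsum s q (a / 2) + hsum s (q + rc (a / 2)) (a / 2).
Proof.
have e : a / 2 ^+ s.+1 = a / 2 / 2 ^+ s by rewrite exprS invfM mulrA.
have n0 : 2 ^+ s != 0 :> R by rewrite expf_neq0.
rewrite /hsum (half_sum s (fun i => f (q + rc (i%:R * (a / 2 ^+ s.+1))))) e mulrDr.
congr (_ + _ * _); apply: eq_bigr => i _; congr f.
by rewrite natrD two_pow -addrA -rcD; congr (_ + rc _); field.
Qed.

Lemma vsumS s q b : vsum s.+1 q b = vsum s q (b / 2) + vsum s (q + iC * rc (b / 2)) (b / 2).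
Proof.
have e : b / 2 ^+ s.+1 = b / 2 / 2 ^+ s by rewrite exprS invfM mulrA.
have n0 : 2 ^+ s != 0 :> R by rewrite expf_neq0.
rewrite /vsum (half_sum s (fun i => f (q + iC * rc (i%:R * (b / 2 ^+ s.+1))))) e mulrDr.
congr (_ + _ * _); apply: eq_bigr => i _; congr f.
by rewrite natrD two_pow -addrA -mulrDr -rcD; congr (_ + _ * rc _); field.
Qed.

(** An exact identity, since halving a side halves its number of steps and inner sides cancel. The
    subdivision argument can thus be run on Riemann sums, without defining integrals. *)
Lemma csumS s p a b : csum s.+1 p a b =
  csum s p (a / 2) (b / 2) + csum s (p + rc (a / 2)) (a / 2) (b / 2) +
  csum s (p + iC * rc (b / 2)) (a / 2) (b / 2) +
  csum s (p + rc (a / 2) + iC * rc (b / 2)) (a / 2) (b / 2).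
Proof.
have ea : rc a = rc (a / 2) + rc (a / 2) by rewrite -rcD; congr rc; field.
have eb : rc b = rc (b / 2) + rc (b / 2) by rewrite -rcD; congr rc; field.
rewrite /csum !hsumS !vsumS ea eb.
have -> : p + iC * (rc (b / 2) + rc (b / 2)) = p + iC * rc (b / 2) + iC * rc (b / 2) by ring.
have -> : p + (rc (a / 2) + rc (a / 2)) = p + rc (a / 2) + rc (a / 2) by ring.
have -> : p + rc (a / 2) + iC * rc (b / 2) = p + iC * rc (b / 2) + rc (a / 2) by ring.
have -> : p + iC * rc (b / 2) + iC * rc (b / 2) + rc (a / 2) =
  p + iC * rc (b / 2) + rc (a / 2) + iC * rc (b / 2) by ring.
have -> : p + rc (a / 2) + rc (a / 2) + iC * rc (b / 2) =
  p + iC * rc (b / 2) + rc (a / 2) + rc (a / 2) by ring.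
ring.
Qed.

(** Affine functions have contour sum exactly 0: opposite sides contribute [- a * c1 * iC * b] and
    [iC * b * c1 * a]. Only the remainder counts, and it is summed over a boundary of length
    [2 * (a + b)]. *)
Lemma csum_local s p a b (c0 c1 z0 : C) (B : R) : 0 <= a -> 0 <= b ->
  (forall x y : R, 0 <= x <= a -> 0 <= y <= b ->
    nm (f (p + rc x + iC * rc y) - c0 - c1 * (p + rc x + iC * rc y - z0)) <= B) ->
  nm (csum s p a b) <= 2 * (a + b) * B.
Proof.
move=> a0 b0 H.
pose r z := f z - c0 - c1 * (z - z0).
have n0 : 2 ^+ s != 0 :> R by rewrite expf_neq0.
have p0 : 0 < 2 ^+ s :> R by rewrite exprn_gt0.
have card0 (x : C) : \sum_(i < (2 ^ s)%N) x = rc (2 ^+ s) * x.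
  have := congr1 (@rc R) (two_pow s); rewrite rc_nat => h.
  by rewrite sumr_const card_ord -[LHS]mulr_natl h.
have E : csum s p a b =
  rc (a / 2 ^+ s) * \sum_(i < (2 ^ s)%N) (r (p + rc (i%:R * (a / 2 ^+ s)))
     - r (p + iC * rc b + rc (i%:R * (a / 2 ^+ s)))) +
  iC * (rc (b / 2 ^+ s) * \sum_(i < (2 ^ s)%N) (r (p + rc a + iC * rc (i%:R * (b / 2 ^+ s)))
     - r (p + iC * rc (i%:R * (b / 2 ^+ s))))).
  have e1 : \sum_(i < (2 ^ s)%N) (r (p + rc (i%:R * (a / 2 ^+ s)))
     - r (p + iC * rc b + rc (i%:R * (a / 2 ^+ s)))) =
     \sum_(i < (2 ^ s)%N) f (p + rc (i%:R * (a / 2 ^+ s))) -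
     \sum_(i < (2 ^ s)%N) f (p + iC * rc b + rc (i%:R * (a / 2 ^+ s))) +
     rc (2 ^+ s) * (c1 * (iC * rc b)).
    rewrite -card0 -sumrB -big_split; apply: eq_bigr => i _.
    by rewrite /r /=; ring.
  have e2 : \sum_(i < (2 ^ s)%N) (r (p + rc a + iC * rc (i%:R * (b / 2 ^+ s)))
     - r (p + iC * rc (i%:R * (b / 2 ^+ s)))) =
     \sum_(i < (2 ^ s)%N) f (p + rc a + iC * rc (i%:R * (b / 2 ^+ s))) -
     \sum_(i < (2 ^ s)%N) f (p + iC * rc (i%:R * (b / 2 ^+ s))) -
     rc (2 ^+ s) * (c1 * rc a).
    rewrite -card0 -sumrB -sumrB; apply: eq_bigr => i _.
    by rewrite /r /=; ring.
  rewrite e1 e2 /csum /hsum /vsum !rcM !rcV rcX.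
  have n0' : rc (2 : R) ^+ s != 0 by rewrite -rcX; apply/eqP => /rc_inj/eqP; rewrite (negPf n0).
  by field.
rewrite E; apply: le_trans (nmD _ _) _; rewrite !nmM nm_iC mul1r !nm_rc.
rewrite !ger0_norm; [|by rewrite divr_ge0// ltW|by rewrite divr_ge0// ltW].
have B1 (F G : nat -> C) : (forall i, (i < 2 ^ s)%N -> nm (F i) <= B) ->
  (forall i, (i < 2 ^ s)%N -> nm (G i) <= B) ->
  nm (\sum_(i < (2 ^ s)%N) (F i - G i)) <= 2 ^+ s * (2 * B).
  move=> h1 h2; apply: le_trans (nm_sum _ _ _) _.
  apply: (@le_trans _ _ (\sum_(i < (2 ^ s)%N) (2 * B))).
    apply: ler_sum => i _; apply: le_trans (nmB _ _) _.
    have := h1 i (ltn_ord i); have := h2 i (ltn_ord i); lra.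
  by rewrite sumr_const card_ord -[leLHS]mulr_natl two_pow.
have bnd (c : R) i : 0 <= c -> (i < 2 ^ s)%N -> 0 <= i%:R * (c / 2 ^+ s) <= c.
  move=> c'0 hi; rewrite mulr_ge0//=; last by rewrite divr_ge0// ltW.
  rewrite mulrCA ler_piMr// ler_pdivrMr// mul1r -two_pow ler_nat; exact: ltnW.
have h1 i : (i < 2 ^ s)%N -> nm (r (p + rc (i%:R * (a / 2 ^+ s)))) <= B.
  move=> hi; have := H _ 0 (bnd a i a0 hi); rewrite lexx b0 => /(_ isT).
  by rewrite rc0 mulr0 addr0.
have h2 i : (i < 2 ^ s)%N -> nm (r (p + iC * rc b + rc (i%:R * (a / 2 ^+ s)))) <= B.
  move=> hi; have := H _ b (bnd a i a0 hi); rewrite lexx b0 => /(_ isT).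
  by rewrite /r [p + iC * rc b + _]addrAC.
have h3 i : (i < 2 ^ s)%N -> nm (r (p + rc a + iC * rc (i%:R * (b / 2 ^+ s)))) <= B.
  by move=> hi; have := H a _ _ (bnd b i b0 hi); rewrite lexx a0 => /(_ isT).
have h4 i : (i < 2 ^ s)%N -> nm (r (p + iC * rc (i%:R * (b / 2 ^+ s)))) <= B.
  move=> hi; have := H 0 _ _ (bnd b i b0 hi); rewrite lexx a0 => /(_ isT).
  by rewrite rc0 addr0.
have k1 := B1 _ _ h1 h2; have k2 := B1 _ _ h3 h4.
have -> : 2 * (a + b) * B = a / 2 ^+ s * (2 ^+ s * (2 * B)) + b / 2 ^+ s * (2 ^+ s * (2 * B)).
  by field.
by apply: lerD; apply: ler_wpM2l => //; rewrite divr_ge0// ltW.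
Qed.

Hypothesis fdiff : forall z, exists D : C, forall e : R, 0 < e ->
  exists2 d : R, 0 < d & forall t : C, nm t < d -> nm (f (z + t) - f z - t * D) <= e * nm t.

Definition big_often p a b (c : R) := forall s0, exists2 s, (s0 <= s)%N & c <= nm (csum s p a b).

(** If each quarter had small sums for all large s, so would the whole, by [csumS]. Asking for
    infinitely many s, rather than for a limit, lets one quarter be chosen once and for all. *)
Lemma big_often_step p a b c : big_often p a b c ->
  exists q : C, (q = 0 \/ q = rc (a / 2) \/ q = iC * rc (b / 2) \/ q = rc (a / 2) + iC * rc (b / 2)) /\
    big_often (p + q) (a / 2) (b / 2) (c / 4).
Proof.
move=> H; apply: contrapT => N.
have K q : (q = 0 \/ q = rc (a / 2) \/ q = iC * rc (b / 2) \/ q = rc (a / 2) + iC * rc (b / 2)) ->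
   exists s0, forall s, (s0 <= s)%N -> nm (csum s (p + q) (a / 2) (b / 2)) < c / 4.
  move=> hq; apply: contrapT => W; apply: N; exists q; split=> // s0.
  apply: contrapT => W'; apply: W; exists s0 => s hs.
  by rewrite ltNge; apply/negP => h; apply: W'; exists s.
have [s1 k1] := K 0 (or_introl erefl).
have [s2 k2] := K _ (or_intror (or_introl erefl)).
have [s3 k3] := K _ (or_intror (or_intror (or_introl erefl))).
have [s4 k4] := K _ (or_intror (or_intror (or_intror erefl))).
have [[|s] hs] := H (maxn (maxn s1 s2) (maxn s3 s4)).+1 => //.
move: hs; rewrite ltnS !geq_max => /andP[/andP[l1 l2] /andP[l3 l4]].
have := k1 _ l1; have := k2 _ l2; have := k3 _ l3; have := k4 _ l4.
rewrite csumS addr0 addrA.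
set x := csum _ _ _ _; set y := csum _ _ _ _; set z := csum _ _ _ _; set w := csum _ _ _ _.
move=> h4 h3 h2 h1; have := nmD (w + z + y) x; have := nmD (w + z) y; have := nmD w z.
lra.
Qed.

(** Nested quarters shrink to a point z0, where differentiability bounds the contour sum by a small
    multiple of the area, against a lower bound that is a fixed multiple of it. *)
Lemma goursat p a b : 0 <= a -> 0 <= b -> forall e : R, 0 < e ->
  exists s0, forall s, (s0 <= s)%N -> nm (csum s p a b) < e.
Proof.
move=> a0 b0 c c0; apply: contrapT => N.
have H0 : big_often p a b c.
  move=> s0; apply: contrapT => W; apply: N; exists s0 => s hs.
  by rewrite ltNge; apply/negP => h; apply: W; exists s.
have /choice[st Hst] : forall x : nat * C, exists q : C,
   big_often x.2 (a / 2 ^+ x.1) (b / 2 ^+ x.1) (c / 4 ^+ x.1) ->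
   nm q <= (a + b) / 2 ^+ x.1.+1 /\
   big_often (x.2 + q) (a / 2 ^+ x.1.+1) (b / 2 ^+ x.1.+1) (c / 4 ^+ x.1.+1).
  move=> [n q]; have [/big_often_step[q' [hq' H]]|h] := pselect (big_often q (a / 2 ^+ n) (b / 2 ^+ n) (c / 4 ^+ n)); last by exists 0.
  exists q' => _; split; last first.
    by rewrite /= (exprSr 2) (exprSr 4) !(invfM (_ ^+ n)) !mulrA.
  have e1 : a / 2 ^+ n / 2 = a / 2 ^+ n.+1 by rewrite exprSr invfM mulrA.
  have e2 : b / 2 ^+ n / 2 = b / 2 ^+ n.+1 by rewrite exprSr invfM mulrA.
  move: hq'; rewrite e1 e2 /= mulrDl.
  have A0 : 0 <= a / 2 ^+ n.+1 by rewrite divr_ge0// exprn_ge0.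
  have B0 : 0 <= b / 2 ^+ n.+1 by rewrite divr_ge0// exprn_ge0.
  case=> [->|[->|[->|->]]]; rewrite ?nm0 ?nmM ?nm_iC ?nm_rc ?mul1r ?ger0_norm//; try lra.
  by apply: le_trans (nmD _ _) _; rewrite nmM nm_iC !nm_rc mul1r !ger0_norm.
pose pp := fix F n := if n is m.+1 then F m + st (m, F m) else p.
have ppH n : big_often (pp n) (a / 2 ^+ n) (b / 2 ^+ n) (c / 4 ^+ n).
  elim: n => [|n IH]; first by rewrite !expr0 !divr1.
  by have [_] := Hst (n, pp n) IH.
have ppD n : nm (pp n.+1 - pp n) <= (a + b) / 2 ^+ n.+1.
  by rewrite /= addrAC subrr add0r; have [] := Hst (n, pp n) (ppH n).
have ab0 : 0 <= a + b by rewrite addr_ge0.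
have ppD' n m : nm (pp (n + m)%N - pp n) <= (a + b) / 2 ^+ n * (1 - 2^-1 ^+ m).
  elim: m => [|m IH]; first by rewrite addn0 subrr nm0 expr0 subrr mulr0.
  rewrite addnS (_ : _ - _ = (pp (n + m).+1 - pp (n + m)%N) + (pp (n + m)%N - pp n)); last by ring.
  apply: le_trans (nmD _ _) _; apply: le_trans (lerD (ppD _) IH) _.
  rewrite -addnS exprD invfM mulrA -mulrDr -exprVn.
  apply: ler_wpM2l; first by rewrite mulr_ge0// exprn_ge0// invr_ge0.
  have -> : 2 ^- m.+1 = 2^-1 * 2^-1 ^+ m :> R by rewrite exprS invfM exprVn.
  rewrite exprS; lra.
have ppC n m : (n <= m)%N -> nm (pp m - pp n) <= (a + b) / 2 ^+ n.
  move=> nlem; rewrite -(subnKC nlem); apply: le_trans (ppD' _ _) _.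
  by rewrite ler_piMr ?divr_ge0 ?exprn_ge0// gerBl exprn_ge0// invr_ge0.
have small (e : R) : 0 < e -> exists n, (a + b) / 2 ^+ n < e.
  move=> e0; exists (Num.trunc ((a + b) / e)).+1; set n := (Num.trunc _).+1.
  have h : (a + b) / e < n%:R by exact: truncnS_gt.
  rewrite ltr_pdivrMr ?exprn_gt0//; move: h; rewrite ltr_pdivrMr// => h.
  apply: lt_trans h _; rewrite mulrC ltr_pM2l// -two_pow ltr_nat; exact: ltn_expl.
have [z0 Hz0] : exists z0, tends pp z0.
  apply: tends_cauchy => e e0; have [n hn] := small (e / 2) (divr_gt0 e0 (ltr0n _ 2)).
  exists n => i j hi hj; rewrite (_ : _ - _ = (pp i - pp n) - (pp j - pp n)); last by ring.
  apply: le_lt_trans (nmB _ _) _; have := ppC _ _ hi; have := ppC _ _ hj; lra.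
have near n : nm (pp n - z0) <= (a + b) / 2 ^+ n.
  rewrite nmC; apply: (tends_le (N := n) (tendsB Hz0 (tends_cst (pp n)))) => m; exact: ppC.
have [D HD] := fdiff z0.
(* The estimate at z0 ends with [4 * e * (a + b) ^+ 2 / 4 ^+ n], which this e keeps below
   [c / 4 ^+ n]. *)
pose e := c / (5 * ((a + b) ^+ 2 + 1)).
have e0 : 0 < e by rewrite divr_gt0// mulr_gt0// ltr_wpDl// sqr_ge0.
have [d d0 Hd] := HD e e0.
have [n hn] := small (d / 2) (divr_gt0 d0 (ltr0n _ 2)).
have A0 : 0 <= a / 2 ^+ n by rewrite divr_ge0// exprn_ge0.
have B0 : 0 <= b / 2 ^+ n by rewrite divr_ge0// exprn_ge0.
have [s _] := ppH n 0%N; apply/negP; rewrite -ltNge.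
set u := (a + b) / 2 ^+ n in hn near.
have u0 : 0 <= u by rewrite divr_ge0// exprn_ge0.
apply: (@le_lt_trans _ _ (2 * (a / 2 ^+ n + b / 2 ^+ n) * (e * (2 * u)))).
  apply: (@csum_local s _ _ _ (f z0) D z0) => // x y /andP[x0 xa] /andP[y0 yb].
  set t := pp n + rc x + iC * rc y - z0.
  have tu : nm t <= 2 * u.
    rewrite /t (_ : _ - _ = (pp n - z0) + (rc x + iC * rc y)); last by ring.
    apply: le_trans (nmD _ _) _; apply: le_trans (lerD (near n) (nmD _ _)) _.
    rewrite nmM nm_iC !nm_rc mul1r !ger0_norm// /u mulrDl; lra.
  have := Hd t; rewrite (_ : z0 + t = pp n + rc x + iC * rc y); last by rewrite /t; ring.
  move=> /(_ _)/Wrap[]; first by lra.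
  rewrite [t * D]mulrC => h; apply: le_trans h _.
  by rewrite ler_pM2l// -/u.
rewrite -mulrDl -/u.
have -> : c / 4 ^+ n = 5 * e * ((a + b) ^+ 2 + 1) / 4 ^+ n.
  by rewrite /e; congr (_ / _); field; apply/eqP; have := sqr_ge0 (a + b); lra.
have -> : 2 * u * (e * (2 * u)) = 4 * e * (a + b) ^+ 2 / 4 ^+ n.
  rewrite /u (_ : 4 ^+ n = 2 ^+ n * 2 ^+ n); last by rewrite -exprMn; congr (_ ^+ _); lra.
  by field; rewrite expf_neq0.
rewrite ltr_pM2r ?invr_gt0 ?exprn_gt0//; have := sqr_ge0 (a + b); nra.
Qed.

End Goursat.

(** * Dyadic means of periodic entire functions *)

Section Means.
Variables (R : realType) (g : nat).
Local Notation C := (CC R).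
Implicit Types (k l : 'rV[int]_g) (z w : 'rV[C]_g) (h : 'rV[C]_g -> C) (s : nat).

Definition zperiodic h := forall p z, h (z + zvec R p) = h z.
Definition near_pt (d : R) z w := forall j, nm (w 0 j - z 0 j) < d.
Definition strip (b : R) z := forall j, `|im (z 0 j)| <= b.
Definition rmx (t : 'rV[R]_g) : 'rV[C]_g := map_mx (@rc R) t.

Lemma strip_real b z t : strip b z -> strip b (z + rmx t).
Proof. by move=> H j; rewrite !mxE imD im_rc addr0; apply: H. Qed.

(** Compactness in the form used for uniform bounds and moduli of continuity. The box is viewed as
    the image of a product of segments in real dimension g + g. *)
Lemma box_cover (B : R) (P : nat -> 'rV[C]_g -> Prop) :
  (forall n m z, (n <= m)%N -> P n z -> P m z) ->
  (forall z, (forall j, `|re (z 0 j)| <= B /\ `|im (z 0 j)| <= B) ->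
    exists2 d : R, 0 < d & exists n, forall w, near_pt d z w -> P n w) ->
  exists n, forall z, (forall j, `|re (z 0 j)| <= B /\ `|im (z 0 j)| <= B) -> P n z.
Proof.
move=> mono loc.
pose psi (v : 'rV[R]_(g + g)) : 'rV[C]_g :=
  \row_j (rc (v 0 (lshift g j)) + iC * rc (v 0 (rshift g j))).
have reP v j : re (psi v 0 j) = v 0 (lshift g j).
  by rewrite mxE reD reM !re_rc re_iC im_rc; ring.
have imP v j : im (psi v 0 j) = v 0 (rshift g j).
  by rewrite mxE imD imM re_rc !im_rc re_iC im_iC; ring.
pose K := [set v : 'rV[R]_(g + g) | forall i, `[- B, B]%classic (v ord0 i)].
have cK : compact K by apply: (@rV_compact _ _ (fun=> `[- B, B]%classic)) => i; exact: segment_compact.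
have [|N _ HN] := (compact_near_coveringP _).1 cK nat \oo (fun n v => P n (psi v)) _; last first.
  exists N => z Hz; pose v : 'rV[R]_(g + g) := \row_i
    match fintype.split i with inl j => re (z 0 j) | inr j => im (z 0 j) end.
  have e1 j : v ord0 (lshift g j) = re (z 0 j).
    by rewrite mxE; case: splitP => [i /= /val_inj ->//|i /= e]; have := ltn_ord j; lia.
  have e2 j : v ord0 (rshift g j) = im (z 0 j).
    rewrite mxE; case: splitP => [i /= e|i /= e]; first by have := ltn_ord i; lia.
    by have -> : j = i by apply: val_inj => /=; lia.
  have -> : z = psi v by apply/rowP => j; apply: Ceq; rewrite ?reP ?imP ?e1 ?e2.
  apply: HN; first by rewrite /=.
  move=> i /=; rewrite in_itv /= -ler_norml -(fintype.splitK i).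
  by case: (fintype.split i) => j /=; rewrite ?e1 ?e2; case: (Hz j).
move=> v Kv; have [|d d0 [n Hn]] := loc (psi v).
  move=> j; rewrite reP imP; have := Kv (lshift g j); have := Kv (rshift g j).
  by rewrite /= !in_itv /= -!ler_norml.
exists (ball v (d / 4), [set m | (n <= m)%N]) => /=.
  split; last by exists n.
  by apply: nbhsx_ballx; rewrite divr_gt0.
case=> v' m /= [[_ Hv] nm']; apply: mono nm' _; apply: Hn => j.
apply: le_lt_trans (nm_reim _) _; rewrite reB imB !reP !imP.
have := Hv 0 (lshift g j); have := Hv 0 (rshift g j); rewrite /ball /=.
rewrite ![`|v 0 _ - _|]distrC; lra.
Qed.

Lemma reduce_real z : exists p, forall j, `|re ((z - zvec R p) 0 j)| <= 1 /\
  im ((z - zvec R p) 0 j) = im (z 0 j).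
Proof.
exists (\row_j Num.floor (re (z 0 j))) => j; rewrite !mxE reB imB -rc_int re_rc im_rc subr0.
split=> //; have /andP[h1 h2] := floor_itv (re (z 0 j)).
move: h2; rewrite intrD => h2; rewrite ger0_norm; lra.
Qed.

(** A strip is unbounded in the real directions; translation by integer vectors brings its points
    into a compact box. *)
Lemma strip_unif h b (e : R) : cont h -> zperiodic h -> 0 < e ->
  exists2 d : R, 0 < d & forall z, strip b z -> forall w, near_pt d z w -> nm (h w - h z) < e.
Proof.
move=> hc hp e0.
have [||n Hn] := @box_cover (1 + `|b|) (fun n z => forall w, near_pt n.+1%:R^-1 z w -> nm (h w - h z) < e).
- move=> n m z nlem H w Hw; apply: H => j; apply: lt_le_trans (Hw j) _.
  by rewrite lef_pV2 ?posrE// ler_nat.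
- move=> z _; have [d d0 Hd] := hc z (e / 2) (divr_gt0 e0 (ltr0n _ 2)).
  exists (d / 2); first exact: divr_gt0.
  exists (Num.trunc (2 / d)).+1; set n := (Num.trunc _).+1 => w Hw w' Hw'.
  have hn : n.+1%:R^-1 < d / 2.
    rewrite -[d / 2]invrK invf_div ltf_pV2 ?posrE ?divr_gt0//.
    by apply: lt_trans (truncnS_gt _) _; rewrite ltr_nat.
  rewrite (_ : _ - _ = (h w' - h z) - (h w - h z)); last by ring.
  apply: le_lt_trans (nmB _ _) _.
  have h1 : nm (h w - h z) < e / 2 by apply: Hd => j; have := Hw j; lra.
  have h2 : nm (h w' - h z) < e / 2.
    apply: Hd => j; rewrite (_ : _ - _ = (w' 0 j - w 0 j) + (w 0 j - z 0 j)); last by ring.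
    by apply: le_lt_trans (nmD _ _) _; have := Hw j; have := lt_trans (Hw' j) hn; lra.
  lra.
exists n.+1%:R^-1 => [|z Hz w Hw]; first by rewrite invr_gt0.
have [p Hp] := reduce_real z.
have := Hn (z - zvec R p); rewrite -(hp p (z - _)) subrK => H.
have := H _ (w - zvec R p); rewrite -(hp p (w - _)) subrK; apply.
  move=> j; have [h1 ->] := Hp j; have := Hz j; have := ler_norm b; have := normr_ge0 b; split; lra.
by move=> j; rewrite !mxE (_ : _ - _ = w 0 j - z 0 j); [exact: Hw|ring].
Qed.

Lemma strip_bound h b : cont h -> zperiodic h ->
  exists2 M : R, 0 <= M & forall z, strip b z -> nm (h z) <= M.
Proof.
move=> hc hp.
have [||n Hn] := @box_cover (1 + `|b|) (fun n z => nm (h z) <= n%:R).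
- by move=> n m z nlem H; apply: le_trans H _; rewrite ler_nat.
- move=> z _; have [d d0 Hd] := hc z 1 ltr01; exists d => //.
  exists (Num.trunc (1 + nm (h z))).+1 => w /Hd Hw.
  apply: ltW; apply: le_lt_trans _ (truncnS_gt _).
  by have := nmD (h z) (h w - h z); rewrite addrC subrK; lra.
exists n%:R => // z Hz; have [p Hp] := reduce_real z.
rewrite -[z](subrK (zvec R p)) hp; apply: Hn => j.
have [h1 ->] := Hp j; have := Hz j; have := ler_norm b; have := normr_ge0 b; split; lra.
Qed.

Definition ipt s (m : 'rV[int]_g) : 'rV[C]_g := \row_j rc ((m 0 j)%:~R / 2 ^+ s).
Definition gidx s (a : {ffun 'I_g -> 'I_(2 ^ s)}) : 'rV[int]_g := \row_j (a j)%:Z.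
(** A Riemann sum for the integral of h over the real torus through z. The dyadic grid is a finite
    subgroup of that torus, and the grids are nested. *)
Definition mean s h z : C :=
  (2 ^+ (s * g))^-1 * \sum_(a : {ffun 'I_g -> 'I_(2 ^ s)}) h (z + ipt s (gidx a)).

Lemma iptD s m m' : ipt s (m + m') = ipt s m + ipt s m'.
Proof. by apply/rowP => j; rewrite !mxE -rcD intrD mulrDl. Qed.

Lemma ipt_real s m : ipt s m = rmx (\row_j ((m 0 j)%:~R / 2 ^+ s)).
Proof. by apply/rowP => j; rewrite !mxE. Qed.

Lemma ipt_full s p : ipt s ((2 ^ s)%:Z *: p) = zvec R p.
Proof.
apply/rowP => j; rewrite !mxE intrM -rc_int; congr rc.
by rewrite -[(2 ^ s)%:Z%:~R]pmulrn natrX mulrAC divff ?mul1r// expf_neq0.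
Qed.

Lemma mean_avg s (c : C) : (2 ^+ (s * g))^-1 * \sum_(a : {ffun 'I_g -> 'I_(2 ^ s)}) c = c.
Proof.
rewrite sumr_const card_ffun !card_ord -expnM -[c *+ _]mulr_natl natrX mulKf//.
Qed.

Lemma nm_pow2 n : nm (2 ^+ n : C)^-1 = (2 ^+ n)^-1.
Proof. by rewrite nmV nmX nm_nat. Qed.

Lemma mean_le s h z c (e : R) :
  (forall a : {ffun 'I_g -> 'I_(2 ^ s)}, nm (h (z + ipt s (gidx a)) - c) <= e) -> nm (mean s h z - c) <= e.
Proof.
move=> H; rewrite -[X in _ - X](mean_avg s) -mulrBr -sumrB nmM nm_pow2.
rewrite mulrC ler_pdivrMr ?exprn_gt0//; apply: le_trans (nm_sum _ _ _) _.
apply: (@le_trans _ _ (\sum_(a : {ffun 'I_g -> 'I_(2 ^ s)}) e)).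
  by apply: ler_sum => a _.
by rewrite sumr_const card_ffun !card_ord -expnM -[X in X <= _]mulr_natr natrX.
Qed.

Lemma mean_bound s h z (e : R) :
  (forall a : {ffun 'I_g -> 'I_(2 ^ s)}, nm (h (z + ipt s (gidx a))) <= e) -> nm (mean s h z) <= e.
Proof.
move=> H; rewrite -[mean _ _ _]subr0; apply: mean_le => a.
by rewrite subr0.
Qed.

Lemma mean_dist s h h' z z' (e : R) :
  (forall a : {ffun 'I_g -> 'I_(2 ^ s)}, nm (h (z + ipt s (gidx a)) - h' (z' + ipt s (gidx a))) <= e) ->
  nm (mean s h z - mean s h' z') <= e.
Proof.
move=> H; have -> : mean s h z - mean s h' z' = mean s (fun w => h (z + w) - h' (z' + w)) 0.
  by rewrite /mean -mulrBr -sumrB; congr (_ * _); apply: eq_bigr => a _; rewrite add0r.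
by apply: mean_bound => a; rewrite add0r.
Qed.

Lemma meanD s h h' z : mean s (fun w => h w + h' w) z = mean s h z + mean s h' z.
Proof. by rewrite /mean big_split mulrDr. Qed.
Lemma meanZ s c h z : mean s (fun w => c * h w) z = c * mean s h z.
Proof. by rewrite /mean -mulr_sumr mulrCA. Qed.
Lemma mean_transl s h z t : mean s (fun w => h (w + t)) z = mean s h (z + t).
Proof. by rewrite /mean; congr (_ * _); apply: eq_bigr => a _; rewrite addrAC. Qed.

(** Translation by a grid point permutes the grid modulo the integers; [sh] is this permutation. *)
Lemma mean_shift s h z m : zperiodic h -> mean s h (z + ipt s m) = mean s h z.
Proof.
move=> hp; rewrite /mean; congr (_ * _).
have N0 : (0 : int) < (2 ^ s)%:Z by rewrite ltz_nat expn_gt0.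
have pf (a : {ffun 'I_g -> 'I_(2 ^ s)}) j : (absz (((a j)%:Z + m ord0 j) %% (2 ^ s)%:Z)%Z < 2 ^ s)%N.
  by have := ltz_pmod ((a j)%:Z + m ord0 j) N0; have := modz_ge0 ((a j)%:Z + m ord0 j) (lt0r_neq0 N0); lia.
pose sh a : {ffun 'I_g -> 'I_(2 ^ s)} := [ffun j => Ordinal (pf a j)].
have shE a : exists q, ipt s m + ipt s (gidx a) = ipt s (gidx (sh a)) + zvec R q.
  exists (\row_j (((a j)%:Z + m ord0 j) %/ (2 ^ s)%:Z)%Z).
  rewrite -(ipt_full s) -!iptD; congr ipt; apply/rowP => j; rewrite !mxE ffunE /=.
  have e := divz_eq ((a j)%:Z + m ord0 j) (2 ^ s)%:Z.
  have := modz_ge0 ((a j)%:Z + m ord0 j) (lt0r_neq0 N0) => h0.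
  by rewrite [LHS]addrC [LHS]e gez0_abs// addrC [_ * (2 ^ s)%:Z]mulrC.
have shI : injective sh.
  move=> a b /ffunP E; apply/ffunP => j; have := E j; rewrite !ffunE => /(congr1 val) /= E'.
  have h1 := modz_ge0 ((a j)%:Z + m ord0 j) (lt0r_neq0 N0).
  have h2 := modz_ge0 ((b j)%:Z + m ord0 j) (lt0r_neq0 N0).
  have {}E' : ((a j)%:Z + m ord0 j = (b j)%:Z + m ord0 j %[mod (2 ^ s)%:Z])%Z by lia.
  move/eqP: E'; rewrite eqz_modDr => /eqP; rewrite !modz_small.
  - by case=> /val_inj.
  - by rewrite lez_nat ltz_nat ltn_ord.
  - by rewrite lez_nat ltz_nat ltn_ord.
rewrite [RHS](reindex_inj shI); apply: eq_bigr => a _.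
by have [q e] := shE a; rewrite -addrA e addrA hp.
Qed.

Lemma mean_real s h b (e d : R) : zperiodic h ->
  (forall z, strip b z -> forall w, near_pt d z w -> nm (h w - h z) < e) ->
  (2 ^+ s)^-1 < d -> forall z t, strip b z -> nm (mean s h (z + rmx t) - mean s h z) <= e.
Proof.
move=> hp H sd z t Hz.
(* The grid point just below t: grid translations are free, and the rest of t is shorter than
   [2 ^- s]. *)
pose m : 'rV[int]_g := \row_j Num.floor (t 0 j * 2 ^+ s).
have -> : z + rmx t = (z + (rmx t - ipt s m)) + ipt s m by rewrite -addrA subrK.
rewrite mean_shift//; apply: mean_dist => a; apply/ltW/H.
  by rewrite ipt_real; apply: strip_real.
move=> j; rewrite !mxE; set x := t 0 j.
rewrite (_ : _ - _ = rc (x - (Num.floor (x * 2 ^+ s))%:~R / 2 ^+ s)); last by rewrite rcB; ring.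
rewrite nm_rc; apply: le_lt_trans _ sd.
have p0 : 0 < 2 ^+ s :> R by rewrite exprn_gt0.
have /andP[h1 h2] := floor_itv (x * 2 ^+ s); move: h2; rewrite intrD => h2.
rewrite -[x in x - _](mulfK (lt0r_neq0 p0)) -mulrBl normrM (gtr0_norm (x := _^-1)) ?invr_gt0//.
by rewrite -[leRHS]mul1r ler_pM2r ?invr_gt0// ger0_norm; lra.
Qed.

(** The two averages commute, and the fine one is invariant under the coarse grid. Hence the means
    of level s' are averages of those of level s, which makes them a Cauchy sequence. *)
Lemma mean_mean s s' h z : zperiodic h -> (s <= s')%N ->
  mean s' (mean s h) z = mean s' h z.
Proof.
move=> hp ss'.
have -> : mean s' (mean s h) z = mean s (mean s' h) z.
  rewrite /mean [in LHS]mulr_sumr [in RHS]mulr_sumr.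
  under eq_bigr do rewrite mulr_sumr mulr_sumr.
  under [in RHS]eq_bigr do rewrite mulr_sumr mulr_sumr.
  rewrite exchange_big; apply: eq_bigr => a _; apply: eq_bigr => b _.
  by rewrite mulrCA addrAC.
have H a : mean s' h (z + ipt s (gidx a)) = mean s' h z.
  rewrite -(@mean_shift s' h z ((2 ^ (s' - s))%:Z *: gidx a))//; congr (mean _ _ (_ + _)).
  apply/rowP => j; rewrite !mxE intrM; congr rc.
  have -> : 2 ^+ s' = 2 ^+ (s' - s) * 2 ^+ s :> R by rewrite -exprD subnK.
  by rewrite -[(2 ^ _)%:Z%:~R]pmulrn natrX -mulf_div divff ?mul1r// expf_neq0.
rewrite {1}/mean (eq_bigr (fun=> mean s' h z)) ?mean_avg//.
Qed.

Lemma pow2_small (d : R) : 0 < d -> exists s0, forall s, (s0 <= s)%N -> (2 ^+ s)^-1 < d.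
Proof.
move=> d0; exists (Num.trunc d^-1).+1 => s hs.
rewrite -[d]invrK ltf_pV2 ?posrE ?exprn_gt0 ?invr_gt0//.
apply: lt_le_trans (truncnS_gt _) _; rewrite -natrX ler_nat.
by apply: leq_trans hs _; apply/ltnW/ltn_expl.
Qed.

Definition mval h z : C := limn (fun s => mean s h z).

Lemma mean_cauchy h b (e : R) : cont h -> zperiodic h -> 0 < e ->
  exists s0, forall s s' z, strip b z -> (s0 <= s)%N -> (s <= s')%N ->
    nm (mean s' h z - mean s h z) <= e /\
    forall t, nm (mean s h (z + rmx t) - mean s h z) <= e.
Proof.
move=> hc hp e0; have [d d0 Hd] := strip_unif b hc hp e0.
have [s0 Hs0] := pow2_small d0; exists s0 => s s' z Hz h1 h2.
have K := mean_real hp Hd (Hs0 _ h1); split=> [|t]; last exact: K.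
by rewrite -(mean_mean _ hp h2); apply: mean_le => a; rewrite ipt_real; apply: K.
Qed.

Lemma strip_ex z : exists b, strip b z.
Proof. by have [b [_ H]] := im_bounded z; exists b. Qed.

Lemma mvalP h z : cont h -> zperiodic h -> tends (fun s => mean s h z) (mval h z).
Proof.
move=> hc hp; have [b Hz] := strip_ex z.
have [|l Hl] := @tends_cauchy R (fun s => mean s h z).
  move=> e e0; have [s0 H] := mean_cauchy b hc hp (divr_gt0 e0 (ltr0n _ 3)).
  exists s0 => n m hn hm.
  have [K1 _] := H _ _ z Hz (leqnn s0) hn; have [K2 _] := H _ _ z Hz (leqnn s0) hm.
  rewrite (_ : _ - _ = (mean n h z - mean s0 h z) - (mean m h z - mean s0 h z)); last by ring.
  by apply: le_lt_trans (nmB _ _) _; lra.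
by rewrite /mval (tends_lim Hl).
Qed.

Lemma mean_mval h b (e : R) : cont h -> zperiodic h -> 0 < e ->
  exists s0, forall s z, strip b z -> (s0 <= s)%N -> nm (mean s h z - mval h z) <= e.
Proof.
move=> hc hp e0; have [s0 H] := mean_cauchy b hc hp e0; exists s0 => s z Hz hs.
rewrite nmC; apply: (tends_le (N := s) (tendsB (mvalP z hc hp) (tends_cst (mean s h z)))) => n hn.
by have [] := H s n z Hz hs hn.
Qed.

Lemma mval_real h z t : cont h -> zperiodic h -> mval h (z + rmx t) = mval h z.
Proof.
move=> hc hp; have [b Hz] := strip_ex z; apply/subr0_eq/nm_small => e e0.
have [s0 H] := mean_cauchy b hc hp e0.
apply: (tends_le (N := s0) (tendsB (mvalP (z + rmx t) hc hp) (mvalP z hc hp))) => s hs.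
by have [_] := H s s z Hz hs (leqnn s); apply.
Qed.

Lemma mval_bound h z (B : R) : cont h -> zperiodic h ->
  (forall t, nm (h (z + rmx t)) <= B) -> nm (mval h z) <= B.
Proof.
move=> hc hp H; apply: (tends_le (N := 0) (mvalP z hc hp)) => s _.
by apply: mean_bound => a; rewrite ipt_real.
Qed.

Lemma cont_add h h' : cont h -> cont h' -> cont (fun z => h z + h' z).
Proof.
move=> hc hc' z e e0; have e2 : 0 < e / 2 by rewrite divr_gt0.
have [d d0 H] := hc z _ e2; have [d' d'0 H'] := hc' z _ e2.
exists (Num.min d d') => [|w Hw]; first by rewrite lt_min d0.
rewrite (_ : _ - _ = (h w - h z) + (h' w - h' z)); last by ring.
apply: le_lt_trans (nmD _ _) _.
have h1 : nm (h w - h z) < e / 2 by apply: H => j; have := Hw j; rewrite lt_min => /andP[].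
have h2 : nm (h' w - h' z) < e / 2 by apply: H' => j; have := Hw j; rewrite lt_min => /andP[].
lra.
Qed.
Lemma cont_scale c h : cont h -> cont (fun z => c * h z).
Proof.
move=> hc z e e0; have c0 : 0 < nm c + 1 by have := nm_ge0 c; lra.
have [d d0 H] := hc z _ (divr_gt0 e0 c0); exists d => // w /H.
rewrite -mulrBr nmM ltr_pdivlMr// => K.
have := nm_ge0 (h w - h z); have := nm_ge0 c; nra.
Qed.
Lemma cont_mul h h' : cont h -> cont h' -> cont (fun z => h z * h' z).
Proof.
move=> hc hc' z e e0.
have A0 := nm_ge0 (h z); have B0 := nm_ge0 (h' z).
set K := nm (h z) + nm (h' z) + 2; have K0 : 0 < K by rewrite /K; lra.
set e' := Num.min 1 (e / K); have e'0 : 0 < e' by rewrite lt_min ltr01 divr_gt0.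
have [d d0 H] := hc z _ e'0; have [d' d'0 H'] := hc' z _ e'0.
exists (Num.min d d') => [|w Hw]; first by rewrite lt_min d0.
have h1 : nm (h w - h z) < e' by apply: H => j; have := Hw j; rewrite lt_min => /andP[].
have h2 : nm (h' w - h' z) < e' by apply: H' => j; have := Hw j; rewrite lt_min => /andP[].
rewrite (_ : _ - _ = (h w - h z) * (h' w - h' z) + ((h w - h z) * h' z + h z * (h' w - h' z))); last by ring.
apply: le_lt_trans (nmD _ _) _; apply: le_lt_trans (lerD (lexx _) (nmD _ _)) _; rewrite !nmM.
have e1 : e' <= 1 by rewrite ge_min lexx.
have e2 : e' * K <= e by rewrite -ler_pdivlMr// ge_min lexx orbT.
have := nm_ge0 (h w - h z); have := nm_ge0 (h' w - h' z); rewrite /K in e2; nra.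
Qed.

Lemma csum_periodic (f : C -> C) s (y : R) : (forall x, f (1 + x) = f x) ->
  csum f s 0 1 y = rc (1 / 2 ^+ s) * \sum_(i < (2 ^ s)%N) f (rc (i%:R * (1 / 2 ^+ s))) -
    rc (1 / 2 ^+ s) * \sum_(i < (2 ^ s)%N) f (iC * rc y + rc (i%:R * (1 / 2 ^+ s))).
Proof.
move=> H; rewrite /csum /hsum /vsum.
have -> : \sum_(i < (2 ^ s)%N) f (0 + rc 1 + iC * rc (i%:R * (y / 2 ^+ s))) =
  \sum_(i < (2 ^ s)%N) f (0 + iC * rc (i%:R * (y / 2 ^+ s))).
  by apply: eq_bigr => i _; rewrite !add0r rc1 H.
rewrite subrr mulr0 addr0 add0r; congr (_ * _ - _).
by apply: eq_bigr => i _; rewrite add0r.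
Qed.

Definition line_diff (f : C -> C) := forall z : C, exists D : C, forall e : R, 0 < e ->
  exists2 d : R, 0 < d & forall t : C, nm t < d -> nm (f (z + t) - f z - t * D) <= e * nm t.

Lemma line_diffD f f' : line_diff f -> line_diff f' -> line_diff (fun x => f x + f' x).
Proof.
move=> H H' z; have [D HD] := H z; have [D' HD'] := H' z; exists (D + D') => e e0.
have e2 : 0 < e / 2 by rewrite divr_gt0.
have [d d0 K] := HD _ e2; have [d' d'0 K'] := HD' _ e2.
exists (Num.min d d') => [|t]; first by rewrite lt_min d0.
rewrite lt_min => /andP[/K k1 /K' k2].
rewrite (_ : _ - _ = (f (z + t) - f z - t * D) + (f' (z + t) - f' z - t * D')); last by ring.
by apply: le_trans (nmD _ _) _; have := lerD k1 k2; rewrite -mulrDl -splitr.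
Qed.

Lemma line_diffZ c f : line_diff f -> line_diff (fun x => c * f x).
Proof.
move=> H z; have [D HD] := H z; exists (c * D) => e e0.
have c0 : 0 < nm c + 1 by have := nm_ge0 c; lra.
have [d d0 K] := HD _ (divr_gt0 e0 c0); exists d => // t /K k.
rewrite (_ : _ - _ = c * (f (z + t) - f z - t * D)); last by ring.
rewrite nmM; have n0 := nm_ge0 t; have n1 := nm_ge0 c.
apply: (@le_trans _ _ ((nm c + 1) * (e / (nm c + 1) * nm t))).
  by have := nm_ge0 (f (z + t) - f z - t * D); nra.
by rewrite mulrA mulrCA divff ?mulr1// lt0r_neq0.
Qed.

Lemma mean_line_diff s h z j : (forall w, differentiable h w) ->
  line_diff (fun x => mean s h (z + x *: delta_mx 0 j)).
Proof.
move=> hd; rewrite /mean; apply: line_diffZ.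
elim: (index_enum _) => [|a r IH].
  move=> x; exists 0 => e e0; exists 1 => // t _.
  by rewrite !big_nil mulr0 !subr0 nm0 mulr_ge0 ?nm_ge0// ltW.
have -> : (fun x : C => \sum_(b <- a :: r) h (z + x *: delta_mx 0 j + ipt s (gidx b))) =
  (fun x : C => h (z + x *: delta_mx 0 j + ipt s (gidx a)) + \sum_(b <- r) h (z + x *: delta_mx 0 j + ipt s (gidx b))).
  by apply/funext => x; rewrite big_cons.
apply: line_diffD => // x; exists ('D_(delta_mx 0 j) h (z + x *: delta_mx 0 j + ipt s (gidx a))) => e e0.
have [d d0 H] := derive_pt (delta_mx 0 j) (hd (z + x *: delta_mx 0 j + ipt s (gidx a))) e0.
exists d => // t td; rewrite scalerDl addrA [z + _ + t *: _ + _]addrAC; exact: H.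
Qed.

Lemma three_eps (a b a' b' : C) (e : R) : nm (a' - a) <= e / 4 -> nm (b' - b) <= e / 4 ->
  nm (a' - b') < e / 4 -> nm (b - a) <= e.
Proof.
move=> H1 H2 H3; rewrite (_ : b - a = (a' - a) - (b' - b) - (a' - b')); last by ring.
by apply: le_trans (nmB _ _) _; apply: le_trans (lerD (nmB _ _) (lexx _)) _; have := nm_ge0 (b' - b); lra.
Qed.

Local Opaque mean mval.

(** Contour shift: in the rectangle of width 1 and height y the vertical sides cancel by
    periodicity, so Goursat's theorem equates the two horizontal sums. It is applied to [mean s0 h],
    which is already uniformly close to [mval h] in all g variables, so that averaging along one
    line is enough. *)
Lemma mval_im h z j (y : R) : (forall w, differentiable h w) -> zperiodic h -> 0 <= y ->
  mval h (z + (iC * rc y) *: delta_mx 0 j) = mval h z.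
Proof.
move=> hd hp y0; have hc := differentiable_cont hd.
have [b [b0 Hb]] := im_bounded z.
have Hz0 : strip (b + y) z by move=> i; have := Hb i; lra.
have Hz1 : strip (b + y) (z + (iC * rc y) *: delta_mx 0 j).
  move=> i; rewrite !mxE imD; apply: le_trans (ler_normD _ _) _; apply: lerD; first exact: Hb.
  apply: le_trans (im_nm _) _; rewrite !nmM nm_iC nm_rc mul1r ger0_norm//.
  rewrite eqxx andTb; case: (i == j); rewrite ?mulr1n ?mulr0n ?nm1 ?nm0; lra.
apply/subr0_eq/nm_small => e e0; have e4 : 0 < e / 4 by rewrite divr_gt0.
have [s0 H0] := mean_mval (b + y) hc hp e4.
have [s1 H1] := goursat (mean_line_diff s0 z j hd) 0 ler01 y0 e4.
set s := maxn s0 s1.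
have rl (x : R) : rc x *: delta_mx 0 j = rmx (x *: delta_mx 0 j) :> 'rV[C]_g.
  by apply/rowP => i; rewrite !mxE eqxx andTb; case: (i == j); rewrite ?mulr1 ?mulr0.
have key w : strip (b + y) w ->
   nm (rc (1 / 2 ^+ s) * \sum_(i < (2 ^ s)%N) mean s0 h (w + rc (i%:R * (1 / 2 ^+ s)) *: delta_mx 0 j) - mval h w) <= e / 4.
  move=> Hw.
  have -> : mval h w = rc (1 / 2 ^+ s) * \sum_(i < (2 ^ s)%N) mval h w.
    rewrite sumr_const card_ord -[X in _ * X]mulr_natl mulrA -rc_nat -rcM natrX.
    by rewrite divfK ?expf_neq0// rc1 mul1r.
  rewrite -mulrBr -sumrB nmM nm_rc ger0_norm ?divr_ge0 ?exprn_ge0//.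
  apply: (@le_trans _ _ (1 / 2 ^+ s * \sum_(i < (2 ^ s)%N) (e / 4))).
    apply: ler_wpM2l; first by rewrite divr_ge0 ?exprn_ge0.
    apply: le_trans (nm_sum _ _ _) _; apply: ler_sum => i _; rewrite rl.
    rewrite -[X in _ - X](mval_real w ((i%:R * (1 / 2 ^+ s)) *: delta_mx 0 j) hc hp).
    by apply: H0 => //; apply: strip_real.
  have -> : \sum_(i < (2 ^ s)%N) (e / 4) = 2 ^+ s * (e / 4).
    by rewrite sumr_const card_ord -[LHS]mulr_natl natrX.
  have -> // : 1 / 2 ^+ s * (2 ^+ s * (e / 4)) = e / 4 by field; rewrite expf_neq0.
have := H1 s (leq_maxr _ _); rewrite csum_periodic; last first.
  move=> x.
  have -> : z + (1 + x) *: delta_mx 0 j =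
    z + x *: delta_mx 0 j + ipt s0 ((2 ^ s0)%:Z *: delta_mx 0 j).
    rewrite ipt_full [1 + x]addrC scalerDl addrA; congr (_ + _).
    by apply/rowP => i'; rewrite !mxE eqxx andTb; case: (i' == j); rewrite /= ?mulr1 ?mulr0.
  exact: mean_shift.
have k0 := key _ Hz0; have k1 := key _ Hz1.
have eB : \sum_(i < (2 ^ s)%N) mean s0 h (z + (iC * rc y) *: delta_mx 0 j + rc (i%:R * (1 / 2 ^+ s)) *: delta_mx 0 j) =
  \sum_(i < (2 ^ s)%N) mean s0 h (z + (iC * rc y + rc (i%:R * (1 / 2 ^+ s))) *: delta_mx 0 j).
  by apply: eq_bigr => i _; rewrite [in RHS]scalerDl [in RHS]addrA.
rewrite eB in k1.
exact: three_eps k0 k1.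
Qed.

Lemma mval_const h z : (forall w, differentiable h w) -> zperiodic h -> mval h z = mval h 0.
Proof.
move=> hd hp; have hc := differentiable_cont hd.
have im1 w j (y : R) : mval h (w + (iC * rc y) *: delta_mx 0 j) = mval h w.
  have [y0|/ltW y0] := leP 0 y; first exact: mval_im.
  have e : w = (w + (iC * rc y) *: delta_mx 0 j) + (iC * rc (- y)) *: delta_mx 0 j.
    by rewrite -addrA -scalerDl rcN mulrN subrr scale0r addr0.
  by rewrite -(@mval_im h (w + (iC * rc y) *: delta_mx 0 j) j (- y)) ?oppr_ge0// -e.
have im2 w (r : seq 'I_g) :
    mval h (w + \sum_(j <- r) (iC * rc (im (z 0 j))) *: delta_mx 0 j) = mval h w.
  by elim: r w => [|j r IH] w; rewrite ?big_nil ?addr0// big_cons addrA IH im1.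
rewrite -[RHS](im2 0 (index_enum _)) -[RHS](mval_real _ (\row_j re (z 0 j)) hc hp); congr mval.
apply/rowP => j; rewrite !mxE summxE (bigD1 j)//= big1 => [|i ij]; last first.
  by rewrite !mxE eqxx eq_sym (negPf ij) mulr0.
by rewrite !mxE !eqxx mulr1 add0r addr0 [LHS]reimE addrC.
Qed.

End Means.

(** * Fourier expansion of periodic entire functions *)

Section Fourier.
Variables (R : realType) (g : nat).
Local Notation C := (CC R).
Implicit Types (k l : 'rV[int]_g) (z w : 'rV[C]_g) (h : 'rV[C]_g -> C) (s : nat).

Lemma meanE s h z : mean s h z = (2 ^+ (s * g))^-1 *
  \sum_(a : {ffun 'I_g -> 'I_(2 ^ s)}) h (z + ipt R s (gidx a)).
Proof. by []. Qed.

Local Opaque mean mval.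

Definition OP h := (forall z, differentiable h z) /\ zperiodic h.

Lemma OP_cont h : OP h -> cont h. Proof. by case=> /differentiable_cont. Qed.

Lemma zsum_single (F : 'rV[int]_g -> C) k0 : (forall k, k != k0 -> F k = 0) -> zsum F = F k0.
Proof.
move=> H; apply: tends_lim; pose N0 := (\max_j absz (k0 ord0 j))%N.
apply: (@tends_near _ N0 (fun=> F k0)) (tends_cst _) => N hN.
have hk j : (absz (k0 ord0 j) <= N)%N by apply: leq_trans (leq_bigmax _) hN.
have pf j : (absz (k0 ord0 j + N%:Z)%R < N.*2.+1)%N by have := hk j; lia.
pose a0 : {ffun 'I_g -> 'I_(N.*2.+1)} := [ffun j => Ordinal (pf j)].
have e0 : boxpt a0 = k0.
  apply/rowP => j; rewrite mxE ffunE /= -[0]/(ord0 : 'I_1); have := hk j; lia.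
rewrite /boxsum (bigD1 a0)//= e0 big1 ?addr0// => a aa0; apply: H.
apply: contraNneq aa0 => e; apply/eqP/ffunP => j; apply: val_inj.
have := congr1 (fun m : 'rV[int]_g => m ord0 j) (etrans e (esym e0)).
by rewrite !mxE /=; case: (a j) => x hx; case: (a0 j) => y hy /=; lia.
Qed.

Lemma decay_single k (c : C) : decay (fun l => if l == k then c else 0).
Proof.
move=> A; exists (nm c * expR (A * l1 R k)) => l; case: eqP => [->|_].
  by rewrite -mulrA -expRD subrr expR0 mulr1.
by rewrite nm0 !mulr_ge0 ?nm_ge0 ?expR_ge0.
Qed.

Lemma chi_ev k : chi k = ev (fun l => if l == k then 1 else 0) :> ('rV[C]_g -> C).
Proof.
apply/funext => z; rewrite /ev (@zsum_single _ k) ?eqxx ?mul1r// => l /negPf ->.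
by rewrite mul0r.
Qed.

Lemma OP_ev (c : 'rV[int]_g -> C) : decay c -> OP (ev c).
Proof. by move=> H; split=> [z|p z]; [have [] := ev_diff z H|exact: ev_periodic]. Qed.
Lemma OP_chi k : OP (@chi R g k).
Proof. by rewrite chi_ev; apply/OP_ev/decay_single. Qed.
Lemma OP_mul h h' : OP h -> OP h' -> OP (fun z => h z * h' z).
Proof.
move=> [H P] [H' P']; split=> [z|p z]; last by rewrite P P'.
exact: (differentiableM (H z) (H' z)).
Qed.
Lemma OP_add h h' : OP h -> OP h' -> OP (fun z => h z + h' z).
Proof.
move=> [H P] [H' P']; split=> [z|p z]; last by rewrite P P'.
exact: (differentiableD (H z) (H' z)).
Qed.
Lemma OP_cst (c : C) : OP (fun=> c).
Proof. by split=> // z; exact: differentiable_cst. Qed.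
Lemma OP_scale (c : C) h : OP h -> OP (fun z => c * h z).
Proof. by apply: OP_mul; exact: OP_cst. Qed.
Lemma OP_sub h h' : OP h -> OP h' -> OP (fun z => h z - h' z).
Proof.
move=> H /(OP_scale (-1)) /(OP_add H); congr OP; apply/funext => z.
by rewrite mulN1r.
Qed.
Lemma OP_sum (I : Type) (r : seq I) (P : pred I) (F : I -> 'rV[C]_g -> C) :
  (forall i, OP (F i)) -> OP (fun z => \sum_(i <- r | P i) F i z).
Proof.
move=> H; elim: r => [|i r IH].
  by have := OP_cst 0; congr OP; apply/funext => z; rewrite big_nil.
have [p|p] := boolP (P i).
  have := OP_add (H i) IH; congr OP; apply/funext => z; by rewrite big_cons p.
by move: IH; congr OP; apply/funext => z; rewrite big_cons (negPf p).
Qed.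
Lemma OP_transl h t : OP h -> OP (fun z => h (z + t)).
Proof.
move=> [H P]; split=> [z|p z]; last by rewrite addrAC P.
apply: (@differentiable_comp _ _ _ _ (fun x : 'rV[C]_g => x + t) h) => //.
Qed.

(** By [mval_const] the value is the same at every base point; [coef_bound] gains its decay from
    this freedom. *)
Definition coef h k : C := mval (fun z => h z * chi (- k) z) 0.

Lemma OP_coef h k : OP h -> OP (fun z => h z * chi (- k) z).
Proof. by move=> H; apply: OP_mul => //; exact: OP_chi. Qed.

Lemma coefP h k z : OP h -> tends (fun s => mean s (fun w => h w * chi (- k) w) z) (coef h k).
Proof.
move=> /(OP_coef k) H; rewrite /coef -(mval_const z H.1 H.2).
by apply: mvalP; [exact: OP_cont|exact: H.2].
Qed.

Lemma coef_bound h k z (B : R) : OP h -> (forall t, nm (h (z + rmx t)) <= B) ->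
  nm (coef h k) <= B * nm (chi (- k) z).
Proof.
move=> H hB; have K := OP_coef k H; rewrite /coef -(mval_const z K.1 K.2).
apply: mval_bound; [exact: OP_cont|exact: K.2|move=> t].
rewrite nmM [X in _ * X](_ : _ = nm (chi (- k) z)); first by rewrite ler_wpM2r ?nm_ge0.
rewrite chiDr nmM -[RHS]mulr1; congr (_ * _).
rewrite /chi nm_ex im_dot big1 ?mulr0 ?oppr0 ?expR0// => j _.
by rewrite [rmx _ _ _]mxE im_rc mulr0.
Qed.

Lemma coef_strip h k (b B : R) : OP h -> 0 <= b -> (forall z, strip b z -> nm (h z) <= B) ->
  nm (coef h k) <= B * expR (- (2 * pi * b * l1 R k)).
Proof.
(* The corner of the strip where [chi (- k)] is smallest: each coordinate contributes [- b * |k_j|]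
   to the exponent. *)
move=> H b0 hB; pose z : 'rV[C]_g := \row_j (iC * rc (- Num.sg ((k 0 j)%:~R) * b)).
have imz j : im (z 0 j) = - Num.sg ((k 0 j)%:~R) * b.
  by rewrite mxE imM re_iC im_iC re_rc im_rc; ring.
apply: le_trans (coef_bound k (z := z) (B := B) H _) _.
  move=> t; apply: hB; apply: strip_real => j; rewrite imz normrM normrN.
  rewrite [X in _ * X]ger0_norm// ler_piMl//.
  by rewrite normr_sg; case: eqP.
have B0 : 0 <= B.
  by apply: le_trans (nm_ge0 (h 0)) (hB _ _) => j; rewrite mxE -rc0 im_rc normr0.
rewrite ler_wpM2l// /chi nm_ex ler_expR im_dot.
have -> : \sum_j ((- k) 0 j)%:~R * im (z 0 j) = b * l1 R k.
  rewrite /l1 mulr_sumr; apply: eq_bigr => j _; rewrite imz mxE mulrNz.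
  by rewrite [X in b * X]normrEsg; ring.
by rewrite lerN2 mulrA.
Qed.

Lemma coef_decay h : OP h -> decay (coef h).
Proof.
move=> H A; pose b := `|A| / (2 * pi) : R.
have p0 := @pi_gt0 R; have pn : pi != 0 :> R by rewrite lt0r_neq0.
have [M M0 HM] := strip_bound b (OP_cont H) H.2.
have b0 : 0 <= b by rewrite divr_ge0// mulr_ge0// ltW.
exists M => k; apply: le_trans (coef_strip k H b0 HM) _.
rewrite ler_wpM2l// ler_expR lerN2 /b mulrCA divff ?mulr1 ?mulf_neq0// ler_wpM2r ?l1_ge0//.
exact: ler_norm.
Qed.

Lemma coef_add h h' k : OP h -> OP h' -> coef (fun z => h z + h' z) k = coef h k + coef h' k.
Proof.
move=> H H'; apply: tends_uniq (coefP k 0 (OP_add H H')) _.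
apply: tends_ext (tendsD (coefP k 0 H) (coefP k 0 H')) => s.
by rewrite -meanD; congr mean; apply/funext => w; rewrite mulrDl.
Qed.
Lemma coef_scale c h k : OP h -> coef (fun z => c * h z) k = c * coef h k.
Proof.
move=> H; apply: tends_uniq (coefP k 0 (OP_scale c H)) _.
apply: tends_ext (tendsZ c (coefP k 0 H)) => s.
by rewrite -meanZ; congr mean; apply/funext => w; rewrite mulrA.
Qed.
Lemma coef_sub h h' k : OP h -> OP h' -> coef (fun z => h z - h' z) k = coef h k - coef h' k.
Proof.
move=> H H'; rewrite -[- coef h' k]mulN1r -coef_scale// -coef_add//; last exact: OP_scale.
by congr coef; apply/funext => z; rewrite mulN1r.
Qed.
Lemma coef_sum (I : Type) (r : seq I) (F : I -> 'rV[C]_g -> C) k :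
  (forall i, OP (F i)) -> coef (fun z => \sum_(i <- r) F i z) k = \sum_(i <- r) coef (F i) k.
Proof.
move=> H; elim: r => [|i r IH].
  rewrite big_nil -[RHS](mul0r (coef (fun=> 0) k)) -coef_scale; last exact: OP_cst.
  by congr coef; apply/funext => z; rewrite big_nil mulr0.
rewrite big_cons -IH -coef_add//; last exact: OP_sum.
by congr coef; apply/funext => z; rewrite big_cons.
Qed.

Lemma mval_chi k : k != 0 -> mval (@chi R g k) 0 = 0.
Proof.
move=> k0; have [j kj] : exists j, k 0 j != 0.
  apply/existsP; apply: contraNT k0; rewrite negb_exists => /forallP H.
  by apply/eqP/rowP => j; rewrite mxE; apply/eqP; have := H j; rewrite negbK.
have O := OP_chi k; have hc := OP_cont O.
(* Half a period of [chi k] in the direction j: the translation changes the sign of [chi k] but not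
   its mean. *)
pose t : 'rV[R]_g := (2 * (k 0 j)%:~R)^-1 *: delta_mx 0 j.
have kn : (k 0 j)%:~R != 0 :> R by rewrite intr_eq0.
have ct : chi k (rmx t) = -1 :> C.
  have -> : chi k (rmx t) = ex (rc (1 / 2)) :> C.
    congr ex; rewrite /dot (bigD1 j)//= big1 => [|i ij].
      by rewrite [rmx _ _ _]mxE /t !mxE !eqxx mulr1 -rc_int -rcM addr0; congr rc; field.
    by rewrite [rmx _ _ _]mxE /t !mxE eqxx (negPf ij) mulr0 rc0 mulr0.
  rewrite /ex ex_arg im_rc re_rc mulr0 oppr0 rc0 add0r.
  apply: Ceq; rewrite ?re_cexp ?im_cexp reM imM re_iC im_iC re_rc im_rc.
    rewrite (_ : 2 * pi * _ = pi); last by field.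
    by rewrite !mulr0 !mul0r mul1r subr0 add0r expR0 cospi mul1r reN -rc1 re_rc.
  rewrite (_ : 2 * pi * _ = pi); last by field.
  by rewrite !mulr0 !mul0r mul1r subr0 add0r expR0 sinpi mulr0 imN -rc1 im_rc oppr0.
have e := mval_real 0 t hc O.2.
have e2 : mval (@chi R g k) (0 + rmx t) = - mval (@chi R g k) 0.
  apply: tends_uniq (mvalP _ hc O.2) _; apply: tends_ext (tendsN (mvalP 0 hc O.2)) => s.
  rewrite -mean_transl -mulN1r -meanZ; congr mean; apply/funext => w.
  by rewrite chiDr ct mulrC.
have : mval (@chi R g k) 0 + mval (@chi R g k) 0 = 0 by rewrite -{1}e e2 addNr.
by move/eqP; rewrite -mulr2n mulrn_eq0 /= => /eqP.
Qed.

Lemma coef_chi k l : coef (@chi R g l) k = (l == k)%:R.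
Proof.
rewrite /coef (_ : (fun z => chi l z * chi (- k) z) = chi (l - k)); last first.
  by apply/funext => z; rewrite -chiDl.
have [->|lk] := eqVneq l k; last by rewrite mval_chi// subr_eq0.
rewrite subrr; have O := OP_chi 0; apply: tends_uniq (mvalP 0 (OP_cont O) O.2) _.
apply: tends_ext (tends_cst 1) => s; apply/esym/subr0_eq/nm_small => e e0.
by apply: mean_le => a; rewrite chi0 subrr nm0 ltW.
Qed.

(** A truncation whose box contains k has the right coefficient by orthogonality, and the tail is
    uniformly small on real points, so that [coef_bound] applies to it. *)
Lemma coef_ev (c : 'rV[int]_g -> C) k : decay c -> coef (ev c) k = c k.
Proof.
move=> H; apply/subr0_eq/nm_small => e e0.
have [M HM] := summ_ev_bound 0 H.
have [N0 HN0] := expRN_small (M * 3 ^+ g) e0.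
pose N := maxn N0 (\max_j absz (k ord0 j))%N.
pose tr z := boxsum N (fun l => c l * chi l z).
have Otr : OP tr by apply: OP_sum => a; apply/OP_scale/OP_chi.
have -> : c k = coef tr k.
  rewrite /tr /boxsum coef_sum => [|a]; last by apply/OP_scale/OP_chi.
  have hk j : (absz (k ord0 j) <= N)%N.
    by apply: leq_trans (leq_bigmax _) (leq_maxr _ _).
  have pf j : (absz (k ord0 j + N%:Z)%R < N.*2.+1)%N by have := hk j; lia.
  pose a0 : {ffun 'I_g -> 'I_(N.*2.+1)} := [ffun j => Ordinal (pf j)].
  have e1 : boxpt a0 = k.
    apply/rowP => j; rewrite mxE ffunE /= -[0]/(ord0 : 'I_1); have := hk j; lia.
  rewrite (bigD1 a0)//= big1 => [|a aa0]; rewrite coef_scale ?coef_chi; try exact: OP_chi.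
    by rewrite e1 eqxx mulr1 addr0.
  case: eqP => [ea|]; last by rewrite mulr0.
  case/eqP: aa0; apply/ffunP => j; apply: val_inj.
  have := congr1 (fun m : 'rV[int]_g => m ord0 j) (etrans ea (esym e1)).
  by rewrite !mxE /=; case: (a j) => x hx; case: (a0 j) => y hy /=; lia.
rewrite -coef_sub//; last exact: OP_ev.
apply: le_trans (coef_bound k (z := 0) (B := e) (OP_sub (OP_ev H) Otr) _) _.
  move=> t; apply: le_trans (zsum_dist N (HM _ _)) _.
    by move=> j; rewrite !mxE add0r im_rc normr0.
  by rewrite mulrAC; apply/ltW/HN0; exact: leq_maxl.
by rewrite /chi (_ : dot _ 0 = 0) ?ex0 ?nm1 ?mulr1// /dot big1// => j _; rewrite [X in _ * X]mxE mulr0.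
Qed.

(** Vanishing of all Fourier coefficients, in a form visibly stable under multiplication by
    trigonometric polynomials, hence by the kernels below. *)
Definition nullmean h := [/\ cont h, zperiodic h &
  forall k z, tends (fun s => mean s (fun w => h w * chi (- k) w) z) 0].

Lemma nullmean_chi h l : nullmean h -> nullmean (fun z => h z * chi l z).
Proof.
move=> [hc hp H]; have O := OP_chi l; split.
- by apply: cont_mul => //; exact: OP_cont.
- by move=> p z; rewrite hp O.2.
move=> k z; apply: tends_ext (H (k - l) z) => s; congr mean; apply/funext => w.
by rewrite opprB addrC chiDl -mulrA [chi (- k) w * _]mulrC.
Qed.
Lemma nullmean_add h h' : nullmean h -> nullmean h' -> nullmean (fun z => h z + h' z).
Proof.
move=> [hc hp H] [hc' hp' H']; split; first exact: cont_add.
  by move=> p z; rewrite hp hp'.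
move=> k z; rewrite -[0]addr0; apply: tends_ext (tendsD (H k z) (H' k z)) => s.
by rewrite -meanD; congr mean; apply/funext => w; rewrite mulrDl.
Qed.
Lemma nullmean_scale c h : nullmean h -> nullmean (fun z => c * h z).
Proof.
move=> [hc hp H]; split; first exact: cont_scale.
  by move=> p z; rewrite hp.
move=> k z; rewrite -[0](mulr0 c); apply: tends_ext (tendsZ c (H k z)) => s.
by rewrite -meanZ; congr mean; apply/funext => w; rewrite mulrA.
Qed.

(** On real translates of z0 this is [(1 + cos (2 pi x)) / 2]: a trigonometric polynomial with
    values in [0, 1] that peaks at z0. Its high powers concentrate there. *)
Definition fejer1 z0 j z : C := (2 + ex (z 0 j - z0 0 j) + ex (- (z 0 j - z0 0 j))) / 4.

Lemma nullmean_fejer1 z0 j h : nullmean h -> nullmean (fun z => h z * fejer1 z0 j z).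
Proof.
move=> H; pose d : 'rV[int]_g := delta_mx 0 j.
have dE z : dot d z = z 0 j.
  rewrite /dot (bigD1 j)//= big1 => [|i ij]; rewrite mxE eqxx ?eqxx ?mul1r ?addr0//.
  by rewrite (negPf ij) mul0r.
have c1 z : chi d z = ex (z 0 j) by rewrite /chi dE.
have c2 z : chi (- d) z = ex (- z 0 j) by rewrite /chi dotNl dE.
have := nullmean_add (nullmean_scale (2 / 4) H) (nullmean_add
  (nullmean_scale (ex (- z0 0 j) / 4) (nullmean_chi d H))
  (nullmean_scale (ex (z0 0 j) / 4) (nullmean_chi (- d) H))).
congr nullmean; apply/funext => z; rewrite c1 c2 /fejer1 opprB (addrC (z0 0 j)) !exD.
by ring.
Qed.

Definition fejer z0 M z : C := \prod_j fejer1 z0 j z ^+ M.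

Lemma nullmean_fejer z0 M h : nullmean h -> nullmean (fun z => h z * fejer z0 M z).
Proof.
move=> H; rewrite /fejer; elim: (index_enum _) => [|j r IH].
  by move: H; congr nullmean; apply/funext => z; rewrite big_nil mulr1.
have /(_ M) : forall n, nullmean (fun z => h z * \prod_(j <- r) fejer1 z0 j z ^+ M * fejer1 z0 j z ^+ n).
  elim=> [|n IHn]; first by move: IH; congr nullmean; apply/funext => z; rewrite mulr1.
  have := nullmean_fejer1 z0 j IHn; congr nullmean; apply/funext => z.
  by rewrite exprSr mulrA.
by congr nullmean; apply/funext => z; rewrite big_cons mulrAC mulrA.
Qed.

Definition kap (x : R) : R := (1 + cos (2 * pi * x)) / 2.

Lemma fejer1_real z0 j (t : 'rV[R]_g) : fejer1 z0 j (z0 + rmx t) = rc (kap (t 0 j)).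
Proof.
have e : (z0 + rmx t) 0 j - z0 0 j = rc (t 0 j) by rewrite !mxE addrAC subrr add0r.
rewrite /fejer1 e /ex -rcN !ex_arg !im_rc !re_rc !mulr0 oppr0 rc0 !add0r.
set y := 2 * pi * t 0 j; rewrite mulrN.
have E (x : R) : cexp (iC * rc x) = rc (cos x) + iC * rc (sin x).
  apply: Ceq; rewrite ?re_cexp ?im_cexp ?reD ?imD ?reM ?imM re_iC im_iC !re_rc !im_rc.
    by rewrite !mulr0 !mul0r !mul1r ?subr0 ?add0r ?expR0; ring.
  by rewrite !mulr0 !mul0r !mul1r ?subr0 ?add0r ?expR0; ring.
rewrite !E cosN sinN rcN /kap -/y rcM rcD rcV !rc_nat rc1.
by field.
Qed.

Lemma kap_ge0 x : 0 <= kap x.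
Proof. by rewrite divr_ge0//; have := cos_geN1 (2 * pi * x); lra. Qed.
Lemma kap_le1 x : kap x <= 1.
Proof. by rewrite ler_pdivrMr//; have := cos_le1 (2 * pi * x); lra. Qed.

Lemma kap_near x : 1 - (4 * x) ^+ 2 <= kap x.
Proof.
have [h _] := cos_abs (2 * pi * x); have := ler_norm (1 - cos (2 * pi * x)).
rewrite distrC /kap => k.
have p0 := @pi_gt0 R; have p4 : pi <= 4 :> R by have := @pihalf_lt2 R; lra.
have : (2 * pi * x) ^+ 2 <= (8 * x) ^+ 2.
  rewrite !exprMn ler_wpM2r ?sqr_ge0// -exprMn.
  by apply: lerXn2r; rewrite ?nnegrE; lra.
have -> : (8 * x) ^+ 2 = 64 * x ^+ 2 by ring.
have -> : (4 * x) ^+ 2 = 16 * x ^+ 2 by ring.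
lra.
Qed.

Lemma kap_far (d : R) : 0 < d <= 1 / 2 -> exists2 rho, 0 <= rho < 1 &
  forall x, d <= x <= 1 - d -> kap x <= rho.
Proof.
move=> /andP[d0 d1]; have p0 := @pi_gt0 R; exists (kap d).
  rewrite kap_ge0 /kap ltr_pdivrMr//.
  suff : cos (2 * pi * d) < cos 0 :> R by rewrite cos0; lra.
  by rewrite ltr_cos ?in_itv /=; [nra|nra|nra].
have H x : d <= x <= 1 / 2 -> kap x <= kap d.
  move=> /andP[h1 h2]; rewrite /kap ler_pM2r ?invr_gt0// lerD2l.
  have [->//|dx] := eqVneq d x.
  have dx' : d < x by rewrite lt_neqAle dx.
  by apply/ltW; rewrite ltr_cos ?in_itv /=; [nra|nra|nra].
move=> x /andP[h1 h2]; have [h|/ltW h] := leP x (1 / 2); first by apply: H; lra.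
rewrite (_ : kap x = kap (1 - x)); first by apply: H; lra.
rewrite /kap (_ : 2 * pi * (1 - x) = - (2 * pi * x) + pi *+ 2); last by rewrite mulr2n; ring.
by rewrite cosD2pi cosN.
Qed.

Lemma pow_dom (K rho q : R) : 0 <= rho < q -> exists M, K * rho ^+ M < q ^+ M.
Proof.
move=> /andP[r0 rq]; have q0 : 0 < q by lra.
have [->|rn] := eqVneq rho 0; first by exists 1%N; rewrite !expr1 mulr0.
have rp : 0 < rho by rewrite lt_neqAle eq_sym rn.
pose x := q / rho - 1; have x0 : 0 < x by rewrite subr_gt0 ltr_pdivlMr// mul1r.
exists (Num.trunc (`|K| / x)).+1; set M := (Num.trunc _).+1.
have hM : `|K| / x < M%:R by exact: truncnS_gt.
have -> : q = rho * (1 + x) by rewrite /x addrCA subrr addr0 mulrCA divff// mulr1.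
rewrite exprMn mulrC ltr_pM2l ?exprn_gt0//.
have B : 1 + M%:R * x <= (1 + x) ^+ M.
  elim: (M) => [|n IH]; first by rewrite mul0r addr0 expr0.
  by rewrite exprS -natr1; have := mulr_ge0 (ler0n R n) (sqr_ge0 x); nra.
apply: lt_le_trans B; move: hM; rewrite ltr_pdivrMr// => hM; have := ler_norm K; lra.
Qed.

(** If h z0 is not 0, normalise it to 1. The means of h against a concentrated kernel tend to 0, yet
    their real part stays above a fixed positive [eta]. *)
Lemma fejer_unique h : nullmean h -> forall z, h z = 0.
Proof.
move=> H z0; apply: contrapT => /eqP hz.
pose f z := (h z0)^-1 * h z.
have Hf : nullmean f by exact: nullmean_scale.
have fz : f z0 = 1 by rewrite /f mulVf.
have [fc fp _] := Hf.
have [d d0 Hd] := fc z0 (1 / 2) (divr_gt0 ltr01 (ltr0n _ 2)).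
pose d1 := Num.min d (1 / 2); have d10 : 0 < d1 <= 1 / 2.
  by rewrite lt_min d0 divr_gt0//= ge_min lexx orbT.
have [rho /andP[rho0 rho1] Hrho] := kap_far d10.
have [b zb] := strip_ex z0.
have [B B0 HB] := strip_bound b fc fp.
have {HB}HB t : nm (f (z0 + rmx t)) <= B by apply/HB/strip_real.
(* In the cube of side [2 ^- r] at z0 each factor of the kernel is at least [1 - x] by [kap_near]; r
   is chosen so that [(1 - x) ^+ g] still exceeds [rho], the bound of one factor away from z0. *)
have [r Hr] : exists r : nat, (g%:R + 1) * (16 * (2 ^+ r)^-1) < 1 - rho :> R.
  have gp : 0 < g%:R + 1 :> R by rewrite ltr_wpDl.
  have e0 : 0 < (1 - rho) / ((g%:R + 1) * 16) by apply: divr_gt0; [lra|exact: mulr_gt0].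
  have [r /(_ r (leqnn r)) hr] := pow2_small e0; exists r.
  by move: hr; rewrite ltr_pdivlMr ?mulr_gt0//; lra.
set x := 16 * (2 ^+ r)^-1 in Hr.
have u0 : 0 < (2 ^+ r)^-1 :> R by rewrite invr_gt0 exprn_gt0.
have u1 : (2 ^+ r)^-1 <= 1 :> R by rewrite invf_le1 ?exprn_gt0// exprn_ege1// ler1n.
have g0 := ler0n R g.
have x0 : 0 < x by rewrite /x; lra.
have x1 : x < 1 by nra.
pose q := (1 - x) ^+ g.
have qr : rho < q.
  have Bn : 1 - g%:R * x <= (1 - x) ^+ g.
    elim: (g) => [|n IH]; first by rewrite mul0r subr0 expr0.
    have := ler0n R n; rewrite exprS -natr1; nra.
  by apply: lt_le_trans Bn; nra.
have [M HM] : exists M, (2 * B + 1) * (2 ^+ r) ^+ g * rho ^+ M < q ^+ M.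
  by apply: pow_dom; rewrite rho0.
(* The cube fills a proportion [2 ^- (r g)] of the grid and f has real part at least 1/2 there; the
   subtracted term covers the grid points where the kernel is at most [rho ^+ M]. *)
pose eta := (2 * (2 ^+ r) ^+ g)^-1 * q ^+ M - (B + 1 / 2) * rho ^+ M.
have rg0 : 0 < (2 ^+ r) ^+ g :> R by rewrite !exprn_gt0.
have eta0 : 0 < eta.
  rewrite subr_gt0 [X in _ < X]mulrC ltr_pdivlMr ?mulr_gt0//; apply: le_lt_trans HM.
  by rewrite le_eqVlt; apply/orP; left; apply/eqP; field.
have [_ _ /(_ 0 z0)/(_ _ eta0)[N HN]] := nullmean_fejer z0 M Hf.
pose s := maxn N r; have rs : (r <= s)%N by exact: leq_maxr.
have := HN s (leq_maxl _ _); rewrite subr0; apply/negP; rewrite -leNgt.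
apply: le_trans _ (re_nm _); apply: le_trans _ (ler_norm _).
pose p (a : {ffun 'I_g -> 'I_(2 ^ s)}) : R := \prod_j kap ((a j)%:R / 2 ^+ s) ^+ M.
have sg0 : 0 < 2 ^+ (s * g) :> R by rewrite exprn_gt0.
have -> : mean s (fun w => f w * fejer z0 M w * chi (- 0) w) z0 =
  rc (2 ^+ (s * g))^-1 * \sum_(a : {ffun 'I_g -> 'I_(2 ^ s)}) f (z0 + ipt R s (gidx a)) * rc (p a).
  rewrite meanE rcV rcX rc_nat; congr (_ * _); apply: eq_bigr => a _.
  rewrite oppr0 chi0 mulr1; congr (_ * _); rewrite /p /fejer [rc _]rmorph_prod /=.
  apply: eq_bigr => j _; rewrite ipt_real fejer1_real -[RHS]/(rc _) rcX !mxE.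
  by congr (rc (kap (_ / _)) ^+ _); rewrite -pmulrn.
rewrite reM re_rc im_rc mul0r subr0 re_sum.
have pt a : 1 / 2 * p a - (B + 1 / 2) * rho ^+ M <= re (f (z0 + ipt R s (gidx a)) * rc (p a)).
  rewrite reM re_rc im_rc mulr0 subr0.
  have p0 : 0 <= p a by apply: prodr_ge0 => j _; rewrite exprn_ge0// kap_ge0.
  have rM : 0 <= rho ^+ M by rewrite exprn_ge0.
  have t01 j : 0 <= ((a j)%:R / 2 ^+ s : R) < 1.
    rewrite divr_ge0 ?exprn_ge0//= ltr_pdivrMr ?exprn_gt0// mul1r -natrX ltr_nat.
    exact: ltn_ord.
  have [/existsP[j /andP[h1 h2]]|N'] := boolP [exists j, (d1 <= (a j)%:R / 2 ^+ s) && ((a j)%:R / 2 ^+ s <= 1 - d1)].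
    have pr : p a <= rho ^+ M.
      rewrite /p (bigD1 j)//= -[leRHS]mulr1; apply: ler_pM.
      - by rewrite exprn_ge0// kap_ge0.
      - by apply: prodr_ge0 => i _; rewrite exprn_ge0// kap_ge0.
      - apply: lerXn2r; rewrite ?nnegrE ?kap_ge0//.
        by apply: Hrho; rewrite h1.
      apply: prodr_ile1 => i _; rewrite exprn_ge0 ?kap_ge0//=.
      by rewrite exprn_ile1 ?kap_ge0 ?kap_le1.
    have := HB (\row_j ((gidx a 0 j)%:~R / 2 ^+ s)); rewrite -ipt_real => hb.
    have := re_nm (f (z0 + ipt R s (gidx a))); set y := re _ => hy.
    have : - B <= y by have := ler_norm (- y); rewrite normrN; lra.
    nra.
  have hf : nm (f (z0 + ipt R s (gidx a)) - f z0) < 1 / 2.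
    (* Coordinates close to 1 are close to 0 modulo the period. *)
    pose n : 'rV[int]_g := \row_j (if (a j)%:R / 2 ^+ s < d1 then 0 else 1).
    rewrite -[z0 + _](subrK (zvec R n)) fp; apply: Hd => j.
    have -> : (z0 + ipt R s (gidx a) - zvec R n) 0 j - z0 0 j = rc ((a j)%:R / 2 ^+ s) - (n 0 j)%:~R.
      by rewrite /zvec !mxE -[((a j)%:Z)%:~R]pmulrn; ring.
    rewrite /n mxE.
    move: N'; rewrite negb_exists => /forallP/(_ j); rewrite negb_and -!ltNge => hh.
    have /andP[h1 h2] := t01 j.
    have d1d : d1 <= d by rewrite ge_min lexx.
    case: ifPn hh => [hh _|]; first by rewrite subr0 nm_rc ger0_norm//; lra.
    move=> _ h4; have h5 : 1 - d1 < (a j)%:R / 2 ^+ s by [].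
    by rewrite -[1%:~R]/(rc 1) -rcB nm_rc ler0_norm; lra.
  have := re_nm (f (z0 + ipt R s (gidx a)) - f z0); rewrite reB fz -rc1 re_rc => hh.
  have := ler_norm (1 - re (f (z0 + ipt R s (gidx a)))); rewrite distrC => h'.
  move: hf; rewrite fz => hf.
  move: hh h'; set y := re (f _) => hh h'; have : 1 / 2 <= y by rewrite rc1 in hh; lra.
  nra.
have S1 : ((2 ^+ (s - r)) * (1 - x) ^+ M) ^+ g <= \sum_a p a.
  rewrite /p -(bigA_distr_bigA (fun (j : 'I_g) (i : 'I_(2 ^ s)) => kap (i%:R / 2 ^+ s) ^+ M)).
  rewrite prodr_const card_ord; apply: lerXn2r; rewrite ?nnegrE.
  - by rewrite mulr_ge0 ?exprn_ge0//; lra.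
  - by apply: sumr_ge0 => i _; rewrite exprn_ge0// kap_ge0.
  have e : (2 ^ s = 2 ^ (s - r) + (2 ^ s - 2 ^ (s - r)))%N.
    by rewrite subnKC// leq_exp2l// leq_subr.
  rewrite -(big_mkord xpredT (fun i => kap (i%:R / 2 ^+ s) ^+ M)) (big_cat_nat (n := 2 ^ (s - r)))//=; last by rewrite leq_exp2l// leq_subr.
  apply: ler_wpDr; first by apply: sumr_ge0 => i _; rewrite exprn_ge0// kap_ge0.
  rewrite big_mkord; apply: (@le_trans _ _ (\sum_(i < (2 ^ (s - r))%N) (1 - x) ^+ M)).
    by rewrite sumr_const card_ord -[leRHS]mulr_natl natrX.
  apply: ler_sum => i _; apply: lerXn2r; rewrite ?nnegrE ?kap_ge0//; first lra.
  apply: le_trans _ (kap_near _).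
  have hi : i%:R / 2 ^+ s <= (2 ^+ r)^-1 :> R.
    rewrite ler_pdivrMr ?exprn_gt0//.
    have -> : (2 ^+ r)^-1 * 2 ^+ s = 2 ^+ (s - r) :> R.
      by rewrite -[in LHS](subnK rs) exprD mulrCA mulVf ?mulr1// expf_neq0.
    by rewrite -natrX ler_nat; apply/ltnW.
  have hi0 : 0 <= i%:R / 2 ^+ s :> R by rewrite divr_ge0 ?exprn_ge0.
  rewrite /x exprMn; set y := i%:R / _ in hi hi0 *; rewrite expr2 expr2; nra.
have S2 : \sum_(a : {ffun 'I_g -> 'I_(2 ^ s)}) (1 / 2 * p a - (B + 1 / 2) * rho ^+ M) <=
  \sum_(a : {ffun 'I_g -> 'I_(2 ^ s)}) re (f (z0 + ipt R s (gidx a)) * rc (p a)).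
  by apply: ler_sum => a _.
rewrite mulrC ler_pdivlMr//; apply: le_trans _ S2.
rewrite sumrB -mulr_sumr sumr_const card_ffun !card_ord -expnM -[X in _ <= _ - X]mulr_natr natrX.
rewrite /eta mulrBl lerD2r -mulrA [_^-1 * _]mulrC.
rewrite ler_pdivrMr ?mulr_gt0//.
apply: (@le_trans _ _ (((2 ^+ (s - r)) * (1 - x) ^+ M) ^+ g * (2 ^+ r) ^+ g)); last first.
  by have := ler_wpM2r (ltW rg0) S1; lra.
rewrite -exprMn /q -exprM [(g * M)%N]mulnC exprM.
rewrite mulrAC -exprD subnK// exprMn [X in _ <= X]mulrC.
by rewrite -[X in _ <= _ * X]exprM -exprM mulnC exprM.
Qed.

Lemma coef_unique h : OP h -> (forall k, coef h k = 0) -> forall z, h z = 0.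
Proof.
move=> H K; apply: fejer_unique; split; [exact: OP_cont|exact: H.2|].
by move=> k z; rewrite -(K k); exact: coefP.
Qed.

(** Both sides have the same coefficients, so no convergence theorem for Fourier series is called
    upon beyond uniqueness. *)
Lemma ev_coef h : OP h -> h = ev (coef h).
Proof.
move=> H; have D := coef_decay H; apply/funext => z; apply/subr0_eq.
apply: (@coef_unique (fun z => h z - ev (coef h) z)); first by apply: OP_sub => //; exact: OP_ev.
by move=> k; rewrite coef_sub ?coef_ev ?subrr//; exact: OP_ev.
Qed.

End Fourier.

(** * The lattice operators and the theta function *)

Section Cholesky.
Variable R : realType.

Definition qf n (Y : 'I_n -> 'I_n -> R) (x : 'I_n -> R) : R := \sum_i \sum_j Y i j * x i * x j.
Definition lf n (u : 'I_n -> 'I_n -> R) (x : 'I_n -> R) (i : 'I_n) : R := \sum_l u i l * x l.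

(** Completing the square in the first variable leaves the Schur complement [Y']. The triangular
    shape matters later: a shift along the p-th coordinate leaves the forms [lf u x i] with i > p
    unchanged, so coordinates can be treated one at a time. *)
Lemma cholesky n (Y : 'I_n -> 'I_n -> R) : (forall i j, Y i j = Y j i) ->
  (forall x, (exists i, x i != 0) -> 0 < qf Y x) ->
  exists d u, [/\ forall i, 0 < d i, forall i, u i i = 1,
    forall i l : 'I_n, (l < i)%N -> u i l = 0,
    forall x, qf Y x = \sum_i d i * lf u x i ^+ 2 &
    exists2 K, 0 <= K & forall x i, `|x i| <= K * \sum_l `|lf u x l| ].
Proof.
elim: n Y => [|n IH] Y Ys Yp.
  exists (fun=> 1), (fun _ _ => 0); split; try by case.
    by move=> x; rewrite /qf !big_ord0.
  by exists 0 => // x [].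
pose a := Y ord0 ord0.
have a0 : 0 < a.
  have := Yp (fun i => (i == ord0)%:R); rewrite /qf big_ord_recl big_ord_recl.
  rewrite [in X in _ + X + _]big1 => [|i _]; last by rewrite /= mulr0.
  rewrite [X in _ + _ + X]big1 => [|i _]; last first.
    by rewrite big1// => j _; rewrite /= mulr0 mul0r.
  by rewrite !eqxx !addr0 !mulr1; apply; exists ord0; rewrite eqxx oner_neq0.
pose Y' i j := Y (lift ord0 i) (lift ord0 j) - Y ord0 (lift ord0 i) * Y ord0 (lift ord0 j) / a.
pose s (x : 'I_n.+1 -> R) := \sum_j Y ord0 (lift ord0 j) / a * x (lift ord0 j).
have E x : qf Y x = a * (x ord0 + s x) ^+ 2 + qf Y' (fun i => x (lift ord0 i)).
  rewrite /qf big_ord_recl big_ord_recl.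
  under [X in _ + X = _]eq_bigr do rewrite big_ord_recl.
  rewrite [in LHS]big_split /= /Y'.
  have -> : \sum_(i < n) \sum_(j < n) (Y (lift ord0 i) (lift ord0 j) -
      Y ord0 (lift ord0 i) * Y ord0 (lift ord0 j) / a) * x (lift ord0 i) * x (lift ord0 j) =
    \sum_(i < n) \sum_(j < n) Y (lift ord0 i) (lift ord0 j) * x (lift ord0 i) * x (lift ord0 j)
    - a * s x ^+ 2.
    have -> : a * s x ^+ 2 = \sum_(i < n) \sum_(j < n)
       Y ord0 (lift ord0 i) * Y ord0 (lift ord0 j) / a * x (lift ord0 i) * x (lift ord0 j).
      rewrite expr2 {1}/s mulr_suml mulr_sumr; apply: eq_bigr => i _.
      rewrite /s !mulr_sumr; apply: eq_bigr => j _; field; exact: lt0r_neq0.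
    rewrite -sumrB; apply: eq_bigr => i _; rewrite -sumrB; apply: eq_bigr => j _; ring.
  have e1 : \sum_(i < n) Y ord0 (lift ord0 i) * x ord0 * x (lift ord0 i) = a * x ord0 * s x.
    rewrite /s mulr_sumr; apply: eq_bigr => i _; field; exact: lt0r_neq0.
  have e2 : \sum_(i < n) Y (lift ord0 i) ord0 * x (lift ord0 i) * x ord0 = a * x ord0 * s x.
    rewrite /s mulr_sumr; apply: eq_bigr => i _; rewrite Ys; field; exact: lt0r_neq0.
  rewrite e1 e2 -/a; set S := \sum_i \sum_j _; ring.
have [|x' [i xi]|d [u [d0 u1 ul Q [K K0 HK]]]] := IH Y'.
- by move=> i j; rewrite /Y' Ys [Y ord0 _ * _]mulrC.
(* The first coordinate is chosen to annihilate the first square, so that [qf Y' x'] is a value of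
   [qf Y]. *)
- pose x k := if unlift ord0 k is Some j then x' j else - \sum_j Y ord0 (lift ord0 j) / a * x' j.
  have xl j : x (lift ord0 j) = x' j by rewrite /x liftK.
  have := Yp x; rewrite E (_ : (fun i => x (lift ord0 i)) = x'); last exact/funext.
  have -> : x ord0 + s x = 0.
    rewrite /x unlift_none /s -sumrN -big_split big1// => j _ /=.
    by rewrite liftK addNr.
  rewrite expr0n mulr0 add0r.
  by apply; exists (lift ord0 i); rewrite xl.
pose d1 k := if unlift ord0 k is Some j then d j else a.
pose u1' k l := if unlift ord0 k is Some i then (if unlift ord0 l is Some j then u i j else 0)
  else (if unlift ord0 l is Some j then Y ord0 (lift ord0 j) / a else 1).
have L0 x : lf u1' x ord0 = x ord0 + s x.
  rewrite /lf big_ord_recl /u1' !unlift_none mul1r; congr (_ + _).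
  by apply: eq_bigr => j _; rewrite liftK.
have L1 x i : lf u1' x (lift ord0 i) = lf u (fun j => x (lift ord0 j)) i.
  rewrite /lf big_ord_recl /u1' liftK unlift_none mul0r add0r.
  by apply: eq_bigr => j _; rewrite liftK.
exists d1, u1'; split.
- by move=> k; rewrite /d1; case: unliftP.
- by move=> k; rewrite /u1'; case: unliftP.
- move=> k l; rewrite /u1'; case: unliftP => [i ->|->//]; case: unliftP => [j ->|//].
  by rewrite !lift0 ltnS => /ul.
- move=> x; rewrite big_ord_recl L0 /d1 unlift_none E; congr (_ + _).
  by rewrite Q; apply: eq_bigr => i _; rewrite liftK L1.
pose K1 := \sum_j `|Y ord0 (lift ord0 j) / a|.
have K10 : 0 <= K1 by apply: sumr_ge0.
exists (1 + K + K1 * K) => [|x k].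
  by rewrite !addr_ge0// mulr_ge0.
have h j : `|x (lift ord0 j)| <= K * \sum_l `|lf u1' x l|.
  apply: le_trans (HK (fun j => x (lift ord0 j)) j) _; rewrite ler_wpM2l// big_ord_recl.
  rewrite -[leLHS]add0r lerD//; apply: ler_sum => i _; by rewrite L1.
set S := \sum_l _ in h *; have S0 : 0 <= S by apply: sumr_ge0.
case: (unliftP ord0 k) => [j ->|->].
  by apply: le_trans (h j) _; rewrite ler_wpM2r//; have := mulr_ge0 K10 K0; lra.
have -> : x ord0 = lf u1' x ord0 - s x by rewrite L0 addrK.
apply: le_trans (ler_normB _ _) _.
have h1 : `|lf u1' x ord0| <= S by rewrite /S big_ord_recl lerDl sumr_ge0.
have h2 : `|s x| <= K1 * (K * S).
  apply: le_trans (ler_norm_sum _ _ _) _; rewrite /K1 mulr_suml.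
  by apply: ler_sum => j _; rewrite normrM ler_wpM2l.
by have := mulr_ge0 K0 S0; nra.
Qed.

End Cholesky.

Section Automorphy.
Variables (R : realType) (g : nat) (tau : 'M[CC R]_g).
Local Notation C := (CC R).
Hypothesis htau : period_matrix tau.
Implicit Types (k l : 'rV[int]_g) (z w : 'rV[C]_g) (h : 'rV[C]_g -> C) (m : int).

Local Opaque mean mval.

Definition bil k l : C := \sum_i \sum_j (k 0 i)%:~R * tau i j * (l 0 j)%:~R.
Definition trow l : 'rV[C]_g := zvec R l *m tau.

Lemma tau_sym i j : tau i j = tau j i.
Proof. by case: htau => e _; rewrite -{1}e mxE. Qed.

Lemma bilC k l : bil k l = bil l k.
Proof.
rewrite /bil exchange_big; apply: eq_bigr => i _; apply: eq_bigr => j _.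
by rewrite tau_sym; ring.
Qed.
Lemma bilDl k k' l : bil (k + k') l = bil k l + bil k' l.
Proof.
rewrite /bil -big_split; apply: eq_bigr => i _; rewrite -big_split; apply: eq_bigr => j _ /=.
by rewrite mxE intrD; ring.
Qed.
Lemma bilDr k l l' : bil k (l + l') = bil k l + bil k l'.
Proof. by rewrite !(bilC k) bilDl. Qed.
Lemma bilZl m k l : bil (m *: k) l = m%:~R * bil k l.
Proof.
rewrite /bil mulr_sumr; apply: eq_bigr => i _; rewrite mulr_sumr; apply: eq_bigr => j _.
by rewrite mxE intrM; ring.
Qed.
Lemma bilZr m k l : bil k (m *: l) = m%:~R * bil k l.
Proof. by rewrite !(bilC k) bilZl. Qed.
Lemma bilNl k l : bil (- k) l = - bil k l.
Proof. by rewrite -scaleN1r bilZl rmorphN1 mulN1r. Qed.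
Lemma bilNr k l : bil k (- l) = - bil k l.
Proof. by rewrite !(bilC k) bilNl. Qed.

Lemma dot_trow k l : dot k (trow l) = bil k l.
Proof.
rewrite bilC /dot /bil /trow [RHS]exchange_big; apply: eq_bigr => j _.
rewrite mxE mulr_sumr; apply: eq_bigr => i _; rewrite !mxE; ring.
Qed.

Lemma trowD l l' : trow (l + l') = trow l + trow l'.
Proof.
rewrite /trow -mulmxDl; congr (_ *m _); apply/rowP => j.
by rewrite !mxE intrD.
Qed.

Definition im_form (i j : 'I_g) : R := im (tau i j).
Definition kreal k : 'I_g -> R := fun i => (k 0 i)%:~R.

Lemma im_bil k : im (bil k k) = qf im_form (kreal k).
Proof.
rewrite im_sum; apply: eq_bigr => i _; rewrite im_sum; apply: eq_bigr => j _.
rewrite !imM !reM -!rc_int !re_rc !im_rc /im_form /kreal; ring.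
Qed.

Lemma chol_tau : exists d u, [/\ forall i, 0 < d i, forall i, u i i = 1,
    forall i l : 'I_g, (l < i)%N -> u i l = 0,
    forall x, qf im_form x = \sum_i d i * lf u x i ^+ 2 &
    exists2 K, 0 <= K & forall x i, `|x i| <= K * \sum_l `|lf u x l| ].
Proof.
apply: cholesky => [i j|x [i xi]]; first by rewrite /im_form tau_sym.
have [_ /(_ (\row_j x j))] := htau; set b := (_ == _); have -> : b = false.
  by apply/negP => /eqP/rowP/(_ i); rewrite !mxE => e; rewrite e eqxx in xi.
move=> /(_ isT); congr (0 < _); rewrite mxE /qf exchange_big; apply: eq_bigr => j _.
rewrite !mxE mulr_suml; apply: eq_bigr => i' _; rewrite !mxE /im_form /im; ring.
Qed.

Definition tk k : C := ex (1 / 2 * bil k k).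

Lemma tk_decay : decay tk.
Proof.
have [d [u [d0 u1 ul Q [K K0 HK]]]] := chol_tau.
move=> A; pose B := g%:R * (`|A| * K) : R.
(* The maximum of [B y - c y ^+ 2] with [c = pi * d i] is [B ^+ 2 / (4 c)]: a Gaussian beats every
   exponential. *)
exists (expR (\sum_i B ^+ 2 / (4 * (pi * d i)))) => k.
rewrite nm_ex -expRD ler_expR.
have -> : im (1 / 2 * bil k k) = 1 / 2 * im (bil k k).
  have -> : (1 / 2 : C) = rc (1 / 2) by rewrite rcM rcV rc_nat rc1.
  by rewrite imM re_rc im_rc mul0r addr0.
rewrite im_bil Q.
have l1b : l1 R k <= g%:R * K * \sum_i `|lf u (kreal k) i|.
  rewrite /l1 -mulrA mulr_natl -[X in _ *+ X](card_ord g) -sumr_const.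
  by apply: ler_sum => j _; apply: (HK (kreal k)).
have -> : - (2 * pi * (1 / 2 * \sum_i d i * lf u (kreal k) i ^+ 2)) =
  \sum_i - (pi * d i * lf u (kreal k) i ^+ 2).
  rewrite sumrN !mulr_sumr; congr (- _); apply: eq_bigr => i _; by field.
have h : A * l1 R k <= \sum_i B * `|lf u (kreal k) i|.
  rewrite -mulr_sumr /B; apply: (@le_trans _ _ (`|A| * l1 R k)).
    by rewrite ler_wpM2r ?l1_ge0// ler_norm.
  by apply: le_trans (ler_wpM2l (normr_ge0 A) l1b) _; rewrite le_eqVlt; apply/orP; left; apply/eqP; ring.
apply: (@le_trans _ _ (\sum_i (B ^+ 2 / (4 * (pi * d i)) - B * `|lf u (kreal k) i|))); last first.
  by rewrite sumrB; lra.
apply: ler_sum => i _; set s := lf _ _ _.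
rewrite -[s ^+ 2]real_normK ?num_real//; set y := `|s|.
have c0 : 0 < pi * d i by rewrite mulr_gt0 ?pi_gt0.
set c := pi * d i in c0 *.
have -> : B ^+ 2 / (4 * c) - B * y = c * (B / (2 * c) - y) ^+ 2 - c * y ^+ 2.
  by field; rewrite lt0r_neq0.
by rewrite -subr_ge0 opprK subrK mulr_ge0 ?sqr_ge0// ltW.
Qed.

(** The operator T_l of weight m. The half in the quadratic term makes it an action of the lattice
    on periodic functions ([tr_comp]). *)
Definition tr m l h z : C := ex (m%:~R * (1 / 2 * bil l l + dot l z)) * h (z + trow l).

Lemma OP_exdot m l : OP (fun z => ex (m%:~R * dot l z) : C).
Proof.
have := OP_chi R (m *: l); congr OP; apply/funext => z; rewrite /chi; congr ex.
rewrite /dot mulr_sumr; apply: eq_bigr => j _.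
by rewrite mxE intrM mulrA.
Qed.

Lemma OP_tr m l h : OP h -> OP (tr m l h).
Proof.
move=> H; have := OP_scale (ex (m%:~R * (1 / 2 * bil l l))) (OP_mul (OP_exdot m l) (OP_transl (trow l) H)).
by congr OP; apply/funext => z; rewrite /tr mulrDr exD mulrA.
Qed.

Lemma trM m m' l h h' z : tr (m + m') l (fun x => h x * h' x) z = tr m l h z * tr m' l h' z.
Proof. by rewrite /tr intrD mulrDl exD; ring. Qed.
Lemma tr_add m l h h' z : tr m l (fun x => h x + h' x) z = tr m l h z + tr m l h' z.
Proof. by rewrite /tr mulrDr. Qed.
Lemma tr_scale m l (c : C) h z : tr m l (fun x => c * h x) z = c * tr m l h z.
Proof. by rewrite /tr mulrCA. Qed.
Lemma tr_comp m l l' h z : tr m l (tr m l' h) z = tr m (l + l') h z.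
Proof.
rewrite /tr mulrA -exD -addrA -trowD; congr (ex _ * _).
rewrite -mulrDr; congr (_ * _).
by rewrite bilDl !bilDr dotDl dotDr dot_trow (bilC l' l); field.
Qed.
Lemma trC m l l' h z : tr m l (tr m l' h) z = tr m l' (tr m l h) z.
Proof. by rewrite !tr_comp addrC. Qed.
Lemma tr0l m h z : tr m 0 h z = h z.
Proof.
rewrite /tr dot0l (_ : bil 0 0 = 0) ?mulr0 ?addr0 ?mulr0 ?ex0 ?mul1r.
  by rewrite /trow (_ : zvec R 0 = 0) ?mul0mx ?addr0//; apply/rowP => j; rewrite !mxE.
by rewrite /bil big1// => i _; rewrite big1// => j _; rewrite mxE !mul0r.
Qed.

Lemma tr_coef m l h k : OP h ->
  coef (tr m l h) k = ex (m%:~R / 2 * bil l l + bil (k - m *: l) l) * coef h (k - m *: l).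
Proof.
move=> H; apply: tends_uniq (coefP k 0 (OP_tr m l H)) _.
apply: tends_ext (tendsZ _ (coefP (k - m *: l) (0 + trow l) H)) => s.
rewrite -mean_transl -meanZ; congr mean; apply/funext => z; rewrite /tr.
rewrite mulrCA [RHS]mulrAC [RHS]mulrC; congr (_ * _).
rewrite /chi -!exD; congr ex; rewrite !dotNl dotDr dot_trow dotBl.
rewrite (_ : dot (m *: l) z = m%:~R * dot l z); last first.
  by rewrite /dot mulr_sumr; apply: eq_bigr => j _; rewrite mxE intrM mulrA.
by rewrite bilDl bilNl; field.
Qed.

(** A solution of the recursion that [tr_coef] imposes on invariants of weight m; dividing
    coefficients by it turns [tr m l] into the pure shift by [m *: l] ([ncoef_tr]). *)
Definition gauss m k : C := ex (bil k k / (2 * m%:~R)).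
Lemma gauss_neq0 m k : gauss m k != 0. Proof. exact: ex_neq0. Qed.

Lemma tr_gauss m l k : m != 0 ->
  ex (m%:~R / 2 * bil l l + bil (k - m *: l) l) * gauss m (k - m *: l) = gauss m k.
Proof.
move=> m0; rewrite /gauss -exD; congr ex.
have mn : (m%:~R : C) != 0 by rewrite intr_eq0.
rewrite !bilDl !bilDr !bilNl !bilNr !bilZl !bilZr (bilC l k); field.
exact: mn.
Qed.

Definition ncoef m h k : C := coef h k / gauss m k.
Lemma ncoefE m h k : coef h k = ncoef m h k * gauss m k.
Proof. by rewrite divfK ?gauss_neq0. Qed.

Lemma ncoef_tr m l h k : m != 0 -> OP h -> ncoef m (tr m l h) k = ncoef m h (k - m *: l).
Proof.
move=> m0 H; rewrite /ncoef tr_coef// -(tr_gauss l k m0) invfM mulrACA divff ?ex_neq0// mul1r.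
by [].
Qed.

Lemma nm_gauss m k : nm (gauss m k) = expR (- (pi / m%:~R * qf im_form (kreal k))).
Proof.
rewrite nm_ex -im_bil; congr expR.
have -> : bil k k / (2 * m%:~R) = rc (2 * m%:~R)^-1 * bil k k.
  by rewrite rcV rcM rc_nat rc_int mulrC.
rewrite imM re_rc im_rc mul0r addr0; have [->|m0] := eqVneq m 0.
  by rewrite !(mulr0, invr0, mul0r, oppr0).
by field; rewrite intr_eq0.
Qed.

Lemma OP_ext h h' : OP h -> OP h' -> (forall k, coef h k = coef h' k) -> h = h'.
Proof. by move=> H H' E; rewrite (ev_coef H) (ev_coef H'); congr ev; apply/funext. Qed.

Definition pd (i : 'I_g) h : 'rV[C]_g -> C := fun z => 'D_(delta_mx 0 i) h z.

Lemma pd_ev i h : OP h -> pd i h = ev (fun k => 2 * iC * rc pi * ((k 0 i)%:~R * coef h k)).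
Proof.
move=> H; apply/funext => z; rewrite /pd {1}(ev_coef H).
by have [_ ->] := ev_diff z (coef_decay H).
Qed.
Lemma pd_decay i h : OP h -> decay (fun k => 2 * iC * rc pi * ((k 0 i)%:~R * coef h k)).
Proof. by move=> H; apply/decayZ/decay_coord/coef_decay. Qed.
Lemma OP_pd i h : OP h -> OP (pd i h).
Proof. by move=> H; rewrite pd_ev//; apply/OP_ev/pd_decay. Qed.
Lemma coef_pd i h k : OP h -> coef (pd i h) k = 2 * iC * rc pi * ((k 0 i)%:~R * coef h k).
Proof. by move=> H; rewrite pd_ev// coef_ev//; exact: pd_decay. Qed.

Local Opaque pd tr coef.
(** The extra term is the derivative of the exponential factor of [tr]. On Fourier coefficients the
    derivation is multiplication by [k 0 i], and the identity says how this multiplier changes under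
    the shift. *)
Lemma tr_pd m l i h : OP h -> tr m l (pd i h) =
  fun z => pd i (tr m l h) z - 2 * iC * rc pi * (m%:~R * (l 0 i)%:~R) * tr m l h z.
Proof.
move=> H; have H1 := OP_tr m l H; have H2 := OP_pd i H; have H3 := OP_pd i H1.
have H4 := OP_scale (2 * iC * rc pi * (m%:~R * (l 0 i)%:~R)) H1.
have H5 := OP_tr m l H2.
apply: (OP_ext H5 (OP_sub H3 H4)) => k.
rewrite (coef_sub k H3 H4).
rewrite (coef_scale _ k H1).
rewrite (tr_coef m l k H2).
have e1 := coef_pd i (k - m *: l) H.
have e2 := coef_pd i k H1.
have e3 := tr_coef m l k H.
revert e1 e2 e3.
generalize (coef (pd i h) (k - m *: l)) (coef (pd i (tr m l h)) k) (coef (tr m l h) k).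
move=> a b c -> -> ->.
have -> : ((k - m *: l) 0 i)%:~R = (k 0 i)%:~R - m%:~R * (l 0 i)%:~R :> C.
  by rewrite !mxE intrD mulrNz intrM.
by ring.
Qed.

Local Transparent pd tr coef.
Definition th0 : 'rV[C]_g -> C := ev tk.

Lemma theta_th0 : theta tau = th0.
Proof.
apply/funext => z; rewrite /theta /th0 /ev /zsum.
apply: (congr1 (fun u : nat -> C => limn u)).
apply/funext => N; apply: eq_bigr => a _; rewrite /theta_term /tk /chi -exD /ex; congr cexp.
rewrite -[(\row_j _)]/(boxpt a); set k := boxpt a.
have -> : (zvec R k *m tau *m (zvec R k)^T) 0 0 = bil k k.
  rewrite mxE /bil [RHS]exchange_big; apply: eq_bigr => i _; rewrite !mxE mulr_suml.
  by apply: eq_bigr => j _; rewrite !mxE; ring.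
have -> : (zvec R k *m z^T) 0 0 = dot k z.
  by rewrite mxE; apply: eq_bigr => j _; rewrite !mxE.
by rewrite -/iC -/(rc pi); field.
Qed.

Lemma OP_th0 : OP th0. Proof. exact/OP_ev/tk_decay. Qed.
Lemma coef_th0 k : coef th0 k = tk k. Proof. exact/coef_ev/tk_decay. Qed.

Lemma tr_th0 l : tr 1 l th0 = th0.
Proof.
apply: OP_ext; [exact/OP_tr/OP_th0|exact: OP_th0|move=> k].
rewrite (tr_coef _ _ _ OP_th0) !coef_th0.
have e k' : tk k' = gauss 1 k' by rewrite /tk /gauss mulr1 mulrC mul1r.
by rewrite !e tr_gauss.
Qed.

End Automorphy.

(** * Seminorms and the Gelfand-Mazur theorem *)

Section GelfandMazur.
Variables (R : realType) (A : comPzRingType) (kp : {rmorphism CC R -> A}).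
Local Notation C := (CC R).
Implicit Types (p : A -> R) (a b x : A).

Record seminorm p : Prop := Seminorm {
  sn_ge0 : forall a, 0 <= p a;
  snD : forall a b, p (a + b) <= p a + p b;
  snM : forall a b, p (a * b) <= p a * p b;
  snZ : forall c a, p (kp c * a) <= nm c * p a;
  sn1 : p 1 = 1 }.

Section SeminormTheory.
Variables (p : A -> R) (hp : seminorm p).

Lemma sn0 : p 0 = 0.
Proof.
apply/eqP; rewrite eq_le (sn_ge0 hp) andbT.
by have := snZ hp 0 1; rewrite rmorph0 mul0r nm0 mul0r.
Qed.
Lemma snN a : p (- a) = p a.
Proof.
have h b : p (- b) <= p b.
  by have := snZ hp (-1) b; rewrite rmorphN1 mulN1r nmN nm1 mul1r.
by apply/eqP; rewrite eq_le h -{1}[a]opprK h.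
Qed.
Lemma snB a b : p (a - b) <= p a + p b.
Proof. by rewrite -(snN b); exact: snD. Qed.
Lemma sn_kp c : p (kp c) = nm c.
Proof.
have h d : p (kp d) <= nm d by have := snZ hp d 1; rewrite (sn1 hp) !mulr1.
have [->|c0] := eqVneq c 0; first by rewrite rmorph0 nm0 sn0.
apply/eqP; rewrite eq_le h /=; have n0 := nm_gt0 c0.
have := snM hp (kp c^-1) (kp c); rewrite -rmorphM mulVf// rmorph1 (sn1 hp).
have := h c^-1; rewrite nmV; have := sn_ge0 hp (kp c) => h1 h2 h3.
rewrite -[leLHS]mulr1; apply: le_trans (ler_wpM2l (ltW n0) h3) _.
rewrite mulrA -[leRHS]mul1r ler_wpM2r// mulrC -ler_pdivlMr// div1r //.
Qed.
Lemma snX a n : p (a ^+ n) <= p a ^+ n.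
Proof.
elim: n => [|n IH]; first by rewrite !expr0 (sn1 hp).
rewrite !exprS; apply: le_trans (snM hp _ _) _.
by rewrite ler_wpM2l// (sn_ge0 hp).
Qed.
Lemma sn_sum (I : Type) (r : seq I) (P : pred I) (F : I -> A) :
  p (\sum_(i <- r | P i) F i) <= \sum_(i <- r | P i) p (F i).
Proof.
elim/big_rec2 : _ => [|i x y _ H]; first by rewrite sn0.
by apply: le_trans (snD hp _ _) _; rewrite lerD2l.
Qed.

(** Partial sums of the geometric series. The ring is not complete for p, so inverses exist only up
    to e; what matters is that their seminorm is bounded independently of e. *)
Lemma geo_inverse a b (rho : R) : 0 <= rho < 1 -> p (1 - a * b) <= rho ->
  forall e, 0 < e -> exists x, p x <= p b / (1 - rho) /\ p (1 - a * x) <= e.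
Proof.
move=> /andP[r0 r1] H e e0; have [N HN] : exists N, 1 * rho ^+ N < e.
  have [N] := @pow_dom R e^-1 rho 1 ltac:(by rewrite r0 r1).
  by rewrite expr1n mulrC ltr_pdivrMr// mul1r => h; exists N; rewrite mul1r.
set q := 1 - a * b in H; exists (b * \sum_(i < N) q ^+ i); split.
  apply: le_trans (snM hp _ _) _; rewrite ler_wpM2l ?(sn_ge0 hp)//.
  apply: le_trans (sn_sum _ _ _) _; apply: (@le_trans _ _ (\sum_(i < N) rho ^+ i)).
    by apply: ler_sum => i _; apply: le_trans (snX _ _) _; rewrite lerXn2r ?nnegrE// (sn_ge0 hp).
  rewrite -[leRHS]mul1r ler_pdivlMr ?subr_gt0// -opprB mulrN mulrC -subrX1 opprB.
  by rewrite gerBl exprn_ge0.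
rewrite (_ : 1 - _ = q ^+ N); last first.
  by rewrite mulrA (_ : a * b = - (q - 1)) ?mulNr -?subrX1 /q; ring.
apply: le_trans (snX _ _) _; apply: le_trans (ltW HN); rewrite mul1r.
by rewrite lerXn2r ?nnegrE// (sn_ge0 hp).
Qed.

Definition wroot N (i : nat) : C := ex (rc (i%:R / N%:R)).

Lemma nm_wroot N i : nm (wroot N i) = 1.
Proof. by rewrite nm_ex im_rc mulr0 oppr0 expR0. Qed.

Lemma wrootX N i k : wroot N i ^+ k = ex (rc (k%:R * (i%:R / N%:R))).
Proof. by rewrite /wroot -exX [in RHS]rcM rc_nat. Qed.

Lemma wrootN N i : (0 < N)%N -> wroot N i ^+ N = 1.
Proof.
move=> N0; rewrite wrootX mulrCA divff ?pnatr_eq0 -?lt0n// mulr1 rc_nat.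
exact: ex_nat.
Qed.

Lemma wroot_sum N k : (0 < k < N)%N -> \sum_(i < N) wroot N i ^+ k = 0.
Proof.
move=> /andP[k0 kN]; have N0 : (0 < N)%N by exact: leq_ltn_trans kN.
have h i : wroot N i ^+ k = wroot N k ^+ i by rewrite !wrootX mulrCA.
have w1 : wroot N k != 1.
  apply/eqP => /(congr1 (@re R)); rewrite /wroot /ex re_cexp ex_arg reD reM !re_rc !im_rc re_iC.
  rewrite imD imM !re_rc !im_rc re_iC im_iC !(mulr0, mul0r, mul1r, addr0, add0r, oppr0, expR0, subr0).
  set x := _ / _; have -> : 2 * pi * x = (pi * x) *+ 2 by rewrite -mulr_natl; ring.
  rewrite cos_mulr2n; have s0 : 0 < sin (pi * x).
    have x0 : 0 < x by rewrite divr_gt0 ?ltr0n.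
    have x1 : x < 1 by rewrite ltr_pdivrMr ?ltr0n// mul1r ltr_nat.
    by apply: sin_gt0_pi; rewrite mulr_gt0 ?pi_gt0//= -[X in _ < X]mulr1 ltr_pM2l ?pi_gt0.
  have := cos2Dsin2 (pi * x); have := exprn_gt0 2 s0; lra.
under eq_bigr do rewrite h.
apply: (mulfI (x := wroot N k - 1)); first by rewrite subr_eq0.
by rewrite -subrX1 wrootN// subrr mulr0.
Qed.

(** With w = u / rho and exact inverses x_i of u - rho omega_i over the N-th roots of unity, the
    mean of the u x_i is w^N / (w^N - 1). As the x_i are only approximate, the identity is
    multiplied out and carries an error proportional to e. *)
Lemma resolvent_mean u (rho e : R) N (x : 'I_N -> A) : (0 < N)%N -> 0 < rho ->
  (forall i : 'I_N, p (1 - (u - kp (rc rho * wroot N i)) * x i) <= e) ->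
  p (kp (N%:R^-1) * (\sum_i u * x i) * ((kp (rc rho^-1) * u) ^+ N - 1) - (kp (rc rho^-1) * u) ^+ N)
    <= p (kp (rc rho^-1) * u) * (\sum_(k < N) p (kp (rc rho^-1) * u) ^+ k) * e.
Proof.
move=> N0 r0 He; set w := kp (rc rho^-1) * u; have rn : rc rho != 0 by rewrite -rc0 (inj_eq (@rc_inj R)) lt0r_neq0.
pose E (i : 'I_N) := 1 - (u - kp (rc rho * wroot N i)) * x i.
pose G (i : 'I_N) := \sum_(k < N) w ^+ (N.-1 - k) * kp (wroot N i) ^+ k.
have uw : u = kp (rc rho) * w by rewrite mulrA -rmorphM rcV divff// rmorph1 mul1r.
have key i : u * x i * (w ^+ N - 1) = w * G i - w * (E i * G i).
  have <- : (w - kp (wroot N i)) * G i = w ^+ N - 1.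
    by rewrite -subrXX -rmorphXn wrootN// rmorph1.
  by rewrite /E {1 2}uw rmorphM; ring.
have sG : kp (N%:R^-1) * \sum_i w * G i = w ^+ N.
  rewrite -mulr_sumr /G exchange_big /=; under eq_bigr do rewrite -mulr_sumr.
  rewrite (bigD1 (Ordinal N0))//= [X in _ * (_ * (_ + X))]big1 ?addr0 => [|k]; last first.
    rewrite -val_eqE /= -lt0n => k0; under eq_bigr do rewrite -rmorphXn.
    by rewrite -rmorph_sum wroot_sum ?k0/=// rmorph0 mulr0.
  under eq_bigr do rewrite expr0.
  rewrite sumr_const card_ord subn0 -(rmorph_nat kp) 2!(mulrCA (kp _)) -rmorphM mulVf.
    by rewrite rmorph1 mulr1 -exprS prednK.
  by rewrite pnatr_eq0 -lt0n.
rewrite -mulrA mulr_suml; under eq_bigr do rewrite key.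
rewrite sumrB mulrBr sG addrC addrA addNr add0r snN.
have nG i : p (G i) <= \sum_(k < N) p w ^+ k.
  apply: le_trans (sn_sum _ _ _) _; rewrite [leRHS](reindex_inj rev_ord_inj) /=.
  apply: ler_sum => k _; apply: le_trans (snM hp _ _) _.
  rewrite -subn1 -subnDA add1n; apply: le_trans (ler_wpM2l _ (snX _ _)) _; first exact: sn_ge0 hp _.
  by rewrite sn_kp nm_wroot expr1n mulr1; exact: snX.
apply: le_trans (snZ hp _ _) _; rewrite nmV nm_nat ler_pdivrMl ?ltr0n//.
apply: le_trans (sn_sum _ _ _) _.
apply: (@le_trans _ _ (\sum_(i < N) p w * (\sum_(k < N) p w ^+ k) * e)); last first.
  by rewrite sumr_const card_ord mulr_natl.
apply: ler_sum => i _; apply: le_trans (snM hp _ _) _; rewrite -mulrA ler_wpM2l ?(sn_ge0 hp)//.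
apply: le_trans (snM hp _ _) _; rewrite mulrC.
by apply: ler_pM; rewrite ?(sn_ge0 hp)// /E.
Qed.

Lemma resolvent_local u : (forall l, exists x, p (1 - (u - kp l) * x) < 1) ->
  forall l, exists2 d : R, 0 < d & exists n : nat, forall m, nm (m - l) < d ->
    forall e, 0 < e -> exists x, p x <= n%:R /\ p (1 - (u - kp m) * x) <= e.
Proof.
move=> H l; have [x Hx] := H l; set q := p _ in Hx.
have q0 : 0 <= q by exact: sn_ge0 hp _.
have px : 0 <= p x by exact: sn_ge0 hp _.
exists ((1 - q) / (2 * (1 + p x))); first by rewrite divr_gt0 ?mulr_gt0 ?subr_gt0//; lra.
exists (Num.trunc (p x / (1 - (1 + q) / 2))).+1 => m Hm e e0.
have [] := @geo_inverse (u - kp m) x ((1 + q) / 2) _ _ e e0.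
- by apply/andP; split; lra.
- rewrite (_ : 1 - _ = (1 - (u - kp l) * x) + kp (m - l) * x); last by rewrite rmorphB; ring.
  apply: le_trans (snD hp _ _) _; have := snZ hp (m - l) x; rewrite -/q.
  have : nm (m - l) * p x <= (1 - q) / 2; last by lra.
  have h2 : 0 < 2 * (1 + p x) by lra.
  rewrite ltr_pdivlMr// in Hm; have := nm_ge0 (m - l); nra.
by move=> y [h1 h2]; exists y; split=> //; apply: le_trans h1 (ltW (truncnS_gt _)).
Qed.

Lemma resolvent_uniform u (B : R) : (forall l, exists x, p (1 - (u - kp l) * x) < 1) ->
  exists n : nat, forall m, nm m <= B ->
    forall e, 0 < e -> exists x, p x <= n%:R /\ p (1 - (u - kp m) * x) <= e.
Proof.
move=> H; have [||n Hn] := @box_cover R 1 B (fun n (z : 'rV[C]_1) =>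
    forall e, 0 < e -> exists x, p x <= n%:R /\ p (1 - (u - kp (z 0 0)) * x) <= e).
- move=> n m z nm' Hz e /Hz[x [h1 h2]]; exists x; split=> //.
  by apply: le_trans h1 _; rewrite ler_nat.
- move=> z _; have [d d0 [n Hn]] := resolvent_local H (z 0 0).
  by exists d => //; exists n => w Hw; apply: Hn; exact: Hw.
exists n => m Hm; have := Hn (\row_j m); rewrite mxE; apply => j; rewrite mxE; split.
  exact: le_trans (re_nm _) Hm.
exact: le_trans (im_nm _) Hm.
Qed.

(** If every u - l had an approximate inverse, the means of the resolvents over circles would vary
    little with the radius. But just above the spectral radius the mean is almost 0, while on a
    circle of radius at most the spectral radius it cannot be small. The invertibility of u keeps
    the radius positive. *)
Lemma gelfand_mazur u v : u * v = 1 -> exists l, forall x, 1 <= p (1 - (u - kp l) * x).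
Proof.
move=> uv; apply: contrapT => /forallNP H.
have {}H l : exists x, p (1 - (u - kp l) * x) < 1.
  by have /existsNP[x /negP] := H l; rewrite -ltNge; exists x.
have [n0 Hn0] := resolvent_uniform (p u + 1) H; set M : R := n0%:R in Hn0.
have M0 : 0 <= M by [].
have pu0 : 0 <= p u by exact: sn_ge0 hp _.
have pv0 : 0 < p v.
  rewrite lt_neqAle (sn_ge0 hp) andbT; apply/eqP => e.
  by have := snM hp u v; rewrite uv (sn1 hp) -e mulr0; lra.
(* Passing from the radius [rho] to [rho + d] changes the mean resolvent by at most 1/16, up to the
   error terms in e. *)
pose d := (16 * (M ^+ 2 * p u + 1))^-1.
have Mp : 0 <= M ^+ 2 * p u by rewrite mulr_ge0// sqr_ge0.
have d0 : 0 < d by rewrite invr_gt0; lra.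
have dM : d * (M ^+ 2 * p u) <= 1 / 16.
  rewrite mulrC ler_pdivrMr; lra.
have d1 : d <= 1 by rewrite invf_le1; lra.
(* For positive rho this says that rho is at most the spectral radius of u. It holds at [(p v)^-1]
   and fails above [p u], so it breaks between two consecutive steps of length d. *)
pose S (rho : R) := forall n, rho ^+ n <= p (u ^+ n).
have S0 : S (p v)^-1.
  move=> n; rewrite exprVn -[leLHS]mul1r ler_pdivrMr ?exprn_gt0//.
  have := snM hp (u ^+ n) (v ^+ n); rewrite -exprMn uv expr1n (sn1 hp) => h.
  by apply: le_trans h _; rewrite ler_wpM2l ?(sn_ge0 hp)//; exact: snX.
have Sle rho : S rho -> rho <= p u by move=> /(_ 1%N); rewrite !expr1.
have [rho [r1 Sr nSr]] : exists rho, [/\ (p v)^-1 <= rho, S rho & ~ S (rho + d)].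
  apply: contrapT => /forallNP h.
  have hk k : (p v)^-1 <= (p v)^-1 + k%:R * d /\ S ((p v)^-1 + k%:R * d).
    elim: k => [|k [IH1 IH2]]; first by rewrite mul0r addr0.
    split; first by rewrite lerDl mulr_ge0// ltW.
    apply: contrapT => nS; apply: (h ((p v)^-1 + k%:R * d)); split=> //.
    by rewrite -natr1 mulrDl mul1r addrA in nS.
  have [_ /Sle] := hk (Num.trunc (p u / d)).+1; apply/negP; rewrite -ltNge.
  have : p u < (Num.trunc (p u / d)).+1%:R * d by rewrite -ltr_pdivrMr// truncnS_gt.
  have : 0 < (p v)^-1 by rewrite invr_gt0.
  lra.
have rho0 : 0 < rho by apply: lt_le_trans r1; rewrite invr_gt0.
have rhoB := Sle _ Sr; pose rho2 := rho + d.
have rho20 : 0 < rho2 by rewrite addr_gt0.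
have {nSr} [n Hn] : exists n, p (u ^+ n) < rho2 ^+ n.
  by have /existsNP[n /negP] := nSr; rewrite -ltNge; exists n.
pose t0 := p (u ^+ n) / rho2 ^+ n.
have t01 : 0 <= t0 < 1.
  by rewrite /t0 divr_ge0 ?(sn_ge0 hp) ?exprn_ge0 ?ltW//= ltr_pdivrMr ?exprn_gt0// mul1r.
have puM : 0 <= p u * M by exact: mulr_ge0.
have [k Hk] := pow_dom (16 * (1 + p u * M)) t01; rewrite expr1n in Hk.
(* One power n shows that [rho2] exceeds the spectral radius; its k-th power makes [w2 ^+ N] as
   small as needed. *)
pose N := (n * k)%N.
have N0 : (0 < N)%N.
  rewrite /N muln_gt0 !lt0n; apply/andP; split; apply/eqP => e.
    by move: Hn; rewrite e !expr0 (sn1 hp) ltxx.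
  by move: Hk; rewrite e expr0; lra.
pose w1 := kp (rc rho^-1) * u; pose w2 := kp (rc rho2^-1) * u.
have Ht : p (w2 ^+ N) * (16 * (1 + p u * M)) <= 1.
  apply: le_trans _ (ltW Hk); rewrite mulrC ler_wpM2l//; first by lra.
  rewrite /N exprM; apply: le_trans (snX _ _) _; rewrite lerXn2r ?nnegrE ?(sn_ge0 hp)//.
    by case/andP: t01.
  rewrite /w2 exprMn -rmorphXn; apply: le_trans (snZ hp _ _) _.
  by rewrite nmX nm_rc gtr0_norm ?invr_gt0// exprVn mulrC.
have HP : 1 <= p (w1 ^+ N).
  have e : u ^+ N = kp (rc (rho ^+ N)) * w1 ^+ N.
    rewrite /w1 exprMn -rmorphXn mulrA -rmorphM -rcX -rcM exprVn divff ?rc1 ?rmorph1 ?mul1r//.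
    by rewrite expf_neq0// lt0r_neq0.
  have := Sr N; rewrite e => h; have := le_trans h (snZ hp _ _).
  by rewrite nm_rc gtr0_norm ?exprn_gt0// ler_pMr ?exprn_gt0.
pose K1 := p w1 * (\sum_(k < N) p w1 ^+ k); pose K2 := p w2 * (\sum_(k < N) p w2 ^+ k).
have K10 : 0 <= K1.
  by rewrite mulr_ge0 ?(sn_ge0 hp)// sumr_ge0// => i _; rewrite exprn_ge0// (sn_ge0 hp).
have K20 : 0 <= K2.
  by rewrite mulr_ge0 ?(sn_ge0 hp)// sumr_ge0// => i _; rewrite exprn_ge0// (sn_ge0 hp).
(* [K1] and [K2] depend on N, which is why the precision of the approximate inverses is fixed only
   now; the bound M on their seminorms does not depend on e. *)
pose e : R := (8 * (K1 + K2 + 2 * (p u * M) + 1))^-1.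
have e0 : 0 < e by rewrite invr_gt0; lra.
have He : e * (K1 + K2 + 2 * (p u * M)) <= 1 / 8.
  rewrite mulrC ler_pdivrMr; lra.
have /choice[x1 Hx1] : forall i : 'I_N, exists x, p x <= M /\ p (1 - (u - kp (rc rho * wroot N i)) * x) <= e.
  by move=> i; apply: Hn0 => //; rewrite nmM nm_rc nm_wroot mulr1 gtr0_norm//; lra.
have /choice[x2 Hx2] : forall i : 'I_N, exists x, p x <= M /\ p (1 - (u - kp (rc rho2 * wroot N i)) * x) <= e.
  by move=> i; apply: Hn0 => //; rewrite nmM nm_rc nm_wroot mulr1 gtr0_norm// /rho2; lra.
pose Z1 := kp (N%:R^-1) * (\sum_i u * x1 i); pose Z2 := kp (N%:R^-1) * (\sum_i u * x2 i).
have mean_le (F : 'I_N -> A) (b : R) : (forall i, p (F i) <= b) -> p (kp (N%:R^-1) * \sum_i F i) <= b.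
  move=> HF; apply: le_trans (snZ hp _ _) _; rewrite nmV nm_nat ler_pdivrMl ?ltr0n//.
  apply: le_trans (sn_sum _ _ _) _; rewrite mulr_natl -[X in _ *+ X](card_ord N) -sumr_const.
  exact: ler_sum.
have R1 := resolvent_mean N0 rho0 (fun i => (Hx1 i).2).
have R2 := resolvent_mean N0 rho20 (fun i => (Hx2 i).2).
rewrite -/w1 -/Z1 -/K1 in R1; rewrite -/w2 -/Z2 -/K2 in R2.
have bZ2 : p Z2 <= p u * M.
  apply: mean_le => i; apply: le_trans (snM hp _ _) _; rewrite ler_wpM2l//.
  by case: (Hx2 i).
have bZ : p (Z1 - Z2) <= p u * (d * M ^+ 2 + 2 * (M * e)).
  rewrite -mulrBr -sumrB; apply: mean_le => i; rewrite -mulrBr.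
  apply: le_trans (snM hp _ _) _; rewrite ler_wpM2l//.
  have [h1 h2] := Hx1 i; have [h3 h4] := Hx2 i.
  set E1 := 1 - _ in h2; set E2 := 1 - _ in h4.
  have -> : x1 i - x2 i = kp (rc (- d) * wroot N i) * (x1 i * x2 i) + (x1 i * E2 - x2 i * E1).
    by rewrite /E1 /E2 /rho2 !rcD rcN !rmorphM rmorphD rmorphN; ring.
  apply: le_trans (snD hp _ _) _; apply: (@le_trans _ _ (d * M ^+ 2 + (M * e + M * e))); last by lra.
  apply: lerD; last first.
    by apply: le_trans (snB _ _) _; apply: lerD; apply: le_trans (snM hp _ _) _;
       apply: ler_pM; rewrite ?(sn_ge0 hp).
  apply: le_trans (snZ hp _ _) _; rewrite nmM nm_rc nm_wroot mulr1 normrN gtr0_norm// ler_wpM2l ?(ltW d0)//.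
  apply: le_trans (snM hp _ _) _; rewrite expr2; apply: ler_pM; rewrite ?(sn_ge0 hp)//.
set P := p (w1 ^+ N) in HP; set t := p (w2 ^+ N) in Ht; have t_ge0 : 0 <= t by exact: sn_ge0 hp _.
have h2 : p Z2 <= p u * M * t + t + K2 * e.
  have -> : Z2 = Z2 * w2 ^+ N - w2 ^+ N - (Z2 * (w2 ^+ N - 1) - w2 ^+ N) by ring.
  apply: le_trans (snB _ _) _; apply: lerD => //; apply: le_trans (snB _ _) _; rewrite lerD2r.
  by apply: le_trans (snM hp _ _) _; rewrite ler_wpM2r.
have h1 : p Z1 <= p Z2 + p (Z1 - Z2) by rewrite -{1}[Z1](subrK Z2) addrC; exact: snD hp _ _.
(* With P >= 1 this forces p Z1 to be larger than the value 1/4 that comes from the other radius. *)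
have h3 : P <= p Z1 * (P + 1) + K1 * e.
  rewrite {1}/P (_ : w1 ^+ N = Z1 * (w1 ^+ N - 1) - (Z1 * (w1 ^+ N - 1) - w1 ^+ N)); last by ring.
  apply: le_trans (snB _ _) _; apply: lerD => //; apply: le_trans (snM hp _ _) _.
  by rewrite ler_wpM2l ?(sn_ge0 hp)//; apply: le_trans (snB _ _) _; rewrite (sn1 hp).
have hz : p Z1 <= 1 / 4.
  move: h1 h2 bZ Ht He dM (mulr_ge0 K10 (ltW e0)).
  move: (p Z1) (p Z2) (p (Z1 - Z2)) => z1 z2 z12; rewrite mulrDr; lra.
have : K1 * e <= 1 / 8.
  by move: He (mulr_ge0 K20 (ltW e0)) (mulr_ge0 puM (ltW e0)); lra.
have := sn_ge0 hp Z1; nra.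
Qed.

(** The distance to the ideal. The last hypothesis says that 1 stays at distance at least 1 from it,
    so that the quotient is again normalised. *)
Lemma quotient_seminorm (I : set A) : I 0 -> (forall a b, I a -> I b -> I (a + b)) ->
  (forall a b, I b -> I (a * b)) -> (forall i, I i -> 1 <= p (1 - i)) ->
  exists q, [/\ seminorm q, forall a, q a <= p a & forall i, I i -> q i = 0].
Proof.
move=> I0 ID IM I1; pose S a := [set p (a - i) | i in I].
have S0 a : S a (p a) by exists 0; rewrite ?subr0.
have Slb a : has_inf (S a).
  by split; [exists (p a)|exists 0 => _ [i _ <-]; exact: sn_ge0 hp _].
have qle a i : I i -> inf (S a) <= p (a - i).
  by move=> Ii; apply: ge_inf; [case: (Slb a)|exists i].
have qeps a e : 0 < e -> exists2 i, I i & p (a - i) < inf (S a) + e.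
  by move=> e0; have [_ [i Ii <-]] := inf_adherent e0 (Slb a); exists i.
have q_ge0 a : 0 <= inf (S a).
  by apply: lb_le_inf; [exists (p a)|move=> _ [i _ <-]; exact: sn_ge0 hp _].
have qp a : inf (S a) <= p a by rewrite -{2}[a]subr0; exact: qle.
exists (fun a => inf (S a)); split=> [|//|i Ii]; last first.
  by apply/eqP; rewrite eq_le q_ge0 andbT -(sn0) -(subrr i); exact: qle.
split=> [//|a b|a b|c a|].
- apply/ler_addgt0Pr => e e0; have e2 : 0 < e / 2 by rewrite divr_gt0.
  have [i Ii Hi] := qeps a _ e2; have [j Ij Hj] := qeps b _ e2.
  apply: le_trans (qle _ _ (ID _ _ Ii Ij)) _.
  have := snD hp (a - i) (b - j); rewrite addrACA -opprD; lra.
- apply/ler_addgt0Pr => e e0.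
  pose d := Num.min 1 (e / (inf (S a) + inf (S b) + 1)).
  have s0 : 0 < inf (S a) + inf (S b) + 1 by have := q_ge0 a; have := q_ge0 b; lra.
  have d0 : 0 < d by rewrite lt_min ltr01 divr_gt0.
  have d1 : d <= 1 by rewrite ge_min lexx.
  have dB : d * (inf (S a) + inf (S b) + 1) <= e.
    by rewrite -ler_pdivlMr// ge_min lexx orbT.
  have [i Ii Hi] := qeps a _ d0; have [j Ij Hj] := qeps b _ d0.
  have Ik : I (a * j + (b - j) * i) by apply: ID; apply: IM.
  apply: le_trans (qle _ _ Ik) _.
  rewrite (_ : _ - _ = (a - i) * (b - j)); last by ring.
  apply: le_trans (snM hp _ _) _.
  apply: (@le_trans _ _ ((inf (S a) + d) * (inf (S b) + d))).
    by apply: ler_pM; rewrite ?(sn_ge0 hp)// ltW.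
  have := q_ge0 a; have := q_ge0 b; nra.
- have [->|c0] := eqVneq c 0.
    rewrite rmorph0 mul0r nm0 mul0r -sn0; exact: qp.
  have n0 := nm_gt0 c0; rewrite -ler_pdivrMl//; apply: lb_le_inf; first by exists (p a).
  move=> _ [i Ii <-]; rewrite ler_pdivrMl//; apply: le_trans (qle _ _ (IM (kp c) _ Ii)) _.
  by rewrite -mulrBr; exact: snZ.
apply/eqP; rewrite eq_le -{1}(sn1 hp) qp/=; apply: lb_le_inf; first by exists (p 1).
by move=> _ [i Ii <-]; exact: I1.
Qed.

End SeminormTheory.

(** The elements u_j are made constant one after the other, each time in the quotient by the ideal
    of u_j - l_j. Finitely many generators are enough for what follows, so no maximal ideal has to
    be chosen. *)
Lemma seminorm_character p n (u v : 'I_n -> A) : seminorm p -> (forall j, u j * v j = 1) ->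
  exists q l, [/\ seminorm q, forall a, q a <= p a & forall j, q (u j - kp (l j)) = 0].
Proof.
move=> hp uv; suff H m : (m <= n)%N -> exists q l, [/\ seminorm q, forall a, q a <= p a &
    forall j : 'I_n, (j < m)%N -> q (u j - kp (l j)) = 0].
  have [q [l [h1 h2 h3]]] := H n (leqnn n); exists q, l; split=> // j; exact: h3.
elim: m => [|m IH] mn; first by exists p, (fun=> 0).
have [q [l [hq qp ql]]] := IH (ltnW mn); pose jm := Ordinal mn.
have [lm Hlm] := gelfand_mazur hq (uv jm).
pose I := [set (u jm - kp lm) * x | x in [set: A]].
have [||||q' [hq' q'q qI]] := @quotient_seminorm q hq I.
- by exists 0; rewrite ?mulr0.
- by move=> _ _ [x _ <-] [y _ <-]; exists (x + y); rewrite ?mulrDr.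
- by move=> a _ [x _ <-]; exists (a * x); rewrite // mulrCA.
- by move=> _ [x _ <-].
exists q', (fun j => if j == jm then lm else l j); split=> // [a|j jm1].
  exact: le_trans (q'q a) (qp a).
case: eqP => [->|ne]; first by apply: qI; exists 1; rewrite ?mulr1.
apply/eqP; rewrite eq_le (sn_ge0 hq') andbT; apply: le_trans (q'q _) _; rewrite ql//.
rewrite ltn_neqAle -ltnS jm1 andbT; apply/eqP => e; apply: ne; exact: val_inj.
Qed.

End GelfandMazur.

(** * A Bezout identity in the ring of periodic entire functions *)

Section Bezout.
Variables (R : realType) (g : nat).
Local Notation C := (CC R).

Definition opred : {pred ('rV[C]_g -> C)} := [pred h | `[< OP h >]].
Lemma opred_subring : subring_closed opred.
Proof.
split=> [|h h' /asboolP H /asboolP H'|h h' /asboolP H /asboolP H']; apply/asboolP.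
- exact: OP_cst.
- exact: OP_sub.
- exact: OP_mul.
Qed.
HB.instance Definition _ := GRing.isSubringClosed.Build _ opred opred_subring.
Record opfun := Opfun { opval :> 'rV[C]_g -> C; _ : opval \in opred }.
HB.instance Definition _ := [isSub for opval].
HB.instance Definition _ := [Choice of opfun by <:].
HB.instance Definition _ := GRing.SubChoice_isSubComPzRing.Build _ _ opfun opred_subring.

Lemma opfunP (a : opfun) : OP a.
Proof. by case: a => h Hh /=; exact/asboolP. Qed.
Definition opf h (H : OP h) : opfun := Opfun (asboolT H : h \in opred).
Lemma opfunD (a b : opfun) z : (a + b) z = a z + b z. Proof. by []. Qed.
Lemma opfunB (a b : opfun) z : (a - b) z = a z - b z. Proof. by []. Qed.
Lemma opfunM (a b : opfun) z : (a * b) z = a z * b z. Proof. by []. Qed.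
Lemma opfun1 z : (1 : opfun) z = 1. Proof. by []. Qed.
Lemma opfun_sum (I : Type) (r : seq I) (P : pred I) (F : I -> opfun) z :
  (\sum_(i <- r | P i) F i) z = \sum_(i <- r | P i) F i z.
Proof. by apply: (big_morph (fun a : opfun => a z)). Qed.
Lemma opfun_ext (a b : opfun) : (forall z, a z = b z) -> a = b.
Proof. by move=> e; apply: val_inj; apply/funext. Qed.

Definition opcst (c : C) : opfun := opf (OP_cst g c).
Lemma opcst_is_additive : zmod_morphism opcst.
Proof. by move=> c d; apply: opfun_ext. Qed.
Lemma opcst_is_multiplicative : monoid_morphism opcst.
Proof. by split=> [|c d]; apply: opfun_ext. Qed.
HB.instance Definition _ := GRing.isZmodMorphism.Build C opfun opcst opcst_is_additive.
HB.instance Definition _ := GRing.isMonoidMorphism.Build C opfun opcst opcst_is_multiplicative.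

Definition snorm (b : R) (a : opfun) : R := sup [set nm (a z) | z in strip b].

Lemma snorm_ub b (a : opfun) z : strip b z -> nm (a z) <= snorm b a.
Proof.
move=> Hz; apply: ub_le_sup; last by exists z.
have [M _ HM] := strip_bound b (OP_cont (opfunP a)) (opfunP a).2.
by exists M => _ [w Hw <-]; exact: HM.
Qed.

Lemma strip0 b : 0 <= b -> strip b (0 : 'rV[C]_g).
Proof. by move=> b0 j; rewrite mxE -rc0 im_rc normr0. Qed.

Lemma snorm_le b (B : R) (a : opfun) : 0 <= b -> (forall z, strip b z -> nm (a z) <= B) -> snorm b a <= B.
Proof.
move=> b0 H; apply: ge_sup => [|_ [z Hz <-]]; last exact: H.
by exists (nm (a 0)); exists 0 => //; exact: strip0.
Qed.

Lemma snorm_ge0 b a : 0 <= b -> 0 <= snorm b a.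
Proof. by move=> b0; apply: le_trans (nm_ge0 (a 0)) (snorm_ub _ (strip0 b0)). Qed.

Lemma snorm_widen b b' a : 0 <= b -> b <= b' -> snorm b a <= snorm b' a.
Proof.
move=> b0 bb; apply: snorm_le => // z Hz; apply: snorm_ub => j.
exact: le_trans (Hz j) bb.
Qed.

Lemma snorm_seminorm b : 0 <= b -> seminorm opcst (snorm b).
Proof.
move=> b0; split=> [a|a a'|a a'|c a|]; first exact: snorm_ge0.
- apply: snorm_le => // z Hz; apply: le_trans (nmD _ _) _.
  by apply: lerD; exact: snorm_ub.
- apply: snorm_le => // z Hz; rewrite opfunM nmM.
  by apply: ler_pM; rewrite ?nm_ge0//; exact: snorm_ub.
- apply: snorm_le => // z Hz; rewrite opfunM nmM ler_wpM2l ?nm_ge0//.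
  exact: snorm_ub.
apply/eqP; rewrite eq_le; apply/andP; split; first by apply: snorm_le => // z _; rewrite opfun1 nm1.
by have := snorm_ub 1 (strip0 b0); rewrite nm1.
Qed.

Lemma ex_surj (l : C) : l != 0 -> exists z, ex z = l.
Proof.
move=> l0; have n0 := nm_gt0 l0; pose w := l / rc (nm l).
have rn : rc (nm l) != 0 by rewrite -rc0 (inj_eq (@rc_inj R)) lt0r_neq0.
have p2 : 2 * pi != 0 :> R by rewrite mulf_neq0// lt0r_neq0// pi_gt0.
have nw : nm w = 1 by rewrite nmM nmV nm_rc gtr0_norm// divff// lt0r_neq0.
have w1 : re w ^+ 2 + im w ^+ 2 = 1.
  rewrite -[RHS](expr1n _ 2) -nw /nm /re /im; case: (w) => a b /=.
  by rewrite sqr_sqrtr// addr_ge0// sqr_ge0.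
have [t [tc ts]] : exists t, cos t = re w /\ sin t = im w.
  have rb : -1 <= re w <= 1 by rewrite -ler_norml (le_trans (re_nm _))// nw.
  have s1 : `|im w| = Num.sqrt (1 - re w ^+ 2) by rewrite -w1 addrC addKr sqrtr_sqr.
  have [h|h] := leP 0 (im w).
    by exists (acos (re w)); rewrite acosK// sin_acos// -s1 ger0_norm.
  by exists (- acos (re w)); rewrite cosN sinN acosK// sin_acos// -s1 ltr0_norm// opprK.
exists (rc (t / (2 * pi)) + iC * rc (- ln (nm l) / (2 * pi))).
set z := _ + _; have rz : re z = t / (2 * pi).
  by rewrite reD reM !re_rc re_iC im_iC im_rc; ring.
have iz : im z = - ln (nm l) / (2 * pi).
  by rewrite imD imM !re_rc re_iC im_iC !im_rc; ring.
have e1 : - (2 * pi * im z) = ln (nm l) by rewrite iz mulrCA divff// mulr1 opprK.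
have e2 : 2 * pi * re z = t by rewrite rz mulrCA divff// mulr1.
have -> : l = rc (nm l) * w by rewrite mulrCA divff// mulr1.
rewrite /ex; apply: Ceq; rewrite ?re_cexp ?im_cexp ex_arg e1 e2.
  rewrite reM re_rc im_rc mul0r subr0 -tc !(reD, imD, reM, imM, re_rc, im_rc, re_iC, im_iC).
  by rewrite !(mul0r, mulr0, subr0, addr0, add0r, mul1r) lnK.
rewrite imM re_rc im_rc mul0r addr0 -ts !(reD, imD, reM, imM, re_rc, im_rc, re_iC, im_iC).
by rewrite !(mul0r, mulr0, subr0, addr0, add0r, mul1r) lnK.
Qed.

Definition opchi (k : 'rV[int]_g) : opfun := opf (@OP_chi R g k).
Lemma opchiD k l : opchi (k + l) = opchi k * opchi l.
Proof. by apply: opfun_ext => z; exact: chiDl. Qed.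

(* A seminorm dominated by a sup norm on a strip and multiplicative modulo constants on the
   coordinate characters is the evaluation at a point of the strip. *)
Lemma character_point b q (l : 'I_g -> C) : 0 <= b -> seminorm opcst q ->
  (forall a, q a <= snorm b a) -> (forall j, q (opchi (delta_mx 0 j) - opcst (l j)) = 0) ->
  exists z, forall a : opfun, q (a - opcst (a z)) = 0.
Proof.
move=> b0 hq qb ql; pose u j := opchi (delta_mx 0 j); pose v j := opchi (- delta_mx 0 j).
have uv j : u j * v j = 1 by rewrite -opchiD subrr; apply: opfun_ext => z; exact: chi0.
have qu j : q (u j) = nm (l j).
  apply/eqP; rewrite -(sn_kp hq) eq_le; apply/andP; split.
    by rewrite -[u j](subrK (opcst (l j))); apply: le_trans (snD hq _ _) _; rewrite ql add0r.
  rewrite [X in q X <= _](_ : _ = (opcst (l j) - u j) + u j); last by rewrite subrK.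
  by apply: le_trans (snD hq _ _) _; rewrite -(snN hq) opprB ql add0r.
have l0 j : l j != 0.
  apply/eqP => e; have := snM hq (u j) (v j); rewrite uv (sn1 hq) qu e nm0 mul0r.
  by rewrite ler10.
have /choice[zf Hz] : forall j, exists z, ex z = l j by move=> j; exact: ex_surj.
pose z : 'rV[C]_g := \row_j zf j; exists z.
have dz j : chi (delta_mx 0 j) z = l j.
  rewrite -Hz /chi /dot (bigD1 j)//= big1 => [|i ij]; rewrite !mxE eqxx.
    by rewrite /= eqxx mul1r addr0.
  by rewrite /= (negbTE ij) mul0r.
pose E (a : opfun) := q (a - opcst (a z)) = 0.
have qz a : 0 <= q a by exact: sn_ge0 hq a.
have E_cst c : E (opcst c) by rewrite /E -[opcst c z]/c subrr (sn0 hq).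
have E_add a a' : E a -> E a' -> E (a + a').
  rewrite /E => h h'; apply/eqP; rewrite eq_le qz andbT opfunD rmorphD opprD addrACA.
  by apply: le_trans (snD hq _ _) _; rewrite h h' addr0.
have E_mul a a' : E a -> E a' -> E (a * a').
  rewrite /E => h h'; apply/eqP; rewrite eq_le qz andbT opfunM rmorphM.
  rewrite (_ : _ - _ = a * (a' - opcst (a' z)) + (a - opcst (a z)) * opcst (a' z)); last by ring.
  apply: le_trans (snD hq _ _) _; apply: le_trans (lerD (snM hq _ _) (snM hq _ _)) _.
  by rewrite h h' mulr0 mul0r addr0.
have E_u j : E (u j) by rewrite /E -[u j z]/(chi _ z) dz; exact: ql.
have E_v j : E (v j).
  rewrite /E; have -> : v j z = (l j)^-1 by rewrite -dz -chiN.
  have e : opcst (l j)^-1 * opcst (l j) = 1 by rewrite -rmorphM mulVf// rmorph1.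
  have -> : v j - opcst (l j)^-1 = - (v j * opcst (l j)^-1) * (u j - opcst (l j)).
    by rewrite -{1}[v j]mulr1 -{1}e -[X in _ - X]mulr1 -{1}(uv j); ring.
  apply/eqP; rewrite eq_le qz andbT; apply: le_trans (snM hq _ _) _.
  by rewrite ql mulr0.
have E_chi k : E (opchi k).
  have E0 : E (opchi 0).
    by have := E_cst 1; congr E; apply: opfun_ext => w; rewrite /= chi0.
  have Ed (m : int) j : E (opchi (m *: delta_mx 0 j)).
    case: (intP m) => [|n|n]; first by rewrite scale0r.
      elim: n.+1 => [|n' IH]; first by rewrite scale0r.
      by rewrite intS scalerDl scale1r opchiD; exact: E_mul (E_u j) IH.
    elim: n.+1 => [|n' IH]; first by rewrite oppr0 scale0r.
    by rewrite intS opprD scalerDl scaleN1r opchiD; exact: E_mul (E_v j) IH.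
  rewrite [k]row_sum_delta; apply: (big_ind (fun k => E (opchi k))) => //.
  by move=> k' k'' h h'; rewrite opchiD; exact: E_mul.
(* The sup norms on the strip of the coordinate character and of its inverse are at most
   [expR (2 * pi * b)]; these two bounds on [l j] confine the imaginary part of z from both
   sides. *)
have zb : strip b z.
  move=> j; have p2 : 0 < 2 * pi :> R by rewrite mulr_gt0// pi_gt0.
  have nl : nm (l j) = expR (- (2 * pi * im (z 0 j))) by rewrite -Hz nm_ex mxE.
  have su (s : bool) w : strip b w -> nm (opchi ((-1) ^+ s *: delta_mx 0 j) w) <= expR (2 * pi * b).
    move=> Hw; rewrite /= ; have := nm_chi_le ((-1) ^+ s *: delta_mx 0 j) Hw.
    have -> : l1 R ((-1) ^+ s *: delta_mx 0 j : 'rV[int]_g) = 1.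
      rewrite /l1 (bigD1 j)//= big1 => [|i ij]; rewrite !mxE eqxx /=.
        by rewrite eqxx mulr1 addr0; case: (s); rewrite ?expr1 ?expr0 ?mulrNz ?normrN normr1.
      by rewrite (negbTE ij) mulr0 normr0.
    by rewrite mulr1.
  have h1 : nm (l j) <= expR (2 * pi * b).
    rewrite -qu; apply: le_trans (qb _) _; apply: snorm_le => // w /(su false).
    by rewrite expr0 scale1r.
  have h2 : nm (l j)^-1 <= expR (2 * pi * b).
    have <- : v j z = (l j)^-1 by rewrite -dz -chiN.
    rewrite -(sn_kp hq) [X in q X <= _](_ : _ = (opcst (v j z) - v j) + v j); last by rewrite subrK.
    apply: le_trans (snD hq _ _) _.
    rewrite -(snN hq) opprB E_v add0r; apply: le_trans (qb _) _; apply: snorm_le => // w /(su true).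
    by rewrite expr1 scaleN1r.
  move: h1 h2; rewrite nmV nl -expRN opprK !ler_expR lerNl ler_norml -mulrN !ler_pM2l//.
  by move=> -> ->.
move=> a; apply/eqP; rewrite eq_le qz andbT; apply/ler_addgt0Pr => e e0; rewrite add0r.
have Ha := opfunP a; have [M HM] := summ_ev_bound b (coef_decay Ha).
have [N /(_ N (leqnn N)) HN] := @expRN_small R (M * 3 ^+ g) (e / 2) ltac:(lra).
(* Truncated Fourier series are dense for the sup norm of the strip, and q is already known to be
   evaluation at z on trigonometric polynomials. *)
pose t : opfun := \sum_(f : {ffun 'I_g -> 'I_(N.*2.+1)}) opcst (coef a (boxpt f)) * opchi (boxpt f).
have Et : E t.
  apply: (big_ind E) => [|//|f _]; last exact: E_mul.
  by have := E_cst 0; rewrite rmorph0.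
have dt w : strip b w -> nm (a w - t w) <= e / 2.
  move=> Hw; have -> : t w = boxsum N (fun k => coef a k * chi k w).
    by rewrite opfun_sum; apply: eq_bigr => f _; rewrite opfunM.
  rewrite {1}(ev_coef Ha); apply: le_trans (zsum_dist N (HM _ Hw)) _.
  by rewrite mulrAC ltW.
rewrite (_ : a - _ = (a - t) + ((t - opcst (t z)) - opcst (a z - t z))); last by rewrite rmorphB; ring.
apply: le_trans (snD hq _ _) _; have := snB hq (t - opcst (t z)) (opcst (a z - t z)).
rewrite Et add0r (sn_kp hq); have := dt _ zb.
have : q (a - t) <= e / 2 by apply: le_trans (qb _) _; apply: snorm_le.
lra.
Qed.

Section Global.
Variables (n : nat) (th : 'I_n -> opfun).
Hypothesis th_nz : forall z, exists i, th i z != 0.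
Local Notation comb a := (\sum_i a i * th i).

(** Otherwise the ideal stays away from 1 in the strip norm; a character of the quotient is
    evaluation at a point, where all the [th i] would vanish. *)
Lemma bezout_strip b : 0 <= b -> exists a : 'I_n -> opfun, snorm b (1 - comb a) < 1.
Proof.
move=> b0; apply: contrapT => /forallNP H.
have hs := snorm_seminorm b0.
pose I := [set comb a | a in [set: 'I_n -> opfun]].
have [||||q [hq qs qI]] := @quotient_seminorm _ _ _ _ hs I.
- by exists (fun=> 0) => //; rewrite big1// => i _; rewrite mul0r.
- move=> _ _ [a _ <-] [a' _ <-]; exists (fun i => a i + a' i) => //.
  by rewrite -big_split; apply: eq_bigr => i _; rewrite mulrDl.
- move=> c _ [a _ <-]; exists (fun i => c * a i) => //.
  by rewrite mulr_sumr; apply: eq_bigr => i _; rewrite mulrA.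
- by move=> _ [a _ <-]; rewrite leNgt; apply/negP; exact: H.
have uv j : opchi (delta_mx 0 j) * opchi (- delta_mx 0 j) = 1.
  by rewrite -opchiD subrr; apply: opfun_ext => z; exact: chi0.
have [p [l [hp pq pl]]] := seminorm_character hq uv.
have [z Hz] := character_point b0 hp (fun a => le_trans (pq a) (qs a)) pl.
case: (th_nz z) => i; apply/negP; rewrite negbK; apply/eqP/nm_eq0.
apply/eqP; rewrite eq_le nm_ge0 andbT -(sn_kp hp).
rewrite [X in p X <= _](_ : _ = th i - (th i - opcst (th i z))); last by rewrite opprB addrC subrK.
apply: le_trans (snB hp _ _) _; rewrite Hz addr0; apply: le_trans (pq _) _.
rewrite qI//; exists (fun j => (j == i)%:R) => //.
rewrite (bigD1 i)//= eqxx mul1r big1 ?addr0// => j /negbTE ->.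
by rewrite mul0r.
Qed.

(** The bound M does not depend on e, because the partial geometric sums are bounded. The gluing in
    [bezout] relies on this. *)
Lemma bezout_approx b : 0 <= b -> exists2 M : R, 0 <= M & forall e : R, 0 < e ->
  exists a : 'I_n -> opfun, (forall i, snorm b (a i) <= M) /\ snorm b (1 - comb a) <= e.
Proof.
move=> b0; have [a Ha] := bezout_strip b0; have hs := snorm_seminorm b0.
have r0 : 0 <= snorm b (1 - comb a) by exact: snorm_ge0.
set rho := snorm b _ in Ha r0; pose S := \sum_i snorm b (a i).
have Si i : snorm b (a i) <= S.
  by rewrite /S (bigD1 i)//= lerDl sumr_ge0// => j _; exact: snorm_ge0.
have S0 : 0 <= S by rewrite sumr_ge0// => j _; exact: snorm_ge0.
have iv : 0 <= (1 - rho)^-1 by rewrite invr_ge0; lra.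
exists (S * (snorm b 1 / (1 - rho))); first by rewrite !mulr_ge0// snorm_ge0.
move=> e e0; have [||x [hx1 hx2]] := @geo_inverse _ _ _ _ hs (comb a) 1 rho _ _ _ e0.
- by rewrite r0.
- by rewrite mulr1.
exists (fun i => a i * x); split=> [i|].
  apply: le_trans (snM hs _ _) _; apply: ler_pM => //; exact: snorm_ge0.
move: hx2; rewrite mulr_suml; congr (snorm b (1 - _) <= e).
by apply: eq_bigr => i _; rewrite mulrAC.
Qed.

End Global.

Lemma OP_limit (h : nat -> 'rV[C]_g -> C) : (forall r, OP (h r)) ->
  (forall r z, strip r%:R z -> nm (h r.+1 z - h r z) <= (2 ^+ r)^-1) ->
  exists2 h0, OP h0 & forall z, tends (fun r => h r z) (h0 z).
Proof.
(* On the strip of half-width r, [coef_strip] gives the better factor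
   [expR (- (2 * pi * r * l1 k))]; the weaker one is simpler and still yields arbitrary decay as r
   grows. *)
move=> H D; pose E r (k : 'rV[int]_g) : R := (2 ^+ r)^-1 * expR (- (r%:R * l1 R k)).
have dcoef r k : nm (coef (h r.+1) k - coef (h r) k) <= E r k.
  rewrite -coef_sub//; apply: le_trans (coef_strip k (OP_sub (H _) (H _)) (ler0n _ r) (@D r)) _.
  rewrite ler_wpM2l ?invr_ge0 ?exprn_ge0// ler_expR lerN2 ler_wpM2r ?l1_ge0//.
  by rewrite ler_peMl//; have := @pi_ge2 R; lra.
have tail r m k : nm (coef (h (r + m)%N) k - coef (h r) k) <= (2 - (2 ^+ m)^-1 *+ 2) * E r k.
  elim: m => [|m IH]; first by rewrite addn0 subrr nm0 expr0 invr1 subrr mul0r.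
  rewrite addnS (_ : _ - _ = (coef (h (r + m).+1) k - coef (h (r + m)%N) k)
    + (coef (h (r + m)%N) k - coef (h r) k)); last by ring.
  apply: le_trans (nmD _ _) _; apply: le_trans (lerD (dcoef _ _) IH) _.
  have : E (r + m)%N k <= (2 ^+ m)^-1 * E r k.
    rewrite /E exprD invfM mulrA (mulrC (2 ^+ m)^-1) ler_wpM2l ?mulr_ge0 ?invr_ge0 ?exprn_ge0//.
    by rewrite ler_expR lerN2 ler_wpM2r ?l1_ge0// ler_nat leq_addr.
  by rewrite exprS invfM; set x := (2 ^+ m)^-1; lra.
have E0 r k : 0 <= E r k by rewrite mulr_ge0 ?invr_ge0 ?exprn_ge0// expR_ge0.
have tail2 r m k : nm (coef (h (r + m)%N) k - coef (h r) k) <= 2 * E r k.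
  apply: le_trans (tail _ _ _) _; rewrite ler_wpM2r//.
  by rewrite lerBlDr lerDl mulrn_wge0// invr_ge0 exprn_ge0.
have Ele r k : E r k <= (2 ^+ r)^-1.
  rewrite ler_piMr ?invr_ge0 ?exprn_ge0// -expR0 ler_expR lerNl oppr0.
  by rewrite mulr_ge0 ?l1_ge0.
have /choice[c Hc] : forall k, exists c, tends (fun r => coef (h r) k) c.
  move=> k; apply: tends_cauchy => e e0; have [N HN] := pow2_small (divr_gt0 e0 (ltr0n R 4)).
  exists N => r s Nr Ns; rewrite (_ : _ - _ = (coef (h r) k - coef (h N) k) - (coef (h s) k - coef (h N) k)); last by ring.
  apply: le_lt_trans (nmB _ _) _.
  rewrite -(subnKC Nr) -(subnKC Ns); have := tail2 N (r - N)%N k; have := tail2 N (s - N)%N k.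
  have := HN N (leqnn N); have := Ele N k; lra.
have dist r k : nm (c k - coef (h r) k) <= 2 * E r k.
  apply: (tends_le (N := r) (tendsB (Hc k) (tends_cst _))) => m rm.
  by rewrite -(subnKC rm).
have dc r : forall A : R, A <= r%:R -> exists M, forall k, nm (c k - coef (h r) k) <= M * expR (- (A * l1 R k)).
  move=> A Ar; exists (2 * (2 ^+ r)^-1) => k; apply: le_trans (dist r k) _.
  rewrite /E mulrA ler_wpM2l ?mulr_ge0 ?invr_ge0 ?exprn_ge0// ler_expR lerN2.
  by rewrite ler_wpM2r ?l1_ge0.
have decc : decay c.
  move=> A; pose r := (Num.trunc A).+1; have [M HM] := dc r A (ltW (truncnS_gt _)).
  have [M' HM'] := coef_decay (H r) A; exists (M + M') => k.
  rewrite -[c k](subrK (coef (h r) k)); apply: le_trans (nmD _ _) _.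
  by rewrite mulrDl lerD.
exists (ev c); first exact: OP_ev.
move=> z; have [b [b0 Hb]] := im_bounded z.
pose r0 := (Num.trunc (2 + 2 * pi * b)).+1.
have dom r : (r0 <= r)%N -> nm (h r z - ev c z) <= 2 * (2 ^+ r)^-1 * 3 ^+ g.
  move=> rr; rewrite (ev_coef (H r)) {1 2}/ev -zsumB; last 2 first.
  - exact/summ_ev/coef_decay.
  - exact: summ_ev.
  apply: zsum_bound => k; rewrite -mulrBl nmM nmC.
  apply: le_trans (ler_pM (nm_ge0 _) (nm_ge0 _) (dist r k) (nm_chi_le k Hb)) _.
  rewrite /E mulrA -[leLHS]mulrA -expRD ler_wpM2l ?mulr_ge0 ?invr_ge0 ?exprn_ge0// ler_expR.
  have : 2 + 2 * pi * b <= r%:R.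
    by apply: le_trans (ltW (truncnS_gt _)) _; rewrite ler_nat.
  by have := l1_ge0 R k; nra.
move=> e e0; have e3 : 0 < e / (2 * 3 ^+ g) by rewrite divr_gt0// mulr_gt0// exprn_gt0.
have [N HN] := pow2_small e3; exists (maxn r0 N) => r; rewrite geq_max => /andP[h1 h2].
apply: le_lt_trans (dom _ h1) _; have := HN _ h2; rewrite ltr_pdivlMr ?mulr_gt0 ?exprn_gt0//.
by rewrite mulrCA mulrA.
Qed.

(** If b has the defect d = 1 - sum b_i th_i, then b + d c has the defect d (1 - sum c_i th_i). With
    c an approximate solution on the next strip, the defects become small there, while the
    corrections d c_i are summable on the current strip; the limits solve the identity exactly. *)
Lemma bezout n (th : 'I_n -> opfun) : (forall z, exists i, th i z != 0) ->
  exists a : 'I_n -> opfun, \sum_i a i * th i = 1.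
Proof.
have frac (x : R) : 0 <= x -> x / (1 + x) <= 1 by move=> x0; rewrite ler_pdivrMr; lra.
move=> nz; have /choice[M HM] : forall r : nat, exists M : R, 0 <= M /\ forall e : R, 0 < e ->
    exists a : 'I_n -> opfun, (forall i, snorm r%:R (a i) <= M) /\ snorm r%:R (1 - \sum_i a i * th i) <= e.
  by move=> r; have [M M0 HM] := bezout_approx nz (ler0n R r); exists M.
(* The allowed defect on strip r anticipates the size [M r.+1] of the next approximate solution, so
   that the correction is at most [2 ^- r]. *)
pose target r : R := (2 ^+ r)^-1 / (1 + M r.+1).
have t0 r : 0 < target r.
  rewrite divr_gt0 ?invr_gt0 ?exprn_gt0//; have := (HM r.+1).1; lra.
pose P r (b : 'I_n -> opfun) := snorm r%:R (1 - \sum_i b i * th i) <= target r.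
have step rb : exists b' : 'I_n -> opfun, P rb.1 rb.2 -> P rb.1.+1 b' /\
    forall i, snorm rb.1%:R (b' i - rb.2 i) <= (2 ^+ rb.1)^-1.
  case: rb => r b /=; have [Pb|nP] := pselect (P r b); last by exists b => /nP.
  have r0 : 0 <= r%:R :> R by [].
  have r1 : 0 <= r.+1%:R :> R by [].
  have rr : r%:R <= r.+1%:R :> R by rewrite ler_nat.
  set d := 1 - \sum_i b i * th i in Pb.
  have D0 : 0 <= snorm r.+1%:R d by exact: snorm_ge0.
  have [M0 /(_ (target r.+1 / (1 + snorm r.+1%:R d)))[|c [c1 c2]]] := HM r.+1.
    by rewrite divr_gt0//; lra.
  exists (fun i => b i + d * c i) => _; split=> [|i].
    rewrite /P; have -> : 1 - \sum_i (b i + d * c i) * th i = d * (1 - \sum_i c i * th i).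
      rewrite mulrBr mulr1 mulr_sumr {1}/d -addrA -opprD -big_split; congr (1 - _).
      by apply: eq_bigr => i _ /=; rewrite mulrDl mulrA.
    apply: le_trans (snM (snorm_seminorm r1) _ _) _.
    apply: le_trans (ler_wpM2l D0 c2) _; rewrite mulrCA ler_piMr ?(ltW (t0 _))//.
    exact: frac.
  rewrite addrC addKr; apply: le_trans (snM (snorm_seminorm r0) _ _) _.
  have h2 : snorm r%:R (c i) <= M r.+1 by apply: le_trans (snorm_widen _ r0 rr) (c1 i).
  apply: le_trans (ler_pM (snorm_ge0 _ r0) (snorm_ge0 _ r0) Pb h2) _.
  rewrite /target -mulrA ler_piMr ?invr_ge0 ?exprn_ge0// mulrC; exact: frac.
have /choice[F HF] := step.
have [_ /(_ _ (t0 0%N))[b0 [_ Hb0]]] := HM 0%N.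
pose b := fix b r := if r is r'.+1 then F (r', b r') else b0.
have Pb r : P r (b r) by elim: r => [//|r IH]; have [] := HF (r, b r) IH.
have Db r i z : strip r%:R z -> nm (b r.+1 i z - b r i z) <= (2 ^+ r)^-1.
  move=> Hz; have [_ /(_ i)] := HF (r, b r) (Pb r); apply: le_trans.
  by rewrite -opfunB; exact: snorm_ub.
have /choice[a Ha] : forall i, exists a : opfun, forall z, tends (fun r => b r i z) (a z).
  move=> i; have [h0 H0 HT] := OP_limit (fun r => opfunP (b r i)) (fun r => Db r i).
  by exists (opf H0).
exists a; apply: opfun_ext => z; rewrite opfun_sum.
have T1 : tends (fun r => \sum_i (b r i * th i) z) (\sum_i (a i * th i) z).
  apply: tends_sum => i; rewrite opfunM mulrC.
  by apply: tends_ext (tendsZ (th i z) (Ha i z)) => r; rewrite opfunM mulrC.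
have T2 : tends (fun r => \sum_i (b r i * th i) z) 1.
  move=> e e0; have [N HN] := pow2_small e0; have [c [c0 Hc]] := im_bounded z.
  exists (maxn N (Num.trunc c).+1) => r; rewrite geq_max => /andP[h1 h2].
  rewrite nmC -opfun_sum -(opfun1 z) -opfunB.
  have Hz : strip r%:R z.
    by move=> j; apply: le_trans (Hc j) _; apply: le_trans (ltW (truncnS_gt _)) _; rewrite ler_nat.
  apply: le_lt_trans (snorm_ub _ Hz) _; apply: le_lt_trans (Pb r) _; apply: le_lt_trans (HN _ h1).
  rewrite ler_piMr ?invr_ge0 ?exprn_ge0//.
  by have := (HM r.+1).1; move: (M _) => x x0; rewrite invf_le1; lra.
exact: tends_uniq T1 T2.
Qed.

End Bezout.

(** * Chases in double complexes and Koszul complexes *)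

Section Chase.
Variables (K : fieldType) (M : lmodType K) (d del : {linear M -> M}) (P : nat -> nat -> set M).
Variables (n g : nat).
Hypothesis P_lin : forall q j a x y, P q j x -> P q j y -> P q j (a *: x + y).
Hypothesis P_0 : forall q j, P q j 0.
Hypothesis P_d : forall q j x, P q j x -> P q.+1 j (d x).
Hypothesis P_del : forall q j x, P q j.+1 x -> P q j (del x).
Hypothesis P_top : forall q j x, P q j x -> (g.+1 < j)%N -> x = 0.
Hypothesis dd : forall x, d (d x) = 0.
Hypothesis deldel : forall x, del (del x) = 0.
Hypothesis d_del : forall x, d (del x) = del (d x).
Hypothesis column_exact : forall q j x, P q j x -> del x = 0 -> exists2 y, P q j.+1 y & del y = x.

(** The component of degree q - 1, so that coboundaries of degree q are the images of [Pm q j] in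
    all degrees, including 0. *)
Definition Pm q j x : Prop := if q is q'.+1 then P q' j x else x = 0.

Hypothesis row_neg : forall q j x, (n < j)%N -> (q < g)%N -> P q j x -> d x = 0 ->
  exists2 y, Pm q j y & d y = x.
Hypothesis row_pos : forall q j x, (j < n)%N -> P q.+1 j x -> d x = 0 -> exists2 y, P q j y & d y = x.

Lemma P_sub q j x y : P q j x -> P q j y -> P q j (x - y).
Proof. by move=> hx hy; rewrite addrC -scaleN1r; exact: P_lin. Qed.
Lemma P_add q j x y : P q j x -> P q j y -> P q j (x + y).
Proof. by move=> hx hy; rewrite -[x]scale1r; exact: P_lin. Qed.

Lemma Pm_del q j x : Pm q j.+1 x -> Pm q j (del x).
Proof. by case: q => [->|q]; [exact: linear0|exact: P_del]. Qed.
Lemma Pm_add q j x y : Pm q j x -> Pm q j y -> Pm q j (x + y).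
Proof. by case: q => [-> ->|q]; [exact: addr0|exact: P_add]. Qed.
Lemma Pm_d q j x : Pm q j x -> P q j (d x).
Proof. by case: q => [->|q]; [rewrite linear0; exact: P_0|exact: P_d]. Qed.

(** A recursion on j up to the top row: the obstruction d u lifts along the column, the lift is
    corrected to a row cocycle, and exactness of the row j + 1 > n makes it a row coboundary. *)
Lemma close_up q j u : (n <= j)%N -> (q.+1 < j)%N -> P q j u -> del (d u) = 0 ->
  exists2 z, P q j.+1 z & d (u - del z) = 0.
Proof.
move=> + + + ddu; have [m Hm] : exists m, (g.+2 - j <= m)%N by exists (g.+2 - j)%N.
elim: m q j u ddu Hm => [|m IH] q j u ddu Hm nj qj Pu.
  have dz : u = 0 by apply: (P_top Pu); lia.
  by exists 0; [exact: P_0|rewrite dz linear0 subr0 linear0].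
have [y Py ey] := column_exact (P_d Pu) ddu.
have ddy : del (d y) = 0 by rewrite -d_del ey dd.
have [z' Pz' ez'] : exists2 z, P q.+1 j.+2 z & d (y - del z) = 0 by apply: IH => //; lia.
(* For j > g the lift [y] lies above the top row g + 1; otherwise q + 1 < j <= g is within the
   degrees where [row_neg] holds. *)
have [big|small] := ltnP g j.
  have y0 : y = 0 by apply: (P_top Py); lia.
  exists 0; first exact: P_0.
  by rewrite linear0 subr0 -ey y0 linear0.
have [z Pz ez] := @row_neg q.+1 j.+1 (y - del z') ltac:(lia) ltac:(lia) (P_sub Py (P_del Pz')) ez'.
exists z => //; rewrite linearB /= -ey d_del ez linearB deldel subr0 subrr //.
Qed.

(* A zigzag of lifts through the exact columns, from x of bidegree (q, j) to a
   cocycle u in the row j + k + 1. *)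
Fixpoint rel k q j (x u : M) : Prop :=
  if k is k'.+1 then exists y, [/\ P q j.+1 y, del y = x & rel k' q.+1 j.+1 (d y) u]
  else [/\ P q j.+1 u, del u = x & d u = 0].

(** The classes that a zigzag sends to coboundaries of the row n. For k = 0 the next row is the row
    n itself; its cocycles are the classes being counted and are not divided out, hence [x2 = 0]. *)
Definition triv k q j (x : M) : Prop := exists x1 x2,
  [/\ Pm q j x1, del x1 = 0, (if k is 0%N then x2 = 0 else P q j.+1 x2), d x2 = 0 & x = d x1 + del x2].

Lemma rel_lin k q j a x u x' u' : rel k q j x u -> rel k q j x' u' ->
  rel k q j (a *: x + x') (a *: u + u').
Proof.
elim: k q j x x' => [|k IH] q j x x' /=.
  by move=> [h1 <- h2] [h3 <- h4]; rewrite !linearP h2 h4 scaler0 addr0; split=> //; exact: P_lin.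
move=> [y [h1 <- h2]] [y' [h3 <- h4]]; exists (a *: y + y'); rewrite !linearP; split=> //.
  exact: P_lin.
exact: IH.
Qed.

Lemma rel_mem k q j x u : rel k q j x u -> P (q + k)%N (j + k).+1 u /\ d u = 0.
Proof.
elim: k q j x => [|k IH] q j x /=; first by rewrite !addn0 => -[].
by move=> [y [_ _ /IH]]; rewrite !addSnnS.
Qed.

(** Lifts through exact columns always exist; only the last one, which lands in the row n, must be
    corrected by [close_up] to become a cocycle. *)
Lemma rel_total_l k q j x : (j + k).+1 = n -> (q < j)%N -> P q j x -> d x = 0 -> del x = 0 ->
  exists u, rel k q j x u.
Proof.
elim: k q j x => [|k IH] q j x jn qj Px dx delx.
  have [y Py ey] := column_exact Px delx.
  have [z Pz ez] := @close_up q j.+1 y ltac:(lia) ltac:(lia) Py ltac:(by rewrite -d_del ey).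
  exists (y - del z); split=> //; first by apply: P_sub => //; exact: P_del.
  by rewrite linearB /= deldel subr0.
have [y Py ey] := column_exact Px delx.
have [u Hu] := @IH q.+1 j.+1 (d y) ltac:(lia) ltac:(lia) (P_d Py) (dd y) ltac:(by rewrite -d_del ey).
by exists u, y.
Qed.

(** The zigzag is built backwards: apply del, then use that a cocycle of positive degree in a row
    below n is a coboundary. *)
Lemma rel_total_r k q j u : (j + k).+1 = n -> P (q + k)%N n u -> d u = 0 ->
  exists x, [/\ rel k q j x u, P q j x, d x = 0 & del x = 0].
Proof.
elim: k q j => [|k IH] q j jn; rewrite -jn ?addn0 => Pu du.
  by exists (del u); rewrite deldel d_del du linear0; split=> //; exact: P_del.
have [||x [h1 h2 h3 h4]] := @IH q.+1 j.+1 _ _ du; first by lia.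
  by rewrite -jn addSnnS.
have [y Py ey] := @row_pos q j.+1 x ltac:(lia) h2 h3.
exists (del y); split=> //; rewrite ?deldel ?d_del ?ey//; last exact: P_del.
by exists y; rewrite ey.
Qed.

Lemma rel_triv k q j x u : (j + k).+1 = n -> (q < j)%N -> rel k q j x u -> (exists2 v, Pm (q + k) n v & u = d v) ->
  triv k q j x.
Proof.
elim: k q j x => [|k IH] q j x jn qj /=.
  move=> [_ <- _] [v]; rewrite addn0 -jn addn0 => Pv ->; exists (del v), 0.
  by rewrite deldel d_del !linear0 addr0; split=> //; exact: Pm_del.
move=> [y [Py <- H]] [v Pv ev].
have [|x1 [x2 [h1 h2 h3 h4 h5]]] := IH q.+1 j.+1 (d y) ltac:(lia) ltac:(lia) H.
  by exists v; rewrite // addSnnS.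
have [x3 Px3 ex3] : exists2 x3, P q j.+2 x3 & d x3 = x2.
  by case: k {IH H} jn h3 Pv => [|k] jn h3 Pv; [exists 0; rewrite ?h3 ?linear0//; exact: P_0|apply: row_pos => //; lia].
exists 0, (y - x1 - del x3); split.
- by case: q {IH H h1 h3 Pv qj Py Px3} => [|q] //=; exact: P_0.
- exact: linear0.
- by apply: P_sub; [exact: P_sub|exact: P_del].
- by rewrite !linearB /= h5 d_del ex3 [d x1 + _]addrC addrK subrr.
by rewrite linear0 add0r !linearB /= h2 deldel !subr0.
Qed.

(** Two lifts of the same x differ by something in the image of the next column map, and the
    ambiguity is pushed along the zigzag. At the end it lies in the rows j > n, where exactness
    requires the degree q + k to be below g. *)
Lemma triv_rel k q j x u : (j + k).+1 = n -> (q < j)%N -> (q + k < g)%N -> rel k q j x u -> triv k q j x ->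
  exists2 v, Pm (q + k) n v & u = d v.
Proof.
have col_m q' j' y : Pm q' j' y -> del y = 0 -> exists2 w, Pm q' j'.+1 w & del w = y.
  by case: q' => [->|q'] /=; [exists 0; rewrite ?linear0|exact: column_exact].
elim: k q j x => [|k IH] q j x jn qj qg /=.
  move=> [Pu <- du] [x1 [x2 [h1 h2 h3 h4 h5]]]; rewrite h3 linear0 addr0 in h5.
  have [w Pw ew] := col_m _ _ _ h1 h2.
  have e0 : del (u - d w) = 0 by rewrite linearB /= -d_del ew h5 subrr.
  have [s Ps es] := column_exact (P_sub Pu (Pm_d Pw)) e0.
  have e1 : del (d s) = 0 by rewrite -d_del es linearB /= dd du subrr.
  have [z Pz ez] := @close_up q j.+2 s ltac:(lia) ltac:(lia) Ps e1.
  have [t Pt et] := @row_neg q j.+2 (s - del z) ltac:(lia) ltac:(lia) (P_sub Ps (P_del Pz)) ez.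
  exists (w + del t); first by rewrite addn0 -jn addn0; apply: Pm_add => //; exact: Pm_del.
  by rewrite linearD /= d_del et linearB /= deldel subr0 es addrC subrK.
move=> [y [Py <- H]] [x1 [x2 [h1 h2 h3 h4 h5]]].
have [w Pw ew] := col_m _ _ _ h1 h2.
have e0 : del (y - d w - x2) = 0.
  by rewrite !linearB /= -d_del ew h5 [d x1 + _]addrC addrK subrr.
have [s Ps es] := column_exact (P_sub (P_sub Py (Pm_d Pw)) h3) e0.
rewrite -addSnnS; apply: (IH _ _ _ _ _ _ H); [lia|lia|lia|].
exists (del s), 0; split; rewrite ?deldel ?linear0//.
- exact: P_del.
- by case: (k) => [//|k']; exact: P_0.
by rewrite addr0 es !linearB /= dd h4 !subr0.
Qed.

End Chase.

(** * Exterior multiplication and contraction *)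

Section Fermions.
Variables (K : numFieldType) (n : nat) (V : lmodType K).
Implicit Types (i j : 'I_n) (S : {set 'I_n}) (w : {set 'I_n} -> V).

Definition sg i S : K := (-1) ^+ #|[set j in S | (j < i)%N]|.
(** [eps i] and [iot i] are wedge and contraction with the i-th basis vector, in the basis indexed
    by subsets. Everything below uses only their anticommutation relations. *)
Definition eps i w : {set 'I_n} -> V := fun S => if i \in S then sg i S *: w (S :\ i) else 0.
Definition iot i w : {set 'I_n} -> V := fun S => if i \in S then 0 else sg i S *: w (i |: S).
(** The change of the sign [sg i] when j enters or leaves the set; its antisymmetry for distinct
    indices is the source of all anticommutation. *)
Definition flip i j : K := if (j < i)%N then -1 else 1.

Lemma sg_sq i S : sg i S * sg i S = 1.
Proof. by rewrite /sg -exprMn mulrNN mulr1 expr1n. Qed.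
Lemma sgDi i S : sg i (S :\ i) = sg i S.
Proof.
rewrite /sg; congr (_ ^+ #|pred_of_set _|); apply/setP => j; rewrite !inE.
by have [->|_] := eqVneq j i; rewrite // ltnn !andbF.
Qed.
Lemma sgUi i S : sg i (i |: S) = sg i S.
Proof.
rewrite /sg; congr (_ ^+ #|pred_of_set _|); apply/setP => j; rewrite !inE.
by have [->|_] := eqVneq j i; rewrite // ltnn !andbF.
Qed.
Lemma sgU i j S : j \notin S -> sg i (j |: S) = flip i j * sg i S.
Proof.
move=> jS; rewrite /sg /flip; case: ltnP => ji.
  rewrite -exprS; congr (_ ^+ _).
  have -> : [set k in j |: S | (k < i)%N] = j |: [set k in S | (k < i)%N].
    by apply/setP => k; rewrite !inE; have [->|_] := eqVneq k j.
  by rewrite cardsU1 !inE (negbTE jS).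
rewrite mul1r; congr (_ ^+ #|pred_of_set _|); apply/setP => k; rewrite !inE.
by have [->|_] := eqVneq k j; rewrite // ltnNge ji !andbF.
Qed.
Lemma flip_sq i j : flip i j * flip i j = 1.
Proof. by rewrite /flip; case: ifP; rewrite ?mulrNN mulr1. Qed.
Lemma sgD i j S : j \in S -> sg i (S :\ j) = flip i j * sg i S.
Proof.
by move=> jS; rewrite -{2}(finset.setD1K jS) sgU ?setD11// mulrA flip_sq mul1r.
Qed.
Lemma flipN i j : i != j -> flip i j = - flip j i.
Proof. by rewrite /flip -val_eqE /= neq_ltn => /orP[] h; rewrite h ltnNge ltnW//= opprK. Qed.

Lemma eps_is_linear i : linear (eps i).
Proof.
move=> a v w; apply/funext => S; rewrite /eps.
change ((if i \in S then sg i S *: (a *: v (S :\ i) + w (S :\ i)) else 0) =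
  a *: (if i \in S then sg i S *: v (S :\ i) else 0) + (if i \in S then sg i S *: w (S :\ i) else 0)).
by case: ifP => _; rewrite ?scaler0 ?addr0// scalerDr !scalerA mulrC.
Qed.
HB.instance Definition _ i := GRing.isLinear.Build K _ _ _ (eps i) (@eps_is_linear i).
Lemma iot_is_linear i : linear (iot i).
Proof.
move=> a v w; apply/funext => S; rewrite /iot.
change ((if i \in S then 0 else sg i S *: (a *: v (i |: S) + w (i |: S))) =
  a *: (if i \in S then 0 else sg i S *: v (i |: S)) + (if i \in S then 0 else sg i S *: w (i |: S))).
by case: ifP => _; rewrite ?scaler0 ?addr0// scalerDr !scalerA mulrC.
Qed.
HB.instance Definition _ i := GRing.isLinear.Build K _ _ _ (iot i) (@iot_is_linear i).

Lemma setU1D1 i j S : i != j -> (i |: S) :\ j = i |: (S :\ j).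
Proof. by move=> ij; apply/setP => k; rewrite !inE; case: (eqVneq k i) => // ->; rewrite ij. Qed.

Lemma eps_eps i j w : eps i (eps j w) = - eps j (eps i w).
Proof.
apply/funext => S; rewrite -[RHS]/(- (eps j (eps i w) S)) /eps !inE.
have [->|ij] := eqVneq i j; first by rewrite /= scaler0 if_same oppr0.
rewrite /=; case: ifP => iS; case: ifP => jS; rewrite ?scaler0 ?oppr0//.
by rewrite !scalerA (sgD _ iS) (sgD _ jS) (flipN ij) finset.setDDl finset.setUC -finset.setDDl -scaleNr; congr (_ *: _); ring.
Qed.

Lemma iot_iot i j w : iot i (iot j w) = - iot j (iot i w).
Proof.
apply/funext => S; rewrite -[RHS]/(- (iot j (iot i w) S)) /iot !inE.
have [->|ij] := eqVneq i j; first by rewrite /= scaler0 if_same oppr0.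
rewrite /=; case: ifP => iS; case: ifP => jS; rewrite ?scaler0 ?oppr0//.
by rewrite !scalerA (sgU _ (negbT iS)) (sgU _ (negbT jS)) (flipN ij) finset.setUCA -scaleNr; congr (_ *: _); ring.
Qed.

Lemma iot_eps i j w : i != j -> iot i (eps j w) = - eps j (iot i w).
Proof.
move=> ij; apply/funext => S; rewrite -[RHS]/(- (eps j (iot i w) S)) /iot /eps !inE.
rewrite eq_sym (negbTE ij) /=; case: ifP => iS; case: ifP => jS; rewrite ?scaler0 ?oppr0//.
by rewrite !scalerA (sgU _ (negbT iS)) (sgD _ jS) (flipN ij) (setU1D1 _ ij) -scaleNr; congr (_ *: _); ring.
Qed.

Lemma iot_eps_id i w : iot i (eps i w) + eps i (iot i w) = w.
Proof.
apply/funext => S; rewrite -[LHS]/(iot i (eps i w) S + eps i (iot i w) S) /iot /eps !inE eqxx /=.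
case: ifP => iS.
  by rewrite add0r sgDi scalerA sg_sq scale1r finset.setD1K.
by rewrite addr0 sgUi scalerA sg_sq scale1r finset.setU1K// iS.
Qed.

Definition cw (f : V -> V) w : {set 'I_n} -> V := fun S => f (w S).
Lemma cw_is_linear (f : {linear V -> V}) : linear (cw f).
Proof. by move=> a v w; apply/funext => S; rewrite /cw /= linearP. Qed.
HB.instance Definition _ (f : {linear V -> V}) := GRing.isLinear.Build K _ _ _ (cw f) (cw_is_linear f).

Lemma cw_eps (f : {linear V -> V}) i w : cw f (eps i w) = eps i (cw f w).
Proof. by apply/funext => S; rewrite /cw /eps; case: ifP => _; rewrite ?linear0// linearZ. Qed.
Lemma cw_iot (f : {linear V -> V}) i w : cw f (iot i w) = iot i (cw f w).
Proof. by apply/funext => S; rewrite /cw /iot; case: ifP => _; rewrite ?linear0// linearZ. Qed.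

(** The mixed terms cancel in pairs and the diagonal ones add up to the identity. With a Bezout
    identity as p and q this is the contraction of a Koszul complex. *)
Lemma iot_eps_sum (p q : 'I_n -> {linear V -> V}) w :
  (forall i j x, p i (q j x) = q j (p i x)) ->
  \sum_i iot i (cw (p i) (\sum_j eps j (cw (q j) w))) +
  \sum_j eps j (cw (q j) (\sum_i iot i (cw (p i) w))) = \sum_i cw (p i) (cw (q i) w).
Proof.
move=> pq; under eq_bigr do rewrite !linear_sum /=.
rewrite [X in _ + X](eq_bigr (fun j => \sum_i eps j (iot i (cw (p i) (cw (q j) w))))); last first.
  move=> j _; rewrite !linear_sum /=; apply: eq_bigr => i _; rewrite cw_iot; congr (eps _ (iot _ _)).
  by apply/funext => S; rewrite /cw pq.
rewrite [X in _ + X]exchange_big -big_split /=; apply: eq_bigr => i _.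
rewrite -big_split /= (bigD1 i)//= [X in _ + X]big1 ?addr0 => [|j ij].
  by rewrite cw_eps iot_eps_id.
by rewrite cw_eps iot_eps 1?eq_sym// addNr.
Qed.

Lemma eps_sum_sq (q : 'I_n -> {linear V -> V}) w : (forall i j x, q i (q j x) = q j (q i x)) ->
  \sum_i eps i (cw (q i) (\sum_j eps j (cw (q j) w))) = 0.
Proof.
move=> qq; under eq_bigr do rewrite !linear_sum /=.
set A : 'I_n -> 'I_n -> ({set 'I_n} -> V) := fun i j => eps i (cw (q i) (eps j (cw (q j) w))).
have AN i j : A i j = - A j i.
  rewrite /A !cw_eps eps_eps; congr (- eps _ (eps _ _)).
  by apply/funext => S; rewrite /cw qq.
have e : \sum_i \sum_j A i j = - \sum_i \sum_j A i j.
  rewrite [LHS]exchange_big -sumrN; apply: eq_bigr => i _; rewrite -sumrN.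
  by apply: eq_bigr => j _; exact: AN.
move: e; set T := \sum_i _ => e.
have : 2%:R *: T = 0 by rewrite scaler_nat mulr2n {1}e addNr.
by move/eqP; rewrite scaler_eq0 pnatr_eq0 /= => /eqP.
Qed.

End Fermions.

(** * Koszul complexes of commuting operators *)

Section Koszul.
Variables (K : numFieldType) (n : nat) (V : lmodType K) (D : 'I_n -> {linear V -> V}).
Hypothesis DC : forall i j x, D i (D j x) = D j (D i x).
Local Notation form := ({set 'I_n} -> V).
Implicit Types (i j : 'I_n) (S : {set 'I_n}) (w v : form) (X : set V).

Definition kz w : form := \sum_i eps i (cw (D i) w).
Lemma kz_is_linear : linear kz.
Proof.
move=> a v w; rewrite /kz scaler_sumr -big_split; apply: eq_bigr => i _ /=.
by rewrite !linearP.
Qed.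
HB.instance Definition _ := GRing.isLinear.Build K _ _ _ kz kz_is_linear.

Lemma sumfE (I : Type) (r : seq I) (P : pred I) (F : I -> form) S :
  (\sum_(i <- r | P i) F i) S = \sum_(i <- r | P i) F i S.
Proof. by apply: (big_morph (fun w : form => w S)). Qed.

Lemma kzE w S : kz w S = \sum_(i in S) sg K i S *: D i (w (S :\ i)).
Proof. by rewrite /kz sumfE [RHS]big_mkcond; apply: eq_bigr => i _. Qed.

Lemma kz_kz w : kz (kz w) = 0.
Proof. exact: eps_sum_sq. Qed.

(** Contraction is a homotopy between [D p] and 0. It drives the elimination of one operator at a
    time below. *)
Lemma kz_iot p w : kz (iot p w) + iot p (kz w) = cw (D p) w.
Proof.
rewrite /kz linear_sum -big_split /= (bigD1 p)//= big1 ?addr0 => [|i ip].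
  by rewrite cw_iot addrC iot_eps_id.
by rewrite iot_eps 1?eq_sym// cw_iot subrr.
Qed.

Lemma kz_eps p w : kz (eps p w) = - eps p (kz w).
Proof.
rewrite /kz linear_sum -sumrN; apply: eq_bigr => i _.
by rewrite cw_eps eps_eps.
Qed.

Definition deg q w := forall S, #|S| != q -> w S = 0.
(** Degree q - 1, without truncated subtraction: for q = 0 it forces w = 0. *)
Definition pdeg q w := forall S, #|S|.+1 != q -> w S = 0.
Definition supp p w := forall S i, i \in S -> (i < p)%N -> w S = 0.
Definition coefs X w := forall S, X (w S).

Definition submod X := X 0 /\ forall a x y, X x -> X y -> X (a *: x + y).

Lemma submodB X x y : submod X -> X x -> X y -> X (x - y).
Proof. by case=> _ h hx hy; rewrite addrC -scaleN1r; apply: h. Qed.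
Lemma submod_sum X (I : Type) (r : seq I) (P : pred I) (F : I -> V) : submod X ->
  (forall k, P k -> X (F k)) -> X (\sum_(k <- r | P k) F k).
Proof.
move=> [h0 h] HF; elim/big_rec: _ => // i x Pi Hx.
by rewrite -[F i]scale1r; apply: h => //; apply: HF.
Qed.
Lemma submodZ X a x : submod X -> X x -> X (a *: x).
Proof. by move=> [h0 h] hx; rewrite -[_ *: _]addr0; apply: h. Qed.

Lemma coefs_kz X w : submod X -> (forall i x, X x -> X (D i x)) -> coefs X w -> coefs X (kz w).
Proof.
move=> hX XD hw S; rewrite kzE; apply: submod_sum => // i _; apply: submodZ => //.
by apply: XD.
Qed.
Lemma coefs_iot X p w : submod X -> coefs X w -> coefs X (iot p w).
Proof. by move=> hX hw S; rewrite /iot; case: ifP => _; [case: hX|exact: submodZ]. Qed.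
Lemma coefs_eps X p w : submod X -> coefs X w -> coefs X (eps p w).
Proof. by move=> hX hw S; rewrite /eps; case: ifP => _; [exact: submodZ|case: hX]. Qed.

Lemma deg_kz q w : pdeg q w -> deg q (kz w).
Proof.
move=> h S Sq; rewrite kzE big1// => i iS; rewrite h ?linear0 ?scaler0//.
by move: Sq; rewrite (cardsD1 i S) iS.
Qed.
Lemma deg_iot q p w : deg q w -> pdeg q (iot p w).
Proof.
move=> h S Sq; rewrite /iot; case: ifP => // pS; rewrite h ?scaler0//.
by rewrite cardsU1 pS.
Qed.

Lemma supp_kz p w : (forall i, (i < p)%N -> forall S, D i (w S) = 0) -> supp p w -> supp p (kz w).
Proof.
move=> inv h S j jS jp; rewrite kzE big1// => i iS.
have [ip|pi] := ltnP i p; first by rewrite inv ?scaler0.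
rewrite (h _ j) ?linear0 ?scaler0// !inE jS andbT.
by apply/eqP => e; move: pi; rewrite -e leqNgt jp.
Qed.

Lemma supp_iot p (ltpn : (p < n)%N) w : supp p w -> supp p.+1 (iot (Ordinal ltpn) w).
Proof.
move=> h S i iS; rewrite ltnS leq_eqVlt /iot => /orP[/eqP ip|ip].
  by rewrite (_ : Ordinal ltpn = i) ?iS//; apply: val_inj.
by case: ifP => // _; rewrite (h _ i) ?scaler0// !inE iS orbT.
Qed.

Lemma iot_supp p (ltpn : (p < n)%N) w : supp p.+1 w -> iot (Ordinal ltpn) w = 0.
Proof.
move=> h; apply/funext => S; rewrite /iot; case: ifP => // _.
by rewrite (h _ (Ordinal ltpn)) ?scaler0// !inE eqxx.
Qed.

Lemma iot_eq0 p w S : iot p w = 0 -> p \in S -> w S = 0.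
Proof.
move=> h pS; have := congr1 (fun f => f (S :\ p)) h; rewrite /iot !inE eqxx /= finset.setD1K//.
move=> /(congr1 (fun x => sg K p (S :\ p) *: x)); rewrite scalerA sg_sq scale1r => ->.
exact: scaler0.
Qed.

Section Surjective.
Variable X : nat -> set V.
Hypotheses (X_mod : forall p, submod (X p)) (XD : forall p i x, X p x -> X p (D i x)).
Hypothesis X_inv : forall p i x, X p x -> (i < p)%N -> D i x = 0.
Hypothesis X_sub : forall p x, X p.+1 x -> X p x.
Hypothesis X_next : forall p (ltpn : (p < n)%N) x, X p x -> D (Ordinal ltpn) x = 0 -> X p.+1 x.
Hypothesis X_surj : forall p (ltpn : (p < n)%N) y, X p y -> exists2 x, X p x & D (Ordinal ltpn) x = y.

(** [X p] collects coefficients killed by the first p operators, on which the next one is still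
    onto. Subtracting a coboundary removes the p-th basis vector from a cocycle; its coefficients
    are then killed by [D p] too, and the induction moves to [X p.+1]. *)
Lemma koszul_surj q w : coefs (X 0) w -> deg q.+1 w -> kz w = 0 ->
  exists v, [/\ coefs (X 0) v, deg q v & kz v = w].
Proof.
suff H m p : (n - p <= m)%N -> forall w, coefs (X p) w -> supp p w -> deg q.+1 w -> kz w = 0 ->
    exists v, [/\ coefs (X p) v, deg q v & kz v = w].
  by move=> *; apply: (H n 0%N) => //; rewrite subn0.
elim: m p => [|m IH] p npm {}w cw' sw dw kw.
  exists 0; split; [by move=> S; case: (X_mod p)|by []|].
  rewrite linear0; apply/funext => S; have [->|[i iS]] := set_0Vmem S.
    by rewrite dw ?cards0.
  by rewrite (sw _ i)//; apply: leq_trans (ltn_ord i) _; rewrite -subn_eq0 -leqn0.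
have [np|ltpn] := leqP n p; first by apply: IH => //; move: np; rewrite -subn_eq0 => /eqP ->.
pose ip := Ordinal ltpn; pose w1 := iot ip w.
have /choice[v1 Hv1] : forall S, exists x, X p x /\ D ip x = w1 S /\ (w1 S = 0 -> x = 0).
  move=> S; have [e|e] := eqVneq (w1 S) 0.
    by exists 0; rewrite linear0 e; split=> //; case: (X_mod p).
  have [x Xx ex] := X_surj ltpn (coefs_iot ip (X_mod p) cw' S).
  by exists x; rewrite ex; split=> //; split=> // e0; rewrite e0 eqxx in e.
have s1 : supp p.+1 v1.
  by move=> S i iS ip'; apply: (Hv1 S).2.2; apply: (supp_iot ltpn sw iS).
have d1 : deg q v1.
  by move=> S Sq; apply: (Hv1 S).2.2; apply: (@deg_iot _ ip w dw S); rewrite eqSS.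
have c1 : coefs (X p) v1 by move=> S; case: (Hv1 S).
(* As v1 does not involve the p-th vector, contracting [kz v1] gives [D ip v1 = w1], so [w2] has
   zero contraction. *)
pose w2 := w - kz v1.
have i2 : iot ip w2 = 0.
  rewrite linearB /= -/w1; have := kz_iot ip v1; rewrite (iot_supp ltpn s1) linear0 add0r => ->.
  by apply/funext => S; rewrite /cw; apply/eqP; rewrite subr_eq0 (Hv1 S).2.1.
have k2 : kz w2 = 0 by rewrite linearB /= kz_kz kw subrr.
have cp2 : coefs (X p) w2 by move=> S; apply: submodB => //; exact: (coefs_kz (X_mod p) (@XD p)).
have c2 : coefs (X p.+1) w2.
  move=> S; apply: (X_next (ltpn := ltpn)) => //; have := kz_iot ip w2; rewrite i2 k2 !linear0 addr0.
  by move=> /(congr1 (fun f => f S)); rewrite /cw => <-.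
have s2 : supp p.+1 w2.
  move=> S i iS; rewrite ltnS leq_eqVlt => /orP[/eqP e|ip'].
    by apply: (iot_eq0 i2); rewrite (_ : ip = i)//; apply: val_inj.
  have s3 := supp_kz (fun j jp S' => X_inv (c1 S') jp) (fun S' j jS jp => s1 S' j jS (ltnW jp)).
  by rewrite /w2; change (w S - kz v1 S = 0); rewrite (sw S i)// (s3 S i)// subr0.
have d3 : deg q.+1 (kz v1) by apply: deg_kz => S Sq; apply: d1; rewrite -eqSS.
have d2 : deg q.+1 w2.
  by move=> S Sq; change (w S - kz v1 S = 0); rewrite dw// d3// subr0.
have [|v [cv dv kv]] := IH p.+1 _ w2 c2 s2 d2 k2; first by lia.
exists (v1 + v); split.
- by move=> S; have := (X_mod p).2 1 _ _ (c1 S) (X_sub (cv S)); rewrite scale1r.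
- by move=> S Sq; change (v1 S + v S = 0); rewrite d1// dv// addr0.
by rewrite linearD /= kv addrC subrK.
Qed.

End Surjective.

Section Injective.
Variables (Y : nat -> set V) (sig E : nat -> V -> V).
Hypotheses (Y_mod : forall p, submod (Y p)) (YD : forall p i x, Y p x -> Y p (D i x)).
Hypothesis Y_inv : forall p i x, Y p x -> (i < p)%N -> D i x = 0.
Hypothesis Y_inj : forall p (ltpn : (p < n)%N) x, Y p x -> D (Ordinal ltpn) x = 0 -> x = 0.
Hypothesis sig_lin : forall p a x y, (p < n)%N -> Y p x -> Y p y -> sig p (a *: x + y) = a *: sig p x + sig p y.
Hypothesis sig_D : forall p i x, (p < n)%N -> Y p x -> sig p (D i x) = D i (sig p x).
Hypothesis sig_Y : forall p x, (p < n)%N -> Y p x -> Y p.+1 (sig p x).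
Hypothesis E_Y : forall p x, (p < n)%N -> Y p.+1 x -> Y p (E p x) /\ sig p (E p x) = x.
Hypothesis E_0 : forall p, (p < n)%N -> E p 0 = 0.
Hypothesis sig_exact : forall p (ltpn : (p < n)%N) x, Y p x -> sig p x = 0 ->
  exists2 y, Y p y & D (Ordinal ltpn) y = x.

Lemma sig0 p : (p < n)%N -> sig p 0 = 0.
Proof.
move=> pn; have [Y0 _] := Y_mod p; have := sig_lin 1 pn Y0 Y0; rewrite !scale1r addr0.
by move/eqP; rewrite -subr_eq0 opprD addNKr oppr_eq0 => /eqP.
Qed.

Lemma sig_kz p w S : (p < n)%N -> coefs (Y p) w -> sig p (kz w S) = kz (cw (sig p) w) S.
Proof.
move=> pn hw; rewrite !kzE; pose Q x y := Y p x /\ sig p x = y.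
suff : Q (\sum_(i in S) sg K i S *: D i (w (S :\ i)))
  (\sum_(i in S) sg K i S *: D i (cw (sig p) w (S :\ i))) by case.
apply: big_ind2 => [|x1 x2 y1 y2 [h1 <-] [h2 <-]|i iS].
- by split; [case: (Y_mod p)|exact: sig0].
- rewrite /Q; have := sig_lin 1 pn h1 h2; rewrite !scale1r => ->; split=> //.
  by have := (Y_mod p).2 1 _ _ h1 h2; rewrite scale1r.
have h : Y p (D i (w (S :\ i))) by apply: YD.
split; first exact: submodZ.
have := sig_lin (sg K i S) pn h (Y_mod p).1; rewrite !addr0 sig0// addr0 => ->.
by rewrite sig_D.
Qed.

(** Here the operators are injective, and [sig p] identifies the cokernel of [D p] on [Y p] with
    [Y p.+1], with the section [E p]. Each operator used lowers the degree by one, so that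
    cohomology can survive only in degree n. *)
Lemma koszul_inj q w : (q < n)%N -> coefs (Y 0) w -> deg q w -> kz w = 0 ->
  exists v, [/\ coefs (Y 0) v, pdeg q v & kz v = w].
Proof.
suff H m p q' : (n - p <= m)%N -> (q' < n - p)%N -> forall w, coefs (Y p) w -> supp p w -> deg q' w ->
    kz w = 0 -> exists v, [/\ coefs (Y p) v, supp p v, pdeg q' v & kz v = w].
  move=> qn cw' dw kw; have s0 : supp 0 w by [].
  by have [v [h1 _ h2 h3]] := H n 0%N q ltac:(lia) ltac:(lia) w cw' s0 dw kw; exists v.
elim: m p q' => [|m IH] p q' npm qn {}w cw' sw dw kw.
  by move: npm qn; rewrite leqn0 => /eqP ->.
have ltpn : (p < n)%N by rewrite -subn_gt0; apply: leq_ltn_trans qn.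
pose ip := Ordinal ltpn; pose w1 := iot ip w; pose y := cw (sig p) w1.
have c1 : coefs (Y p) w1 by exact: coefs_iot.
have s1 : supp p.+1 w1 := supp_iot ltpn sw; have d1 : pdeg q' w1 := deg_iot ip dw.
have kw1 : kz w1 = cw (D ip) w.
  by have := kz_iot ip w; rewrite kw linear0 addr0.
have sD x : Y p x -> sig p (D ip x) = 0.
  by move=> hx; rewrite sig_D//; apply: (Y_inv (sig_Y ltpn hx)); exact: ltnSn.
have cy : coefs (Y p.+1) y by move=> S; apply: sig_Y.
have sy : supp p.+1 y by move=> S i iS ii; rewrite /y /cw (s1 S i)// sig0.
have ky : kz y = 0.
  by apply/funext => S; rewrite -sig_kz// kw1 sD.
have [z [cz sz dz kzz]] : exists z, [/\ coefs (Y p.+1) z, supp p.+1 z,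
    forall S, #|S|.+2 != q' -> z S = 0 & kz z = y].
  case: q' qn dw d1 => [|q'] qn dw d1.
    exists 0; split=> //; first by move=> S; case: (Y_mod p.+1).
    rewrite linear0; apply/funext => S; rewrite /y /cw d1//.
    by rewrite sig0.
  have dy : deg q' y by move=> S h; rewrite /y /cw d1// sig0.
  have [z [h1 h2 h3 h4]] := IH p.+1 q' ltac:(lia) ltac:(lia) y cy sy dy ky.
  by exists z; split=> // S h; apply: h3.
pose z' := cw (E p) z.
have cz' : coefs (Y p) z' by move=> S; case: (E_Y ltpn (cz S)).
have sz' : supp p.+1 z' by move=> S i iS ii; rewrite /z' /cw (sz S i)// E_0.
have sEz : cw (sig p) z' = z by apply/funext => S; case: (E_Y ltpn (cz S)).
pose r S := if ip \in S then 0 else w1 S - kz z' S.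
have ckz' : coefs (Y p) (kz z') by apply: coefs_kz => //; exact: YD.
have cr : coefs (Y p) r.
  by move=> S; rewrite /r; case: ifP => _; [case: (Y_mod p)|exact: submodB].
have sr S : sig p (r S) = 0.
  rewrite /r; case: ifP => _; first exact: sig0.
  rewrite addrC -scaleN1r sig_lin// scaleN1r sig_kz// sEz kzz /y /cw addNr //.
have /choice[v1 Hv1] : forall S, exists x, Y p x /\ D ip x = r S /\ (r S = 0 -> x = 0).
  move=> S; have [e|e] := eqVneq (r S) 0.
    by exists 0; rewrite linear0 e; split=> //; case: (Y_mod p).
  have [x Xx ex] := sig_exact ltpn (cr S) (sr S).
  by exists x; rewrite ex; split=> //; split=> // e0; rewrite e0 eqxx in e.
have r0 S i : i \in S -> (i < p.+1)%N -> r S = 0.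
  rewrite /r => iS ii; case: ifP => // pS; rewrite (s1 S i)// sub0r.
  have s3 := supp_kz (fun j jp S' => Y_inv (cz' S') jp) (fun S' j jS jp => sz' S' j jS (ltnW jp)).
  rewrite (s3 S i) ?oppr0//.
  by move: ii; rewrite ltnS leq_eqVlt => /orP[/eqP e|//]; move: pS; rewrite (_ : ip = i) ?iS//; apply: val_inj.
have rd S : #|S|.+1 != q' -> r S = 0.
  move=> h; rewrite /r; case: ifP => // _; rewrite d1// kzE big1 ?subrr// => i iS.
  rewrite /z' /cw dz ?E_0 ?linear0 ?scaler0//.
  by move: h; rewrite (cardsD1 i S) iS.
have cv1 : coefs (Y p) v1 by move=> S; case: (Hv1 S).
have sv1 : supp p.+1 v1 by move=> S i iS ii; apply: (Hv1 S).2.2; exact: r0 iS ii.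
(* Away from the p-th vector, the contraction of [kz v] is [r + kz z'], that is [w1]. So [w2] is
   closed with zero contraction, whence [D ip w2 = 0], and injectivity gives [w2 = 0]. *)
pose v := v1 - eps ip z'; pose w2 := w - kz v.
have cv : coefs (Y p) v.
  by move=> S; apply: submodB => //; exact: coefs_eps.
have i2 : iot ip w2 = 0.
  have e1 : iot ip (kz v1) = r.
    have := kz_iot ip v1; rewrite (iot_supp ltpn sv1) linear0 add0r => ->.
    by apply/funext => S; case: (Hv1 S) => _ [].
  have e2 : kz v = kz v1 + eps ip (kz z') by rewrite linearB /= kz_eps opprK.
  apply/funext => S; have [pS|pS] := boolP (ip \in S); first by rewrite /iot pS.
  rewrite /w2 e2 linearB linearD /= e1 -/w1.
  have := iot_eps_id ip (kz z') => /(congr1 (fun f => f S)).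
  change (iot ip (eps ip (kz z')) S + eps ip (iot ip (kz z')) S = kz z' S ->
    w1 S - (r S + iot ip (eps ip (kz z')) S) = 0).
  rewrite {2}/eps (negbTE pS) addr0 => ->.
  by rewrite /r (negbTE pS) subrK subrr.
have k2 : kz w2 = 0 by rewrite linearB /= kz_kz kw subrr.
have w20 : w2 = 0.
  apply/funext => S; apply: (Y_inj (p := p) (ltpn := ltpn)).
    by apply: submodB => //; apply: coefs_kz => //; exact: YD.
  have := kz_iot ip w2; rewrite i2 k2 !linear0 addr0.
  by move=> /(congr1 (fun f => f S)); rewrite /cw => <-.
exists v; split=> //.
- move=> S i iS ii; rewrite /v; change (v1 S - eps ip z' S = 0).
  rewrite (sv1 S i iS (ltnW ii)) sub0r /eps; case: ifP => _; last by rewrite oppr0.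
  rewrite (sz' _ i) ?scaler0 ?oppr0//; last exact: ltnW.
  by rewrite !inE iS andbT; apply/eqP => e; move: ii; rewrite e ltnn.
- move=> S Sq; change (v1 S - eps ip z' S = 0).
  rewrite (Hv1 S).2.2; last exact: rd.
  rewrite sub0r /eps; case: ifP => pS; last by rewrite oppr0.
  rewrite /z' /cw dz ?E_0 ?scaler0 ?oppr0//.
  by move: Sq; rewrite (cardsD1 ip S) pS.
by apply/eqP; rewrite eq_sym -subr_eq0 -/w2 w20.
Qed.

End Injective.
End Koszul.

Lemma kz_transfer (K : numFieldType) (n : nat) (V V' : lmodType K) (D : 'I_n -> {linear V -> V})
  (D' : 'I_n -> {linear V' -> V'}) (f : {linear V -> V'}) (X : set V) (w : {set 'I_n} -> V) :
  (forall i x, X x -> f (D i x) = D' i (f x)) -> coefs X w ->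
  (fun S => f (kz D w S)) = kz D' (fun S => f (w S)).
Proof.
move=> H cw'; apply/funext => S; rewrite !kzE linear_sum; apply: eq_bigr => i _.
by rewrite linearZ /= H.
Qed.

(** * Coefficient sequences of weight m functions *)

Section HalfSums.
Variable R : realType.
Local Notation C := (CC R).
Implicit Types (f : nat -> C) (M : R).

Definition hs f : C := limn (fun N => \sum_(t < N) f t).
Definition hdom M f := forall t, nm (f t) <= M / 2 ^+ t.

Lemma exp_pow2 (t : nat) : expR (- t%:R) <= (2 ^+ t)^-1 :> R.
Proof.
elim: t => [|t IH]; first by rewrite oppr0 expR0 expr0 invr1.
rewrite -natr1 opprD expRD exprSr invfM; apply: ler_pM; rewrite ?expR_ge0//.
by rewrite expRN lef_pV2 ?posrE ?expR_gt0//; have := expR_ge1Dx (1 : R); lra.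
Qed.

Lemma hsum_bound M f N m : hdom M f ->
  nm (\sum_(t < N + m) f t - \sum_(t < N) f t) <= 2 * M / 2 ^+ N * (1 - (2 ^+ m)^-1).
Proof.
move=> H; elim: m => [|m IH]; first by rewrite addn0 subrr nm0 expr0 invr1 subrr mulr0.
rewrite addnS big_ord_recr /= addrAC; apply: le_trans (nmD _ _) _.
apply: le_trans (lerD IH (H _)) _; rewrite exprD [2 ^+ m.+1]exprS !invfM.
by move: (2 ^+ N)^-1 (2 ^+ m)^-1 => x y; rewrite le_eqVlt; apply/orP; left; apply/eqP; field.
Qed.

Lemma hdom_ge0 M f : hdom M f -> 0 <= M.
Proof. by move=> /(_ 0%N); rewrite expr0 divr1; apply: le_trans; exact: nm_ge0. Qed.

Lemma hsP M f : hdom M f -> tends (fun N => \sum_(t < N) f t) (hs f).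
Proof.
move=> H; have M0 := hdom_ge0 H.
have [|l Hl] := @tends_cauchy R (fun N => \sum_(t < N) f t); last by rewrite /hs (tends_lim Hl).
move=> e e0; have e1 : 0 < e / (4 * M + 1) by rewrite divr_gt0//; lra.
have [N0 HN] := pow2_small e1; exists N0 => n m hn hm.
have /(_ N0 (leqnn N0)) h := HN; rewrite ltr_pdivlMr in h; last by lra.
have B k : (N0 <= k)%N -> nm (\sum_(t < k) f t - \sum_(t < N0) f t) <= 2 * M / 2 ^+ N0.
  move=> hk; rewrite -(subnKC hk); apply: le_trans (hsum_bound _ _ H) _.
  by rewrite ler_piMr ?divr_ge0 ?mulr_ge0 ?exprn_ge0// lerBlDr lerDl invr_ge0 exprn_ge0.
rewrite (_ : _ - _ = (\sum_(t < n) f t - \sum_(t < N0) f t) - (\sum_(t < m) f t - \sum_(t < N0) f t)); last by ring.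
apply: le_lt_trans (nmB _ _) _; have := B _ hn; have := B _ hm.
have x0 : 0 < (2 ^+ N0)^-1 :> R by rewrite invr_gt0 exprn_gt0.
by move: h x0; set x := (2 ^+ N0)^-1; lra.
Qed.

Lemma hs_bound M f : hdom M f -> nm (hs f) <= 2 * M.
Proof.
move=> H; have M0 := hdom_ge0 H; apply: (tends_le (N := 0%N) (hsP H)) => n _.
have := @hsum_bound M f 0 n H; rewrite add0n big_ord0 subr0 expr0 divr1 => h.
by apply: le_trans h _; rewrite ler_piMr ?mulr_ge0// lerBlDr lerDl invr_ge0.
Qed.

Lemma hs_lin M M' a f f' : hdom M f -> hdom M' f' -> hs (fun t => a * f t + f' t) = a * hs f + hs f'.
Proof.
move=> H H'; have T := tendsD (tendsZ a (hsP H)) (hsP H').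
have H2 : hdom (nm a * M + M') (fun t => a * f t + f' t).
  move=> t; apply: le_trans (nmD _ _) _; rewrite nmM mulrDl lerD//.
  by rewrite -mulrA ler_wpM2l ?nm_ge0.
apply: tends_uniq (hsP H2) _; apply: tends_ext T => N.
by rewrite big_split mulr_sumr.
Qed.

Lemma hsS M f : hdom M f -> hs f = f 0%N + hs (fun t => f t.+1).
Proof.
move=> H; have H2 : hdom M (fun t => f t.+1).
  move=> t; apply: le_trans (H _) _; rewrite ler_wpM2l ?(hdom_ge0 H)//.
  by rewrite lef_pV2 ?posrE ?exprn_gt0// ler_eXn2l// ltr1n.
apply: tends_uniq (hsP H) _; have T := tendsD (tends_cst (f 0%N)) (hsP H2).
move=> e e0; have [N HN] := T _ e0; exists N.+1 => -[//|n] hn.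
by rewrite big_ord_recl; exact: HN.
Qed.

Lemma hs0 : hs (fun=> 0) = 0.
Proof.
have H : hdom 0 (fun=> 0) by move=> t; rewrite nm0 mul0r.
by have := hs_bound H; rewrite mulr0 => h; apply/nm_eq0/eqP; rewrite eq_le h nm_ge0.
Qed.

Lemma hs_single f : (forall t, f t.+1 = 0) -> hs f = f 0%N.
Proof.
move=> h; rewrite (@hsS (nm (f 0%N))).
  by rewrite (_ : (fun t => f t.+1) = (fun=> 0)) ?hs0 ?addr0//; apply/funext.
by case=> [|t]; rewrite ?expr0 ?divr1// h nm0 divr_ge0 ?nm_ge0 ?exprn_ge0.
Qed.
End HalfSums.

Section CoefClasses.
Variables (R : realType) (g : nat).
Local Notation C := (CC R).
Local Notation Z := ('rV[int]_g).
Variables (u : 'I_g -> 'I_g -> R) (c : 'I_g -> R) (mu : nat).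
Hypotheses (u1 : forall i, u i i = 1) (ul : forall i l : 'I_g, (l < i)%N -> u i l = 0) (mu0 : (0 < mu)%N).
Implicit Types (k : Z) (b : Z -> C) (i : 'I_g) (p : nat).

Definition LL i k : R := lf u (kreal R k) i.
(** In weight m, with [mu] the absolute value of m, the generators act on normalised coefficients by
    such shifts. *)
Definition sh (p : 'I_g) (t : int) k : Z := k + t *: (mu%:Z *: delta_mx 0 p).

Lemma shD (p : 'I_g) s t k : sh p s (sh p t k) = sh p (s + t) k.
Proof. by rewrite /sh -addrA [t *: _ + _]addrC -scalerDl. Qed.
Lemma shC (p p' : 'I_g) s t k : sh p s (sh p' t k) = sh p' t (sh p s k).
Proof. by rewrite /sh addrAC. Qed.
Lemma sh0 (p : 'I_g) k : sh p 0 k = k.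
Proof. by rewrite /sh scale0r addr0. Qed.

Lemma LL_sh i (p : 'I_g) t k : LL i (sh p t k) = LL i k + t%:~R * mu%:R * u i p.
Proof.
rewrite /LL /lf [in RHS](bigD1 p)//= [in LHS](bigD1 p)//=.
have -> : \sum_(l < g | l != p) u i l * kreal R (sh p t k) l = \sum_(l < g | l != p) u i l * kreal R k l.
  by apply: eq_bigr => l lp; rewrite /kreal !mxE eqxx /= (negbTE lp) !mulr0 addr0.
have -> : kreal R (sh p t k) p = kreal R k p + t%:~R * mu%:R.
  by rewrite /kreal !mxE !eqxx /= mulr1 intrD intrM -pmulrn.
by move: (\sum_(l < g | _) _) => x; ring.
Qed.
Lemma LL_sh_id (p : 'I_g) t k : LL p (sh p t k) = LL p k + t%:~R * mu%:R.
Proof. by rewrite LL_sh u1 mulr1. Qed.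
Lemma LL_sh_lt i (p : 'I_g) t k : (p < i)%N -> LL i (sh p t k) = LL i k.
Proof. by move=> pi; rewrite LL_sh ul// mulr0 addr0. Qed.

(** Minus the exponent of the bounds below. The sign of c decides between Gaussian growth (positive
    weight) and Gaussian decay (negative weight); the linear term, with A arbitrary, encodes that
    the function is entire. *)
Definition EE (p : nat) (A : R) k : R := \sum_(i < g | (p <= i)%N) (c i * LL i k ^+ 2 + A * `|LL i k|).

Lemma EE_split (p : 'I_g) A k : EE p A k = (c p * LL p k ^+ 2 + A * `|LL p k|) + EE p.+1 A k.
Proof.
rewrite /EE (bigD1 p)//=; congr (_ + _); apply: eq_bigl => i.
by rewrite [in RHS]ltn_neqAle andbC eq_sym.
Qed.
Lemma EE_sh (p : 'I_g) A t k : EE p.+1 A (sh p t k) = EE p.+1 A k.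
Proof. by apply: eq_bigr => i pi; rewrite LL_sh_lt. Qed.
Lemma EE_mono p A A' k : A <= A' -> EE p A k <= EE p A' k.
Proof. by move=> AA; apply: ler_sum => i _; rewrite lerD2l ler_wpM2r. Qed.

(** A bounded displacement changes the quadratic part by a linear term, which is absorbed by
    enlarging A. This is why the bounds quantify over all A. *)
Lemma EE_near p A (h : R) : exists A' M, forall k k',
  (forall i, `|LL i k' - LL i k| <= h) -> EE p A k <= EE p A' k' + M.
Proof.
have [h0|h0] := ltP h 0.
  exists 0, 0 => k k' H; rewrite /EE !big1 ?addr0// => i.
    by have := le_trans (normr_ge0 _) (H i); rewrite leNgt h0.
  by have := le_trans (normr_ge0 _) (H i); rewrite leNgt h0.
pose cb := \sum_i `|c i|; pose A' := `|A| + 2 * cb * h.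
have ci i : `|c i| <= cb by rewrite /cb (bigD1 i)//= lerDl sumr_ge0.
have cb0 : 0 <= cb by exact: sumr_ge0.
have A'0 : 0 <= A' by rewrite addr_ge0// !mulr_ge0.
exists A', (\sum_(i < g | (p <= i)%N) (cb * h ^+ 2 + A' * h)) => k k' H.
rewrite /EE -big_split; apply: ler_sum => i _ /=.
have := H i; set x := LL i k; set x' := LL i k' => xh; have := ci i; set ca := c i.
have e : x' = x + (x' - x) by rewrite addrC subrK.
set t := x' - x in xh e; rewrite e => cc.
have n1 : `|x| <= `|x + t| + h by apply: le_trans _ (lerD (lexx _) xh); rewrite -{1}[x](addrK t) ler_normB.
have n2 : A * `|x| <= `|A| * `|x| by rewrite ler_wpM2r// ler_norm.
have n3 : - (ca * t ^+ 2) <= cb * h ^+ 2.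
  apply: le_trans (ler_norm _) _; rewrite normrN normrM; apply: ler_pM => //.
  by rewrite ger0_norm ?sqr_ge0// -[t ^+ 2]real_normK ?num_real// ler_sqr ?nnegrE.
have n4 : - (2 * ca * x * t) <= 2 * cb * h * `|x|.
  apply: le_trans (ler_norm _) _; rewrite normrN !normrM (ger0_norm (ler0n _ 2)) -!mulrA ler_pM2l//.
  by rewrite [h * _]mulrC; apply: ler_pM; rewrite ?mulr_ge0//; apply: ler_pM.
have n5 : A' * `|x| <= A' * (`|x + t| + h) by rewrite ler_wpM2l.
have : A' * `|x| = `|A| * `|x| + 2 * cb * h * `|x| by rewrite /A' mulrDl.
have -> : ca * (x + t) ^+ 2 = ca * x ^+ 2 + 2 * ca * x * t + ca * t ^+ 2 by ring.
move: n2 n3 n4 n5; rewrite [A' * (_ + h)]mulrDr; lra.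
Qed.

Definition bnd (p : nat) b := forall A : R, exists M, forall k, nm (b k) <= M * expR (- EE p A k).
Definition shop (s : int) (p : 'I_g) b : Z -> C := fun k => b (sh p s k) - b k.
Lemma shop_is_linear s (p : 'I_g) : linear (shop s p).
Proof. by move=> a b b'; apply/funext => k; rewrite /shop !fctE; ring. Qed.
HB.instance Definition _ s (p : 'I_g) := GRing.isLinear.Build C _ _ _ (shop s p) (shop_is_linear s p).

Lemma shopC s s' (p p' : 'I_g) b : shop s p (shop s' p' b) = shop s' p' (shop s p b).
Proof. by apply/funext => k; rewrite /shop shC; ring. Qed.

(* Invariant under the shifts along the first p coordinates, with Gaussian bounds in
   the directions of the Cholesky forms [LL i], p <= i. *)
Definition XX (s : int) (p : nat) : set (Z -> C) :=
  [set b | (forall i, (i < p)%N -> shop s i b = 0) /\ bnd p b].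

Lemma bnd_ge0 p b : bnd p b -> forall A : R, exists2 M, 0 <= M & forall k, nm (b k) <= M * expR (- EE p A k).
Proof.
move=> H A; have [M HM] := H A; exists `|M| => // k; apply: le_trans (HM k) _.
by rewrite ler_wpM2r ?expR_ge0// ler_norm.
Qed.

Lemma XX_mod s p : submod (XX s p).
Proof.
split=> [|a b b' [h1 h2] [h3 h4]].
  by split=> [i _|A]; [exact: linear0|exists 0 => k; rewrite nm0 mul0r].
split=> [i ip|A]; first by rewrite linearP /= h1// h3// scaler0 addr0.
have [M HM] := h2 A; have [M' HM'] := h4 A; exists (nm a * M + M') => k.
rewrite !fctE mulrDl; apply: le_trans (nmD _ _) _; apply: lerD => //.
by rewrite -mulrA nmM ler_wpM2l ?nm_ge0.
Qed.

Lemma bnd_sh p b i t : bnd p b -> bnd p (fun k => b (sh i t k)).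
Proof.
move=> H A; have [A' [M0 H0]] := @EE_near p A (\sum_j `|t%:~R * mu%:R * u j i|).
have [M M_ge0 HM] := bnd_ge0 H A'; exists (M * expR M0) => k; apply: le_trans (HM _) _.
rewrite -mulrA -expRD ler_wpM2l// ler_expR.
have : EE p A k <= EE p A' (sh i t k) + M0; last by lra.
by apply: H0 => j; rewrite LL_sh addrC addKr (bigD1 j)//= lerDl sumr_ge0.
Qed.

Lemma XX_shop s p i b : XX s p b -> XX s p (shop s i b).
Proof.
move=> [h1 h2]; split=> [j jp|A]; first by rewrite shopC h1// linear0.
have [M HM] := bnd_sh i s h2 A; have [M' HM'] := h2 A; exists (M + M') => k.
by apply: le_trans (nmB _ _) _; rewrite mulrDl lerD.
Qed.

Lemma shop_iter s (p : 'I_g) b : s = 1 \/ s = -1 -> shop s p b = 0 -> forall t k, b (sh p t k) = b k.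
Proof.
move=> hs inv; have h1 k : b (sh p s k) = b k.
  by apply/eqP; rewrite -subr_eq0 -/(shop s p b k) inv.
have h2 k : b (sh p 1 k) = b k /\ b (sh p (-1) k) = b k.
  by case: hs => e; rewrite e in h1; split; rewrite ?h1//; rewrite -[LHS]h1 shD ?addrN ?addNr sh0.
move=> t k; case: (intP t) => [|n|n]; first by rewrite sh0.
  elim: n.+1 => [|n' IH]; first by rewrite sh0.
  by rewrite intS -shD (h2 _).1.
elim: n.+1 => [|n' IH]; first by rewrite oppr0 sh0.
by rewrite intS opprD -shD (h2 _).2.
Qed.

(** The number of shifts that brings k into the fundamental strip where the p-th form lies in [0,
    mu). *)
Definition fl (p : 'I_g) k : int := Num.floor (LL p k / mu%:R).
Lemma flP (p : 'I_g) k : 0 <= LL p (sh p (- fl p k) k) < mu%:R.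
Proof.
have m0 : 0 < mu%:R :> R by rewrite ltr0n.
rewrite LL_sh_id /fl; have := floor_itv (LL p k / mu%:R); set f := Num.floor _.
set x := _ / _; have -> : LL p k = x * mu%:R by rewrite divfK// lt0r_neq0.
rewrite mulrNz -mulrDl intrD => /andP[h1 h2]; apply/andP; split; first by rewrite mulr_ge0// subr_ge0.
rewrite -[ltRHS]mul1r ltr_pM2r//; lra.
Qed.

Lemma fl_sh (p : 'I_g) t k : fl p (sh p t k) = fl p k + t.
Proof.
rewrite /fl LL_sh_id mulrDl mulfK ?pnatr_eq0 -?lt0n//.
by rewrite floorDrz ?intr_int// intrKfloor.
Qed.
Lemma fl_sh_lt i (p : 'I_g) t k : (p < i)%N -> fl i (sh p t k) = fl i k.
Proof. by move=> pi; rewrite /fl LL_sh_lt. Qed.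

Lemma EE_base (p : 'I_g) (A : R) k : 0 <= A -> 0 <= LL p k < mu%:R ->
  EE p.+1 A k <= EE p A k + `|c p| * mu%:R ^+ 2 /\
  EE p A k <= EE p.+1 A k + (`|c p| * mu%:R ^+ 2 + A * mu%:R).
Proof.
move=> A0 /andP[l0 l1]; rewrite EE_split ger0_norm//; set x := LL p k in l0 l1 *.
have h1 : `|c p * x ^+ 2| <= `|c p| * mu%:R ^+ 2.
  by rewrite normrM ler_wpM2l// ger0_norm ?sqr_ge0// ler_sqr ?nnegrE// ltW.
have h2 : 0 <= A * x <= A * mu%:R by rewrite mulr_ge0//= ler_wpM2l// ltW.
move: h1 h2; rewrite ler_norml => /andP[h3 h4] /andP[h5 h6].
by split; lra.
Qed.

Section Growing.
Hypothesis c_lt0 : forall i, c i < 0.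

(** With c < 0 the admissible bound grows in the direction p, so a bound that ignores this direction
    is stronger, up to the constant found by completing a square. *)
Lemma XX_subset s p b : XX s p.+1 b -> XX s p b.
Proof.
move=> [h1 h2]; split=> [i ip|A]; first by apply: h1; apply: ltnW.
have [M M0 HM] := bnd_ge0 h2 A; have [gp|pg] := leqP g p.
  exists M => k; apply: le_trans (HM k) _.
  by rewrite /EE !big_pred0// => i; rewrite leqNgt (leq_trans (ltn_ord i))// ltnW.
pose ip := Ordinal pg; have c0 := c_lt0 ip.
exists (M * expR (A ^+ 2 / (- (4 * c ip)))) => k; apply: le_trans (HM k) _.
rewrite -mulrA -expRD ler_wpM2l// ler_expR (EE_split ip).
set x := `|_|; have -> : LL ip k ^+ 2 = x ^+ 2 by rewrite real_normK ?num_real.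
have : 0 <= - c ip * (x - A / (- (2 * c ip))) ^+ 2 by rewrite mulr_ge0 ?sqr_ge0// oppr_ge0 ltW.
have -> : - c ip * (x - A / (- (2 * c ip))) ^+ 2 = - (c ip * x ^+ 2) - A * x + A ^+ 2 / (- (4 * c ip)).
  by field; rewrite ltr0_neq0.
lra.
Qed.

(** An invariant sequence can be evaluated in the fundamental strip, where the p-th term of the
    exponent is bounded. *)
Lemma XX_next s p (pg : (p < g)%N) b : s = 1 \/ s = -1 -> XX s p b -> shop s (Ordinal pg) b = 0 -> XX s p.+1 b.
Proof.
move=> hs [h1 h2] inv; split=> [i|A].
  rewrite ltnS leq_eqVlt => /orP[/eqP e|]; last exact: h1.
  by rewrite (_ : i = Ordinal pg)//; apply: val_inj.
pose ip := Ordinal pg; have [M M0 HM] := bnd_ge0 h2 `|A|.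
exists (M * expR (`|c ip| * mu%:R ^+ 2)) => k.
rewrite -(shop_iter hs inv (- fl ip k)); apply: le_trans (HM _) _.
rewrite -mulrA -expRD ler_wpM2l// ler_expR.
have [+ _] := EE_base (normr_ge0 A) (flP ip k); rewrite /= (EE_sh ip `|A|).
have := @EE_mono p.+1 A `|A| k (ler_norm _).
by set k' := sh _ _ k; lra.
Qed.

(** The discrete primitive of y along the line through k0 that vanishes at t = 0, for both signs of
    t. *)
Definition prim (p : 'I_g) (y : Z -> C) (k0 : Z) (t : int) : C :=
  match t with
  | Posz n => - \sum_(s < n) y (sh p s.+1%:Z k0)
  | Negz n => \sum_(s < n.+1) y (sh p (- s%:Z) k0)
  end.

Lemma primS (p : 'I_g) y k0 t : prim p y k0 (t - 1) - prim p y k0 t = y (sh p t k0).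
Proof.
case: (intP t) => [|n|n].
- by rewrite sub0r /= big_ord0 oppr0 subr0 big_ord_recr big_ord0 /= add0r oppr0.
- have -> : n.+1%:Z - 1 = n by rewrite -addn1 PoszD addrK.
  by rewrite /= big_ord_recr /= opprK addKr.
have -> : - n.+1%:Z - 1 = Negz n.+1 by rewrite NegzE -opprD -PoszD addn1.
by rewrite -NegzE /= [X in X - _]big_ord_recr /= addrAC subrr add0r.
Qed.

Lemma prim_bound (p : 'I_g) y k0 t (B : R) : (forall s : int, `|s%:~R| <= `|t%:~R| :> R -> nm (y (sh p s k0)) <= B) ->
  nm (prim p y k0 t) <= `|t%:~R| * B.
Proof.
move=> H; have nn (n : nat) : `|n%:Z%:~R| = n%:R :> R by rewrite -pmulrn normr_nat.
case: (intP t) H => [|n|n] H; rewrite -?NegzE /=.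
- by rewrite big_ord0 oppr0 nm0 normr0 mul0r.
- rewrite nmN nn; apply: le_trans (nm_sum _ _ _) _.
  rewrite mulr_natl -[X in _ *+ X]card_ord -sumr_const; apply: ler_sum => s _.
  by apply: H; rewrite !nn ler_nat.
rewrite NegzE mulrNz normrN nn; apply: le_trans (nm_sum _ _ _) _.
rewrite mulr_natl -[X in _ *+ X]card_ord -sumr_const; apply: ler_sum => s _.
by apply: H; rewrite !mulrNz !normrN !nn ler_nat; apply: ltnW.
Qed.

(** The exponent is not monotone in [|x|] near the origin, and z may exceed x by h; a larger A' and
    a constant make up for both. *)
Lemma grow_near (a A h : R) : 0 < a -> 0 <= h -> exists2 A', A <= A' & exists M, forall x z : R,
  `|z| <= `|x| + h -> a * z ^+ 2 - A' * `|z| <= a * x ^+ 2 - A * `|x| + M.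
Proof.
move=> a0 h0; pose A' := `|A| + 2 * a * h; have ah : 0 <= a * h by rewrite mulr_ge0// ltW.
have An := ler_norm A; exists A'; first by rewrite /A'; lra.
exists (A ^+ 2 / (4 * a) + a * h ^+ 2) => x z.
rewrite -[x ^+ 2]real_normK ?num_real// -[z ^+ 2]real_normK ?num_real//.
have := normr_ge0 x; have := normr_ge0 z; move: `|x| `|z| => {}x {}z z0 x0 zx.
have sq : 0 <= a * x ^+ 2 - A * x + A ^+ 2 / (4 * a).
  have -> : a * x ^+ 2 - A * x + A ^+ 2 / (4 * a) = a * (x - A / (2 * a)) ^+ 2.
    by field; rewrite lt0r_neq0.
  by rewrite mulr_ge0 ?sqr_ge0// ltW.
have ah2 : 0 <= a * h ^+ 2 by rewrite mulr_ge0 ?sqr_ge0// ltW.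
have [az|az] := leP (a * z) A'.
  have : a * z ^+ 2 - A' * z <= 0 by rewrite expr2 mulrA -mulrBl mulr_le0_ge0// subr_le0.
  lra.
have s0 : 0 <= A ^+ 2 / (4 * a) by rewrite divr_ge0 ?sqr_ge0// mulr_ge0// ltW.
have : z * (a * z - A') <= (x + h) * (a * (x + h) - A').
  apply: ler_pM => //; first by rewrite subr_ge0 ltW.
  by rewrite lerD2r ler_pM2l.
have Ax : A * x <= `|A| * x by rewrite ler_wpM2r.
have Ah : 0 <= A' * h by rewrite mulr_ge0// /A' addr_ge0// -mulrA mulr_ge0.
have e : A' * x = `|A| * x + 2 * a * h * x by rewrite /A' mulrDl.
have -> : z * (a * z - A') = a * z ^+ 2 - A' * z by ring.
have -> : (x + h) * (a * (x + h) - A') = a * x ^+ 2 + 2 * a * h * x + a * h ^+ 2 - A' * x - A' * h by ring.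
lra.
Qed.

(** Sum along each line from its point in the fundamental strip. Since growth is allowed, the sum is
    controlled by its last term and the number of terms. *)
Lemma XX_surj p (pg : (p < g)%N) y : XX (-1) p y -> exists2 x, XX (-1) p x & shop (-1) (Ordinal pg) x = y.
Proof.
move=> [inv bd]; pose ip := Ordinal pg.
pose x k := prim ip y (sh ip (- fl ip k) k) (fl ip k); exists x; last first.
  apply/funext => k; rewrite /shop /x fl_sh shD.
  have -> : - (fl ip k - 1) - 1 = - fl ip k by rewrite opprD opprK addrK.
  by rewrite -[fl ip k + -1]/(fl ip k - 1) primS shD addrN sh0.
split=> [i ilt|A].
  apply/funext => k; rewrite /shop /x fl_sh_lt// (shC ip i).
  apply/eqP; rewrite subr_eq0; apply/eqP.
  have yi k' : y (sh i (-1) k') = y k'.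
    by apply/eqP; rewrite -subr_eq0 -/(shop (-1) i y k') inv.
  move: (sh ip (- fl ip k) k) (fl ip k) => k0 [n|n] /=; [congr (- _)|];
    by apply: eq_bigr => s _; rewrite shC yi.
have cp : 0 < - c ip by rewrite oppr_gt0.
(* The extra unit in [A + 1] absorbs the number of terms; intermediate points exceed the end point
   by at most [2 * mu] in absolute value of the p-th form. *)
have [A' AA' [M1 HM1]] := @grow_near (- c ip) (A + 1) (2 * mu%:R) cp ltac:(by rewrite mulr_ge0).
have [M M0 HM] := bnd_ge0 bd A'; have m0 : 0 < mu%:R :> R by rewrite ltr0n.
have m1 : 1 <= mu%:R :> R by rewrite ler1n.
exists ((1 + mu%:R) * (M * expR M1)) => k.
set k0 := sh ip (- fl ip k) k; have /andP[l0 l1] := flP ip k; rewrite -/k0 in l0 l1.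
have kE : k = sh ip (fl ip k) k0 by rewrite shD addrN sh0.
have xE : LL ip k = LL ip k0 + (fl ip k)%:~R * mu%:R by rewrite {1}kE LL_sh_id.
have fb : `|(fl ip k)%:~R| * mu%:R <= `|LL ip k| + mu%:R.
  rewrite -{1}[mu%:R]ger0_norm// -normrM (_ : _ * _ = LL ip k - LL ip k0); last by rewrite xE addrC addKr.
  by apply: le_trans (ler_normB _ _) _; rewrite lerD2l ger0_norm// ltW.
have Hs (s : int) : `|s%:~R| <= `|(fl ip k)%:~R| :> R ->
    nm (y (sh ip s k0)) <= M * expR M1 * expR (- ((c ip) * LL ip k ^+ 2 + (A + 1) * `|LL ip k|) - EE p.+1 A k).
  move=> sf; apply: le_trans (HM _) _; rewrite -mulrA -expRD ler_wpM2l// ler_expR (EE_split ip).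
  rewrite (EE_sh ip) (EE_sh ip) LL_sh_id.
  have h1 : EE p.+1 A k <= EE p.+1 A' k by apply: EE_mono; lra.
  have h2 : `|LL ip k0 + s%:~R * mu%:R| <= `|LL ip k| + 2 * mu%:R.
    apply: le_trans (ler_normD _ _) _; rewrite normrM (ger0_norm l0) (ger0_norm (ltW m0)).
    have : `|s%:~R| * mu%:R <= `|(fl ip k)%:~R| * mu%:R :> R by rewrite ler_wpM2r// ltW.
    lra.
  have := HM1 _ _ h2; lra.
apply: le_trans (prim_bound Hs) _.
have h3 : `|(fl ip k)%:~R| <= (1 + mu%:R) * expR `|LL ip k|.
  have : `|(fl ip k)%:~R| <= `|(fl ip k)%:~R| * mu%:R :> R by rewrite ler_peMr.
  have := expR_ge1Dx `|LL ip k|; have := normr_ge0 (LL ip k).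
  by move: fb; move: `|_| `|_| (expR _) => f z ez; nra.
rewrite mulrA -[leRHS]mulrA [leRHS]mulrAC; apply: le_trans (ler_wpM2r _ h3) _.
  by rewrite !mulr_ge0 ?expR_ge0.
rewrite le_eqVlt; apply/orP; left; apply/eqP; rewrite (EE_split ip).
set z := `|_|; have -> : - (c ip * LL ip k ^+ 2 + (A + 1) * z) - EE p.+1 A k =
  - (c ip * LL ip k ^+ 2 + A * z + EE p.+1 A k) - z by ring.
rewrite [in LHS]expRD (expRN z) -[EE ip.+1 A k]/(EE p.+1 A k).
by field; exact: lt0r_neq0 (expR_gt0 _).
Qed.

End Growing.

Section Decaying.
Hypothesis c_gt0 : forall i, 0 < c i.

Definition fwd (p : 'I_g) b k (t : nat) := b (sh p t%:Z k).
Definition bwd (p : 'I_g) b k (t : nat) := b (sh p (- t.+1%:Z) k).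
(** The sum of b over the whole line through k in the direction p: the only obstruction to a
    decaying primitive. *)
Definition sgm (p : 'I_g) b : Z -> C := fun k => hs (fwd p b k) + hs (bwd p b k).

Lemma EE_ge (p : 'I_g) (A : R) k : 0 <= A -> EE p.+1 A k >= 0.
Proof.
move=> A0; apply: sumr_ge0 => i _.
by rewrite addr_ge0// mulr_ge0 ?sqr_ge0// ltW.
Qed.

(* The extra unit of exponential decay pays for a summation along the p-th direction. *)
Lemma line_bound (p : 'I_g) b (A : R) : 0 <= A -> bnd p b -> exists2 M, 0 <= M & forall k (t : int),
  nm (b (sh p t k)) <= M * expR (- EE p.+1 A k) *
    expR (- (c p * (LL p k + t%:~R * mu%:R) ^+ 2 + A * `|LL p k + t%:~R * mu%:R|)) *
    expR (- `|LL p k + t%:~R * mu%:R|).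
Proof.
move=> A0 bd; have [M M0 HM] := bnd_ge0 bd (A + 1); exists M => // k t.
apply: le_trans (HM _) _; rewrite -!mulrA -!expRD ler_wpM2l// ler_expR EE_split LL_sh_id EE_sh.
have := @EE_mono p.+1 A (A + 1) k ltac:(by rewrite lerDl); lra.
Qed.

Lemma mu_ge1 : 1 <= mu%:R :> R. Proof. by rewrite ler1n. Qed.

Lemma fwd_dom (p : 'I_g) b : bnd p b -> forall k, exists M, hdom M (fwd p b k).
Proof.
move=> bd k; have [M M0 HM] := line_bound (lexx 0) bd.
exists (M * expR `|LL p k|) => t; apply: le_trans (HM k t) _.
rewrite -!mulrA ler_wpM2l// -!expRD; apply: (@le_trans _ _ (expR `|LL p k| * expR (- t%:R))); last first.
  by rewrite ler_wpM2l ?expR_ge0 ?exp_pow2.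
rewrite -expRD ler_expR mul0r addr0; have := EE_ge p k (lexx 0).
set x := LL p k; have : 0 <= c p * (x + t%:~R * mu%:R) ^+ 2 by rewrite mulr_ge0 ?sqr_ge0// ltW.
have : t%:R <= `|x + t%:~R * mu%:R| + `|x|.
  rewrite -{1}[t%:R]normr_nat; apply: (@le_trans _ _ `|t%:~R * mu%:R|).
    by rewrite normrM -pmulrn normr_nat ler_peMr// ger0_norm// mu_ge1.
  by rewrite -{1}[t%:~R * mu%:R](addKr x) [_ + (x + _)]addrC ler_normB.
lra.
Qed.

Lemma bwd_dom (p : 'I_g) b : bnd p b -> forall k, exists M, hdom M (bwd p b k).
Proof.
move=> bd k; have [M M0 HM] := line_bound (lexx 0) bd.
exists (M * expR `|LL p k|) => t; apply: le_trans (HM k _) _.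
rewrite -!mulrA ler_wpM2l// -!expRD; apply: (@le_trans _ _ (expR `|LL p k| * expR (- t%:R))); last first.
  by rewrite ler_wpM2l ?expR_ge0 ?exp_pow2.
rewrite -expRD ler_expR mul0r addr0; have := EE_ge p k (lexx 0).
set x := LL p k; set s : int := - t.+1%:Z; have : 0 <= c p * (x + s%:~R * mu%:R) ^+ 2 by rewrite mulr_ge0 ?sqr_ge0// ltW.
have : t%:R <= `|x + s%:~R * mu%:R| + `|x|.
  apply: (@le_trans _ _ `|s%:~R * mu%:R|).
    rewrite normrM mulrNz normrN -pmulrn normr_nat (ger0_norm (ler0n _ mu)).
    have := mu_ge1; have : t%:R <= t.+1%:R :> R by rewrite ler_nat.
    by have : 0 <= t.+1%:R :> R by []; nra.
  by rewrite -{1}[s%:~R * mu%:R](addKr x) [_ + (x + _)]addrC ler_normB.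
lra.
Qed.

Lemma fwdS (p : 'I_g) b k : bnd p b -> hs (fwd p b k) = b k + hs (fwd p b (sh p 1 k)).
Proof.
move=> bd; have [M HM] := fwd_dom bd k; rewrite (hsS HM) {1}/fwd sh0; congr (_ + hs _).
by apply/funext => t; rewrite /fwd shD; congr (b (sh _ _ _)); rewrite addrC -intS.
Qed.
Lemma bwdS (p : 'I_g) b k : bnd p b -> hs (bwd p b (sh p 1 k)) = b k + hs (bwd p b k).
Proof.
move=> bd; have [M HM] := bwd_dom bd (sh p 1 k); rewrite (hsS HM) {1}/bwd shD addNr sh0; congr (_ + hs _).
by apply/funext => t; rewrite /bwd shD; congr (b (sh _ _ _)); rewrite [in LHS]intS opprD addrAC addNr add0r.
Qed.

Lemma sgm_inv (p : 'I_g) b : bnd p b -> shop 1 p (sgm p b) = 0.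
Proof.
move=> bd; apply/funext => k; rewrite /shop /sgm (bwdS k bd) (fwdS k bd).
by rewrite addrCA addrA subrr.
Qed.

Lemma sgm_lin (p : 'I_g) a b b' : bnd p b -> bnd p b' -> sgm p (a *: b + b') = a *: sgm p b + sgm p b'.
Proof.
move=> bd bd'; apply/funext => k; rewrite /sgm !fctE.
have [M1 H1] := fwd_dom bd k; have [M2 H2] := fwd_dom bd' k.
have [M3 H3] := bwd_dom bd k; have [M4 H4] := bwd_dom bd' k.
have -> : fwd p (fun x => a *: b x + b' x) k = (fun t => a * fwd p b k t + fwd p b' k t) by [].
have -> : bwd p (fun x => a *: b x + b' x) k = (fun t => a * bwd p b k t + bwd p b' k t) by [].
by rewrite (hs_lin a H1 H2) (hs_lin a H3 H4) /GRing.scale /=; ring.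
Qed.

Lemma sgm_sh (p i : 'I_g) s b : sgm p (fun k => b (sh i s k)) = fun k => sgm p b (sh i s k).
Proof.
by apply/funext => k; congr (hs _ + hs _); apply/funext => t; rewrite /fwd /bwd shC.
Qed.

Lemma sgm_shop (p i : 'I_g) s b : bnd p b -> sgm p (shop s i b) = shop s i (sgm p b).
Proof.
move=> bd; have -> : shop s i b = (-1) *: b + (fun k => b (sh i s k)).
  by apply/funext => k; rewrite /shop !fctE scaleN1r addrC.
rewrite sgm_lin//; last exact: bnd_sh.
by rewrite sgm_sh; apply/funext => k; rewrite /shop !fctE scaleN1r addrC.
Qed.

Lemma sgm_XX (p : nat) (pg : (p < g)%N) b : XX 1 p b -> XX 1 p.+1 (sgm (Ordinal pg) b).
Proof.
move=> [inv bd]; pose ip := Ordinal pg; split=> [i|A0].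
  rewrite ltnS leq_eqVlt => /orP[/eqP e|ip'].
    by rewrite (_ : i = ip); [exact: sgm_inv|apply: val_inj].
  rewrite -sgm_shop// inv//; apply/funext => k.
  by rewrite /sgm (_ : fwd _ _ _ = fun=> 0)// (_ : bwd _ _ _ = fun=> 0)// hs0 addr0.
pose A := `|A0|; have [M M0 HM] := line_bound (p := ip) (normr_ge0 A0) bd.
exists (4 * (M * expR (mu%:R))) => k; set k0 := sh ip (- fl ip k) k.
have bdi : bnd ip b by exact: bd.
have si := shop_iter (or_introl (erefl (1 : int))) (sgm_inv bdi).
rewrite -(si (- fl ip k) k) -/k0.
have E1 : expR (- EE p.+1 A k0) <= expR (- EE p.+1 A0 k).
  by rewrite ler_expR lerN2 (EE_sh ip); apply: EE_mono; exact: ler_norm.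
have /andP[l0 l1] := flP ip k; rewrite -/k0 in l0 l1.
have dom (s : nat -> int) : (forall t : nat, t%:R <= `|LL ip k0 + (s t)%:~R * mu%:R|) ->
    hdom (M * expR (- EE p.+1 A k0)) (fun t => b (sh ip (s t) k0)).
  move=> hs' t; apply: le_trans (HM k0 (s t)) _; rewrite -mulrA ler_wpM2l ?mulr_ge0 ?expR_ge0//.
  apply: le_trans _ (exp_pow2 R t); rewrite -expRD ler_expR.
  set x := LL ip k0 + _; have : 0 <= c ip * x ^+ 2 by rewrite mulr_ge0 ?sqr_ge0// ltW.
  have : 0 <= `|A0| * `|x| by rewrite mulr_ge0.
  by have := hs' t; rewrite -/x; lra.
have m1 := mu_ge1; have mm : 1 <= expR mu%:R :> R by rewrite -expR0 ler_expR.
have d1 : hdom (M * expR (- EE p.+1 A k0)) (fwd ip b k0).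
  apply: (dom (fun t => t%:Z)) => t; rewrite -pmulrn ger0_norm; last by rewrite addr_ge0// mulr_ge0.
  by have : 0 <= t%:R :> R by []; nra.
have d2 : hdom (M * expR (- EE p.+1 A k0)) (bwd ip b k0).
  apply: (dom (fun t => - t.+1%:Z)) => t; rewrite mulrNz -pmulrn mulNr distrC ger0_norm -natr1.
    by have : 0 <= t%:R :> R by []; nra.
  by have : 0 <= t%:R :> R by []; nra.
apply: le_trans (nmD _ _) _; apply: le_trans (lerD (hs_bound d1) (hs_bound d2)) _.
have e0 := expR_ge0 (- EE p.+1 A k0).
have : M * expR (- EE p.+1 A k0) <= M * expR mu%:R * expR (- EE p.+1 A0 k).
  apply: ler_pM => //; rewrite ler_peMr//.
lra.
Qed.

(** A sequence that is both periodic along a line and tends to 0 along it vanishes. *)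
Lemma decay_inj (p : nat) (pg : (p < g)%N) b : XX 1 p b -> shop 1 (Ordinal pg) b = 0 -> b = 0.
Proof.
move=> [_ bd] inv; pose ip := Ordinal pg; apply/funext => k; apply: nm_small => e e0.
have [M HM] := fwd_dom (p := ip) bd k.
have M0 := hdom_ge0 HM; have M1 : 0 < M + 1 by lra.
have [N HN] := pow2_small (divr_gt0 e0 M1); have si := shop_iter (or_introl (erefl (1 : int))) inv.
have := HM N; rewrite /fwd si => h; apply: le_trans h _.
have := HN _ (leqnn N); rewrite ltr_pdivlMr//.
have : 0 < (2 ^+ N)^-1 :> R by rewrite invr_gt0 exprn_gt0.
by move: (2 ^+ N)^-1 => x; nra.
Qed.

Lemma sgm_exact (p : nat) (pg : (p < g)%N) y : XX 1 p y -> sgm (Ordinal pg) y = 0 ->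
  exists2 x, XX 1 p x & shop 1 (Ordinal pg) x = y.
Proof.
move=> [inv bd] sy; pose ip := Ordinal pg.
pose x k := - hs (fwd ip y k); exists x; last first.
  by apply/funext => k; rewrite /shop /x opprK [hs (fwd ip y k)]fwdS// addrC addrK.
have xb k : x k = hs (bwd ip y k).
  have := congr1 (fun f => f k) sy; rewrite /sgm => /eqP; rewrite addrC addr_eq0 => /eqP.
  by move=> ->.
split=> [i ilt|A0].
  apply/funext => k; apply/eqP; rewrite subr_eq0 /x; apply/eqP; congr (- hs _).
  apply/funext => t; rewrite /fwd shC; apply/eqP; rewrite -subr_eq0 -/(shop 1 i y _).
  by rewrite inv.
pose A := `|A0|; have A_ge0 : 0 <= A := normr_ge0 A0.
have [M M0 HM] := line_bound (p := ip) A_ge0 bd.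
exists (2 * M) => k.
suff [f fx d] : exists2 f, nm (x k) = nm (hs f) & hdom (M * expR (- EE p A k)) f.
  rewrite fx; apply: le_trans (hs_bound d) _; rewrite mulrA ler_wpM2l ?mulr_ge0//.
  by rewrite ler_expR lerN2; apply: EE_mono; exact: ler_norm.
have m1 := mu_ge1; set l := LL ip k.
have dom (s : nat -> int) : (forall t : nat, `|l| + t%:R <= `|l + (s t)%:~R * mu%:R|) ->
    hdom (M * expR (- EE p A k)) (fun t => y (sh ip (s t) k)).
  move=> hs' t; apply: le_trans (HM k (s t)) _; rewrite -!mulrA ler_wpM2l//.
  apply: (@le_trans _ _ (expR (- EE p A k) * expR (- t%:R))); last first.
    by rewrite ler_wpM2l ?expR_ge0 ?exp_pow2.
  rewrite -!expRD ler_expR (EE_split ip) -/l.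
  set z := l + _; have := hs' t; rewrite -/z => zt.
  have t0 : 0 <= t%:R :> R by []. 
  have lz : `|l| <= `|z| by lra.
  have : c ip * l ^+ 2 <= c ip * z ^+ 2.
    by rewrite ler_pM2l// -[l ^+ 2]real_normK ?num_real// -[z ^+ 2]real_normK ?num_real// ler_sqr ?nnegrE.
  have : A * `|l| <= A * `|z| by rewrite ler_wpM2l.
  have := normr_ge0 l; lra.
(* The primitive is a half-line sum in either direction, as the full sum is 0; the direction that
   leads away from the origin is taken, so that every term is bounded at k itself. *)
have [l0|l0] := leP 0 l.
  exists (fwd ip y k); first by rewrite /x nmN.
  apply: (dom (fun t => t%:Z)) => t; have t0 : 0 <= t%:R :> R by [].
  by rewrite -pmulrn !ger0_norm ?addr_ge0 ?mulr_ge0// lerD2l ler_peMr.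
exists (bwd ip y k); first by rewrite xb.
apply: (dom (fun t => - t.+1%:Z)) => t; have t0 : 0 <= t%:R :> R by [].
rewrite mulrNz -pmulrn mulNr ltr0_norm// ler0_norm -natr1; first by nra.
by nra.
Qed.

(** Restriction to the fundamental strip. Each line meets it exactly once, so this is a section of
    [sgm]. *)
Definition emb (p : 'I_g) b : Z -> C := fun k => if 0 <= LL p k < mu%:R then b k else 0.

Lemma emb_XX (p : nat) (pg : (p < g)%N) b : XX 1 p.+1 b ->
  XX 1 p (emb (Ordinal pg) b) /\ sgm (Ordinal pg) (emb (Ordinal pg) b) = b.
Proof.
move=> [inv bd]; pose ip := Ordinal pg; have XE : XX 1 p (emb ip b).
  split=> [i ilt|A0].
    apply/funext => k; apply/eqP; rewrite subr_eq0 /emb LL_sh_lt//.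
    have /eqP := congr1 (fun f => f k) (inv i (leqW ilt)); rewrite subr_eq0 => /eqP ->.
    by [].
  pose A := `|A0|; have [M M0 HM] := bnd_ge0 bd A.
  exists (M * expR (`|c ip| * mu%:R ^+ 2 + A * mu%:R)) => k; rewrite /emb.
  case: ifP => [h|_]; last by rewrite nm0 !mulr_ge0 ?expR_ge0.
  apply: le_trans (HM k) _; rewrite -mulrA -expRD ler_wpM2l// ler_expR.
  have [_ h2] := EE_base (normr_ge0 A0) h.
  have := @EE_mono p A0 A k (ler_norm _); rewrite /= in h2; rewrite -/A in h2 *; lra.
split=> //; apply/funext => k; have [_ bdE] := XE.
have bdi : bnd ip (emb ip b) by exact: bdE.
have s1 := shop_iter (or_introl (erefl (1 : int))) (sgm_inv bdi).
have s2 := shop_iter (or_introl (erefl (1 : int))) (inv ip (ltnSn p)).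
rewrite -(s1 (- fl ip k) k) -(s2 (- fl ip k) k).
set k0 := sh _ _ k; have h0 := flP ip k; rewrite -/k0 in h0.
have m1 := mu_ge1; have /andP[l0 l1] := h0.
rewrite /sgm hs_single => [|t]; last first.
  rewrite /fwd /emb ifF// LL_sh_id -pmulrn -natr1; apply/negbTE; rewrite negb_and -!leNgt.
  apply/orP; right; by have : 0 <= t%:R :> R by []; nra.
rewrite (_ : bwd _ _ _ = fun=> 0) ?hs0 ?addr0; first by rewrite /fwd sh0 /emb h0.
apply/funext => t; rewrite /bwd /emb ifF// LL_sh_id mulrNz -pmulrn -natr1; apply/negbTE; rewrite negb_and -!ltNge.
apply/orP; left; by have : 0 <= t%:R :> R by []; nra.
Qed.

End Decaying.

End CoefClasses.

(** * Linear operators on the ring of periodic entire functions *)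

Section OpfunModule.
Variables (R : realType) (g : nat).
Local Notation C := (CC R).
Local Notation F := (opfun R g).

Definition opscale (a : C) (h : F) : F := opcst g a * h.
Lemma opscaleA a b h : opscale a (opscale b h) = opscale (a * b) h.
Proof. by rewrite /opscale rmorphM mulrA. Qed.
Lemma opscale1 : left_id 1 opscale.
Proof. by move=> h; rewrite /opscale rmorph1 mul1r. Qed.
Lemma opscaleDr : right_distributive opscale +%R.
Proof. by move=> a h h'; rewrite /opscale mulrDr. Qed.
Lemma opscaleDl h : {morph opscale^~ h : a b / a + b}.
Proof. by move=> a b; rewrite /opscale rmorphD mulrDl. Qed.
HB.instance Definition _ := GRing.Zmodule_isLmodule.Build C F opscaleA opscale1 opscaleDr opscaleDl.

Lemma opfunZ a (h : F) z : (a *: h) z = a * h z. Proof. by []. Qed.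

Definition mulop (a h : F) : F := a * h.
Lemma mulop_is_linear a : linear (mulop a).
Proof. by move=> c h h'; rewrite /mulop mulrDr; congr (_ + _); apply: opfun_ext => z; rewrite opfunM !opfunZ opfunM mulrCA. Qed.
HB.instance Definition _ a := GRing.isLinear.Build C F F _ (mulop a) (mulop_is_linear a).

Definition pdO (i : 'I_g) (h : F) : F := opf (OP_pd i (opfunP h)).
Lemma coef_pdO i (h : F) k : coef (pdO i h) k = 2 * iC * rc pi * ((k 0 i)%:~R * coef h k).
Proof. exact: coef_pd (opfunP h). Qed.
Lemma opfun_coef (h h' : F) : (forall k, coef h k = coef h' k) -> h = h'.
Proof. by move=> e; apply: opfun_ext => z; rewrite (OP_ext (opfunP h) (opfunP h') e). Qed.
Lemma coef_lin a (h h' : F) k : coef (a *: h + h' : F) k = a * coef h k + coef h' k.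
Proof.
have := coef_add k (OP_scale a (opfunP h)) (opfunP h'); rewrite (coef_scale _ _ (opfunP h)) => <-.
by [].
Qed.
Local Opaque coef.
Lemma pdO_is_linear i : linear (pdO i).
Proof.
move=> a h h'; apply: opfun_coef => k.
have e1 := coef_pdO i (a *: h + h') k; have e2 := coef_lin a (pdO i h) (pdO i h') k.
have e3 := coef_pdO i h k; have e4 := coef_pdO i h' k; have e5 := coef_lin a h h' k.
apply: (etrans _ (esym e2)); revert e1 e3 e4 e5.
generalize (coef (pdO i (a *: h + h')) k) (coef (pdO i h) k)
  (coef (pdO i h') k) (coef (a *: h + h') k).
by move=> x1 x2 x3 x4 -> -> -> ->; ring.
Qed.
HB.instance Definition _ i := GRing.isLinear.Build C F F _ (pdO i) (pdO_is_linear i).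

Local Transparent coef.
Variable tau : 'M[C]_g.
Hypothesis htau : period_matrix tau.

Definition trO m l (h : F) : F := opf (OP_tr tau m l (opfunP h)).
Lemma trO_is_linear m l : linear (trO m l).
Proof.
move=> a h h'; apply: opfun_ext => z; rewrite opfunD opfunZ /=.
by rewrite tr_add tr_scale.
Qed.
HB.instance Definition _ m l := GRing.isLinear.Build C F F _ (trO m l) (trO_is_linear m l).

Lemma trO_comm m l l' h : trO m l (trO m l' h) = trO m l' (trO m l h).
Proof. by apply: opfun_ext => z; exact: trC. Qed.
Lemma trO_mul m m' l a h : trO (m + m') l (a * h) = trO m l a * trO m' l h.
Proof. by apply: opfun_ext => z; exact: trM. Qed.

Definition cpi : C := - (2 * iC * rc pi).
Lemma trO_pd m l i h : trO m l (pdO i h) = pdO i (trO m l h) + (cpi * (m%:~R * (l 0 i)%:~R)) *: trO m l h.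
Proof.
apply: opfun_ext => z; have := congr1 (fun f => f z) (tr_pd htau m l i (opfunP h)) => e.
by rewrite opfunD opfunZ /= [LHS]e /cpi !mulNr.
Qed.

Definition thO : F := opf (OP_th0 htau).
Lemma trO_th l : trO 1 l thO = thO.
Proof. by apply: opfun_ext => z; rewrite /= tr_th0. Qed.
Lemma trO_pdth l i : trO 1 l (pdO i thO) = pdO i thO + (cpi * (l 0 i)%:~R) *: thO.
Proof. by rewrite trO_pd trO_th mul1r. Qed.

Definition gseq m (h : F) : 'rV[int]_g -> C := ncoef tau m h.
Lemma bseq_is_linear m : linear (gseq m).
Proof.
move=> a h h'; apply/funext => k; rewrite /gseq /ncoef coef_lin !fctE mulrDl; congr (_ + _).
exact/esym/mulrA.
Qed.
HB.instance Definition _ m := GRing.isLinear.Build C F _ _ (gseq m) (bseq_is_linear m).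

Lemma bseq_inj m h : gseq m h = 0 -> h = 0.
Proof.
move=> e; apply: opfun_coef => k; rewrite (ncoefE tau m) -/(gseq m h k) e mul0r.
by have := coef_lin (-1) h h k; rewrite scaleN1r addNr mulN1r addNr => ->.
Qed.
End OpfunModule.

(** * Exactness in non-zero weight, before twisting *)

Section ScalarRows.
Variables (R : realType) (g : nat) (tau : 'M[CC R]_g).
Local Notation C := (CC R).
Local Notation F := (opfun R g).
Hypothesis htau : period_matrix tau.
Variables (d : 'I_g -> R) (u : 'I_g -> 'I_g -> R).
Hypotheses (d0 : forall i, 0 < d i) (u1 : forall i, u i i = 1).
Hypothesis ul : forall i l : 'I_g, (l < i)%N -> u i l = 0.
Hypothesis Q : forall x, qf (im_form tau) x = \sum_i d i * lf u x i ^+ 2.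
Hypothesis HK : exists2 K, 0 <= K & forall x i, `|x i| <= K * \sum_l `|lf u x l|.

(** The coefficients in the exponent of [nm (gauss tau m k)], so that dividing by [gauss] turns
    [decay] into [bnd] and back. *)
Definition cm (m : int) i : R := - (pi * d i / m%:~R).

Lemma nm_gauss_sum m k : nm (gauss tau m k) = expR (\sum_i cm m i * LL u i k ^+ 2).
Proof.
rewrite nm_gauss Q mulr_sumr -sumrN; congr expR; apply: eq_bigr => i _.
by rewrite /cm /LL; ring.
Qed.

Lemma bseq_bnd m (h : F) : bnd u (cm m) 0 (gseq tau m h).
Proof.
have [K K0 HK'] := HK; have dh := coef_decay (opfunP h).
pose U := \sum_i \sum_l `|u i l|.
have U0 : 0 <= U by apply: sumr_ge0 => i _; apply: sumr_ge0.
have LU k : \sum_i `|LL u i k| <= U * l1 R k.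
  rewrite /U mulr_suml; apply: ler_sum => i _; apply: le_trans (ler_norm_sum _ _ _) _.
  rewrite mulr_suml; apply: ler_sum => l _; rewrite normrM ler_wpM2l//.
  exact: l1_coord.
move=> A; have [M HM] := dh (`|A| * U); exists `|M| => k.
rewrite /gseq /ncoef nmM nmV nm_gauss_sum ler_pdivrMr ?expR_gt0// -mulrA -expRD.
apply: le_trans (HM k) _; apply: (@le_trans _ _ (`|M| * expR (- (`|A| * U * l1 R k)))).
  by rewrite ler_wpM2r ?expR_ge0// ler_norm.
rewrite ler_wpM2l// ler_expR /EE big_split /= -mulr_sumr opprD addrAC addNr add0r lerN2.
apply: (@le_trans _ _ (`|A| * \sum_i `|LL u i k|)).
  by rewrite ler_wpM2r ?sumr_ge0// ler_norm.
by rewrite -mulrA ler_wpM2l.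
Qed.

Lemma bseq_surj m b : bnd u (cm m) 0 b -> exists h : F, gseq tau m h = b.
Proof.
have [K K0 HK'] := HK; move=> bd; pose B := g%:R * K : R.
have B0 : 0 <= B by rewrite mulr_ge0.
have l1b k : l1 R k <= B * \sum_i `|LL u i k|.
  rewrite /l1 /B -mulrA mulr_natl -[X in _ *+ X](card_ord g) -sumr_const.
  by apply: ler_sum => j _; apply: (HK' (kreal R k)).
have dc : decay (fun k => b k * gauss tau m k).
  move=> A; have [M M0 HM] := bnd_ge0 bd (`|A| * B); exists M => k.
  rewrite nmM nm_gauss_sum; apply: le_trans (ler_wpM2r (expR_ge0 _) (HM k)) _.
  rewrite -mulrA -expRD ler_wpM2l// ler_expR /EE big_split /= -mulr_sumr.
  rewrite opprD addrAC addNr add0r lerN2; apply: (@le_trans _ _ (`|A| * l1 R k)).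
    by rewrite ler_wpM2r ?l1_ge0// ler_norm.
  by rewrite -mulrA ler_wpM2l.
exists (opf (OP_ev dc)); apply/funext => k.
by rewrite /gseq /ncoef /= coef_ev// mulfK// gauss_neq0.
Qed.

Definition Dm m i : {linear F -> F} := trO tau m (delta_mx 0 i) \- idfun.
Lemma DmE m i h : Dm m i h = trO tau m (delta_mx 0 i) h - h. Proof. by []. Qed.

Lemma bseq_D (s : int) mu i h : (s = 1 \/ s = -1) -> (0 < mu)%N ->
  gseq tau (- s * mu%:Z) (Dm (- s * mu%:Z) i h) = shop mu s i (gseq tau (- s * mu%:Z) h).
Proof.
move=> hs mu0; set m := - s * _; have m0 : m != 0 by case: hs => e; rewrite /m e; lia.
rewrite DmE linearB /=; apply/funext => k; rewrite /shop.
rewrite [LHS](_ : _ = gseq tau m (trO tau m (delta_mx 0 i) h) k - gseq tau m h k)//.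
congr (_ - _); rewrite /gseq [LHS](ncoef_tr htau _ _ m0 (opfunP h)); congr (ncoef _ _ _ _).
by rewrite /sh scalerA -scaleNr /m mulNr opprK.
Qed.

(** In positive weight the Gaussian normaliser is small, so normalised sequences may grow and every
    difference equation is solvable. *)
Lemma row_pos_scalar (m : int) q (w : {set 'I_g} -> F) : 0 < m -> deg q.+1 w -> kz (Dm m) w = 0 ->
  exists2 v, deg q v & kz (Dm m) v = w.
Proof.
case: m => // mu mp dw kw; have mu0 : (0 < mu)%N by [].
have em : mu%:Z = - (-1) * mu%:Z by rewrite opprK mul1r.
have c0 i : cm mu i < 0.
  by rewrite /cm oppr_lt0 divr_gt0 ?mulr_gt0 ?pi_gt0// -pmulrn ltr0n.
have hs : (-1 = 1 :> int) \/ (-1 = -1 :> int) by right.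
have bD i h : gseq tau mu (Dm mu i h) = shop mu (-1) i (gseq tau mu h).
  by have := bseq_D i h hs mu0; rewrite -em.
pose X p := XX u (cm mu) mu (-1) p.
have tr' (v : {set 'I_g} -> F) : (fun S => gseq tau mu (kz (Dm mu) v S)) = kz (shop mu (-1)) (fun S => gseq tau mu (v S)).
  by apply: (kz_transfer (X := setT)) => // i x _; exact: bD.
have m0 : (mu%:Z != 0) by rewrite eqz_nat -lt0n.
have cX : coefs (X 0) (fun S => gseq tau mu (w S)).
  by move=> S; split=> // A; exact: bseq_bnd.
have dX : deg q.+1 (fun S => gseq tau mu (w S)).
  by move=> S Sq; rewrite dw// linear0.
have kX : kz (shop mu (-1)) (fun S => gseq tau mu (w S)) = 0.
  by rewrite -tr' kw; apply/funext => S; rewrite linear0.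
have [v [cv dv kv]] := koszul_surj (@shopC R g mu (-1) (-1))
  (XX_mod u (cm mu) mu (-1)) (fun p i b => @XX_shop R g u (cm mu) mu (-1) p i b)
  (fun p i b (h : XX u (cm mu) mu (-1) p b) => h.1 i)
  (fun p b => @XX_subset R g u (cm mu) mu c0 (-1) p b)
  (fun p pg b => @XX_next R g u (cm mu) mu u1 ul mu0 (-1) p pg b hs)
  (fun p pg b => @XX_surj R g u (cm mu) mu u1 ul mu0 c0 p pg b) cX dX kX.
have /choice[v' Hv'] : forall S, exists h : F, gseq tau mu h = v S /\ (v S = 0 -> h = 0).
  move=> S; have [_ bv] := cv S; have [h eh] := bseq_surj bv; exists h; split=> // e.
  by apply: (@bseq_inj R g tau mu); rewrite eh.
exists v'; first by move=> S Sq; apply: (Hv' S).2; exact: dv.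
apply/funext => S; apply/eqP; rewrite -subr_eq0; apply/eqP/(@bseq_inj R g tau mu).
rewrite linearB /=; have := congr1 (fun f => f S) (tr' v') => /= ->.
rewrite (_ : (fun S => _) = v); last by apply/funext => S'; case: (Hv' S').
by rewrite kv subrr.
Qed.

(** In negative weight normalised sequences must decay, so the shifts have no invariants and
    cohomology sits in degree g alone. *)
Lemma row_neg_scalar (m : int) q (w : {set 'I_g} -> F) : m < 0 -> (q < g)%N -> deg q w -> kz (Dm m) w = 0 ->
  exists2 v, pdeg q v & kz (Dm m) v = w.
Proof.
move=> mneg qg dw kw; pose mu := `|m|%N.
have em : m = - 1 * mu%:Z by rewrite /mu mulN1r; lia.
have mu0 : (0 < mu)%N by rewrite /mu; lia.
have c0 i : 0 < cm m i.
  rewrite /cm oppr_gt0 nmulr_llt0 ?mulr_gt0 ?pi_gt0// invr_lt0 ltrz0 //.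
have hs : (1 = 1 :> int) \/ (1 = -1 :> int) by left.
have bD i h : gseq tau m (Dm m i h) = shop mu 1 i (gseq tau m h).
  by have := bseq_D i h hs mu0; rewrite -em.
pose X p := XX u (cm m) mu 1 p.
have tr' (v : {set 'I_g} -> F) : (fun S => gseq tau m (kz (Dm m) v S)) = kz (shop mu 1) (fun S => gseq tau m (v S)).
  by apply: (kz_transfer (X := setT)) => // i x _; exact: bD.
have cX : coefs (X 0) (fun S => gseq tau m (w S)).
  by move=> S; split=> // A; exact: bseq_bnd.
have dX : deg q (fun S => gseq tau m (w S)).
  by move=> S Sq; rewrite dw// linear0.
have kX : kz (shop mu 1) (fun S => gseq tau m (w S)) = 0.
  by rewrite -tr' kw; apply/funext => S; rewrite linear0.
have g0 : (0 < g)%N by exact: leq_ltn_trans qg.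
(* [koszul_inj] takes operators indexed by all naturals; the default value is only reached for p >=
   g. *)
pose ix (p : nat) : 'I_g := insubd (Ordinal g0) p.
have ixE p (pg : (p < g)%N) : ix p = Ordinal pg.
  by apply: val_inj; rewrite /ix insubdK.
pose sg' p := @sgm R g mu (ix p); pose em' p := emb u mu (ix p).
have sl p a x y : (p < g)%N -> X p x -> X p y -> sg' p (a *: x + y) = a *: sg' p x + sg' p y.
  by move=> pg [_ hx] [_ hy]; rewrite /sg' (ixE p pg); exact: (sgm_lin u1 ul mu0 c0 a).
have sD p i x : (p < g)%N -> X p x -> sg' p (shop mu 1 i x) = shop mu 1 i (sg' p x).
  by move=> pg [_ hx]; rewrite /sg' (ixE p pg); exact: (sgm_shop u1 ul mu0 c0).
have sX p x : (p < g)%N -> X p x -> X p.+1 (sg' p x).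
  by move=> pg hx; rewrite /sg' (ixE p pg); exact: sgm_XX.
have eX p x : (p < g)%N -> X p.+1 x -> X p (em' p x) /\ sg' p (em' p x) = x.
  by move=> pg hx; rewrite /sg' /em' (ixE p pg); exact: emb_XX.
have e0 p : (p < g)%N -> em' p 0 = 0.
  by move=> pg; apply/funext => k; rewrite /em' /emb; case: ifP.
have sE p (pg : (p < g)%N) x : X p x -> sg' p x = 0 -> exists2 y, X p y & shop mu 1 (Ordinal pg) y = x.
  by move=> hx; rewrite /sg' (ixE p pg); exact: sgm_exact.
have [v [cv dv kv]] := @koszul_inj C g _ (shop mu 1) (@shopC R g mu 1 1) X sg' em'
  (XX_mod u (cm m) mu 1) (fun p i b => @XX_shop R g u (cm m) mu 1 p i b)
  (fun p i b (h : X p b) => h.1 i)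
  (fun p pg b => @decay_inj R g u (cm m) mu u1 ul mu0 c0 p pg b)
  sl sD sX eX e0 sE q _ qg cX dX kX.
have /choice[v' Hv'] : forall S, exists h : F, gseq tau m h = v S /\ (v S = 0 -> h = 0).
  move=> S; have [_ bv] := cv S; have [h eh] := bseq_surj bv; exists h; split=> // e.
  by apply: (@bseq_inj R g tau m); rewrite eh.
exists v'; first by move=> S Sq; apply: (Hv' S).2; exact: dv.
apply/funext => S; apply/eqP; rewrite -subr_eq0; apply/eqP/(@bseq_inj R g tau m).
rewrite linearB /=; have := congr1 (fun f => f S) (tr' v') => /= ->.
rewrite (_ : (fun S => _) = v); last by apply/funext => S'; case: (Hv' S').
by rewrite kv subrr.
Qed.

End ScalarRows.

(** * The twisted double complex *)

Section Twisted.
Variables (R : realType) (g : nat) (tau : 'M[CC R]_g).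
Local Notation C := (CC R).
Local Notation F := (opfun R g).
Local Notation N := ({set 'I_g.+1} -> F).
Hypothesis htau : period_matrix tau.
Variable n : nat.
Implicit Types (v : N) (B : {set 'I_g.+1}) (i l : 'I_g).
Local Notation up i := (lift ord0 i : 'I_g.+1).
Local Notation dl l := (delta_mx 0 l : 'rV[int]_g).

(** [v B] is the coefficient of the product of the Koszul generators in B, with [ord0] for theta and
    [up i] for d_i theta; each generator lowers the weight by one. *)
Definition Ttw l v : N := fun B => trO tau (n%:Z - #|B|%:Z) (dl l) (v B).
Lemma Ttw_is_linear l : linear (Ttw l).
Proof. by move=> a v v'; apply/funext => B; rewrite /Ttw linearP. Qed.
HB.instance Definition _ l := GRing.isLinear.Build C N N _ (Ttw l) (Ttw_is_linear l).

(** The derivation of the exterior algebra that replaces the generator [up i] by [ord0]. It squares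
    to zero, so [1 + cpi EO] is the induced action on exterior powers. *)
Definition EO i v : N := eps ord0 (iot (up i) v).
Lemma EO_is_linear i : linear (EO i).
Proof. by move=> a v v'; rewrite /EO !linearP. Qed.
HB.instance Definition _ i := GRing.isLinear.Build C N N _ (EO i) (EO_is_linear i).

Lemma EOE i v B : EO i v B = if (ord0 \in B) && (up i \notin B)
  then (sg C ord0 B * sg C (up i) (B :\ ord0)) *: v (up i |: (B :\ ord0)) else 0.
Proof.
rewrite /EO /eps /iot !inE; case: ifP => //= _.
by case: ifP => _; rewrite ?scaler0// scalerA.
Qed.

Lemma EO_card i B : ord0 \in B -> up i \notin B -> #|up i |: (B :\ ord0)| = #|B|.
Proof.
move=> oB iB; rewrite cardsU1 !inE (negbTE iB) andbF /= (cardsD1 ord0 B) oB.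
by [].
Qed.

Lemma Ttw_EO l i v : Ttw l (EO i v) = EO i (Ttw l v).
Proof.
apply/funext => B; rewrite EOE /Ttw EOE; case: ifP => [/andP[h1 h2]|_]; last exact: linear0.
by rewrite linearZ EO_card.
Qed.
Lemma iot_iot0 i v : iot (up i) (iot (up i) v) = 0.
Proof.
by apply/funext => B; rewrite /iot; case: ifP => // _; rewrite !inE eqxx scaler0.
Qed.
Lemma eps_eps0 v : eps ord0 (eps ord0 v) = 0.
Proof.
by apply/funext => B; rewrite /eps; case: ifP => // _; rewrite !inE eqxx scaler0.
Qed.
Lemma EO_EO i j v : EO i (EO j v) = 0.
Proof. by rewrite /EO iot_eps// linearN /= eps_eps0 oppr0. Qed.
Lemma Ttw_comm l l' v : Ttw l (Ttw l' v) = Ttw l' (Ttw l v).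
Proof. by apply/funext => B; exact: trO_comm. Qed.

(* Since T_l (d_i theta) = d_i theta + cpi delta_il theta, the lattice also acts on
   the Koszul generators. *)
Definition tw l v : N := Ttw l v + cpi R *: EO l (Ttw l v).
Lemma tw_is_linear l : linear (tw l).
Proof.
move=> a v v'; rewrite /tw !linearP; rewrite !scalerDr !scalerA mulrC -!scalerA.
by rewrite -!addrA; congr (_ + _); rewrite addrCA.
Qed.
HB.instance Definition _ l := GRing.isLinear.Build C N N _ (tw l) (tw_is_linear l).

Lemma tw_comm l l' v : tw l (tw l' v) = tw l' (tw l v).
Proof.
rewrite /tw !linearD !linearZ /= !Ttw_EO !EO_EO !scaler0 !addr0 (Ttw_comm l l').
by rewrite -!addrA; congr (_ + _); rewrite addrC.
Qed.

Definition th (b : 'I_g.+1) : F := if unlift ord0 b is Some i then pdO i (thO htau) else thO htau.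
Definition delta v : N := \sum_b iot b (cw (mulop (th b)) v).
Lemma delta_is_linear : linear delta.
Proof.
move=> a v v'; rewrite /delta scaler_sumr -big_split; apply: eq_bigr => b _ /=.
by rewrite !linearP.
Qed.
HB.instance Definition _ := GRing.isLinear.Build C N N _ delta delta_is_linear.

Lemma mulop_comm (a b x : F) : mulop a (mulop b x) = mulop b (mulop a x).
Proof. exact: mulrCA. Qed.

Lemma deltaE v B : delta v B = \sum_(b | b \notin B) sg C b B *: (th b * v (b |: B)).
Proof.
rewrite /delta sumfE [RHS]big_mkcond; apply: eq_bigr => b _.
by rewrite /iot; case: (b \in B).
Qed.

Lemma delta_iot b v : delta (iot b v) = - iot b (delta v).
Proof.
rewrite /delta linear_sum -sumrN; apply: eq_bigr => b' _.
by rewrite cw_iot iot_iot.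
Qed.

Lemma delta_mul a v : delta (cw (mulop a) v) = cw (mulop a) (delta v).
Proof.
rewrite /delta linear_sum; apply: eq_bigr => b _ /=; rewrite cw_iot; congr iot.
by apply/funext => B; exact: mulop_comm.
Qed.

Lemma delta_delta v : delta (delta v) = 0.
Proof.
have e : delta (delta v) = - delta (delta v).
  have e1 : delta (delta v) = \sum_b delta (iot b (cw (mulop (th b)) v)) by exact: linear_sum.
  have e2 : - delta (delta v) = \sum_b - iot b (cw (mulop (th b)) (delta v)) by rewrite sumrN.
  by rewrite e2 e1; apply: eq_bigr => b _; rewrite delta_iot delta_mul.
have : 2%:R *: delta (delta v) = 0 by rewrite scaler_nat mulr2n {1}e addNr.
by move/eqP; rewrite scaler_eq0 pnatr_eq0 /= => /eqP.
Qed.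

Lemma delta_eps0 v : delta (eps ord0 v) = cw (mulop (thO htau)) v - eps ord0 (delta v).
Proof.
rewrite /delta big_ord_recl [in X in _ - X]big_ord_recl linearD opprD addrA cw_eps /=.
have h := iot_eps_id ord0 (cw (mulop (th ord0)) v).
have -> : iot ord0 (eps ord0 (cw (mulop (th ord0)) v)) =
  cw (mulop (th ord0)) v - eps ord0 (iot ord0 (cw (mulop (th ord0)) v)) by rewrite -{2}h addrK.
rewrite {1}/th unlift_none; congr (_ + _).
rewrite linear_sum -sumrN; apply: eq_bigr => i _.
by rewrite cw_eps iot_eps// eq_sym.
Qed.

Lemma delta_EO i v : delta (EO i v) = iot (up i) (cw (mulop (thO htau)) v) + EO i (delta v).
Proof. by rewrite /EO delta_eps0 delta_iot linearN opprK cw_iot. Qed.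

Lemma opfun_scalerAl (a : C) (x y : F) : (a *: x) * y = a *: (x * y).
Proof. by apply: opfun_ext => z; rewrite opfunM !opfunZ opfunM mulrA. Qed.

Lemma th_tr l b : trO tau 1 (dl l) (th b) = th b + (cpi R * (b == up l)%:R) *: thO htau.
Proof.
rewrite /th; case: unliftP => [i ->|->].
  by rewrite trO_pdth mxE eqxx /= (inj_eq lift_inj) rmorph_nat.
by rewrite trO_th (negbTE (neq_lift _ _)) mulr0 scale0r addr0.
Qed.

Lemma Ttw_delta l v : Ttw l (delta v) = delta (Ttw l v) + cpi R *: iot (up l) (cw (mulop (thO htau)) (Ttw l v)).
Proof.
apply/funext => B; rewrite /Ttw deltaE linear_sum /=.
rewrite -[RHS]/(delta (Ttw l v) B + cpi R *: iot (up l) (cw (mulop (thO htau)) (Ttw l v)) B) deltaE.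
have -> : cpi R *: iot (up l) (cw (mulop (thO htau)) (Ttw l v)) B =
  \sum_(b | b \notin B) (cpi R * (b == up l)%:R) *: (sg C b B *: (thO htau * Ttw l v (b |: B))).
  rewrite /iot; have [lB|lB] := boolP (up l \in B).
    rewrite scaler0 big1// => b bB; rewrite (_ : b == up l = false) ?mulr0 ?scale0r//.
    by apply/negbTE; apply: contraNneq bB => ->.
  rewrite (bigD1 (up l))//= eqxx mulr1 big1 ?addr0// => b /andP[_ /negbTE ->].
  by rewrite mulr0 scale0r.
rewrite -big_split; apply: eq_bigr => b bB /=; rewrite linearZ /= /Ttw.
have -> : n%:Z - #|B|%:Z = 1 + (n%:Z - #|b |: B|%:Z).
  by rewrite cardsU1 bB add1n intS; ring.
rewrite trO_mul th_tr mulrDl scalerDr; congr (_ + _).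
by rewrite opfun_scalerAl !scalerA mulrC.
Qed.

(** [Ttw] alone fails to commute with [delta] by a contraction along [up l] ([Ttw_delta]); the
    anticommutator in [delta_EO] supplies exactly the same term. *)
Lemma delta_tw l v : delta (tw l v) = tw l (delta v).
Proof.
have e : EO l (Ttw l (delta v)) = EO l (delta (Ttw l v)).
  rewrite Ttw_delta linearD linearZ /= [X in _ + _ *: X](_ : _ = 0) ?scaler0 ?addr0//.
  by rewrite /EO iot_iot0 linear0.
by rewrite /tw linearD linearZ /= delta_EO e Ttw_delta scalerDr addrA.
Qed.

Lemma delta_contract (a : 'I_g.+1 -> F) v : \sum_b a b * th b = 1 ->
  delta (\sum_b eps b (cw (mulop (a b)) v)) + \sum_b eps b (cw (mulop (a b)) (delta v)) = v.
Proof.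
move=> ab; have := @iot_eps_sum C g.+1 F (fun b => mulop (th b)) (fun b => mulop (a b)) v.
move=> ->; last by move=> *; exact: mulop_comm.
apply/funext => B; rewrite sumfE /cw /mulop.
rewrite (eq_bigr (fun b => a b * th b * v B)) => [|b _]; last first.
  by rewrite -[LHS]/(th b * (a b * v B)) mulrA [th b * _]mulrC.
by rewrite -mulr_suml ab mul1r.
Qed.

Definition grow (j : nat) : set N := [set v | forall B, #|B| != j -> v B = 0].

Lemma row_mod j : submod (grow j).
Proof.
split=> [B _ //|a v v' hv hv' B Bj].
by rewrite -[LHS]/(a *: v B + v' B) hv// hv'// scaler0 addr0.
Qed.
Lemma row_Ttw j l v : grow j v -> grow j (Ttw l v).
Proof. by move=> hv B Bj; rewrite /Ttw hv// linear0. Qed.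
Lemma row_EO j i v : grow j v -> grow j (EO i v).
Proof.
move=> hv B Bj; rewrite EOE; case: ifP => // /andP[h1 h2].
by rewrite hv ?scaler0// EO_card.
Qed.
Lemma row_tw j l v : grow j v -> grow j (tw l v).
Proof.
move=> hv; rewrite /tw addrC; apply: (row_mod j).2; last exact: row_Ttw.
exact/row_EO/row_Ttw.
Qed.
Lemma row_delta j v : grow j.+1 v -> grow j (delta v).
Proof.
move=> hv B Bj; rewrite deltaE big1// => b bB; rewrite hv ?mulr0 ?scaler0//.
by rewrite cardsU1 bB.
Qed.
Lemma row_eps j b v : grow j v -> grow j.+1 (eps b v).
Proof.
move=> hv B Bj; rewrite /eps; case: ifP => // bB; rewrite hv ?scaler0//.
by move: Bj; rewrite (cardsD1 b B) bB.
Qed.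
Lemma row_top j v : grow j v -> (g.+1 < j)%N -> v = 0.
Proof.
move=> hv gj; apply/funext => B; apply: hv; apply/eqP => e.
by have := max_card (mem B); rewrite card_ord e leqNgt gj.
Qed.

Definition Dtw l : {linear N -> N} := tw l \- idfun.
Lemma DtwE l v : Dtw l v = tw l v - v. Proof. by []. Qed.
Lemma Dtw_comm l l' v : Dtw l (Dtw l' v) = Dtw l' (Dtw l v).
Proof.
rewrite !DtwE [tw l (_ - _)]linearB [tw l' (_ - _)]linearB /= (tw_comm l l').
by rewrite !opprB addrACA [RHS]addrACA; congr (_ + _); exact: addrC.
Qed.
Lemma Dtw_delta l v : Dtw l (delta v) = delta (Dtw l v).
Proof. by rewrite !DtwE linearB /= delta_tw. Qed.
Lemma row_Dtw j l v : grow j v -> grow j (Dtw l v).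
Proof. by move=> hv; rewrite DtwE addrC -scaleN1r; apply: (row_mod j).2 => //; exact: row_tw. Qed.

Definition GG v : N := \sum_i EO i (cw (pdO i) v).
Lemma GG_is_linear : linear GG.
Proof.
move=> a v v'; rewrite /GG scaler_sumr -big_split; apply: eq_bigr => b _ /=.
by rewrite !linearP.
Qed.
HB.instance Definition _ := GRing.isLinear.Build C N N _ GG GG_is_linear.

Lemma EO_GG i v : EO i (GG v) = 0.
Proof. by rewrite /GG linear_sum big1// => j _; exact: EO_EO. Qed.
Lemma GG_EO i v : GG (EO i v) = 0.
Proof.
rewrite /GG big1// => j _; rewrite (_ : cw (pdO j) (EO i v) = EO i (cw (pdO j) v)) ?EO_EO//.
by rewrite /EO cw_eps cw_iot.
Qed.
Lemma GG_GG v : GG (GG v) = 0.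
Proof. by rewrite {2}/GG linear_sum big1// => j _; exact: GG_EO. Qed.
Lemma row_GG j v : grow j v -> grow j (GG v).
Proof.
move=> hv; apply: submod_sum => [|i _]; first exact: row_mod.
by apply: row_EO => B Bj; rewrite /cw hv// linear0.
Qed.

(* In a row of non-zero weight the twist is removed by the connection [GG]:
   [Phi] conjugates [tw l] into [Ttw l] (lemma [tw_Phi]). *)
Definition Phi (k : C) v : N := v + k *: GG v.
Lemma Phi_is_linear k : linear (Phi k).
Proof.
move=> a v v'; rewrite /Phi linearP scalerDr !scalerA mulrC -scalerA scalerDr.
by rewrite -!addrA; congr (_ + _); rewrite addrCA.
Qed.
HB.instance Definition _ k := GRing.isLinear.Build C N N _ (Phi k) (Phi_is_linear k).
Lemma PhiK k v : Phi k (Phi (- k) v) = v.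
Proof.
rewrite /Phi linearD linearZ /= GG_GG scaler0 addr0 scaleNr.
by rewrite subrK.
Qed.
Lemma row_Phi j k v : grow j v -> grow j (Phi k v).
Proof.
by move=> hv; rewrite /Phi addrC; apply: (row_mod j).2 => //; exact: row_GG.
Qed.

Lemma Ttw_pd l i j v : grow j v -> Ttw l (cw (pdO i) v) =
  cw (pdO i) (Ttw l v) + (cpi R * ((n%:Z - j%:Z)%:~R * (i == l)%:R)) *: Ttw l v.
Proof.
move=> hv; apply/funext => B; rewrite -[RHS]/(cw (pdO i) (Ttw l v) B +
  (cpi R * ((n%:Z - j%:Z)%:~R * (i == l)%:R)) *: Ttw l v B) /Ttw /cw.
have [/eqP e|e] := boolP (#|B| == j); last by rewrite hv// !linear0 ?scaler0 ?addr0.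
by have := trO_pd htau (n%:Z - #|B|%:Z) (dl l) i (v B); rewrite mxE eqxx rmorph_nat -e.
Qed.

(** The commutator of [Ttw l] with [GG] is [cpi m EO l] followed by nothing else, where m = n - j is
    the weight, because [Ttw_pd] produces a factor m. Scaling [GG] by -1/m cancels the twist. *)
Lemma tw_Phi l j v : grow j v -> n != j -> tw l (Phi (- ((n%:Z - j%:Z)%:~R)^-1) v) =
  Phi (- ((n%:Z - j%:Z)%:~R)^-1) (Ttw l v).
Proof.
move=> hv nj; set m : C := _%:~R; have m0 : m != 0.
  by rewrite intr_eq0 subr_eq0 eqz_nat.
have TG : Ttw l (GG v) = GG (Ttw l v) + (cpi R * m) *: EO l (Ttw l v).
  rewrite /GG linear_sum /=; under eq_bigr do rewrite Ttw_EO (Ttw_pd _ _ hv) linearD linearZ /=.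
  rewrite big_split /=; congr (_ + _); rewrite (bigD1 l)//= eqxx mulr1 big1 ?addr0// => i /negbTE ->.
  by rewrite !mulr0 scale0r.
set k := - m^-1; have e1 : Ttw l (Phi k v) = Ttw l v + k *: (GG (Ttw l v) + (cpi R * m) *: EO l (Ttw l v)).
  by rewrite -TG /Phi linearD linearZ.
have e2 : EO l (Ttw l (Phi k v)) = EO l (Ttw l v).
  rewrite e1 linearD linearZ /= linearD linearZ /= EO_GG EO_EO.
  by rewrite scaler0 addr0 scaler0 addr0.
rewrite /tw e2 e1 /Phi scalerDr scalerA -!addrA; congr (_ + _); rewrite -[RHS]addr0; congr (_ + _).
rewrite /k.
rewrite -scalerDl (_ : - m^-1 * (cpi R * m) + cpi R = 0) ?scale0r//.
by rewrite mulNr mulrCA mulVf// mulr1 addNr.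
Qed.

Definition PP q j (w : {set 'I_g} -> N) := deg q w /\ coefs (grow j) w.
Definition TD l : {linear N -> N} := Ttw l \- idfun.

Lemma kz_row B (w : {set 'I_g} -> N) :
  (fun S => kz TD w S B) = kz (Dm tau (n%:Z - #|B|%:Z)) (fun S => w S B).
Proof.
apply/funext => S; rewrite !kzE.
rewrite -[LHS]/((\sum_(i in S) sg C i S *: TD i (w (S :\ i)) : N) B).
by rewrite (big_morph (fun v : N => v B) (id1 := 0) (op1 := +%R)).
Qed.

(** Once [Phi] has removed the twist, the row splits into one scalar complex for each B with j
    elements ([kz_row]), and the hypothesis is the exactness of these. *)
Lemma untwist_row (q q' j : nat) (w : {set 'I_g} -> N) : n != j ->
  (forall B w0, #|B| = j -> deg q w0 -> kz (Dm tau (n%:Z - #|B|%:Z)) w0 = 0 ->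
     exists2 v0 : {set 'I_g} -> F, (forall S : {set 'I_g}, #|S|.+1 != q' -> v0 S = 0) & kz (Dm tau (n%:Z - #|B|%:Z)) v0 = w0) ->
  PP q j w -> kz Dtw w = 0 -> exists2 v, (forall S : {set 'I_g}, #|S|.+1 != q' -> v S = 0) /\ coefs (grow j) v & kz Dtw v = w.
Proof.
move=> nj H [dw cw'] kw; set k : C := - ((n%:Z - j%:Z)%:~R)^-1.
have conj (w0 : {set 'I_g} -> N) : coefs (grow j) w0 ->
    (fun S => Phi k (kz TD w0 S)) = kz Dtw (fun S => Phi k (w0 S)).
  apply: (kz_transfer (X := grow j)) => i x hx.
  by rewrite linearB DtwE (tw_Phi _ hx nj).
clearbody k; pose w0 S := Phi (- k) (w S).
have cw0 : coefs (grow j) w0 by move=> S; exact: row_Phi.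
have w0E : (fun S => Phi k (w0 S)) = w by apply/funext => S; rewrite /w0 PhiK.
have kw0 : kz TD w0 = 0.
  apply/funext => S; have := congr1 (fun f => f S) (conj _ cw0); rewrite w0E kw => e.
  have : Phi (- k) (Phi k (kz TD w0 S)) = 0 by rewrite e linear0.
  by move=> e'; rewrite -[LHS](PhiK (- k)) opprK e'.
have /choice[v0 Hv0] : forall B, exists vB : {set 'I_g} -> F,
    [/\ forall S : {set 'I_g}, #|S|.+1 != q' -> vB S = 0, #|B| != j -> vB = 0 &
     kz (Dm tau (n%:Z - #|B|%:Z)) vB = fun S => w0 S B].
  move=> B; have [/eqP e|e] := boolP (#|B| == j); last first.
    by exists 0; split=> //; rewrite linear0; apply/funext => S; rewrite cw0.
  have dB : deg q (fun S => w0 S B) by move=> S Sq; rewrite /w0 dw// linear0.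
  have kB : kz (Dm tau (n%:Z - #|B|%:Z)) (fun S => w0 S B) = 0 by rewrite -kz_row kw0.
  by have [vB h1 h2] := H B _ e dB kB; exists vB.
pose v1 S : N := fun B => v0 B S.
have cv1 : coefs (grow j) v1.
  by move=> S B Bj; rewrite /v1; have [_ -> //] := Hv0 B.
have kv1 : kz TD v1 = w0.
  apply/funext => S; apply/funext => B; have := congr1 (fun f => f S) (kz_row B v1) => ->.
  by have [_ _ ->] := Hv0 B.
exists (fun S => Phi k (v1 S)).
  split=> [S Sq|S]; last exact: row_Phi.
  rewrite (_ : v1 S = 0) ?linear0//; apply/funext => B; have [h _ _] := Hv0 B.
  exact: h.
by rewrite -(conj _ cv1) kv1 w0E.
Qed.

Hypothesis hTheta : nonsingular_theta_divisor tau.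

Lemma th_bezout : exists a : 'I_g.+1 -> F, \sum_b a b * th b = 1.
Proof.
apply: bezout => z; have [e|e] := eqVneq (theta tau z) 0.
  have [i hi] := hTheta e; exists (up i); rewrite /th liftK.
  by move: hi; rewrite theta_th0.
by exists ord0; rewrite /th unlift_none /= -theta_th0.
Qed.

Definition dG : ({set 'I_g} -> N) -> ({set 'I_g} -> N) := kz Dtw.
HB.instance Definition _ := GRing.Linear.on dG.
Definition dT : ({set 'I_g} -> N) -> ({set 'I_g} -> N) := cw delta.
HB.instance Definition _ := GRing.Linear.on dT.

Lemma PP_lin q j a x y : PP q j x -> PP q j y -> PP q j (a *: x + y).
Proof.
move=> [h1 h2] [h3 h4]; split=> [S Sq|S]; last exact: (row_mod j).2.
by rewrite -[LHS]/(a *: x S + y S) h1// h3// scaler0 addr0.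
Qed.
Lemma PP_0 q j : PP q j 0.
Proof. by split=> [S _ //|S]; exact: (row_mod j).1. Qed.
Lemma PP_d q j x : PP q j x -> PP q.+1 j (dG x).
Proof.
move=> [h1 h2]; split; first by apply: deg_kz => S Sq; apply: h1; rewrite -eqSS.
by apply: coefs_kz => //; [exact: row_mod|move=> i v; exact: row_Dtw].
Qed.
Lemma PP_del q j x : PP q j.+1 x -> PP q j (dT x).
Proof.
by move=> [h1 h2]; split=> [S Sq|S]; rewrite /dT /cw; [rewrite h1// linear0|exact: row_delta].
Qed.
Lemma PP_top q j x : PP q j x -> (g.+1 < j)%N -> x = 0.
Proof. by move=> [_ h] gj; apply/funext => S; exact: row_top (h S) gj. Qed.
Lemma dG_dG x : dG (dG x) = 0.
Proof. by apply: kz_kz => i j v; exact: Dtw_comm. Qed.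
Lemma dT_dT x : dT (dT x) = 0.
Proof. by apply/funext => S; exact: delta_delta. Qed.
Lemma dG_dT x : dG (dT x) = dT (dG x).
Proof.
have h : forall i v, setT v -> delta (Dtw i v) = Dtw i (delta v) by move=> i v _; rewrite Dtw_delta.
by rewrite /dG /dT -[LHS](@kz_transfer _ _ _ _ _ _ delta setT x h).
Qed.
Lemma PP_exact q j x : PP q j x -> dT x = 0 -> exists2 y, PP q j.+1 y & dT y = x.
Proof.
move=> [h1 h2] dx; have [a ab] := th_bezout.
pose s v : N := \sum_b eps b (cw (mulop (a b)) v).
have s0 : s 0 = 0 by rewrite /s big1// => b _; rewrite !linear0.
exists (fun S => s (x S)); last first.
  apply/funext => S; rewrite -[LHS]/(delta (s (x S))) -[RHS](delta_contract (x S) ab).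
  rewrite [X in _ = _ + X]big1 ?addr0// => b _.
  by rewrite -[delta (x S)]/(dT x S) dx !linear0.
split=> [S Sq|S]; first by rewrite h1.
apply: submod_sum => [|b _]; first exact: row_mod.
by apply: row_eps => B Bj; rewrite /cw h2// linear0.
Qed.

Lemma PP_neg q j x : (n < j)%N -> (q < g)%N -> PP q j x -> dG x = 0 -> exists2 y, Pm PP q j y & dG y = x.
Proof.
move=> nj qg hx dx; have [d [u [d0 u1 ul Q HK]]] := chol_tau htau.
have [||v [h1 h2] kv] := @untwist_row q q j x _ _ hx dx; first by rewrite neq_ltn nj.
  move=> B w0 Bj dw kw; apply: (row_neg_scalar htau d0 u1 ul Q HK _ qg dw kw).
  by rewrite Bj; lia.
exists v => //; case: q {qg hx} h1 => [|q] h1 /=; first by apply/funext => S; rewrite h1.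
by split=> // S Sq; apply: h1; rewrite eqSS.
Qed.

Lemma PP_pos q j x : (j < n)%N -> PP q.+1 j x -> dG x = 0 -> exists2 y, PP q j y & dG y = x.
Proof.
move=> nj hx dx; have [d [u [d0 u1 ul Q HK]]] := chol_tau htau.
have [||v [h1 h2] kv] := @untwist_row q.+1 q.+1 j x _ _ hx dx; first by rewrite neq_ltn nj orbT.
  move=> B w0 Bj dw kw.
  have [|v dv kv] := row_pos_scalar htau d0 u1 ul Q HK _ dw kw; first by rewrite Bj; lia.
  by exists v => // S Sq; apply: dv; rewrite -eqSS.
by exists v => //; split=> // S Sq; apply: h1; rewrite eqSS.
Qed.

End Twisted.

(** * Dimensions of quotients *)

Section DimQuotient.
Variable K : fieldType.

Definition subsp (E : lmodType K) (V : set E) := V 0 /\ forall a x y, V x -> V y -> V (a *: x + y).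

Lemma subsp_sum (E : lmodType K) (V : set E) (I : Type) (r : seq I) (P : pred I) (F : I -> E) : subsp V ->
  (forall k, P k -> V (F k)) -> V (\sum_(k <- r | P k) F k).
Proof.
move=> [h0 h] HF; elim/big_rec: _ => // i x Pi Hx.
by rewrite -[F i]scale1r; apply: h => //; apply: HF.
Qed.
Lemma subspZ (E : lmodType K) (V : set E) a x : subsp V -> V x -> V (a *: x).
Proof. by move=> [h0 h] hx; rewrite -[_ *: _]addr0; apply: h. Qed.
Lemma subspD (E : lmodType K) (V : set E) x y : subsp V -> V x -> V y -> V (x + y).
Proof. by move=> [h0 h] hx hy; rewrite -[x]scale1r; apply: h. Qed.
Lemma subspN (E : lmodType K) (V : set E) x : subsp V -> V x -> V (- x).
Proof. by move=> hV hx; rewrite -scaleN1r; apply: subspZ. Qed.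
Lemma subspB (E : lmodType K) (V : set E) x y : subsp V -> V x -> V y -> V (x - y).
Proof. by move=> hV hx hy; apply: subspD => //; exact: subspN. Qed.

Lemma dq_fin (E : lmodType K) (V W : set E) (T : finType) (v : T -> E) :
  (forall i, V (v i)) -> (forall c : T -> K, W (\sum_i c i *: v i) -> forall i, c i = 0) ->
  (forall x, V x -> exists c : T -> K, W (x - \sum_i c i *: v i)) -> dim_quotient V W #|T|.
Proof.
move=> h1 h2 h3; exists (fun j => v (enum_val j)); split=> // [c|x /h3[c hc]].
  rewrite (reindex (@enum_rank T)) => [|]; last by exists enum_val => i _; [exact: enum_rankK|exact: enum_valK].
  under eq_bigr do rewrite enum_rankK.
  by move=> /h2 h i; rewrite -(enum_valK i).
exists (fun j => c (enum_val j)); move: hc; congr (W (_ - _)).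
rewrite (reindex (@enum_val T predT)) //.
by exists enum_rank => i _; [exact: enum_valK|exact: enum_rankK].
Qed.

(** Zigzags define linear relations rather than maps; a relation that is total on both sides and
    matches W with W' induces an isomorphism of the quotients. *)
Lemma dq_rel (E E' : lmodType K) (V W : set E) (V' W' : set E') (rho : E -> E' -> Prop) d :
  subsp V -> subsp W' ->
  (forall a x y x' y', rho x x' -> rho y y' -> rho (a *: x + y) (a *: x' + y')) -> rho 0 0 ->
  (forall y, V' y -> exists2 x, V x & rho x y) -> (forall x, V x -> exists2 y, V' y & rho x y) ->
  (forall x y, V x -> V' y -> rho x y -> (W x <-> W' y)) -> subsp V' ->
  dim_quotient V' W' d -> dim_quotient V W d.
Proof.
move=> sV sW' rl r0 tr tl rw sV' [v [h1 h2 h3]].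
have /choice[x Hx] : forall i, exists x, V x /\ rho x (v i).
  by move=> i; have [x Vx rx] := tr _ (h1 i); exists x.
have rs (c : 'I_d -> K) : rho (\sum_i c i *: x i) (\sum_i c i *: v i).
  elim/big_rec2: _ => // i y1 y2 _ H.
  by apply: rl => //; case: (Hx i).
have Vs (c : 'I_d -> K) : V (\sum_i c i *: x i).
  by apply: subsp_sum => // i _; apply: subspZ => //; case: (Hx i).
have Vs' (c : 'I_d -> K) : V' (\sum_i c i *: v i).
  by apply: subsp_sum => // i _; exact: subspZ.
exists x; split=> [i|c Wc i|y Vy]; first by case: (Hx i).
  by apply: h2; apply/(rw _ _ (Vs c) (Vs' c) (rs c)).
have [y' V'y ry] := tl _ Vy; have [c hc] := h3 _ V'y; exists c.
have r2 : rho (y - \sum_i c i *: x i) (y' - \sum_i c i *: v i).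
  by rewrite ![_ - _]addrC -!scaleN1r; exact: rl.
by apply/(rw _ _ _ _ r2) => //; exact: subspB.
Qed.

Lemma dq_le (E : lmodType K) (V W : set E) d d' : subsp V -> subsp W ->
  dim_quotient V W d -> dim_quotient V W d' -> (d <= d')%N.
Proof.
move=> sV sW [v [h1 h2 h3]] [v' [h1' h2' h3']].
have /choice[c Hc] : forall i, exists c : 'I_d' -> K, W (v i - \sum_j c j *: v' j) by move=> i; exact: h3'.
pose M : 'M[K]_(d, d') := \matrix_(i, j) c i j.
suff : row_free M by rewrite -row_leq_rank => /leq_trans; apply; exact: rank_leq_col.
rewrite -kermx_eq0; apply/eqP/row_matrixP => r; rewrite row0; apply/rowP => i.
have kz : row r (kermx M) *m M = 0 by rewrite -row_mul mulmx_ker row0.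
rewrite [RHS]mxE; apply: (h2 (fun i => row r (kermx M) 0 i)).
set y := row r (kermx M) in kz *.
have -> : \sum_i y 0 i *: v i = \sum_i y 0 i *: (v i - \sum_j c i j *: v' j).
  apply/eqP; rewrite -subr_eq0 -sumrB; apply/eqP.
  rewrite (eq_bigr (fun i => \sum_j (y 0 i * c i j) *: v' j)) => [|k _]; last first.
    rewrite -scalerBr opprB addrC subrK scaler_sumr; apply: eq_bigr => j _.
    by rewrite scalerA.
  rewrite exchange_big big1// => j _; rewrite -scaler_suml.
  have := congr1 (fun A : 'rV_d' => A 0 j) kz; rewrite !mxE => e.
  rewrite (_ : \sum_i _ = 0) ?scale0r// -[RHS]e; apply: eq_bigr => k _.
  by rewrite [M k j]mxE.
apply: subsp_sum => // k _; exact: subspZ.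
Qed.

Lemma dq_uniq (E : lmodType K) (V W : set E) d d' : subsp V -> subsp W ->
  dim_quotient V W d -> dim_quotient V W d' -> d = d'.
Proof. by move=> sV sW h h'; apply/eqP; rewrite eqn_leq !(dq_le sV sW). Qed.

(** A matrix of maximal rank among those with row space inside P: another vector of P would raise
    the rank. *)
Lemma submatrix (c : nat) (P : set 'rV[K]_c) : subsp P -> exists A : 'M[K]_c, forall x, P x <-> (x <= A)%MS.
Proof.
move=> sP; pose Q (r : nat) := `[< exists A : 'M[K]_c, \rank A = r /\ forall x : 'rV_c, (x <= A)%MS -> P x >].
have Q0 : exists r, Q r.
  exists 0%N; apply/asboolP; exists 0; rewrite mxrank0; split=> // x.
  by rewrite submx0 => /eqP ->; case: sP.
have Qb r : Q r -> (r <= c)%N by move=> /asboolP[A [<- _]]; exact: rank_leq_col.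
case: (ex_maxnP Q0 Qb) => r /asboolP[A [rA hA]] mx; exists A => x; split=> [Px|]; last exact: hA.
apply: contrapT => /negP nx; have /mx : Q (\rank (A + x)%MS).
  apply/asboolP; exists (A + x)%MS; split=> // y.
  move=> /sub_addsmxP[[y1 y2] /= ->].
  have -> : y1 *m A + y2 *m x = (y2 0 0) *: x + y1 *m A.
    by rewrite addrC; congr (_ + _); rewrite [y2 in LHS]mx11_scalar mul_scalar_mx.
  by apply: sP.2 => //; apply: hA; exact: submxMl.
rewrite -rA leqNgt => /negP; apply; apply: rank_ltmx; rewrite ltmxE addsmxSl /=.
by apply: contra nx => h; apply: submx_trans h; exact: addsmxSr.
Qed.

(** The quotient U/W is coordinatised by row vectors, V becomes the row space of a matrix A, and its
    complement gives a basis of U/V. The spaces themselves have infinite dimension in general. *)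
Lemma dq_split (E : lmodType K) (U V W : set E) c : subsp U -> subsp V -> W `<=` V -> V `<=` U ->
  dim_quotient U W c -> exists a, [/\ (a <= c)%N, dim_quotient V W a & dim_quotient U V (c - a)].
Proof.
move=> sU sV WV VU [v [h1 h2 h3]]; pose lin (x : 'rV[K]_c) : E := \sum_k x 0 k *: v k.
have linP a x y : lin (a *: x + y) = a *: lin x + lin y.
  rewrite /lin scaler_sumr -big_split; apply: eq_bigr => k _.
  by rewrite !mxE scalerDl scalerA.
have lin0 : lin 0 = 0 by rewrite /lin big1// => k _; rewrite mxE scale0r.
have linM r (B : 'M[K]_(r, c)) (e : 'I_r -> K) : \sum_i e i *: lin (row i B) = lin ((\row_i e i) *m B).
  rewrite /lin; under eq_bigr do rewrite scaler_sumr; rewrite exchange_big; apply: eq_bigr => k _.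
  rewrite mxE scaler_suml; apply: eq_bigr => i _.
  by rewrite !mxE scalerA.
have lin_row (e : 'I_c -> K) : lin (\row_i e i) = \sum_i e i *: v i.
  by apply: eq_bigr => k _; rewrite mxE.
have [|A HA] := @submatrix c [set x | V (lin x)].
  by split=> [|a x y hx hy]; rewrite /= ?lin0 ?linP; [exact: sV.1|exact: sV.2].
have free r (B : 'M[K]_(r, c)) (e : 'I_r -> K) : row_free B -> (\row_i e i) *m B = 0 -> forall i, e i = 0.
  move=> fB eB i; have : \row_i e i = 0 by apply: (row_free_inj fB); rewrite eB mul0mx.
  by move=> /(congr1 (fun x : 'rV_r => x 0 i)); rewrite !mxE.
exists (\rank A); split; first exact: rank_leq_row.
- exists (fun i => lin (row i (row_base A))); split=> [i|e|x Vx].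
  + by apply/HA; rewrite -(eq_row_base A) row_sub.
  + rewrite linM => /h2 z; apply: (free _ _ _ (row_base_free A)).
    by apply/rowP => k; rewrite [RHS]mxE; exact: z.
  have [e We] := h3 _ (VU _ Vx).
  have : (\row_i e i <= row_base A)%MS.
    rewrite eq_row_base; apply/HA; rewrite /= lin_row.
    have -> : \sum_i e i *: v i = x - (x - \sum_i e i *: v i) by rewrite opprB addrC subrK.
    by apply: subspB => //; exact: WV.
  case/submxP=> y ey; exists (fun i => y 0 i); rewrite linM (_ : \row_i y 0 i = y) -?ey ?lin_row//.
  by apply/rowP => k; rewrite mxE.
rewrite -mxrank_compl; pose Ac := (A^C)%MS; rewrite -/Ac; exists (fun i => lin (row i (row_base Ac))); split=> [i|e|x Ux].
- by apply: subsp_sum => // k _; apply: subspZ.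
- rewrite linM => /HA h; apply: (free _ _ _ (row_base_free Ac)).
  apply/eqP; rewrite -submx0 -(capmx_compl A) sub_capmx h /=.
  by rewrite -/Ac; apply: submx_trans (submxMl _ _) _; rewrite eq_row_base.
have [e We] := h3 _ Ux.
have : (\row_i e i <= A + A^C)%MS by apply: submx_full; exact: addsmx_compl_full.
case/sub_addsmxP=> -[y1 y2] /= ey.
have : (y2 *m Ac <= row_base Ac)%MS by rewrite eq_row_base submxMl.
case/submxP=> y ey2; exists (fun i => y 0 i); rewrite linM (_ : \row_i y 0 i = y); last first.
  by apply/rowP => k; rewrite mxE.
rewrite -ey2; have -> : lin (y2 *m Ac) = lin (\row_i e i) - lin (y1 *m A).
  by have := linP 1 (y1 *m A) (y2 *m Ac); rewrite !scale1r -ey => ->; rewrite addrC addKr.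
rewrite lin_row opprB addrA addrAC; apply: subspD => //; first exact: WV.
by apply/HA; exact: submxMl.
Qed.
End DimQuotient.

(** * The row of weight zero *)

Section WeightZero.
Variables (R : realType) (g : nat) (tau : 'M[CC R]_g).
Local Notation C := (CC R).
Local Notation F := (opfun R g).
Local Notation N := ({set 'I_g.+1} -> F).
Local Notation NC := ({set 'I_g.+1} -> C).
Hypothesis htau : period_matrix tau.
Variable n : nat.
Implicit Types (v : N) (x : NC) (B : {set 'I_g.+1}) (i l : 'I_g) (k : 'rV[int]_g).
Local Notation up i := (lift ord0 i : 'I_g.+1).
Local Notation dl l := (delta_mx 0 l : 'rV[int]_g).

Definition mode k v : NC := fun B => coef (v B) k.
Lemma mode_is_linear k : linear (mode k).
Proof. by move=> a v v'; apply/funext => B; exact: coef_lin. Qed.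
HB.instance Definition _ k := GRing.isLinear.Build C N NC _ (mode k) (mode_is_linear k).

Definition EC i x : NC := eps ord0 (iot (up i) x).
Lemma EC_is_linear i : linear (EC i).
Proof. by move=> a x x'; rewrite /EC !linearP. Qed.
HB.instance Definition _ i := GRing.isLinear.Build C NC NC _ (EC i) (EC_is_linear i).

Lemma EC_Z i a x : EC i (a *: x) = a *: EC i x.
Proof. by have := EC_is_linear i a x 0; rewrite linear0 !addr0. Qed.

Lemma eps0_sq x : eps ord0 (eps ord0 x) = 0.
Proof. by apply/funext => B; rewrite /eps; case: ifP => // _; rewrite !inE eqxx scaler0. Qed.
Lemma EC_EC i j x : EC i (EC j x) = 0.
Proof. by rewrite /EC iot_eps// linearN /= eps0_sq oppr0. Qed.

(** The eigenvalue of T_l on the k-th Fourier mode in weight 0, where no shift takes place. *)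
Definition lam k l : C := ex (bil tau k (dl l)).
Definition DC k l x : NC := (lam k l - 1) *: x + (lam k l * cpi R) *: EC l x.
Lemma DC_is_linear k l : linear (DC k l).
Proof.
move=> a x y; rewrite /DC EC_is_linear; apply/funext => B; move: (EC l x) (EC l y) => x' y'.
rewrite -[LHS]/((lam k l - 1) * (a * x B + y B) + lam k l * cpi R * (a * x' B + y' B)).
rewrite -[RHS]/(a * ((lam k l - 1) * x B + lam k l * cpi R * x' B) + ((lam k l - 1) * y B + lam k l * cpi R * y' B)).
by ring.
Qed.
HB.instance Definition _ k l := GRing.isLinear.Build C NC NC _ (DC k l) (DC_is_linear k l).

Lemma coefO0 k : coef (0 : F) k = 0.
Proof. by have := coef_lin (-1) (0 : F) 0 k; rewrite scaleN1r addNr mulN1r addNr. Qed.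

Lemma coefZ a (h : F) k : coef (a *: h : F) k = a * coef h k.
Proof. by have := coef_lin a h 0 k; rewrite addr0 coefO0 addr0. Qed.

Lemma mode_EO k i v : mode k (EO i v) = EC i (mode k v).
Proof.
apply/funext => B; rewrite /mode /EO /EC /eps /iot.
by case: ifP => _; rewrite ?coefO0// coefZ; case: ifP => _; rewrite ?coefO0// coefZ.
Qed.

Lemma mode_Dtw k l v : grow n v -> mode k (Dtw tau n l v) = DC k l (mode k v).
Proof.
move=> hv; have mT : mode k (Ttw tau n l v) = lam k l *: mode k v.
  apply/funext => B; rewrite -[RHS]/(lam k l * coef (v B) k) /mode /Ttw.
  have [/eqP e|e] := boolP (#|B| == n); last by rewrite hv// linear0 coefO0 mulr0.
  have := tr_coef htau (n%:Z - #|B|%:Z) (dl l) k (opfunP (v B)).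
  by rewrite e subrr scale0r subr0 mul0r mul0r add0r.
rewrite DtwE /tw linearB linearD linearZ /= mode_EO mT linearZ /= /DC.
by rewrite scalerBl scale1r addrAC scalerA mulrC.
Qed.

Definition rowC (j : nat) : set NC := [set x | forall B, #|B| != j -> x B = 0].
Lemma rowC_mod j : submod (rowC j).
Proof.
split=> [B _ //|a x y hx hy B Bj].
by rewrite -[LHS]/(a *: x B + y B) hx// hy// scaler0 addr0.
Qed.
Lemma rowC_EC j i x : rowC j x -> rowC j (EC i x).
Proof.
move=> hx B Bj; rewrite /EC /eps; case: ifP => // oB; rewrite /iot !inE.
case: ifP => [|/= iB]; first by rewrite scaler0.
rewrite hx ?scaler0//; by rewrite EO_card// iB.
Qed.
Lemma mode_row k j v : grow j v -> rowC j (mode k v).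
Proof. by move=> hv B Bj; rewrite /mode hv// coefO0. Qed.

(** The inverse of a + b E is 1/a - (b/a^2) E, as [EC i] squares to zero. *)
Definition DInv k i x : NC := (lam k i - 1)^-1 *: x - ((lam k i - 1) ^- 2 * (lam k i * cpi R)) *: EC i x.
Lemma Inv_is_linear k i : linear (DInv k i).
Proof.
move=> a x y; rewrite /DInv EC_is_linear; apply/funext => B; move: (EC i x) (EC i y) => x' y'.
move: (lam k i - 1)^-1 ((lam k i - 1) ^- 2 * (lam k i * cpi R)) => p q.
rewrite -[LHS]/(p * (a * x B + y B) - q * (a * x' B + y' B)).
rewrite -[RHS]/(a * (p * x B - q * x' B) + (p * y B - q * y' B)).
by ring.
Qed.
HB.instance Definition _ k i := GRing.isLinear.Build C NC NC _ (DInv k i) (Inv_is_linear k i).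

Lemma EC_Inv k i l x : EC l (DInv k i x) = (lam k i - 1)^-1 *: EC l x.
Proof.
rewrite /DInv; move: (lam k i - 1)^-1 ((lam k i - 1) ^- 2 * (lam k i * cpi R)) => p q.
have -> : p *: x - q *: EC i x = (- q) *: EC i x + p *: x by rewrite addrC scaleNr.
by rewrite EC_is_linear EC_EC scaler0 add0r EC_Z.
Qed.

Lemma DC_Inv k i x : lam k i != 1 -> DC k i (DInv k i x) = x.
Proof.
rewrite -subr_eq0 => m0; have e := EC_Inv k i i x.
rewrite /DC e; apply/funext => B; rewrite /DInv; move: (EC i x) => x1; move: (lam k i) m0 => p m0.
rewrite -[LHS]/((p - 1) * ((p - 1)^-1 * x B - (p - 1) ^- 2 * (p * cpi R) * x1 B) + p * cpi R * ((p - 1)^-1 * x1 B)).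
by field.
Qed.
Lemma Inv_DC k i l x : DInv k i (DC k l x) = DC k l (DInv k i x).
Proof.
have e : EC i (DC k l x) = (lam k l - 1) *: EC i x.
  by rewrite /DC EC_is_linear EC_Z EC_EC scaler0 addr0.
have e' := EC_Inv k i l x.
rewrite {1}/DInv [RHS]/DC e e'; apply/funext => B; rewrite /DC /DInv.
move: (EC i x) (EC l x) => x1 x2; move: (lam k i - 1)^-1 ((lam k i - 1) ^- 2 * (lam k i * cpi R)) (lam k l) => p q r.
rewrite -[LHS]/(p * ((r - 1) * x B + r * cpi R * x2 B) - q * ((r - 1) * x1 B)).
rewrite -[RHS]/((r - 1) * (p * x B - q * x1 B) + r * cpi R * (p * x2 B)).
by ring.
Qed.

Lemma im_bil_delta k i : im (bil tau k (dl i)) = \sum_j (k 0 j)%:~R * im_form tau j i.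
Proof.
rewrite /bil im_sum; apply: eq_bigr => j _; rewrite (bigD1 i)//= big1 ?addr0 => [|l li].
  by rewrite !mxE !eqxx mulr1 imM -rc_int re_rc im_rc mul0r addr0.
by rewrite !mxE eqxx /= (negbTE li) mulr0.
Qed.

(* If all the lam k i are close to 1 in modulus, then Im tau applied to k is small,
   contradicting positivity as k is integral. *)
Lemma lam_gap : exists2 rho : R, 0 < rho & forall k, k != 0 -> exists i, rho <= nm (lam k i - 1).
Proof.
have [d [u [d0 u1 ul Q [K K0 HK]]]] := chol_tau htau.
pose S := \sum_i (d i)^-1; pose dm := (1 + S)^-1.
have S0 : 0 <= S by apply: sumr_ge0 => i _; rewrite invr_ge0 ltW.
have dm0 : 0 < dm by rewrite invr_gt0; lra.
have dmi i : dm <= d i.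
  rewrite /dm -[d i]invrK lef_pV2 ?posrE ?invr_gt0//; last by lra.
  by rewrite /S (bigD1 i)//=; have : 0 <= \sum_(j | j != i) (d j)^-1; [apply: sumr_ge0 => j _; rewrite invr_ge0 ltW|lra].
pose G : R := g%:R; have G0 : 0 <= G by [].
(* The constant that the chain of estimates [h1] to [h5] produces; [r0] is chosen with [r0 * T < dm]
   to contradict them. *)
pose T := K ^+ 2 * G ^+ 3; have T0 : 0 <= T by rewrite mulr_ge0 ?exprn_ge0.
pose r0 := dm / (2 * (1 + T)); have r00 : 0 < r0 by rewrite divr_gt0//; lra.
have r0T : r0 * T < dm.
  have : r0 * (2 * (1 + T)) = dm by rewrite divfK// lt0r_neq0//; lra.
  by have : 0 <= r0 * T by [rewrite mulr_ge0// ltW]; lra.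
pose a := 2 * pi * r0; have a0 : 0 < a by rewrite /a mulr_gt0// mulr_gt0// pi_gt0.
exists (1 - expR (- a)); first by rewrite subr_gt0 -expR0 ltr_expR oppr_lt0.
move=> k k0; pose y i := \sum_j (k 0 j)%:~R * im_form tau j i.
have [i yi] : exists i, r0 <= `|y i|.
  apply: contrapT => /forallNP H.
  have {}H i : `|y i| <= r0 by rewrite ltW// ltNge; apply/negP/H.
  have [j kj] : exists j, k 0 j != 0.
    apply: contrapT => /forallNP h; move/eqP: k0; apply; apply/rowP => j; rewrite mxE.
    by apply/eqP/negPn/negP/h.
  have kj1 : 1 <= `|(k 0 j)%:~R| :> R by rewrite -intr_norm ler1z; have := kj; rewrite -normr_gt0; lia.
  (* The largest form dominates all coordinates of k, one of which is at least 1 in absolute value;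
     the quadratic form is bounded below by its square and above by [r0] times its first power. *)
  pose L i := `|lf u (kreal R k) i|; pose j0 := [arg max_(i > j) L i]%O.
  have Ls i : L i <= L j0 by rewrite /j0; case: arg_maxP => // i0 _; apply.
  have sL : \sum_i L i <= G * L j0.
    by rewrite /G mulr_natl -[X in _ *+ X](card_ord g) -sumr_const; apply: ler_sum.
  have L0 : 0 <= L j0 by exact: normr_ge0.
  have h1 : 1 <= K * (G * L j0).
    apply: le_trans kj1 _; apply: le_trans (HK (kreal R k) j) _.
    by rewrite ler_wpM2l.
  have h2 : dm * L j0 ^+ 2 <= qf (im_form tau) (kreal R k).
    rewrite Q (bigD1 j0)//=; apply: (@le_trans _ _ (d j0 * lf u (kreal R k) j0 ^+ 2)).
      by rewrite /L real_normK ?num_real// ler_wpM2r ?sqr_ge0.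
    by rewrite lerDl sumr_ge0// => i _; rewrite mulr_ge0 ?sqr_ge0// ltW.
  have h3 : qf (im_form tau) (kreal R k) <= r0 * (G * (K * (G * L j0))).
    have -> : qf (im_form tau) (kreal R k) = \sum_i (k 0 i)%:~R * y i.
      rewrite /qf exchange_big; apply: eq_bigr => i _; rewrite mulr_sumr; apply: eq_bigr => i' _.
      by rewrite /kreal; ring.
    rewrite {1}/G mulr_natl -[X in _ *+ X](card_ord g) -sumr_const mulr_sumr.
    apply: ler_sum => i _; apply: le_trans (ler_norm _) _; rewrite normrM mulrC.
    apply: ler_pM => //; apply: le_trans (HK (kreal R k) i) _.
    by rewrite ler_wpM2l.
  have h4 : dm * L j0 <= r0 * (K * G ^+ 2).
    have Lp : 0 < L j0.
      rewrite lt_neqAle L0 andbT; apply/eqP => e; move: h1; rewrite -e !mulr0; lra.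
    have := le_trans h2 h3; have -> : dm * L j0 ^+ 2 = dm * L j0 * L j0 by rewrite expr2 mulrA.
    have -> : r0 * (G * (K * (G * L j0))) = r0 * (K * G ^+ 2) * L j0 by ring.
    by rewrite ler_pM2r.
  have KG : 0 <= K * G by exact: mulr_ge0.
  have h5 : K * G * (dm * L j0) <= r0 * T.
    by apply: le_trans (ler_wpM2l KG h4) _; rewrite le_eqVlt /T; apply/orP; left; apply/eqP; ring.
  have h6 : dm * 1 <= dm * (K * (G * L j0)) by rewrite ler_pM2l.
  have e : dm * (K * (G * L j0)) = K * G * (dm * L j0) by ring.
  lra.
exists i; have nl : nm (lam k i) = expR (- (2 * pi * y i)) by rewrite nm_ex im_bil_delta.
have := ler_nmB (lam k i) 1; rewrite nm1 nl; apply: le_trans.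
have e1 := expR_ge1Dx a; have e2 := expR_gt0 a.
have ea : expR a - 1 >= 1 - expR (- a).
  rewrite expRN; set z := expR a in e2 *.
  have : 0 <= (z - 1) ^+ 2 / z by rewrite divr_ge0 ?sqr_ge0// ltW.
  have -> : (z - 1) ^+ 2 / z = z - 2 + z^-1 by field; rewrite lt0r_neq0.
  lra.
have p2 : 0 < 2 * pi :> R by rewrite mulr_gt0// pi_gt0.
move: yi; rewrite ler_normr => /orP[h|h].
  have : expR (- (2 * pi * y i)) <= expR (- a) by rewrite ler_expR lerN2 ler_pM2l.
  rewrite distrC; move=> h'; apply: le_trans _ (ler_norm _); lra.
have : expR a <= expR (- (2 * pi * y i)) by rewrite ler_expR -mulrN ler_pM2l.
by move=> h'; apply: le_trans _ (ler_norm _); lra.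
Qed.

End WeightZero.

(** * Injectivity of a Lefschetz operator *)

Section Lefschetz.
Variables (K : numFieldType) (g : nat).
Local Notation NC := ({set 'I_g.+1} -> K^o).
Local Notation form := ({set 'I_g} -> NC).
Implicit Types (u : form) (B : {set 'I_g.+1}) (i l : 'I_g) (S : {set 'I_g}).
Local Notation up i := (lift ord0 i : 'I_g.+1).

(* The wedge with the canonical bivector; with [lam_op] it generates an action of sl_2. *)
Definition lef u : form := \sum_l eps l (cw (iot (up l)) u).
Definition lam_op u : form := \sum_l iot l (cw (eps (up l)) u).
Lemma lef_is_linear : linear lef.
Proof. by move=> a u v; rewrite /lef scaler_sumr -big_split; apply: eq_bigr => b _ /=; rewrite !linearP. Qed.
HB.instance Definition _ := GRing.isLinear.Build K form form _ lef lef_is_linear.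
Lemma lam_op_is_linear : linear lam_op.
Proof. by move=> a u v; rewrite /lam_op scaler_sumr -big_split; apply: eq_bigr => b _ /=; rewrite !linearP. Qed.
HB.instance Definition _ := GRing.isLinear.Build K form form _ lam_op lam_op_is_linear.

(** Terms with distinct indices cancel by anticommutation. What remains are number operators, which
    count the [up l] in B and the elements of S. *)
Lemma lef_comm u : lam_op (lef u) - lef (lam_op u) =
  \sum_l (cw (fun x => eps (up l) (iot (up l) x)) u - eps l (iot l u)).
Proof.
have e1 : lam_op (lef u) = \sum_l \sum_m iot l (eps m (cw (eps (up l)) (cw (iot (up m)) u))).
  apply: eq_bigr => l _; rewrite /lef !linear_sum /=; apply: eq_bigr => m _.
  by rewrite cw_eps.
have e2 : lef (lam_op u) = \sum_l \sum_m eps m (iot l (cw (iot (up m)) (cw (eps (up l)) u))).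
  rewrite exchange_big; apply: eq_bigr => m _; rewrite /lam_op !linear_sum /=.
  by apply: eq_bigr => l _; rewrite cw_iot.
rewrite e1 e2 -sumrB; apply: eq_bigr => l _; rewrite -sumrB (bigD1 l)//= big1 ?addr0; last first.
  move=> m ml; rewrite iot_eps 1?eq_sym//.
  have -> : cw (eps (up l)) (cw (iot (up m)) u) = - cw (iot (up m)) (cw (eps (up l)) u).
    apply/funext => S; rewrite -[RHS]/(- (iot (up m) (eps (up l) (u S)))) iot_eps ?opprK//.
  by rewrite !linearN opprK subrr.
have h u' := iot_eps_id l u'; set X := cw (eps _) (cw (iot _) u).
have -> : cw (iot (up l)) (cw (eps (up l)) u) = u - X.
  by apply/funext => S; have := iot_eps_id (up l) (u S) => e; rewrite -[RHS]/(u S - X S) -{1}e addrK.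
have -> : cw (fun x => eps (up l) (iot (up l) x)) u = X by [].
have e3 : eps l (iot l (u - X)) = eps l (iot l u) - eps l (iot l X) by rewrite !linearB.
by rewrite e3 -[in RHS](h X) opprB addrA.
Qed.

Lemma eps_iotE m (V : lmodType K) (l : 'I_m) (w : {set 'I_m} -> V) (S : {set 'I_m}) : eps l (iot l w) S = if l \in S then w S else 0.
Proof.
rewrite /eps; case: ifP => // lS; rewrite /iot !inE eqxx /= sgDi scalerA sg_sq scale1r.
by rewrite finset.setD1K.
Qed.

Lemma lef_commE u S B : ord0 \notin B ->
  (lam_op (lef u) - lef (lam_op u)) S B = (#|B|%:R - #|S|%:R) * u S B.
Proof.
move=> oB; rewrite lef_comm.
rewrite (big_morph (fun w : form => w S B) (id1 := 0) (op1 := +%R))//.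
transitivity (\sum_l (((up l \in B)%:R - (l \in S)%:R) * u S B)).
  apply: eq_bigr => l _; rewrite -[LHS]/(eps (up l) (iot (up l) (u S)) B - eps l (iot l u) S B).
  rewrite !eps_iotE; case: (up l \in B); case: (l \in S); rewrite ?mulrBl ?mul1r ?mul0r//.
rewrite -mulr_suml sumrB; congr ((_ - _) * _).
  rewrite -natr_sum; congr (_%:R); rewrite -sum1_card [RHS]big_mkcond [RHS]big_ord_recl /= (negbTE oB) add0n.
  by apply: eq_bigr => l _; case: (_ \in _).
rewrite -natr_sum; congr (_%:R); rewrite -sum1_card [RHS]big_mkcond.
by apply: eq_bigr => l _; case: (_ \in _).
Qed.

Definition bideg q p u := forall S B, ~~ [&& #|S| == q, #|B| == p & ord0 \notin B] -> u S B = 0.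

Lemma lam_opE u S B : lam_op u S B = \sum_l if (l \notin S) && (up l \in B)
  then sg K l S * (sg K (up l) B * u (l |: S) (B :\ up l)) else 0.
Proof.
rewrite /lam_op (big_morph (fun w : form => w S B) (id1 := 0) (op1 := +%R))//.
apply: eq_bigr => l _; rewrite /iot; case: ifP => //= lS.
by rewrite -[LHS]/(sg K l S * eps (up l) (u (l |: S)) B) /eps; case: ifP => //; rewrite mulr0.
Qed.

Lemma lam_op_bideg q p u : bideg q.+1 p u -> bideg q p.+1 (lam_op u).
Proof.
move=> hu S B h; rewrite lam_opE big1// => l _; case: ifP => // /andP[lS lB].
rewrite hu ?mulr0//; apply: contra h; rewrite cardsU1 lS add1n eqSS.
by rewrite (cardsD1 (up l) B) lB eqSS !inE.
Qed.
Lemma lam_op_bideg0 p u : bideg 0 p u -> lam_op u = 0.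
Proof.
move=> hu; apply/funext => S; apply/funext => B; rewrite lam_opE big1// => l _; case: ifP => // /andP[lS lB].
by rewrite hu ?mulr0// cardsU1 lS.
Qed.

Lemma bideg_commE q p u : bideg q p u -> lam_op (lef u) - lef (lam_op u) = (p%:R - q%:R) *: u.
Proof.
move=> hu; apply/funext => S; apply/funext => B.
rewrite -[RHS]/((p%:R - q%:R) * u S B).
have [/and3P[/eqP <- /eqP <- oB]|h] := boolP [&& #|S| == q, #|B| == p & ord0 \notin B].
  exact: lef_commE.
rewrite (hu S B h) mulr0; have [oB|oB] := boolP (ord0 \in B); last by rewrite lef_commE// hu// mulr0.
rewrite lef_comm (big_morph (fun w : form => w S B) (id1 := 0) (op1 := +%R))// big1// => l _.
rewrite -[LHS]/(eps (up l) (iot (up l) (u S)) B - eps l (iot l u) S B) !eps_iotE.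
have -> : (if l \in S then u S else 0) B = 0 by case: ifP => // _; exact: hu.
by rewrite hu// if_same subr0.
Qed.

(** [lef] raises q and lowers p. After duality in the second factor the total degree is q + g - p,
    so q < p means below the middle degree. Repeated application of [lam_op] ends in 0, and [lef]
    brings each iterate back to a non-zero multiple of the previous one. *)
Lemma lef_inj q p u : (q < p)%N -> bideg q p u -> lef u = 0 -> u = 0.
Proof.
move=> qp hu u0; pose v k := iter k lam_op u.
have bv k : (k <= q)%N -> bideg (q - k)%N (p + k)%N (v k).
  elim: k => [|k IH] kq; first by rewrite subn0 addn0.
  by rewrite addnS /v iterS; apply: lam_op_bideg; rewrite -subSn//; apply: IH; exact: ltnW.
(* The sum of the weights p - q + 2 i of the iterates [v i] for i <= k; positive because q < p. *)
pose c k : K := k.+1%:R * (p%:R - q%:R) + (k.+1 * k)%:R.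
have lv k : (k <= q)%N -> lef (v k.+1) = - (c k *: v k).
  elim: k => [|k IH] kq.
    have := bideg_commE (bv 0%N kq); rewrite u0 linear0 sub0r subn0 addn0 => e.
    by rewrite -[LHS]opprK [v 1%N]iterS e /c mul1r mul1n addr0.
  have := bideg_commE (bv k.+1 kq); rewrite IH ?(ltnW kq)// linearN linearZ /= => e.
  move: e; rewrite /= -/(v k); move: (lam_op (v k)) => y; move: (lef (lam_op y)) => z e.
  have {}e : - z = ((p + k.+1)%:R - (q - k.+1)%:R + c k) *: y.
    by rewrite scalerDl -e addrAC addNr add0r.
  rewrite -[LHS]opprK e; congr (- (_ *: _)); rewrite /c natrB// !natrM !natrD -[in k.+2%:R]addn1 natrD.
  by rewrite -[in k.+1%:R]addn1 natrD; ring.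
have c0 k : c k != 0.
  rewrite /c -natrB ?(ltnW qp)// -natrM -natrD pnatr_eq0 -lt0n addn_gt0 muln_gt0 /= subn_gt0 qp.
  by [].
have vq : v q.+1 = 0.
  by have := bv q (leqnn q); rewrite subnn => h; exact: lam_op_bideg0 h.
have vk k : (k <= q)%N -> v (q - k)%N = 0.
  elim: k => [|k IH] kq.
    rewrite subn0; have := lv q (leqnn q); rewrite vq linear0 => /eqP.
    by rewrite eq_sym oppr_eq0 scaler_eq0 (negbTE (c0 q)) => /eqP.
  have := lv (q - k.+1)%N (leq_subr _ _); rewrite -subSn// subSS (IH (ltnW kq)) linear0 => /eqP.
  by rewrite eq_sym oppr_eq0 scaler_eq0 (negbTE (c0 _)) => /eqP.
by have := vk q (leqnn q); rewrite subnn.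
Qed.

End Lefschetz.

(** * Weight zero: the non-constant Fourier modes *)

Section RowZero.
Variables (R : realType) (g : nat) (tau : 'M[CC R]_g).
Local Notation C := (CC R).
Local Notation F := (opfun R g).
Local Notation N := ({set 'I_g.+1} -> F).
Local Notation NC := ({set 'I_g.+1} -> C).
Hypothesis htau : period_matrix tau.
Variable n : nat.
Implicit Types (v : N) (x : NC) (B : {set 'I_g.+1}) (i l : 'I_g) (k : 'rV[int]_g) (S : {set 'I_g}).
Local Notation up i := (lift ord0 i : 'I_g.+1).

Definition DCl k i : {linear NC -> NC} := DC tau k i.
Definition modes k (w : {set 'I_g} -> N) : {set 'I_g} -> NC := fun S => mode k (w S).

Lemma modes_dG k (w : {set 'I_g} -> N) : coefs (@grow R g n) w -> modes k (dG tau n w) = kz (DCl k) (modes k w).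
Proof.
move=> cw'; apply: (kz_transfer (X := @grow R g n)) => // i v hv.
exact: mode_Dtw.
Qed.

Lemma mode_exact k i (w : {set 'I_g} -> NC) : lam tau k i != 1 -> kz (DCl k) w = 0 ->
  kz (DCl k) (iot i (cw (DInv tau k i) w)) = w.
Proof.
move=> li kw; have h := kz_iot (DCl k) i (cw (DInv tau k i) w).
have e : kz (DCl k) (cw (DInv tau k i) w) = 0.
  have e' := @kz_transfer _ _ _ _ (DCl k) (DCl k) (DInv tau k i) setT w.
  rewrite -e'//; last by move=> l x _; exact: Inv_DC.
  by apply/funext => S; rewrite kw linear0.
move: h; rewrite e linear0 addr0 => ->.
by apply/funext => S; rewrite /cw /= DC_Inv.
Qed.

Lemma nm_sg m (b : 'I_m) (B : {set 'I_m}) : nm (sg C b B) = 1.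
Proof. by rewrite /sg nmX nmN nm1 expr1n. Qed.

Lemma nm_EC i x B : nm (EC i x B) <= \sum_B' nm (x B').
Proof.
have h : 0 <= \sum_B' nm (x B') by apply: sumr_ge0 => B' _; exact: nm_ge0.
rewrite /EC /eps; case: ifP => _; last by rewrite nm0.
rewrite /iot; case: ifP => _; first by rewrite scaler0 nm0.
rewrite nmM nm_sg nmM nm_sg !mul1r (bigD1 (up i |: B :\ ord0))//= lerDl.
by apply: sumr_ge0 => B' _; exact: nm_ge0.
Qed.

Lemma nm_Inv k i x B (rho : R) : 0 < rho -> rho <= nm (lam tau k i - 1) ->
  nm (DInv tau k i x B) <= (rho^-1 + (rho^-1 + rho^-1 ^+ 2) * nm (cpi R)) * \sum_B' nm (x B').
Proof.
move=> r0 rl; set p := lam tau k i; have p0 : p - 1 != 0.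
  by apply: contraTneq rl => ->; rewrite nm0 -ltNge.
have ip : nm (p - 1)^-1 <= rho^-1 by rewrite nmV lef_pV2// posrE ?nm_gt0.
have hX : nm (x B) <= \sum_B' nm (x B').
  by rewrite (bigD1 B)//= lerDl; apply: sumr_ge0 => B' _; exact: nm_ge0.
have hE := nm_EC i x B.
have -> : DInv tau k i x B = (p - 1)^-1 * x B - ((p - 1)^-1 + (p - 1)^-1 ^+ 2) * cpi R * EC i x B.
  rewrite /DInv -/p; move: (EC i x) => x1.
  rewrite -[LHS]/((p - 1)^-1 * x B - (p - 1) ^- 2 * (p * cpi R) * x1 B).
  by field.
apply: le_trans (nmB _ _) _; rewrite !nmM mulrDl lerD//.
  by apply: ler_pM => //; exact: nm_ge0.
apply: ler_pM => //; rewrite ?mulr_ge0 ?nm_ge0//.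
rewrite ler_wpM2r ?nm_ge0//; apply: le_trans (nmD _ _) _; rewrite lerD//.
by rewrite nmX lerXn2r// nnegrE ?nm_ge0// invr_ge0 ltW.
Qed.

(** Each mode k != 0 has a primitive given by contraction with an index i at which [lam k i] is far
    from 1. The gap is uniform in k, so the primitives decay like w and reassemble to entire
    functions. *)
Lemma row0_exact q (w : {set 'I_g} -> N) : PP q n w -> dG tau n w = 0 -> modes 0 w = 0 ->
  exists2 v, Pm (@PP R g) q n v & dG tau n v = w.
Proof.
move=> [dw cw'] kw w0; have [rho r0 Hr] := lam_gap htau.
pose M := rho^-1 + (rho^-1 + rho^-1 ^+ 2) * nm (cpi R).
have M0 : 0 <= M.
  by rewrite addr_ge0 ?mulr_ge0 ?addr_ge0 ?exprn_ge0 ?nm_ge0// invr_ge0 ltW.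
have /choice[vk Hk] : forall k, exists vk : {set 'I_g} -> NC,
    [/\ pdeg q vk, coefs (@rowC R g n) vk, kz (DCl k) vk = modes k w &
     forall S B, nm (vk S B) <= M * \sum_S' \sum_B' nm (coef (w S' B') k)].
  move=> k; have SS0 : 0 <= \sum_S' \sum_B' nm (coef (w S' B') k).
    by apply: sumr_ge0 => S' _; apply: sumr_ge0 => B' _; exact: nm_ge0.
  have [k0|k0] := eqVneq k 0.
    exists 0; split=> [//|S||S B]; first exact: (@rowC_mod R g n).1.
      by rewrite linear0 k0 w0.
    by rewrite nm0 mulr_ge0.
  have [i hi] := Hr k k0; have li : lam tau k i != 1.
    by apply: contraTneq hi => ->; rewrite subrr nm0 -ltNge.
  have dm : deg q (modes k w) by move=> S Sq; rewrite /modes dw// linear0.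
  have cm' : coefs (@rowC R g n) (modes k w) by move=> S; exact: mode_row.
  exists (iot i (cw (DInv tau k i) (modes k w))); split.
  - by apply: deg_iot => S Sq; rewrite /cw dm// linear0.
  - apply: coefs_iot; first exact: rowC_mod.
    move=> S; rewrite /cw /DInv addrC -scaleNr; apply: (@rowC_mod R g n).2.
      exact/rowC_EC/cm'.
    rewrite -[_ *: _]addr0; apply: (@rowC_mod R g n).2; [exact: cm'|exact: (@rowC_mod R g n).1].
  - by apply: mode_exact => //; rewrite -modes_dG// kw; apply/funext => S; rewrite /modes linear0.
  move=> S B; rewrite /iot; case: ifP => _; first by rewrite nm0 mulr_ge0.
  rewrite nmM nm_sg mul1r /cw; apply: le_trans (nm_Inv _ _ r0 hi) _.
  rewrite ler_wpM2l// (bigD1 (i |: S))//= lerDl.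
  by apply: sumr_ge0 => S' _; apply: sumr_ge0 => B' _; exact: nm_ge0.
have dec S B : decay (fun k => vk k S B).
  move=> A0; have h S' B' := coef_decay (opfunP (w S' B')) A0.
  have /choice[m1 H1] : forall S', exists m1 : {set 'I_g.+1} -> R, forall B' k, nm (coef (w S' B') k) <= m1 B' * expR (- (A0 * l1 R k)).
    by move=> S'; have [f Hf] := choice (h S'); exists f.
  exists (M * \sum_S' \sum_B' m1 S' B') => k; have [_ _ _ h'] := Hk k.
  apply: le_trans (h' S B) _; rewrite -mulrA ler_wpM2l// mulr_suml.
  by apply: ler_sum => S' _; rewrite mulr_suml; apply: ler_sum => B' _; exact: H1.
pose v : {set 'I_g} -> N := fun S B => opf (OP_ev (dec S B)).
have mv k : modes k v = vk k.
  by apply/funext => S; apply/funext => B; exact: (coef_ev k (dec S B)).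
have zero (h : F) : (forall k, coef h k = 0) -> h = 0.
  by move=> h0; apply: opfun_coef => k; rewrite h0 coefO0.
have dv : pdeg q v.
  move=> S Sq; apply/funext => B; apply: zero => k; rewrite -[LHS]/(modes k v S B) mv.
  by have [h1 _ _ _] := Hk k; rewrite h1.
have cv : coefs (@grow R g n) v.
  move=> S B Bn; apply: zero => k; rewrite -[LHS]/(modes k v S B) mv.
  by have [_ h1 _ _] := Hk k; rewrite h1.
have kv : dG tau n v = w.
  apply/funext => S; apply/funext => B; apply: opfun_coef => k.
  rewrite -[LHS]/(modes k (dG tau n v) S B) modes_dG// mv.
  by have [_ _ -> _] := Hk k.
exists v => //; clear -dv cv; case: q dv => [|q] dv; first by apply/funext => S; rewrite dv.
by split=> // S Sq; apply: dv; rewrite eqSS.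
Qed.

End RowZero.

Lemma card_subsets g q : #|[pred S : {set 'I_g} | #|S| == q]| = 'C(g, q).
Proof.
rewrite -[g in RHS]card_ord -cardsT -cards_draws; apply: eq_card => S.
by rewrite !inE finset.subsetT.
Qed.
Lemma card_subsetsN0 g q : #|[pred B : {set 'I_g.+1} | (#|B| == q) && (ord0 \notin B)]| = 'C(g, q).
Proof.
have e : #|finset.setC (finset.set1 (ord0 : 'I_g.+1))| = g by rewrite cardsC1 card_ord.
rewrite -[g in RHS]e -cards_draws; apply: eq_card => S.
by rewrite !inE finset.subsetC finset.sub1set inE andbC.
Qed.
Lemma card_subsets0 g q : (0 < q)%N -> #|[pred B : {set 'I_g.+1} | (#|B| == q) && (ord0 \in B)]| = 'C(g, q.-1).
Proof.
case: q => // q _; have := binS g q; rewrite -(card_subsets g.+1) -(card_subsetsN0 g q.+1) /=.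
move/eqP; rewrite -(cardID [pred B : {set 'I_g.+1} | ord0 \in B]) addnC.
have e1 : #|[predI [pred S : {set 'I_g.+1} | #|S| == q.+1] & [pred B : {set 'I_g.+1} | ord0 \in B]]| =
  #|[pred B : {set 'I_g.+1} | (#|B| == q.+1) && (ord0 \in B)]| by apply: eq_card => B; rewrite !inE.
have e2 : #|[predD [pred S : {set 'I_g.+1} | #|S| == q.+1] & [pred B : {set 'I_g.+1} | ord0 \in B]]| =
  #|[pred B : {set 'I_g.+1} | (#|B| == q.+1) && (ord0 \notin B)]|.
  by apply: eq_card => B; rewrite !inE andbC.
by rewrite e1 e2 eqn_add2l => /eqP.
Qed.

(** The model space in all dimension counts: functions on a finite set of pairs of indices. *)
Lemma supp_dim (K : fieldType) (T1 T2 : finType) (P : pred (T1 * T2)) :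
  dim_quotient (E := T1 -> T2 -> K^o) [set w | forall a b, ~~ P (a, b) -> w a b = 0] [set 0] #|P|.
Proof.
rewrite -card_sig.
pose v (x : {x | P x}) : T1 -> T2 -> K^o := fun a b => ((a, b) == val x)%:R.
have vE (c : {x | P x} -> K) a b : (\sum_x c x *: v x) a b = \sum_x c x * ((a, b) == val x)%:R.
  rewrite (big_morph (fun w : T1 -> T2 -> K^o => w a b) (id1 := 0) (op1 := +%R))//.
have vE1 (c : {x | P x} -> K) a b (h : P (a, b)) : (\sum_x c x *: v x) a b = c (exist _ (a, b) h).
  rewrite vE (bigD1 (exist _ (a, b) h))//= eqxx mulr1 big1 ?addr0// => y.
  by rewrite -val_eqE /= eq_sym => /negbTE ->; rewrite mulr0.
apply: (dq_fin (v := v)) => [x a b h|c e [[a b] h]|w hw].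
- by rewrite /v; case: eqP => // e; move: h; rewrite e (valP x).
- by rewrite -vE1 (_ : \sum_x c x *: v x = 0).
exists (fun x => w (val x).1 (val x).2); rewrite /=; apply/funext => a; apply/funext => b.
set s := \sum_x _; rewrite -[LHS]/(w a b - s a b); have [h|h] := boolP (P (a, b)).
  by rewrite /s vE1 subrr.
rewrite hw// /s vE big1 ?subrr// => -[[a' b'] h'] _ /=.
by case: eqP => [e|_]; [move: h; rewrite e h'|rewrite mulr0].
Qed.

(** * Weight zero: the constant mode *)

Section ConstCohomology.
Variables (K : numFieldType) (g n : nat).
Hypothesis n0 : (0 < n)%N.
Local Notation NC := ({set 'I_g.+1} -> K^o).
Local Notation form := ({set 'I_g} -> NC).
Implicit Types (u v w : form) (B : {set 'I_g.+1}) (i l : 'I_g) (S : {set 'I_g}).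
Local Notation up i := (lift ord0 i : 'I_g.+1).

Definition formC q w := forall S B, ~~ ((#|S| == q) && (#|B| == n)) -> w S B = 0.
(** The differential of the row n on constants, up to the factor [cpi] ([kz_DC0]): for k = 0 all
    eigenvalues are 1 and only the nilpotent part of the twist survives. *)
Definition dC w : form := cw (eps ord0) (lef w).
Lemma dC_is_linear : linear dC.
Proof. by move=> a u v; rewrite /dC lef_is_linear; exact: cw_is_linear. Qed.
HB.instance Definition _ := GRing.isLinear.Build K form form _ dC dC_is_linear.

Lemma dC_Z a u : dC (a *: u) = a *: dC u.
Proof. by have := dC_is_linear a u 0; rewrite linear0 !addr0. Qed.

Lemma lefE u S B : lef u S B = \sum_l if (l \in S) && (up l \notin B)
  then sg K l S * (sg K (up l) B * u (S :\ l) (up l |: B)) else 0.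
Proof.
rewrite /lef (big_morph (fun w : form => w S B) (id1 := 0) (op1 := +%R))//.
apply: eq_bigr => l _; rewrite /eps; case: ifP => //= lS.
by rewrite -[LHS]/(sg K l S * iot (up l) (u (S :\ l)) B) /iot; case: ifP => //; rewrite mulr0.
Qed.
Lemma lef_restr u v S B : (forall S' B', ord0 \notin B' -> u S' B' = v S' B') -> ord0 \notin B -> lef u S B = lef v S B.
Proof.
by move=> e oB; rewrite !lefE; apply: eq_bigr => l _; case: ifP => // _; rewrite e// !inE (negbTE oB).
Qed.
Lemma lef_restr0 u S B : (forall S' B', ord0 \in B' -> u S' B' = 0) -> ord0 \in B -> lef u S B = 0.
Proof.
move=> e oB; rewrite lefE big1// => l _; case: ifP => // _.
by rewrite e ?mulr0// !inE oB orbT.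
Qed.

Lemma dCE w S B : dC w S B = if ord0 \in B then sg K ord0 B * lef w S (B :\ ord0) else 0.
Proof. by rewrite /dC /cw /eps; case: ifP. Qed.

(** The part of w without [ord0] has bidegree (q, n), to which [lef_inj] applies as q < n; the
    operator [eps ord0] does not lose information on it. *)
Lemma dC_inj q w : (q < n)%N -> formC q w -> dC w = 0 -> forall S B, ord0 \notin B -> w S B = 0.
Proof.
move=> qn hw dw; pose w' : form := fun S B => if ord0 \in B then 0 else w S B.
have bw : bideg q n w'.
  move=> S B h; rewrite /w'; case: ifP => // oB; apply: hw; apply: contra h => /andP[-> ->].
  by rewrite oB.
suff w0 : w' = 0.
  by move=> S B oB; have := congr1 (fun f : form => f S B) w0; rewrite /w' (negbTE oB).
apply: (lef_inj qn bw); apply/funext => S; apply/funext => B.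
have [oB|oB] := boolP (ord0 \in B).
  by apply: lef_restr0 => // S' B' h; rewrite /w' h.
rewrite (@lef_restr w' w)//; last by move=> S' B' h; rewrite /w' (negbTE h).
have := congr1 (fun f : form => f S (ord0 |: B)) dw; rewrite dCE !inE eqxx /= finset.setU1K//.
by move/eqP; rewrite mulf_eq0 /sg signr_eq0 => /eqP.
Qed.

Lemma dC_closed w : (forall S B, ord0 \notin B -> w S B = 0) -> dC w = 0.
Proof.
move=> h; apply/funext => S; apply/funext => B; rewrite dCE; case: ifP => // oB.
rewrite (@lef_restr w 0) ?setD11//; by rewrite linear0 mulr0.
Qed.

Lemma dC_form q w : formC q w -> formC q.+1 (dC w).
Proof.
move=> hw S B h; rewrite dCE; case: ifP => // oB; rewrite lefE big1 ?mulr0// => l _.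
case: ifP => // /andP[lS lB]; rewrite hw ?mulr0//; apply: contra h => /andP[/eqP <- /eqP <-].
rewrite (cardsD1 l S) lS eqxx /=; apply/eqP; rewrite cardsU1 lB (cardsD1 ord0 B) oB.
by [].
Qed.

Lemma dC_ord0 w S B : ord0 \notin B -> dC w S B = 0.
Proof. by move=> oB; rewrite dCE (negbTE oB). Qed.

Definition closedC q := [set w | formC q w /\ dC w = 0].
Definition exactC q := [set w | if q is q'.+1 then exists2 v, formC q' v & w = dC v else w = 0].

Lemma formC_subsp q : subsp (formC q).
Proof.
split=> [//|a u v hu hv S B h]; rewrite -[LHS]/(a * u S B + v S B) hu// hv//.
by rewrite mulr0 addr0.
Qed.
Lemma closedC_subsp q : subsp (closedC q).
Proof.
split=> [|a u v [hu du] [hv dv]]; first by split; [|rewrite linear0].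
by split; [exact: (formC_subsp q).2|rewrite dC_is_linear du dv scaler0 addr0].
Qed.
Lemma exactC_subsp q : subsp (exactC q).
Proof.
case: q => [|q]; first by split=> [//|a u v /= -> ->]; rewrite scaler0 addr0.
split=> [|a u v [u' hu ->] [v' hv ->]]; first by exists 0; rewrite ?linear0.
by exists (a *: u' + v'); [exact: (formC_subsp q).2|rewrite linearP].
Qed.
Lemma exact_closed q : (q < n)%N -> exactC q `<=` closedC q.
Proof.
case: q => [|q] qn w /=; first by move=> ->; exact: (closedC_subsp 0).1.
by move=> [v hv ->]; split; [exact: dC_form|apply: dC_closed => S B; exact: dC_ord0].
Qed.

Lemma set0_subsp (E : lmodType K) : subsp ([set 0] : set E).
Proof. by split=> [//|a x y /= -> ->]; rewrite scaler0 addr0. Qed.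

(** Below degree n the closed forms are exactly those supported on sets B that contain [ord0]. *)
Lemma closed_dim q : (q < n)%N -> dim_quotient (closedC q) [set 0] ('C(g, q) * 'C(g, n.-1))%N.
Proof.
move=> qn; rewrite -card_subsets -(card_subsets0 _ n0) -cardX.
have := @supp_dim K _ _ [predX [pred S : {set 'I_g} | #|S| == q] & [pred B : {set 'I_g.+1} | (#|B| == n) && (ord0 \in B)]].
rewrite (_ : [set w | _] = closedC q)//; apply/seteqP; split=> [w hw|w [hw dw] S B h].
  split=> [S B h|].
    by apply: hw; apply: contra h; rewrite !inE /= => /andP[-> /andP[-> _]].
  by apply: dC_closed => S B h; apply: hw; rewrite !inE /= (negbTE h) !andbF.
have [oB|oB] := boolP (ord0 \in B); last by apply: dC_inj hw dw _ _ oB.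
by apply: hw; apply: contra h; rewrite !inE /= oB andbT.
Qed.

(** [dC] is injective on the forms without [ord0] and kills the others, so its image is counted by
    the former in one degree less. *)
Lemma exact_dim q : (q < n)%N ->
  dim_quotient (exactC q) [set 0] (if q is q'.+1 then 'C(g, q') * 'C(g, n) else 0)%N.
Proof.
case: q => [|q] qn.
  by exists (fun=> 0); split=> [[]//|c _ []//|x /= ->]; exists (fun=> 0); rewrite big_ord0 subrr.
rewrite -card_subsets -card_subsetsN0 -cardX.
have := @supp_dim K _ _ [predX [pred S : {set 'I_g} | #|S| == q] & [pred B : {set 'I_g.+1} | (#|B| == n) && (ord0 \notin B)]].
set V0 := [set w | _] => hd.
have V0f w : V0 w -> formC q w.
  by move=> hw S B h; apply: hw; apply: contra h; rewrite !inE /= => /andP[-> /andP[-> _]].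
have V00 w S B : V0 w -> ord0 \in B -> w S B = 0.
  by move=> hw h; apply: hw; rewrite !inE /= h !andbF.
apply: (@dq_rel _ _ _ _ _ _ _ (fun x y => x = dC y) _ _ _ _ _ _ _ _ _ hd).
- exact: exactC_subsp.
- exact: set0_subsp.
- by move=> a x y x' y' -> ->; rewrite linearP.
- by rewrite linear0.
- by move=> y /V0f hy; exists (dC y) => //; exists y.
- move=> x [v hv ->]; pose v0 : form := fun S B => if ord0 \in B then 0 else v S B.
  exists v0.
    move=> S B h; rewrite /v0; case: ifP => // oB; apply: hv; apply: contra h.
    by rewrite !inE /= oB andbT.
  apply/subr0_eq; rewrite -linearB; apply: dC_closed => S B h.
  by rewrite -[LHS]/(v S B - v0 S B) /v0 (negbTE h) subrr.
- move=> x y _ Vy ->; split=> [e|->]; last by rewrite /= linear0.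
  apply/funext => S; apply/funext => B; have [oB|oB] := boolP (ord0 \in B); first exact: V00.
  by apply: (dC_inj _ (V0f _ Vy) e S oB); exact: ltnW.
- split=> [//|a u v hu hv S B h]; rewrite -[LHS]/(a * u S B + v S B) hu// hv//.
  by rewrite mulr0 addr0.
Qed.

Lemma const_dim q : (q < n)%N -> exists e, dim_quotient (closedC q) (exactC q) e /\
  ((if q is q'.+1 then 'C(g, q') * 'C(g, n) else 0) + e = 'C(g, q) * 'C(g, n.-1))%N.
Proof.
move=> qn; have h1 := closed_dim qn; have h2 := exact_dim qn.
have h0 : [set 0] `<=` exactC q by move=> x /= ->; exact: (exactC_subsp q).1.
have [a [ac ha hb]] := dq_split (closedC_subsp q) (exactC_subsp q) h0 (exact_closed qn) h1.
have e := dq_uniq (exactC_subsp q) (set0_subsp _) ha h2.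
by exists ('C(g, q) * 'C(g, n.-1) - a)%N; split=> //; rewrite -e subnKC.
Qed.

End ConstCohomology.

(** * Weight zero: the dimension of the cohomology *)

Section RowZeroDim.
Variables (R : realType) (g : nat) (tau : 'M[CC R]_g).
Local Notation C := (CC R).
Local Notation F := (opfun R g).
Local Notation N := ({set 'I_g.+1} -> F).
Local Notation NC := ({set 'I_g.+1} -> C).
Hypothesis htau : period_matrix tau.
Variable n : nat.
Hypothesis n0 : (0 < n)%N.
Implicit Types (w : {set 'I_g} -> N) (x y : {set 'I_g} -> NC) (B : {set 'I_g.+1}) (i l : 'I_g) (S : {set 'I_g}).

Lemma cpi_neq0 : cpi R != 0.
Proof.
apply/eqP => /(congr1 (@nm R)); rewrite /cpi nmN !nmM nm_iC nm_rc nm0 mulr1 => /eqP.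
by rewrite mulf_eq0 normr_eq0 (gt_eqF (pi_gt0 R)) orbF (nm_nat R 2) pnatr_eq0.
Qed.

Lemma lam0 l : lam tau 0 l = 1.
Proof.
rewrite /lam (_ : bil tau 0 _ = 0) ?ex0// /bil big1// => i _; rewrite big1// => j _.
by rewrite mxE !mul0r.
Qed.

Lemma kz_DC0 x : kz (DCl tau 0) x = cpi R *: dC x.
Proof.
have e : dC x = \sum_l eps l (cw (eps ord0) (cw (iot (lift ord0 l)) x)).
  by rewrite /dC /lef linear_sum; apply: eq_bigr => l _; rewrite /= cw_eps.
rewrite e /kz scaler_sumr; apply: eq_bigr => l _; rewrite -linearZ; congr eps.
apply/funext => S; rewrite /cw /= /DC lam0 subrr scale0r add0r mul1r.
by [].
Qed.

Definition const_form x : {set 'I_g} -> N := fun S B => opcst g (x S B).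

Lemma coef_const (c : C) k : coef (opcst g c : F) k = if k == 0 then c else 0.
Proof.
have -> : (opcst g c : 'rV[C]_g -> C) = fun z => c * chi 0 z.
  apply/funext => z; rewrite -[LHS]/c /chi /=.
  by rewrite (_ : dot _ _ = 0) ?ex0 ?mulr1// /dot big1// => i _; rewrite !mxE mul0r.
rewrite coef_scale; last exact: OP_chi.
by rewrite coef_chi eq_sym; case: eqP => _; rewrite ?mulr1 ?mulr0.
Qed.

Lemma modes_const k x : modes k (const_form x) = if k == 0 then x else 0.
Proof.
by apply/funext => S; apply/funext => B; rewrite /modes /mode coef_const; case: ifP.
Qed.

Lemma opcst0 : opcst g 0 = 0 :> F.
Proof. exact: opfun_ext. Qed.

Lemma const_PP q x : formC n q x -> PP q n (const_form x).
Proof.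
move=> h; split=> [S Sq|S B Bn]; last by rewrite /const_form h ?opcst0// (negbTE Bn) andbF.
by apply/funext => B; rewrite /const_form h ?opcst0// (negbTE Sq).
Qed.

Lemma modes_formC q w : PP q n w -> formC n q (modes 0 w).
Proof.
move=> [dw cw'] S B; rewrite negb_and => /orP[h|h]; first by rewrite /modes dw// linear0.
by rewrite /modes /mode cw'// coefO0.
Qed.

Lemma modes_is_linear k : linear (modes (R := R) (g := g) k).
Proof. by move=> a w w'; apply/funext => S; rewrite /modes linearP. Qed.
HB.instance Definition _ k := GRing.isLinear.Build C ({set 'I_g} -> N) ({set 'I_g} -> NC) _ (@modes R g k) (modes_is_linear k).

Lemma const_closed q x : formC n q x -> dC x = 0 -> dG tau n (const_form x) = 0.
Proof.
move=> hx dx; apply/funext => S; apply/funext => B; apply: opfun_coef => k.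
rewrite -[LHS]/(modes k (dG tau n (const_form x)) S B) modes_dG//; last by case: (const_PP hx).
rewrite modes_const coefO0; case: eqP => [->|_]; last by rewrite linear0.
by rewrite kz_DC0 dx scaler0.
Qed.

Lemma dG_lin a w w' : dG tau n (a *: w + w') = a *: dG tau n w + dG tau n w'.
Proof. exact: kz_is_linear. Qed.
Lemma dG0 : dG tau n 0 = 0.
Proof. exact: linear0. Qed.
Lemma dG_ker_subsp q j : subsp [set w | PP q j w /\ dG tau n w = 0].
Proof.
split=> [|a w w' [h1 h2] [h3 h4]]; first by split; [exact: PP_0|exact: dG0].
by split; [exact: PP_lin|rewrite dG_lin h2 h4 scaler0 addr0].
Qed.

Lemma row0_dim q : (q < n)%N -> exists e, dim_quotient [set w | PP q n w /\ dG tau n w = 0]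
  [set w | exists2 v, Pm (@PP R g) q n v & w = dG tau n v] e /\
  ((if q is q'.+1 then 'C(g, q') * 'C(g, n) else 0) + e = 'C(g, q) * 'C(g, n.-1))%N.
Proof.
move=> qn; have [e [he hc]] := const_dim C g n0 qn; exists e; split=> //.
have cp0 := cpi_neq0.
apply: (@dq_rel _ _ _ _ _ _ _ (fun w y => y = modes 0 w) _ _ _ _ _ _ _ _ _ he).
- exact: dG_ker_subsp.
- exact: exactC_subsp.
- by move=> a x y x' y' -> ->; rewrite linearP.
- by rewrite linear0.
- move=> y [hy dy]; exists (const_form y); last by rewrite modes_const eqxx.
  by split; [exact: const_PP|exact: const_closed hy dy].
- move=> w [hw dw]; exists (modes 0 w) => //; split; first exact: modes_formC.
  have := modes_dG htau 0 hw.2; rewrite dw linear0 kz_DC0 => /eqP.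
  by rewrite eq_sym scaler_eq0 (negbTE cp0) => /eqP.
- move=> w _ [hw dw] _ ->; split=> [[v hv ev]|].
    case: q hv {hc he qn hw} => [|q] hv; first by rewrite /= ev hv dG0; exact: linear0.
    exists (cpi R *: modes 0 v).
      exact: (subspZ _ (@formC_subsp C g n q) (modes_formC hv)).
    by rewrite ev (modes_dG htau 0 hv.2) kz_DC0 dC_Z.
  case: q qn he hc hw => [|q] qn he hc hw.
    move=> /= m0; have [v hv ev] := row0_exact htau hw dw m0.
    by exists v.
  move=> [y hy ey]; pose y' := (cpi R)^-1 *: y.
  have hy' : formC n q y' by exact: (subspZ _ (@formC_subsp C g n q) hy).
  (* A constant primitive of the constant mode is subtracted first; the remainder has no constant
     mode and is a coboundary by [row0_exact]. *)
  pose c := const_form y'; have hc' : PP q n c by exact: const_PP.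
  have mc : modes 0 (dG tau n c) = modes 0 w.
    by rewrite (modes_dG htau 0 hc'.2) modes_const eqxx kz_DC0 ey /y' dC_Z scalerA mulfV// scale1r.
  have [|||v hv ev] := @row0_exact R g tau htau n q.+1 (w - dG tau n c).
  + by rewrite addrC -scaleN1r; apply: PP_lin => //; exact: PP_d.
  + have -> : w - dG tau n c = (-1) *: dG tau n c + w by rewrite scaleN1r addrC.
    have e0 : dG tau n (dG tau n c) = 0 by exact: dG_dG.
    by apply: (etrans (dG_lin _ _ _)); rewrite e0 scaler0 add0r.
  + by rewrite linearB /= mc subrr.
  exists (v + c); first by have := PP_lin 1 hv hc'; rewrite scale1r.
  by have := dG_lin 1 v c; rewrite !scale1r ev subrK.
split=> [|a x y [h1 h2] [h3 h4]]; first exact: (closedC_subsp C g n q).1.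
exact: (closedC_subsp C g n q).2.
Qed.

End RowZeroDim.

(** * Invariants in the rows of positive weight *)

Section Periodic.
Variables (R : realType) (g m' : nat).
Local Notation C := (CC R).
Local Notation m := m'.+1.
Implicit Types (k : 'rV[int]_g) (r : {ffun 'I_g -> 'I_m}) (b : 'rV[int]_g -> C).

Definition red k : {ffun 'I_g -> 'I_m} := [ffun i => inord (absz (modz (k 0 i) m%:Z))].
Definition rvec r : 'rV[int]_g := \row_i (r i)%:Z.

Lemma red_val k i : (red k i)%:Z = (modz (k 0 i) m%:Z).
Proof.
have h0 : (0 <= modz (k 0 i) m%:Z) by rewrite modz_ge0.
have h1 : (modz (k 0 i) m%:Z < m%:Z) by rewrite ltz_pmod.
by rewrite ffunE inordK; [rewrite gez0_abs|lia].
Qed.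
Lemma red_rvec r : red (rvec r) = r.
Proof.
apply/ffunP => i; apply: val_inj => /=; apply/eqP; rewrite -eqz_nat; apply/eqP.
by have := red_val (rvec r) i; rewrite mxE modz_small// lez_nat ltz_nat ltn_ord.
Qed.
Lemma red_shift k l : red (k - m%:Z *: delta_mx 0 l) = red k.
Proof.
apply/ffunP => i; apply: val_inj => /=; apply/eqP; rewrite -eqz_nat; apply/eqP.
have := red_val k i; have := red_val (k - m%:Z *: delta_mx 0 l) i => -> ->.
by rewrite !mxE eqxx /= -mulrN mulrC addrC modzMDl.
Qed.

(** k and its vector of residues differ by a sum of multiples of the period vectors, which are
    removed coordinate by coordinate. *)
Lemma periodic_red b k : (forall l k, b (k - m%:Z *: delta_mx 0 l) = b k) -> b (rvec (red k)) = b k.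
Proof.
move=> per.
have it l t k' : b (sh m l t k') = b k'.
  have h0 : shop m (-1) l b = 0.
    by apply/funext => k0; rewrite /shop /sh scaleN1r per subrr.
  have hs : (-1 = 1 :> int) \/ (-1 = -1 :> int) by right.
  have X := @shop_iter R g m (-1) l b hs h0 t k'.
  exact: X.
have sum (q : 'I_g -> int) (s : seq 'I_g) k' : b (k' + \sum_(l <- s) q l *: (m%:Z *: delta_mx 0 l)) = b k'.
  elim: s k' => [|l s IH] k'; first by rewrite big_nil addr0.
  by rewrite big_cons addrA IH; exact: it.
rewrite -(sum (fun l => - (divz (k 0 l) m%:Z)) (index_enum _) k); congr b.
apply/rowP => i; rewrite !mxE red_val summxE (bigD1 i)//= big1 => [|j ji].
  by rewrite !mxE !eqxx mulr1 addr0 {2}(divz_eq (k 0 i) m%:Z) mulNr addrC addKr.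
by rewrite !mxE eqxx /= eq_sym (negbTE ji) mulr0 mulr0.
Qed.

(** A sequence periodic in all directions takes finitely many values, hence lies in the class with p
    = g; [XX_subset] then descends to p = 0. *)
Lemma periodic_bnd (c : {ffun 'I_g -> 'I_m} -> C) (u : 'I_g -> 'I_g -> R) (cc : 'I_g -> R) :
  (forall i, cc i < 0) -> bnd u cc 0 (fun k => c (red k)).
Proof.
move=> c0; set b := fun k => _.
have sb l : shop m (-1) l b = 0.
  by apply/funext => k; rewrite /shop /sh scaleN1r /b red_shift subrr.
suff : forall p, (p <= g)%N -> XX u cc m (-1) (g - p) b.
  by move=> /(_ g (leqnn g)); rewrite subnn => -[].
elim=> [_|p IH pg].
  rewrite subn0; split=> [l _|A]; first exact: sb.
  exists (\sum_r nm (c r)) => k; have -> : EE u cc g A k = 0.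
    by rewrite /EE big1// => i gi; have := leq_trans (ltn_ord i) gi; rewrite ltnn.
  rewrite oppr0 expR0 mulr1 /b (bigD1 (red k))//= lerDl.
  by apply: sumr_ge0 => r _; exact: nm_ge0.
apply: XX_subset => //; rewrite -subSn// subSS; apply: IH; exact: ltnW.
Qed.

End Periodic.

Section KernelDim.
Variables (R : realType) (g : nat) (tau : 'M[CC R]_g).
Local Notation C := (CC R).
Local Notation F := (opfun R g).
Local Notation N := ({set 'I_g.+1} -> F).
Hypothesis htau : period_matrix tau.
Variables (n j : nat).
Hypothesis jn : (j < n)%N.
Implicit Types (x : {set 'I_g} -> N) (v : N) (B : {set 'I_g.+1}) (i l : 'I_g) (S : {set 'I_g}).
Local Notation m := (n - j).-1.+1.

Definition vform v : {set 'I_g} -> N := fun S => if S == finset.set0 then v else 0.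
Lemma vform_PP q v : grow q v -> PP 0 q (vform v).
Proof.
move=> hv; split=> S; rewrite /vform; first by rewrite cards_eq0 => /negbTE ->.
by case: ifP => // _; exact: (row_mod _).1.
Qed.
Lemma PP_vform q x : PP 0 q x -> x = vform (x finset.set0).
Proof.
move=> [h _]; apply/funext => S; rewrite /vform; case: eqP => [->//|/eqP S0].
by rewrite h// cards_eq0.
Qed.
Lemma dG_vform v : (forall l, Dtw tau n l v = 0) -> dG tau n (vform v) = 0.
Proof.
move=> h; apply/funext => S; rewrite /dG kzE big1// => i _; rewrite /vform.
have -> : Dtw tau n i (if S :\ i == finset.set0 then v else 0) = 0 by case: ifP => _; [exact: h|exact: linear0].
exact: scaler0.
Qed.
Lemma vform_dG v l : dG tau n (vform v) = 0 -> Dtw tau n l v = 0.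
Proof.
move=> /(congr1 (fun f => f (finset.set1 l))); rewrite /dG kzE big_set1 finset.setDv /vform eqxx => e.
have : sg C l (finset.set1 l) *: (sg C l (finset.set1 l) *: Dtw tau n l v) = 0 by rewrite e scaler0.
by rewrite scalerA sg_sq scale1r.
Qed.

Let kk : C := - ((n%:Z - j%:Z)%:~R)^-1.
Let nj : n != j. Proof. by rewrite neq_ltn jn orbT. Qed.

Lemma PhiNK (k : C) v : Phi (- k) (Phi k v) = v.
Proof. by have := PhiK (- k) v; rewrite opprK. Qed.

Lemma untwist_fix v : grow j v -> (forall l, Dtw tau n l v = 0) -> forall l, Ttw tau n l (Phi (- kk) v) = Phi (- kk) v.
Proof.
move=> hv dv l; have h0 : grow j (Phi (- kk) v) by exact: row_Phi.
have := tw_Phi htau l h0 nj; rewrite -/kk PhiK => e.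
have e' : tw tau n l v = v by apply/subr0_eq; exact: dv.
move: e; rewrite e' => e; have e2 := congr1 (Phi (- kk)) e.
by rewrite PhiNK in e2.
Qed.

(** After untwisting, each of the ['C(g.+1, j)] components is a T_l-invariant function of weight m =
    n - j. Its normalised coefficients are periodic modulo m, and they may be prescribed freely on
    the m^g residue classes. *)
Lemma kernel_dim : dim_quotient [set x | PP 0 j x /\ dG tau n x = 0] [set 0] ('C(g.+1, j) * (n - j) ^ g)%N.
Proof.
have m0 : (m%:Z != 0) by [].
have mE : n%:Z - j%:Z = m%:Z by rewrite prednK ?subn_gt0// -subzn// ltnW.
have mEN : (n - j)%N = m by rewrite prednK ?subn_gt0.
have hcard : #|[predX [pred B : {set 'I_g.+1} | #|B| == j] & predT : pred {ffun 'I_g -> 'I_m}]| = ('C(g.+1, j) * (n - j) ^ g)%N.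
  rewrite cardX card_subsets; congr (_ * _)%N.
  by rewrite mEN -[RHS](_ : #|{ffun 'I_g -> 'I_m}| = _) ?card_ffun ?card_ord.
have := @supp_dim C _ _ [predX [pred B : {set 'I_g.+1} | #|B| == j] & predT : pred {ffun 'I_g -> 'I_m}].
rewrite hcard; set V0 := [set w | _] => hd.
have [d [u [d0 u1 ul Q HK]]] := chol_tau htau.
have c0 i : cm d m i < 0 by rewrite /cm oppr_lt0 divr_gt0 ?mulr_gt0 ?pi_gt0// -pmulrn ltr0n.
pose b v B := gseq tau m (Phi (- kk) v B).
have bper v B : grow j v -> (forall l, Dtw tau n l v = 0) ->
    forall l k, b v B (k - m%:Z *: delta_mx 0 l) = b v B k.
  move=> hv dv l k; have [/eqP Bj|Bj] := boolP (#|B| == j); last first.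
    have -> : b v B = 0 by rewrite /b (row_Phi (- kk) hv)// linear0.
    by [].
  have e := congr1 (fun f : N => f B) (untwist_fix hv dv l).
  rewrite /b -[in RHS]e /Ttw Bj mE.
  by rewrite [RHS](ncoef_tr htau _ _ m0 (opfunP _)).
have blin a v v' B : b (a *: v + v') B = a *: b v B + b v' B.
  by rewrite /b (Phi_is_linear (- kk) a v v'); exact: bseq_is_linear.
apply: (@dq_rel _ _ _ _ _ _ _ (fun x c => c = fun B r => b (x finset.set0) B (rvec r)) _ _ _ _ _ _ _ _ _ hd).
- exact: dG_ker_subsp.
- exact: set0_subsp.
- move=> a x y x' y' -> ->; apply/funext => B; apply/funext => r.
  exact: (esym (congr1 (fun f => f (rvec r)) (blin a (x finset.set0) (y finset.set0) B))).
- by apply/funext => B; apply/funext => r; rewrite /b linear0 linear0.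
- move=> c hc; have /choice[h Hh] : forall B, exists h : F, gseq tau m h = fun k => c B (red m.-1 k).
    by move=> B; apply: (bseq_surj Q HK); exact: periodic_bnd.
  have hg : grow j (h : N).
    move=> B Bj; apply: (@bseq_inj _ _ tau m); rewrite Hh; apply/funext => k.
    by apply: hc; rewrite !inE /= (negbTE Bj).
  have hf l : Ttw tau n l (h : N) = h.
    apply/funext => B; rewrite /Ttw; have [/eqP Bj|Bj] := boolP (#|B| == j); last by rewrite hg// linear0.
    apply/subr0_eq/(@bseq_inj _ _ tau m); rewrite linearB Bj mE /=.
    apply/funext => k; rewrite -[LHS]/(gseq tau m (trO tau m (delta_mx 0 l) (h B)) k - gseq tau m (h B) k).
    rewrite [X in X - _](ncoef_tr htau _ _ m0 (opfunP _)) -/(gseq tau m (h B) _) Hh red_shift subrr.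
    by [].
  have gP : grow j (Phi kk h) by exact: row_Phi.
  exists (vform (Phi kk h)).
    split; first exact: vform_PP.
    by apply: dG_vform => l; rewrite DtwE (tw_Phi htau l hg nj) -/kk hf subrr.
  apply/funext => B; apply/funext => r; rewrite /vform eqxx /b.
  by rewrite PhiNK Hh red_rvec.
- move=> x [[h1 h2] h3]; exists (fun B r => b (x finset.set0) B (rvec r)) => //.
  move=> B r; rewrite !inE /= andbT => Bj.
  by rewrite /b (row_Phi (- kk) (h2 _))// linear0.
- move=> x c [hx dx] hc ->; split=> [->|e].
    by apply/funext => B; apply/funext => r; rewrite /b linear0 linear0.
  have xv := PP_vform hx; have gx := hx.2 finset.set0.
  have dv l : Dtw tau n l (x finset.set0) = 0 by apply: vform_dG; rewrite -xv.
  suff v0 : Phi (- kk) (x finset.set0) = 0.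
    rewrite xv; apply/funext => S; rewrite /vform; case: ifP => // _.
    by rewrite -(PhiK kk (x finset.set0)) v0 linear0.
  apply/funext => B; apply: (@bseq_inj _ _ tau m); apply/funext => k.
  rewrite -[LHS](periodic_red _ (bper _ B gx dv)).
  by have := congr1 (fun f => f B (red m.-1 k)) e.
split=> [//|a c c' h h' B r hB]; rewrite -[LHS]/(a * c B r + c' B r) h// h'//.
by rewrite mulr0 addr0.
Qed.

End KernelDim.

(** * Ranks *)

Section RankNullity.
Variables (K : fieldType) (E E' : lmodType K).

Lemma zero_subsp : subsp ([set 0] : set E).
Proof. by split=> [//|a x y /= -> ->]; rewrite scaler0 addr0. Qed.

Lemma rank_nullity (f : {linear E -> E'}) (V : set E) h : subsp V -> dim_quotient V [set 0] h ->
  exists z, [/\ (z <= h)%N, dim_quotient [set x | V x /\ f x = 0] [set 0] z &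
    dim_quotient [set y | exists2 x, V x & y = f x] [set 0] (h - z)].
Proof.
move=> sV hd; set Z := [set x | V x /\ f x = 0].
have sZ : subsp Z.
  split=> [|a x y [h1 h2] [h3 h4]]; first by split; [exact: sV.1|exact: linear0].
  by split; [exact: sV.2|rewrite linearP h2 h4 scaler0 addr0].
have h0 : [set 0] `<=` Z by move=> x /= ->; exact: sZ.1.
have hZ : Z `<=` V by move=> x [].
have [z [zh h1 h2]] := dq_split sV sZ h0 hZ hd.
exists z; split=> //; apply: (@dq_rel _ _ _ _ _ _ _ (fun y x => y = f x) _ _ _ _ _ _ _ _ _ h2).
- split=> [|a _ _ [x hx ->] [y hy ->]]; first by exists 0; rewrite ?linear0//; exact: sV.1.
  by exists (a *: x + y); [exact: sV.2|rewrite linearP].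
- exact: sZ.
- by move=> a x y x' y' -> ->; rewrite linearP.
- by rewrite linear0.
- by move=> x hx; exists (f x) => //; exists x.
- by move=> _ [x hx ->]; exists x.
- by move=> x y _ Vy ->; split=> [/= e|[]].
exact: sV.
Qed.

Lemma dq_add (V W : set E) z b e : subsp V -> subsp W -> W `<=` V -> dim_quotient V [set 0] z ->
  dim_quotient W [set 0] b -> dim_quotient V W e -> z = (b + e)%N.
Proof.
move=> sV sW WV hz hb he; have h0 : [set 0] `<=` W by move=> x /= ->; exact: sW.1.
have [a [az ha hza]] := dq_split sV sW h0 WV hz.
by rewrite (dq_uniq sW zero_subsp hb ha) (dq_uniq sV sW he hza) subnKC.
Qed.
End RankNullity.

Lemma Posz_exp (a b : nat) : (a ^ b)%:Z = a%:Z ^+ b.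
Proof. by rewrite -!natz natrX. Qed.

(** * Homology of the complex of invariants *)

Section Ranks.
Variables (R : realType) (g : nat) (tau : 'M[CC R]_g).
Local Notation C := (CC R).
Local Notation F := (opfun R g).
Local Notation N := ({set 'I_g.+1} -> F).
Hypothesis htau : period_matrix tau.
Hypothesis hTheta : nonsingular_theta_divisor tau.
Variable n : nat.
Hypothesis hn : (2 <= n <= g.+1)%N.
Implicit Types (x : {set 'I_g} -> N).

Let d : {linear ({set 'I_g} -> N) -> ({set 'I_g} -> N)} := dG tau n.
Let del : {linear ({set 'I_g} -> N) -> ({set 'I_g} -> N)} := dT htau.
Let rl := rel d del (@PP R g).

Definition Hk j := [set x | PP 0 j x /\ dG tau n x = 0].
Definition Zk j := [set x | Hk j x /\ dT htau x = 0].
(** The complex of invariants is cut off at the row n - 1: the cycles there are counted by the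
    cohomology of the row n in degree 0, so they are not divided by the image of the invariants of
    row n. *)
Definition Bk j := [set x | if (j.+1 < n)%N then exists2 y, Hk j.+1 y & x = dT htau y else x = 0].

Lemma dT_lin a x y : dT htau (a *: x + y) = a *: dT htau x + dT htau y.
Proof. exact: (cw_is_linear (@delta R g tau htau)). Qed.
Lemma dT0 : dT htau 0 = 0. Proof. exact: (linear0 del). Qed.

Lemma Hk_subsp j : subsp (Hk j). Proof. exact: dG_ker_subsp. Qed.
Lemma Zk_subsp j : subsp (Zk j).
Proof.
split=> [|a x y [h1 h2] [h3 h4]]; first by split; [exact: (Hk_subsp j).1|exact: dT0].
by split; [exact: (Hk_subsp j).2|rewrite dT_lin h2 h4 scaler0 addr0].
Qed.
Lemma BkE j : (j.+1 < n)%N -> Bk j = [set x | exists2 y, Hk j.+1 y & x = dT htau y].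
Proof. by rewrite /Bk => ->. Qed.
Lemma BkE0 j : (j.+1 < n)%N = false -> Bk j = [set 0].
Proof. by rewrite /Bk => ->. Qed.
Lemma Bk_subsp j : subsp (Bk j).
Proof.
case e : (j.+1 < n)%N; last by rewrite (BkE0 e); exact: zero_subsp.
rewrite (BkE e).
split=> [|a _ _ [x hx ->] [y hy ->]]; first by exists 0; [exact: (Hk_subsp _).1|rewrite dT0].
by exists (a *: x + y); [exact: (Hk_subsp _).2|rewrite dT_lin].
Qed.
Lemma Hk_dT j x : Hk j.+1 x -> Zk j (dT htau x).
Proof.
move=> [h1 h2]; split; last exact: dT_dT.
split; first exact: PP_del.
by rewrite dG_dT// h2 dT0.
Qed.
Lemma Bk_Zk j : Bk j `<=` Zk j.
Proof.
case e : (j.+1 < n)%N; last by rewrite (BkE0 e) => x /= ->; exact: (Zk_subsp j).1.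
by rewrite (BkE e) => x [y hy ->]; exact: Hk_dT.
Qed.

Let d0E : d 0 = 0 := dG0 tau n.
Let del0E : del 0 = 0 := dT0.
Lemma triv_Bk j k x : (j + k).+1 = n -> triv d del (@PP R g) k 0 j x <-> Bk j x.
Proof.
move=> jk; rewrite /triv; case: k jk => [|k'] jk.
  have e : (j.+1 < n)%N = false by lia.
  rewrite (BkE0 e); split=> [[x1 [x2 [-> _ -> _ ->]]]|->]; first by rewrite d0E del0E addr0.
  by exists 0, 0; rewrite d0E del0E addr0.
have e : (j.+1 < n)%N by lia.
rewrite (BkE e); split=> [[x1 [x2 [-> _ h2 h3 ->]]]|[y [h1 h2] ->]].
  by exists x2 => //; rewrite d0E add0r.
by exists 0, y; split=> //; rewrite d0E add0r.
Qed.

Let rel0 k q j : rl k q j 0 0.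
Proof.
elim: k q j => [|k IH] q j; first by split=> //; exact: PP_0.
by exists 0; split; [exact: PP_0|exact: del0E|rewrite d0E; exact: IH].
Qed.

Definition coh_dim (q : nat) : int := 'C(g, q)%:Z * 'C(g, n.-1)%:Z - (if q is q'.+1 then 'C(g, q')%:Z * 'C(g, n)%:Z else 0).

Lemma homology_dim j k : (j + k).+1 = n -> (0 < j)%N -> exists e, dim_quotient (Zk j) (Bk j) e /\ e%:Z = coh_dim k.
Proof.
move=> jk j0; have kn : (k < n)%N by lia.
have n0 : (0 < n)%N by lia.
have [e [he hc]] := row0_dim htau n0 kn; exists e; split; last first.
  rewrite /coh_dim -[_ * 'C(g, n.-1)%:Z]PoszM -hc; case: (k) => [|k'] /=; first by rewrite add0n subr0.
  by rewrite PoszD PoszM addrAC subrr add0r.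
have P_lin q j' a x y : PP q j' x -> PP q j' y -> PP q j' (a *: x + y) by exact: PP_lin.
have P_0 q j' : PP q j' (0 : {set 'I_g} -> N) by exact: PP_0.
have P_top q j' x : PP q j' x -> (g.+1 < j')%N -> x = 0 by exact: PP_top.
have P_d q j' x : PP q j' x -> PP q.+1 j' (d x) by exact: PP_d.
have P_del q j' x : PP q j'.+1 x -> PP q j' (del x) by exact: PP_del.
have d_d x : d (d x) = 0 by exact: dG_dG.
have del_del x : del (del x) = 0 by exact: dT_dT.
have d_del x : d (del x) = del (d x) by exact: dG_dT.
have col q j' x : PP q j' x -> del x = 0 -> exists2 y, PP q j'.+1 y & del y = x by exact: PP_exact.
have neg q j' x : (n < j')%N -> (q < g)%N -> PP q j' x -> d x = 0 -> exists2 y, Pm (@PP R g) q j' y & d y = x.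
  exact: PP_neg.
have pos q j' x : (j' < n)%N -> PP q.+1 j' x -> d x = 0 -> exists2 y, PP q j' y & d y = x.
  exact: PP_pos.
have tE x := triv_Bk x jk.
(* From j >= 1 and n <= g + 1. *)
have kg : (0 + k < g)%N by lia.
apply: (@dq_rel _ _ _ _ _ _ _ (rl k 0 j) _ _ _ _ _ _ _ _ _ he).
- exact: Zk_subsp.
- split=> [|a u v hu hv].
    by exists 0; [case: (k) => [|k'] //=; exact: PP_0|rewrite dG0].
  case: hu => u' hu ->; case: hv => v' hv ->; exists (a *: u' + v'); last by rewrite dG_lin.
  by move: hu hv; case: (k) => [|k'] /=; [move=> -> ->; rewrite scaler0 addr0|exact: PP_lin].
- by move=> a x y x' y' h1 h2; apply: rel_lin => //; exact: PP_lin.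
- exact: rel0.
- move=> u [hu du].
  by have [x [h1 h2 h3 h4]] := rel_total_r (q := 0%N) P_del del_del d_del pos jk hu du; exists x.
- move=> x [[h1 h2] h3]; have [u hu] := rel_total_l P_lin P_0 P_d P_del P_top d_d del_del d_del col neg jk j0 h1 h2 h3.
  by exists u => //; have [h4 h5] := rel_mem hu; rewrite jk in h4.
- move=> x u _ _ hr; rewrite -tE; split=> [ht|hu].
    exact: (triv_rel P_lin P_0 P_d P_del P_top d_d del_del d_del col neg jk j0 kg hr ht).
  exact: (rel_triv P_lin P_0 P_del del_del d_del pos jk j0 hr hu).
split=> [|a u v [h1 h2] [h3 h4]]; first exact: (dG_ker_subsp tau n k n).1.
exact: (dG_ker_subsp tau n k n).2.
Qed.

(** The dimension of [Bk (n.-1 - t)]: boundaries from a row are its invariants minus its cycles, and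
    its cycles are its boundaries plus its homology. *)
Fixpoint bdim (t : nat) : int :=
  if t is s.+1 then 'C(g.+1, n.-1 - s)%:Z * (s.+1)%:Z ^+ g - coh_dim s - bdim s else 0.

Lemma Bk_dim t : (t < n)%N -> exists b, dim_quotient (Bk (n.-1 - t)) [set 0] b /\ b%:Z = bdim t.
Proof.
elim: t => [_|t IH tn].
  exists 0%N; split=> //; rewrite BkE0; last by lia.
  by exists (fun=> 0); split=> [[]//|c _ []//|x /= ->]; exists (fun=> 0); rewrite big_ord0 subrr.
have [b [hb eb]] := IH (ltnW tn); set j := (n.-1 - t)%N.
have jE : (n.-1 - t.+1).+1 = j by rewrite /j; lia.
have jn : (j < n)%N by rewrite /j; lia.
have [z [zh hz hi]] := rank_nullity del (Hk_subsp j) (kernel_dim htau jn).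
have [e [he ee]] : exists e, dim_quotient (Zk j) (Bk j) e /\ e%:Z = coh_dim t.
  by apply: homology_dim; rewrite /j; lia.
have zE := dq_add (Zk_subsp j) (Bk_subsp j) (@Bk_Zk j) hz hb he.
exists ('C(g.+1, j) * (n - j) ^ g - z)%N; split.
  by rewrite BkE ?jE//; lia.
have nj : (n - j)%N = t.+1 by rewrite /j; lia.
rewrite /= -eb -ee -/j -subzn// zE PoszD PoszM -Posz_exp -nj.
by rewrite opprD addrA addrAC.
Qed.

Lemma top_dim : exists a, dim_quotient (Hk 0) (Bk 0) a /\ a%:Z = n%:Z ^+ g - bdim n.-1.
Proof.
have nn : (n.-1 < n)%N by lia.
have [b [hb eb]] := Bk_dim nn; rewrite subnn in hb.
have n0 : (0 < n)%N by lia.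
have hH := kernel_dim htau n0; rewrite bin0 mul1n subn0 in hH.
have BH : Bk 0 `<=` Hk 0 by move=> x /Bk_Zk [].
have h0 : [set 0] `<=` Bk 0 by move=> x /= ->; exact: (Bk_subsp 0).1.
have [a [ah ha hHB]] := dq_split (Hk_subsp 0) (Bk_subsp 0) h0 BH hH.
exists (n ^ g - a)%N; split=> //.
by rewrite -subzn// (dq_uniq (Bk_subsp 0) (zero_subsp _) ha hb) eb Posz_exp.
Qed.
End Ranks.

(** * From the recursion to the closed formula *)

Section Formula.
Variables (g n : nat).
Hypothesis hn : (2 <= n)%N.
Lemma top_formula : n%:Z ^+ g - bdim g n n.-1 = (-1) ^+ (n - 1) * 'C(g, n - 2)%:Z
      + \sum_(2 <= i < n.+1) (-1) ^+ (n - i) * 'C(g.+1, n - i)%:Z * i%:Z ^+ g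
      + \sum_(0 <= i < n - 2) (-1) ^+ i *
          ('C(g, n - 1)%:Z * 'C(g, n - 2 - i)%:Z
           - 'C(g, n)%:Z * 'C(g, n - 3 - i)%:Z) :> int.
Proof.
(* The recursion unrolled as an alternating sum. *)
have bE t : bdim g n t = \sum_(0 <= s < t) (-1) ^+ (t - s.+1) * ('C(g.+1, n.-1 - s)%:Z * (s.+1)%:Z ^+ g - coh_dim g n s).
  elim: t => [|t IH]; first by rewrite big_nil.
  rewrite big_nat_recr//= subnn expr0 mul1r IH addrC -sumrN; congr (_ + _).
  rewrite !big_nat; apply: eq_bigr => s /andP[_ st].
  by rewrite subSS -mulNr -mulN1r -exprS subnSK.
have [p np] : exists p, n = p.+2 by exists n.-2; rewrite -subn2; lia.
rewrite np in bE *.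
have -> : (p.+2 - 2 = p)%N by lia.
have -> : (p.+2 - 1 = p.+1)%N by lia.
have -> : (p.+2 - 3 = p.-1)%N by lia.
rewrite -[p.+2.-1]/p.+1 bE -sumrN.
have -> : \sum_(0 <= s < p.+1) - ((-1) ^+ (p.+1 - s.+1) * ('C(g.+1, p.+1 - s)%:Z * s.+1%:Z ^+ g - coh_dim g p.+2 s)) =
  \sum_(0 <= s < p.+1) ((-1) ^+ (p.+1 - s) * 'C(g.+1, p.+1 - s)%:Z * s.+1%:Z ^+ g) +
  \sum_(0 <= s < p.+1) (-1) ^+ (p - s) * coh_dim g p.+2 s :> int.
  rewrite -big_split /= !big_nat; apply: eq_bigr => s /andP[_ sp].
  by rewrite subSS subSn ?exprS; [ring|lia].
have -> : \sum_(0 <= s < p.+1) (-1) ^+ (p - s) * coh_dim g p.+2 s =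
  \sum_(0 <= i < p) (-1) ^+ i * ('C(g, p.+1)%:Z * 'C(g, p - i)%:Z - 'C(g, p.+2)%:Z * 'C(g, p.-1 - i)%:Z)
  + (-1) ^+ p * 'C(g, p.+1)%:Z :> int.
  rewrite big_nat_rev /= add0n big_nat_recr//= !subSS !subnn subn0 /coh_dim bin0 mul1r subr0; congr (_ + _).
  rewrite !big_nat; apply: eq_bigr => i /andP[_ ip].
  rewrite subSS (_ : (p - (p - i) = i)%N); last by lia.
  have [q e] : exists q, (p - i)%N = q.+1 by exists (p - i).-1; lia.
  rewrite e (_ : (p.-1 - i = q)%N); last by lia.
  by ring.
rewrite big_nat_recl//= subn0 expr1n mulr1.
have -> : \sum_(2 <= i < p.+3) (-1) ^+ (p.+2 - i) * 'C(g.+1, p.+2 - i)%:Z * i%:Z ^+ g =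
  \sum_(0 <= i < p) (-1) ^+ (p.+1 - i.+1) * 'C(g.+1, p.+1 - i.+1)%:Z * i.+2%:Z ^+ g + p.+2%:Z ^+ g :> int.
  rewrite big_nat_recr//= subnn expr0 bin0 !mul1r; congr (_ + _).
  by rewrite big_add1 /= big_add1 /=; apply: eq_bigr => i _; rewrite !subSS.
(* The term of base 1 in the power sum and the degree 0 term of the cohomology combine by Pascal's
   rule into the isolated binomial ['C(g, n - 2)] of the formula. *)
rewrite binS PoszD exprS; move: (\sum_(0 <= i < p) _) (\sum_(0 <= i < p) _) => X Y.
by ring.
Qed.
End Formula.

(** * Meromorphic functions as quotients by powers of theta *)

Section GenericDerivatives.
Variables (R : realType) (g : nat).
Local Notation C := (CC R).
Implicit Types (a q : 'rV[C]_g -> C) (z v : 'rV[C]_g).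

Lemma differentiable_exp q n z : differentiable q z -> differentiable (fun x => q x ^+ n) z.
Proof.
move=> dq; elim: n => [|n IH].
  by rewrite (_ : (fun _ => _) = cst 1)//; apply/funext => x; rewrite expr0.
rewrite (_ : (fun _ => _) = q * (fun x => q x ^+ n)); first exact: differentiableM.
by apply/funext => x; rewrite exprS.
Qed.

Lemma derive_exp q n z v : differentiable q z -> 'D_v (fun x => q x ^+ n.+1) z = n.+1%:R * q z ^+ n * 'D_v q z.
Proof.
move=> dq; elim: n => [|n IH].
  rewrite (_ : (fun _ => _) = q); first by rewrite expr0 mul1r mul1r.
  by apply/funext => x; rewrite expr1.
rewrite (_ : (fun _ => _) = q * (fun x => q x ^+ n.+1)); last by apply/funext => x; rewrite exprS.
rewrite deriveM; [|exact: diff_derivable|exact/diff_derivable/differentiable_exp].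
rewrite IH; move: ('D_v q z) (q z) => d t.
rewrite -[LHS]/(t * (n.+1%:R * t ^+ n * d) + t ^+ n.+1 * d) -[in RHS]natr1 [in t ^+ n.+1]exprS.
by ring.
Qed.

Lemma differentiable_quot a q z : differentiable a z -> differentiable q z -> q z != 0 ->
  differentiable (fun x => a x * (q x)^-1) z.
Proof.
by move=> da dq q0; apply: (@differentiableM _ _ a (fun x => (q x)^-1)) => //; exact: differentiableV.
Qed.

Lemma derive_quot a q z v : differentiable a z -> differentiable q z -> q z != 0 ->
  'D_v (fun x => a x * (q x)^-1) z = (q z)^-1 * 'D_v a z - a z * (q z) ^- 2 * 'D_v q z.
Proof.
move=> da dq q0; have dd : derivable q z v by exact: diff_derivable.
have dV := derivableV q0 dd.
rewrite (_ : (fun _ => _) = a * (fun x => (q x)^-1))//.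
have da' : derivable a z v by exact: diff_derivable.
apply: (etrans (deriveM da' dV)); rewrite (deriveV q0 dd); move: ('D_v q z) ('D_v a z) (a z) (q z) => d d' t u.
rewrite -[LHS]/(t * (- (u ^- 2) * d) + u^-1 * d').
by ring.
Qed.

Lemma cvg_sub a q z : differentiable a z -> differentiable q z -> (fun x => a x - q x) x @[x --> z] --> a z - q z.
Proof.
move=> /differentiable_continuous ca /differentiable_continuous cq.
exact: (cvgB ca cq).
Qed.

End GenericDerivatives.

Lemma quot_scale (K : fieldType) (e a b : K) n : e != 0 -> e ^+ n * a / (e * b) ^+ n = a / b ^+ n.
Proof. by move=> e0; rewrite exprMn invfM mulrACA divff ?expf_neq0// mul1r. Qed.

Section Quotients.
Variables (R : realType) (g : nat) (tau : 'M[CC R]_g).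
Local Notation C := (CC R).
Local Notation F := (opfun R g).
Hypothesis htau : period_matrix tau.
Hypothesis hTheta : nonsingular_theta_divisor tau.
Implicit Types (h : F) (z : 'rV[C]_g) (l : 'rV[int]_g).
Local Notation th := (theta tau).
Local Opaque theta th0 pd coef.

(** If f and f' differed at z, theta would vanish in a neighbourhood of z, and all its derivatives
    at z with it, against the non-singularity of the divisor. *)
Lemma theta_dense (f f' : 'rV[C]_g -> C) : (forall z, differentiable f z) -> (forall z, differentiable f' z) ->
  (forall z, th z != 0 -> f z = f' z) -> forall z, f z = f' z.
Proof.
move=> df df' e z; apply: contrapT => /eqP; rewrite -subr_eq0 => ne.
have c := cvg_sub (df z) (df' z).
have th_near : \forall x \near z, th x = cst 0 x.
  have nr : \forall t \near z, f t - f' t != 0 by apply: (cvgr_neq0 _ c ne).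
  near=> x.
  apply/eqP; apply: contraT => tx.
  have : f x - f' x != 0 by near: x.
  by rewrite e// subrr eqxx.
case: (hTheta (nbhs_singleton th_near)) => i.
by rewrite (near_eq_derive _ th_near) derive_cst eqxx.
Unshelve. all: by end_near. Qed.

Definition inV (n : nat) h := forall i, trO tau n%:Z (delta_mx 0 i) h = h.

Lemma inV_all n h : inV n h -> forall l, trO tau n%:Z l h = h.
Proof.
move=> hh; have tadd l l' : trO tau n%:Z l h = h -> trO tau n%:Z l' h = h -> trO tau n%:Z (l + l') h = h.
  move=> e e'; rewrite -[RHS]e -[in RHS]e'; apply: opfun_ext => z.
  by rewrite -[LHS](tr_comp htau).
have t0 : trO tau n%:Z 0 h = h by apply: opfun_ext => z; exact: tr0l.
have topp l : trO tau n%:Z l h = h -> trO tau n%:Z (- l) h = h.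
  move=> e; rewrite -[in LHS]e; apply: opfun_ext => z.
  by rewrite -[LHS]/(tr tau n%:Z (- l) (tr tau n%:Z l h) z) tr_comp// addNr tr0l.
have tnat i (k : nat) : trO tau n%:Z (k%:Z *: delta_mx 0 i) h = h.
  elim: k => [|k IH]; first by rewrite scale0r.
  by rewrite intS scalerDl scale1r; apply: tadd.
have tint i (k : int) : trO tau n%:Z (k *: delta_mx 0 i) h = h.
  by case: k => k //; rewrite NegzE scaleNr; exact: topp.
move=> l; rewrite [l]row_sum_delta; elim/big_ind: _ => //.
Qed.

Lemma exMn (n : nat) (c : C) : ex (n%:Z%:~R * c) = ex c ^+ n.
Proof.
elim: n => [|n IH]; first by rewrite mul0r ex0.
by rewrite intS intrD mulrDl mul1r exD IH exprS.
Qed.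

Lemma theta_shift l z : th z = ex (1 / 2 * bil tau l l + dot l z) * th (z + trow tau l).
Proof.
rewrite theta_th0; have := congr1 (fun f => f z) (tr_th0 htau l).
rewrite /tr; move: (1 / 2 * bil tau l l + dot l z) => c.
by rewrite (_ : (1%:~R : C) * c = c) //; exact: mul1r.
Qed.
Lemma inV_shift n h l z : inV n h -> h z = ex (1 / 2 * bil tau l l + dot l z) ^+ n * h (z + trow tau l).
Proof.
move=> hh; have := congr1 (fun f : F => f z) (inV_all hh l) => e.
by rewrite -exMn -[LHS]e.
Qed.

Lemma theta_trow l z : exists2 E : C, E != 0 & th z = E * th (z + trow tau l) /\
  forall (n : nat) h, inV n h -> h z = E ^+ n * h (z + trow tau l).
Proof.
exists (ex (1 / 2 * bil tau l l + dot l z)); first exact: ex_neq0.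
by split=> [|n h]; [exact: theta_shift|exact: inV_shift].
Qed.

(* The value is 0 where theta vanishes if n > 0, because 0^-1 = 0. *)
Definition fr (n : nat) h : 'rV[C]_g -> C := fun z => h z * (th z ^+ n)^-1.

Lemma fr0 n h z : (0 < n)%N -> th z = 0 -> fr n h z = 0.
Proof. by move=> n0 e; rewrite /fr e expr0n gtn_eqF// invr0 mulr0. Qed.

Lemma th_differentiable z : differentiable th z.
Proof. by rewrite theta_th0//; case: (OP_th0 htau). Qed.
Lemma opfun_differentiable h z : differentiable h z.
Proof. by case: (opfunP h). Qed.
Lemma thX_differentiable n z : differentiable (fun x => th x ^+ n) z.
Proof.
exact/differentiable_exp/th_differentiable.
Qed.

Lemma fr_A n h : (0 < n)%N -> inV n h -> A tau n%:Z (fr n h).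
Proof.
move=> n0 hh; split.
- move=> p q z; have [E E0 [et eh]] := theta_trow q (z + zvec R p).
  have ph : h (z + zvec R p) = h z by case: (opfunP h) => _; apply.
  have pt : th (z + zvec R p) = th z by rewrite theta_th0//; case: (OP_th0 htau) => _; apply.
  rewrite /fr -ph -pt (eh n h hh) et -/(trow tau q); move: (h _) (th _) => a b.
  by rewrite quot_scale.
- by move=> z; exact: fr0.
- move=> z tz; apply: differentiable_quot; [exact: opfun_differentiable|exact: thX_differentiable|].
  exact: expf_neq0.
exists h; first by move=> z _; exact: opfun_differentiable.
by move=> z tz; rewrite /fr mulrCA divff ?mulr1// expf_neq0.
Qed.

(** The holomorphic extension of theta^n f inherits its transformation laws from f and theta outside
    the divisor, and everywhere by density. *)
Lemma A_fr n f : (0 < n)%N -> A tau n%:Z f -> exists2 h, inV n h & f = fr n h.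
Proof.
move=> n0 [per f0 _ [H dH HE]].
have dH' z : differentiable H z by exact: dH.
have pt p z : th (z + zvec R p) = th z by rewrite theta_th0//; case: (OP_th0 htau) => _; apply.
have OH : OP H.
  split=> // p z; apply: (@theta_dense (fun z => H (z + zvec R p)) H) => //.
    by move=> {}z; apply: (@differentiable_comp _ _ _ _ (fun x : 'rV[C]_g => x + zvec R p) H).
  move=> {}z tz; have tz' : th (z + zvec R p) != 0 by rewrite pt.
  have e1 := HE _ tz; have e2 := HE _ tz'; rewrite -e1 -e2 pt; congr (_ * _); have := per p 0 z.
  by rewrite (_ : zvec R 0 *m tau = 0) ?addr0//; rewrite (_ : zvec R 0 = 0) ?mul0mx//; apply/rowP => j; rewrite !mxE.
exists (opf OH).
  move=> i; apply: opfun_ext; apply: theta_dense.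
  - exact: opfun_differentiable.
  - exact: opfun_differentiable.
  move=> z tz; rewrite -[LHS]/(tr tau n (delta_mx 0 i) H z) -[RHS]/(H z) /tr exMn.
  have et := theta_shift (delta_mx 0 i) z.
  have tz' : th (z + trow tau (delta_mx 0 i)) != 0.
    by apply: contraNneq tz => e; rewrite et e mulr0.
  have e1 := HE _ tz; have e2 := HE _ tz'; rewrite -e1 -e2 mulrA -exprMn -et; congr (_ * _).
  have := per 0 (delta_mx 0 i) z.
  by rewrite (_ : zvec R 0 = 0) ?addr0//; apply/rowP => j; rewrite !mxE.
apply/funext => z; have [tz|tz] := eqVneq (th z) 0; first by rewrite f0// fr0.
by rewrite /fr /= -HE// mulrC mulKf// expf_neq0.
Qed.

Definition dnum (i : 'I_g) (n : nat) h : F := thO htau * pdO i h - n%:R *: (h * pdO i (thO htau)).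

Lemma fr_partial i n h : (0 < n)%N -> partial tau i (fr n h) = fr n.+1 (dnum i n h).
Proof.
case: n => // n _; apply/funext => z; rewrite /partial; case: eqVneq => [tz|tz]; first by rewrite fr0.
have X0 : th z ^+ n.+1 != 0 by exact: expf_neq0.
rewrite /fr derive_quot//; [|exact: opfun_differentiable|exact: thX_differentiable].
rewrite derive_exp; last exact: th_differentiable.
have -> : (dnum i n.+1 h) z = th z * 'D_(delta_mx 0 i) h z - n.+1%:R * (h z * 'D_(delta_mx 0 i) th z).
  by rewrite theta_th0.
move: ('D_ _ h z) ('D_ _ th z) (h z) => a b c.
rewrite !exprS; move: (th z) tz {X0} => t tz; have tn : t ^+ n != 0 by exact: expf_neq0.
by field; rewrite tn tz.
Qed.

Lemma fr_inj n h h' : fr n h = fr n h' -> h = h'.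
Proof.
move=> e; apply: opfun_ext; apply: theta_dense => [z|z|z tz]; [exact: opfun_differentiable|exact: opfun_differentiable|].
have := congr1 (fun f => f z * th z ^+ n) e; rewrite /fr !divfK ?expf_neq0//.
Qed.

Lemma fr_lin n a h h' : fr n (a *: h + h') = a *: fr n h + fr n h'.
Proof. by apply/funext => z; rewrite /fr opfunD opfunZ mulrDl -mulrA. Qed.

Lemma fr_th n h : (0 < n)%N -> fr n.+1 (thO htau * h) = fr n h.
Proof.
move=> n0; apply/funext => z; rewrite /fr opfunM -[thO htau z]/(th0 tau z) -theta_th0.
have [tz|tz] := eqVneq (th z) 0; last by rewrite exprS invfM mulrACA divff// mul1r.
by rewrite tz mul0r mul0r !expr0n gtn_eqF// invr0 mulr0.
Qed.

End Quotients.

(** * The end of the complex of invariants in terms of numerators *)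

Section TopDegree.
Variables (R : realType) (g : nat) (tau : 'M[CC R]_g).
Local Notation C := (CC R).
Local Notation F := (opfun R g).
Local Notation N := ({set 'I_g.+1} -> F).
Hypothesis htau : period_matrix tau.
Hypothesis hTheta : nonsingular_theta_divisor tau.
Variable n : nat.
Hypothesis hn : (2 <= n <= g.+1)%N.
Implicit Types (h : F) (z : 'rV[C]_g) (i l : 'I_g) (S : {set 'I_g}) (B : {set 'I_g.+1}).
Local Notation up i := (lift ord0 i : 'I_g.+1).
Local Notation s1 b := (finset.set1 b).
Local Notation s0 := finset.set0.

Definition theta_image h := exists (u : F) (hh : 'I_g -> F), [/\ inV tau n.-1 u, forall i, inV tau n.-1 (hh i) &
  h = thO htau * u + \sum_i dnum htau i n.-1 (hh i)].

Lemma inV_lin m a h h' : inV tau m h -> inV tau m h' -> inV tau m (a *: h + h').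
Proof. by move=> e e' i; rewrite trO_is_linear e e'. Qed.
Lemma inV_subsp m : subsp (inV tau m).
Proof. by split=> [i|a x y]; [exact: linear0|exact: inV_lin]. Qed.

Lemma dnum_lin i m a h h' : dnum htau i m (a *: h + h') = a *: dnum htau i m h + dnum htau i m h'.
Proof.
apply: opfun_ext => z; rewrite /dnum pdO_is_linear.
move: (pdO i (thO htau)) => a3; move: (pdO i h) (pdO i h') (thO htau) => a1 a2 a4.
rewrite -[LHS]/(a4 z * (a * a1 z + a2 z) - m%:R * ((a * h z + h' z) * a3 z)).
rewrite -[RHS]/(a * (a4 z * a1 z - m%:R * (h z * a3 z)) + (a4 z * a2 z - m%:R * (h' z * a3 z))).
by ring.
Qed.
Lemma dnum0 i m : dnum htau i m 0 = 0.
Proof. by have := dnum_lin i m (-1) 0 0; rewrite scaler0 addr0 scaleN1r addNr. Qed.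

Definition vec0 h : N := fun B => if B == s0 then h else 0.
Lemma vec0_grow h : grow 0 (vec0 h).
Proof. by move=> B; rewrite cards_eq0 /vec0 => /negbTE ->. Qed.
Lemma grow_vec0 (v : N) : grow 0 v -> v = vec0 (v s0).
Proof.
move=> hv; apply/funext => B; rewrite /vec0; case: eqP => [->//|/eqP B0].
by apply: hv; rewrite cards_eq0.
Qed.
Lemma EO_grow0 l (v : N) : grow 0 v -> EO l v = 0.
Proof.
move=> hv; apply/funext => B; rewrite EOE; case: ifP => // /andP[oB lB].
by rewrite hv ?scaler0// cardsU1 !inE (negbTE lB) andbF.
Qed.
Lemma Hk0E h : inV tau n h <-> Hk tau n 0 (vform (vec0 h)).
Proof.
have D l (v : N) : grow 0 v -> Dtw tau n l v s0 = trO tau n%:Z (delta_mx 0 l) (v s0) - v s0.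
  move=> hv; rewrite -[LHS]/(Ttw tau n l v s0 + cpi R *: EO l (Ttw tau n l v) s0 - v s0).
  by rewrite EO_grow0; [rewrite scaler0 addr0 /Ttw cards0 subr0|exact: row_Ttw].
split=> [hh|[h1 h2]].
  split; first exact/vform_PP/vec0_grow.
  apply: dG_vform => l; apply/funext => B; have [->|B0] := eqVneq B s0.
    by rewrite (D l _ (vec0_grow h)) /vec0 eqxx hh subrr.
  have r : grow 0 (Dtw tau n l (vec0 h)) by exact/row_Dtw/vec0_grow.
    by rewrite r// cards_eq0.
move=> l; apply/subr0_eq; have := D l _ (vec0_grow h).
by rewrite (vform_dG l h2) /vec0 eqxx => <-.
Qed.

Lemma delta_vec1 (v : N) : delta htau v s0 = \sum_b th htau b * v (s1 b).
Proof.
rewrite deltaE; apply: eq_big => [b|b _]; first by rewrite inE.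
rewrite (_ : b |: s0 = s1 b); last by apply/setP => x; rewrite !inE orbF.
rewrite /sg (_ : [set j in _ | _] = s0); last by apply/setP => x; rewrite !inE.
by rewrite cards0 expr0 scale1r.
Qed.

(** Explicit form of invariance in the row 1: only the component at [ord0] feels the twist. *)
Lemma Dtw1 (v : N) : grow 1 v -> (forall l, Dtw tau n l v = 0) <->
  (forall i, inV tau n.-1 (v (s1 (up i)))) /\
  (forall l, trO tau n.-1%:Z (delta_mx 0 l) (v (s1 ord0)) = v (s1 ord0) - cpi R *: v (s1 (up l))).
Proof.
move=> hv; have nE : n%:Z - 1%N%:Z = n.-1%:Z by lia.
have T l b : Ttw tau n l v (s1 b) = trO tau n.-1%:Z (delta_mx 0 l) (v (s1 b)).
  by rewrite /Ttw cards1 nE.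
have Du l i : Dtw tau n l v (s1 (up i)) = trO tau n.-1%:Z (delta_mx 0 l) (v (s1 (up i))) - v (s1 (up i)).
  rewrite -[LHS]/(Ttw tau n l v (s1 (up i)) + cpi R *: EO l (Ttw tau n l v) (s1 (up i)) - v (s1 (up i))).
  by rewrite EOE inE (negbTE (neq_lift _ _)) scaler0 addr0 T.
have D0 l : Dtw tau n l v (s1 ord0) = trO tau n.-1%:Z (delta_mx 0 l) (v (s1 ord0)) +
    cpi R *: trO tau n.-1%:Z (delta_mx 0 l) (v (s1 (up l))) - v (s1 ord0).
  rewrite -[LHS]/(Ttw tau n l v (s1 ord0) + cpi R *: EO l (Ttw tau n l v) (s1 ord0) - v (s1 ord0)).
  rewrite EOE !inE eqxx eq_sym (neq_lift _ _) /= finset.setDv.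
  rewrite (_ : up l |: s0 = s1 (up l)); last by apply/setP => x; rewrite !inE orbF.
  rewrite !T; congr (_ + _ *: _ - _).
  rewrite /sg (_ : [set j in s1 ord0 | _]%SET = s0); last by apply/setP => x; rewrite !inE; case: eqP => // ->.
  rewrite (_ : [set j in s0 | _]%SET = s0); last by apply/setP => x; rewrite !inE.
  by rewrite cards0 expr0 mul1r scale1r.
split=> [h|[h1 h2] l].
  have hi i : inV tau n.-1 (v (s1 (up i))).
    by move=> l; apply/subr0_eq; rewrite -Du h.
  split=> // l; have := D0 l; rewrite h (hi l l) => e.
  by apply/eqP; rewrite eq_sym subr_eq eq_sym -subr_eq0 -e.
apply/funext => B; have [/cards1P[b ->]|B1] := boolP (#|B| == 1%N); last first.
  have r : grow 1 (Dtw tau n l v) by exact: row_Dtw.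
  by rewrite r.
case: (unliftP ord0 b) => [i ->|->]; first by rewrite Du h1 subrr.
by rewrite D0 h1 h2 subrK subrr.
Qed.

Lemma dT_vform (v : N) : dT htau (vform v) = vform (delta htau v).
Proof. by apply/funext => S; rewrite /dT /cw /vform; case: ifP => // _; exact: linear0. Qed.

Lemma vform_inj (v w : N) : vform v = vform w -> v = w.
Proof. by move=> /(congr1 (fun f => f s0)); rewrite /vform eqxx. Qed.

Lemma delta_split (v : N) : delta htau v s0 = thO htau * v (s1 ord0) + \sum_i pdO i (thO htau) * v (s1 (up i)).
Proof.
rewrite delta_vec1 big_ord_recl /th unlift_none; congr (_ + _).
by apply: eq_bigr => i _; rewrite liftK.
Qed.

Lemma trO_pd1 m l i h : inV tau m h ->
  trO tau m%:Z (delta_mx 0 l) (pdO i h) = pdO i h + (cpi R * (m%:R * (i == l)%:R)) *: h.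
Proof. by move=> hh; rewrite trO_pd// hh mxE eqxx /= rmorph_nat -pmulrn. Qed.

Lemma trO_sum_pd m l (hh : 'I_g -> F) : (forall i, inV tau m (hh i)) ->
  trO tau m%:Z (delta_mx 0 l) (\sum_i pdO i (hh i)) = \sum_i pdO i (hh i) + (cpi R * m%:R) *: hh l.
Proof.
move=> hi; rewrite linear_sum /=; under eq_bigr do rewrite trO_pd1//.
rewrite big_split /=; congr (_ + _); rewrite (bigD1 l)//= eqxx mulr1 big1 ?addr0// => i /negbTE ->.
by rewrite !mulr0 scale0r.
Qed.

Let m0 : (n.-1)%:R != 0 :> C. Proof. by rewrite pnatr_eq0; lia. Qed.

Lemma sum_dnum m (hh : 'I_g -> F) : \sum_i dnum htau i m (hh i) =
  thO htau * (\sum_i pdO i (hh i)) + \sum_i pdO i (thO htau) * (- m%:R *: hh i).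
Proof.
rewrite mulr_sumr -big_split; apply: eq_bigr => i _; rewrite /dnum; congr (_ + _).
apply: opfun_ext => z; move: (pdO i _) => p.
rewrite -[LHS]/(- (m%:R * (hh i z * p z))) -[RHS]/(p z * (- m%:R * hh i z)).
by ring.
Qed.

(** By [trO_sum_pd], the sum of the d_i h_i has the same defect of invariance as the component at
    [ord0] when the other components are [- (n - 1) h_i]. The difference is then an honest element u
    of weight n - 1, and the correspondence works both ways. *)
Lemma Bk0E h : theta_image h <-> Bk htau n 0 (vform (vec0 h)).
Proof.
have n1 : (1 < n)%N by lia.
rewrite (BkE htau n1); split=> [[u [hh [hu hi ->]]]|[y [hy dy] e]].
  set m : C := (n.-1)%:R.
  pose h0 := u + \sum_i pdO i (hh i).
  pose v : N := fun B => if B == s1 ord0 then h0 else \sum_(i | B == s1 (up i)) (- m) *: hh i.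
  have v0 : v (s1 ord0) = h0 by rewrite /v eqxx.
  have vu i : v (s1 (up i)) = (- m) *: hh i.
    rewrite /v (inj_eq set1_inj) eq_sym (negbTE (neq_lift _ _)) (big_pred1 i)// => j /=.
    by rewrite (inj_eq set1_inj) (inj_eq lift_inj) eq_sym.
  have gv : grow 1 v.
    move=> B B1; rewrite /v; case: eqP => [e|_]; first by move: B1; rewrite e cards1.
    by rewrite big1// => i /eqP e; move: B1; rewrite e cards1.
  exists (vform v); last first.
    rewrite dT_vform (grow_vec0 (row_delta htau gv)) delta_split v0 sum_dnum; congr (vform (vec0 _)).
    rewrite /h0 mulrDr -addrA; congr (_ + (_ + _)); apply: eq_bigr => i _.
    by rewrite vu.
  split; first exact: vform_PP.
  apply: dG_vform; apply/(Dtw1 gv); split=> [i|l].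
    by rewrite vu; exact: (subspZ _ (inV_subsp _) (hi i)).
  rewrite v0 vu /h0 linearD /= hu trO_sum_pd// addrA; congr (_ + _).
  by rewrite scalerA -scaleNr mulrN opprK.
have yv := PP_vform hy; set v := y s0 in yv; have gv : grow 1 v by exact: hy.2.
have hD l : Dtw tau n l v = 0 by apply: vform_dG; rewrite -yv.
have [hi h0] := (Dtw1 gv).1 hD.
have hE : h = delta htau v s0.
  move: e; rewrite yv dT_vform => /vform_inj /(congr1 (fun f => f s0)).
  by rewrite /vec0 eqxx.
set m : C := (n.-1)%:R; pose hh i := (- m^-1) *: v (s1 (up i)).
have hhV i : inV tau n.-1 (hh i) by exact: (subspZ _ (inV_subsp _) (hi i)).
have hv i : v (s1 (up i)) = - m *: hh i.
  by rewrite /hh scalerA mulrNN mulfV// scale1r.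
exists (v (s1 ord0) - \sum_i pdO i (hh i)), hh; split=> //.
  move=> l; rewrite linearB /= trO_sum_pd// h0 opprD addrACA hv -[RHS]addr0; congr (_ + _).
  by rewrite scalerA mulrN scaleNr opprK subrr.
rewrite sum_dnum hE delta_split mulrBr addrA subrK; congr (_ + _).
by apply: eq_bigr => i _; rewrite hv.
Qed.

Lemma top_dimV : exists a, dim_quotient (inV tau n : set F) [set h | theta_image h] a /\ a%:Z = n%:Z ^+ g - bdim g n n.-1.
Proof.
have [a [ha ea]] := top_dim htau hTheta hn; exists a; split=> //.
have vl b h h' : vform (vec0 (b *: h + h')) = b *: vform (vec0 h) + vform (vec0 h').
  apply/funext => S; apply/funext => B.
  rewrite -[RHS]/(b *: (vform (vec0 h) S B) + vform (vec0 h') S B) /vform.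
  by case: (S == s0); rewrite /vec0; [case: (B == s0)|]; rewrite ?scaler0 ?addr0.
have v00 : vform (vec0 0) = 0 :> ({set 'I_g} -> N).
  by apply/funext => S; apply/funext => B; rewrite /vform; case: (S == s0); rewrite // /vec0; case: (B == s0).
apply: (@dq_rel _ _ _ _ _ _ _ (fun h x => x = vform (vec0 h)) _ _ _ _ _ _ _ _ _ ha).
- exact: inV_subsp.
- exact: Bk_subsp.
- by move=> b x y x' y' -> ->; rewrite vl.
- by rewrite v00.
- move=> x [h1 h2]; have ex := PP_vform h1; rewrite (grow_vec0 (h1.2 s0)) in ex.
  exists (x s0 s0) => //; apply/Hk0E; rewrite -ex; split=> //.
- by move=> h /Hk0E hh; exists (vform (vec0 h)).
- by move=> h x _ _ ->; exact: Bk0E.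
exact: Hk_subsp.
Qed.

End TopDegree.

(** * Top-degree forms and the cohomology of the graded complex *)

Section Cohomology.
Variables (R : realType) (g : nat) (tau : 'M[CC R]_g).
Local Notation C := (CC R).
Local Notation F := (opfun R g).
Hypothesis htau : period_matrix tau.
Hypothesis hTheta : nonsingular_theta_divisor tau.
Variable n : nat.
Hypothesis hn : (2 <= n <= g.+1)%N.
Implicit Types (h : F) (z : 'rV[C]_g) (i l : 'I_g) (S : {set 'I_g}) (w : {set 'I_g} -> 'rV[C]_g -> C).
Local Notation sT := (finset.setTfor 'I_g).
Local Opaque theta th0 pd coef.

Lemma fr_0 m : fr tau m 0 = 0 :> ('rV[C]_g -> C).
Proof. by apply/funext => z; rewrite /fr mul0r. Qed.

Lemma fr_linear m : linear (fr tau m : F -> ('rV[C]_g -> C)).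
Proof. by move=> a h h'; exact: fr_lin. Qed.
HB.instance Definition _ m := GRing.isLinear.Build C F ('rV[C]_g -> C) _ (fr tau m) (fr_linear m).

Lemma card_setT S : (#|S| == g) = (S == sT).
Proof.
apply/eqP/eqP => [e|->]; last by rewrite cardsT card_ord.
by apply/eqP; rewrite eqEcard finset.subsetT cardsT card_ord e leqnn.
Qed.

Definition top_form h : {set 'I_g} -> 'rV[C]_g -> C := fun S => if S == sT then fr tau n h else 0.

Lemma top_form_lin a h h' : top_form (a *: h + h') = a *: top_form h + top_form h'.
Proof.
apply/funext => S; rewrite -[RHS]/(a *: top_form h S + top_form h' S) /top_form.
by case: ifP => _; [exact: fr_lin|rewrite scaler0 addr0].
Qed.
Lemma top_form0 : top_form 0 = 0.
Proof. by apply/funext => S; rewrite /top_form fr_0 if_same. Qed.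

Lemma partial0 i : partial tau i 0 = 0.
Proof. by apply/funext => z; rewrite /partial; case: ifP => // _; exact: derive_cst. Qed.

Lemma setD1_neqT S i : i \in S -> S :\ i == sT = false.
Proof. by move=> iS; apply/negP => /eqP e; have : i \in S :\ i; [rewrite e inE|rewrite !inE eqxx]. Qed.

Let n0 : (0 < n)%N. Proof. by lia. Qed.
Let n1 : (0 < n.-1)%N. Proof. by lia. Qed.
Let nS : n = n.-1.+1. Proof. by lia. Qed.

(** In top degree the differential vanishes identically, since a form supported on the full set has
    no component on [S :\ i]. *)
Lemma cocycle_top h k : k = g -> inV tau n h -> cocycle tau k (n%:Z - k%:Z) (top_form h).
Proof.
move=> -> hh; split; rewrite subrK.
  move=> S; rewrite card_setT /top_form; case: (S == sT); last by [].
  by apply: fr_A.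
move=> S; have -> : (#|S| == g.+1) = false.
  by apply/negP => /eqP e; have := max_card (mem S); rewrite card_ord e ltnn.
apply/funext => z; rewrite /dform big1// => i iS.
by rewrite /top_form setD1_neqT// partial0 mulr0.
Qed.

Lemma top_cocycle w k : k = g -> cocycle tau k (n%:Z - k%:Z) w -> exists2 h, inV tau n h & w = top_form h.
Proof.
move=> -> [hw _]; rewrite subrK in hw.
have := hw sT; rewrite cardsT card_ord eqxx => /(A_fr htau hTheta n0)[h hh e].
exists h => //; apply/funext => S; rewrite /top_form -card_setT; have := hw S.
by case: ifP => //; rewrite card_setT => /eqP -> _.
Qed.

Definition sgT i : C := (-1) ^+ #|[set j in sT | (j < i)%N]|%SET.
Lemma sgT_sq i : sgT i * sgT i = 1.
Proof. by rewrite /sgT -exprMn mulrNN mulr1 expr1n. Qed.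

Lemma dform_top (e : {set 'I_g} -> 'rV[C]_g -> C) (hh : 'I_g -> F) : (forall i, e (sT :\ i) = fr tau n.-1 (hh i)) ->
  dform tau e sT = fr tau n (\sum_i dnum htau i n.-1 (sgT i *: hh i)).
Proof.
move=> he; have -> : fr tau n (\sum_i dnum htau i n.-1 (sgT i *: hh i)) = \sum_i fr tau n (dnum htau i n.-1 (sgT i *: hh i)).
  exact: linear_sum.
apply/funext => z; rewrite (big_morph (fun f : 'rV[C]_g -> C => f z) (id1 := 0) (op1 := +%R))//.
rewrite /dform; apply: eq_big => [i|i _]; first by rewrite inE.
rewrite he (fr_partial htau)// -nS -/(sgT i).
have -> : dnum htau i n.-1 (sgT i *: hh i) = sgT i *: dnum htau i n.-1 (hh i).
  by have := dnum_lin htau i n.-1 (sgT i) (hh i) 0; rewrite dnum0 !addr0.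
have e2 := fr_lin tau n (sgT i) (dnum htau i n.-1 (hh i)) 0.
by rewrite fr_0 !addr0 in e2; rewrite e2.
Qed.

Lemma coboundary_image h k' : k'.+1 = g ->
  coboundary tau k'.+1 (n%:Z - k'.+1%:Z) (top_form h) -> theta_image htau n h.
Proof.
move=> kg [e [r [he hr ew]]].
have E1 : n%:Z - k'.+1%:Z + k'%:Z = n.-1%:Z by lia.
have E2 : n%:Z - k'.+1%:Z + k'.+1%:Z - 1 = n.-1%:Z by lia.
rewrite E1 in he; rewrite E2 in hr.
have cT i : #|sT :\ i| = k'.
  by have := cardsD1 i sT; rewrite cardsT card_ord inE add1n => c; apply: succn_inj; rewrite -c kg.
have /choice[hh Hh] : forall i, exists hi, inV tau n.-1 hi /\ e (sT :\ i) = fr tau n.-1 hi.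
  by move=> i; have := he (sT :\ i); rewrite cT eqxx => /(A_fr htau hTheta n1)[hi h1 h2]; exists hi.
have := hr sT; rewrite cardsT card_ord kg eqxx => /(A_fr htau hTheta n1)[u hu eu].
have := congr1 (fun f => f sT) ew; rewrite /top_form eqxx.
rewrite -[(dform tau e + r) sT]/(dform tau e sT + r sT) (@dform_top e hh); last by move=> i; case: (Hh i).
rewrite eu -(fr_th htau _ n1) -nS => E.
exists u, (fun i => sgT i *: hh i); split=> //.
  by move=> i; exact: (subspZ _ (inV_subsp _ _) (Hh i).1).
(* The lower-order term r has been written as a fraction over theta^n by [fr_th]; this is where the
   summand theta u of [theta_image] comes from. *)
apply: (fr_inj hTheta (n := n)); rewrite E addrC.
by have := fr_lin tau n 1 (thO htau * u) (\sum_i dnum htau i n.-1 (sgT i *: hh i)); rewrite !scale1r.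
Qed.

Lemma image_coboundary h k' : k'.+1 = g -> theta_image htau n h ->
  coboundary tau k'.+1 (n%:Z - k'.+1%:Z) (top_form h).
Proof.
move=> kg [u [hh [hu hi ->]]].
have E1 : n%:Z - k'.+1%:Z + k'%:Z = n.-1%:Z by lia.
have E2 : n%:Z - k'.+1%:Z + k'.+1%:Z - 1 = n.-1%:Z by lia.
have cT i : #|sT :\ i| = k'.
  by have := cardsD1 i sT; rewrite cardsT card_ord inE add1n => c; apply: succn_inj; rewrite -c kg.
pose e S := fr tau n.-1 (\sum_(i | S == sT :\ i) sgT i *: hh i).
pose r S : 'rV[C]_g -> C := if S == sT then fr tau n.-1 u else 0.
have eE i : e (sT :\ i) = fr tau n.-1 (sgT i *: hh i).
  rewrite /e (big_pred1 i)// => j /=; apply/eqP/eqP => [E|->//].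
  apply/eqP; apply: contraT => ji; have : i \in sT :\ j by rewrite !inE eq_sym ji.
  by rewrite -E !inE eqxx.
have e0 S : #|S| != k' -> e S = 0.
  move=> Sk; rewrite /e big1 ?fr_0// => i /eqP E; move: Sk; rewrite E cT eqxx //.
exists e, r; split.
- rewrite E1 => S; case: ifP => [Sk|/negbT/e0//]; apply: fr_A => //.
  by apply: subsp_sum => [|i _]; [exact: inV_subsp|exact: (subspZ _ (inV_subsp _ _) (hi i))].
- rewrite E2 => S; rewrite kg card_setT /r; case: (S == sT); last by [].
  by apply: fr_A.
apply/funext => S; rewrite -[RHS]/(dform tau e S + r S) /top_form /r.
case: eqP => [->|/eqP ST].
  rewrite (dform_top eE) -(fr_th htau _ n1) -nS addrC.
  have := fr_lin tau n 1 (\sum_i dnum htau i n.-1 (hh i)) (thO htau * u); rewrite !scale1r => ->.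
  by congr (fr tau n _ + _); apply: eq_bigr => i _; rewrite scalerA sgT_sq scale1r.
rewrite addr0; apply/funext => z; rewrite /dform big1// => i iS.
rewrite e0 ?partial0 ?mulr0//; apply: contra ST => /eqP c.
by rewrite -card_setT (cardsD1 i S) iS c add1n kg.
Qed.

Lemma theta_image_subsp : subsp [set h | theta_image htau n h].
Proof.
split=> [|b _ _ [u [hh [hu hi ->]]] [u' [hh' [hu' hi' ->]]]].
  exists 0, (fun=> 0); split=> [|i|]; [exact: (inV_subsp _ _).1|exact: (inV_subsp _ _).1|].
  by rewrite mulr0 add0r big1// => i _; exact: dnum0.
exists (b *: u + u'), (fun i => b *: hh i + hh' i); split=> [|i|].
- exact: (inV_subsp _ _).2.
- exact: (inV_subsp _ _).2.
under [in RHS]eq_bigr do rewrite dnum_lin.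
have -> : \sum_i (b *: dnum htau i n.-1 (hh i) + dnum htau i n.-1 (hh' i)) =
    b *: (\sum_i dnum htau i n.-1 (hh i)) + \sum_i dnum htau i n.-1 (hh' i).
  by rewrite big_split /=; congr (_ + _); exact/esym/scaler_sumr.
rewrite scalerDr addrACA; congr (_ + _).
by have := mulop_is_linear (thO htau) b u u'; rewrite /mulop => ->.
Qed.

Lemma top_cohomology k : k = g -> exists a, dim_H tau k (n%:Z - k%:Z) a /\ a%:Z = n%:Z ^+ g - bdim g n n.-1.
Proof.
move=> kg; have [a [ha ea]] := top_dimV htau hTheta hn; exists a; split=> //.
have g0 : (0 < g)%N by lia.
case: k kg => [e|k' kg]; first by rewrite -e in g0.
apply: (@dq_rel _ _ _ _ _ _ _ (fun w h => w = top_form h) _ _ _ _ _ _ _ _ _ ha).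
- split=> [|b w w' /(top_cocycle kg)[h hh ->] /(top_cocycle kg)[h' hh' ->]].
    by rewrite -top_form0; apply: cocycle_top => //; exact: (inV_subsp _ _).1.
  by rewrite -top_form_lin; apply: cocycle_top => //; exact: (inV_subsp _ _).2.
- exact: theta_image_subsp.
- by move=> b x y x' y' -> ->; rewrite top_form_lin.
- by rewrite top_form0.
- by move=> h hh; exists (top_form h) => //; exact: cocycle_top.
- by move=> w /(top_cocycle kg)[h hh ->]; exists h.
- by move=> w h _ _ ->; split; [exact: coboundary_image|exact: image_coboundary].
exact: inV_subsp.
Qed.

End Cohomology.

Theorem proposition2 (R : realType) (g : nat) (tau : 'M[CC R]_g) (n : nat)
    (hg : (2 <= g)%N) (htau : period_matrix tau)
    (hTheta : nonsingular_theta_divisor tau)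
    (hn : (2 <= n <= g.+1)%N) :
  exists a : nat, dim_H tau g (n%:Z - g%:Z) a /\
    a%:Z = (-1) ^+ (n - 1) * 'C(g, n - 2)%:Z
      + \sum_(2 <= i < n.+1) (-1) ^+ (n - i) * 'C(g.+1, n - i)%:Z * i%:Z ^+ g
      + \sum_(0 <= i < n - 2) (-1) ^+ i *
          ('C(g, n - 1)%:Z * 'C(g, n - 2 - i)%:Z
           - 'C(g, n)%:Z * 'C(g, n - 3 - i)%:Z).
Proof.
have [a [ha ea]] := top_cohomology htau hTheta hn (erefl g).
by exists a; split=> //; rewrite ea; apply: top_formula; case/andP: hn.
Qed.
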